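(* There exists an absolute constant $c_0>0$ such that, with the dissipation wavenumber $\Lambda(t)=2^{Q(t)}$ defined using this $c_0$ as in the context, the following holds. Let $\nu>0$, $0<T<\infty$, and let $u$ be a Leray-Hopf solution on $[0,T]$ of the 3D Navier-Stokes equations $\partial_t u-\nu\Delta u+(u\cdot\nabla)u+\nabla p=0$, $\nabla\cdot u=0$ on $\mathbb{R}^3$, for which the intermittency dimension satisfies $d>3/2$; that is, there exist $s\in[0,3]$ with $d=3-s>3/2$ and a constant $K>0$ such that $$\frac1T\int_0^T\Lambda(t)^{2-s}\|u_{Q(t)}(t)\|_\infty^2\,dt\le K\,\frac1T\int_0^T\Lambda(t)^2\|u_{Q(t)}(t)\|_2^2\,dt.$$ Then $u(t)$ is regular on $(0,T]$.
   Context: Weak solution: for divergence-free $u_0\in L^2(\mathbb{R}^3)$, a weak solution on $[0,T]$ with initial data $u_0$ is a vector field $u\in C_{\mathrm w}([0,T];L^2(\mathbb{R}^3))$ (weakly continuous in time) with $u(0)=u_0$, $\nabla_x\cdot u(t)=0$ in the sense of distributions for all $t\in[0,T]$, and $$(u(t),\varphi(t))-(u_0,\varphi(0))=\int_0^t\{(u(s),\partial_s\varphi(s))+\nu(u(s),\Delta\varphi(s))+(u(s)\cdot\nabla\varphi(s),u(s))\}\,ds$$ for all $t\in[0,T]$ and all vector-valued test functions $\varphi\in C_0^\infty([0,T]\times\mathbb{R}^3)$ with $\nabla_x\cdot\varphi=0$, where $(\cdot,\cdot)$ is the $L^2$ inner product. Leray-Hopf solution ($\nu>0$): a weak solution with $u\in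 L^2([0,T];H^1(\mathbb{R}^3))$ satisfying $\|u(t)\|_2^2+2\nu\int_{t_0}^t\|\nabla u(s)\|_2^2\,ds\le\|u(t_0)\|_2^2$ for almost all $t_0\in(0,T)$ and all $t\in(t_0,T]$. Regularity: a weak solution $u$ is regular on a time interval $\mathcal I$ if $\|u(t)\|_{H^3}$ is (finite and) continuous on $\mathcal I$. Littlewood-Paley notation: $\lambda_q=2^q$. Fix a nonnegative radial $\chi\in C_0^\infty(B_1)$, $B_1\subset\mathbb{R}^3$ the unit ball centered at $0$, with $\chi(\xi)=1$ for $|\xi|\le 1/2$; $\varphi(\xi)=\chi(\xi/2)-\chi(\xi)$, $\varphi_q(\xi)=\varphi(2^{-q}\xi)$. For a tempered distribution $u$: $u_q=\mathcal F^{-1}(\varphi_q)*u$ for $q\ge0$, $u_{-1}=\mathcal F^{-1}(\chi)*u$. Dissipation wavenumber: $\Lambda(t)=\min\{\lambda_q:\ q\ge0,\ \lambda_p^{-1}\|u_p(t)\|_\infty<c_0\nu\ \text{ for all } p>q\}$, with $\Lambda(t)=\infty$ if no such $q$ exists (for a Leray-Hopf solution $\Lambda(t)<\infty$ for a.e. $t$), and $Q(t)$ is defined by $\lambda_{Q(t)}=\Lambda(t)$. *)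

(* Defs.v *)
From HB Require Import structures.
From mathcomp Require Import all_boot all_order all_algebra.
From mathcomp Require Import complex.
From mathcomp Require Import all_classical all_reals all_analysis.

Set Implicit Arguments.
Unset Strict Implicit.
Unset Printing Implicit Defensive.

Import Order.TTheory GRing.Theory Num.Theory.
Import numFieldNormedType.Exports.

Local Open Scope classical_set_scope.
Local Open Scope ring_scope.

(* Time is R; the topology on [space3 R] is that of the (sup-normed) product,
   the Euclidean norm is [enorm]. *)
Notation space3 R := (R * R * R)%type.

(* A vector field is given by its three components. *)
Notation vfield R := ('I_3 -> space3 R -> R).

Section Space.
Context {R : realType}.
Implicit Types (x y : space3 R) (i : 'I_3).

Definition leb : {measure set (measurableTypeR R) -> \bar R} := @lebesgue_measure R.

Definition leb3 :
    {measure set (measurableTypeR R * measurableTypeR R * measurableTypeR R) -> \bar R} :=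
  (@lebesgue_measure R \x @lebesgue_measure R \x @lebesgue_measure R)%E.

Definition component i x : R := nth 0 [:: x.1.1; x.1.2; x.2] i.

Definition unit_vector i : space3 R :=
  ((i == 0%N :> nat)%:R, (i == 1%N :> nat)%:R, (i == 2%N :> nat)%:R).

Definition dot x y : R := \sum_i component i x * component i y.

Definition enorm x : R := Num.sqrt (dot x x).

End Space.

Section TestFunctions.
Context {R : realType} {W : normedModType R}.
Implicit Types (f : W -> R) (l : seq W).

Definition iter_derive l f : W -> R := foldr (fun v g => 'D_v g) f l.

(* On a finite-dimensional W this is C^oo: all iterated directional (hence all
   iterated partial) derivatives exist everywhere and are continuous. *)
Definition smooth f : Prop :=
  forall l, continuous (iter_derive l f) /\
            forall x v, derivable (iter_derive l f) x v.

Definition supp f : set W := closure [set x | f x != 0].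

Definition test_function f : Prop := smooth f /\ compact (supp f).

End TestFunctions.

Section FunctionSpaces.
Context {R : realType}.
Implicit Types (f g : space3 R -> R) (u v : vfield R) (i : 'I_3).

Definition partial i f : space3 R -> R := 'D_(unit_vector i) f.

Definition laplacian f : space3 R -> R := fun x => \sum_i partial i (partial i f) x.

Definition divergence u : space3 R -> R := fun x => \sum_i partial i (u i) x.

Definition L2 f : Prop := f \in Lfun leb3 2%:E.

Definition vL2 u : Prop := forall i, L2 (u i).

Definition inner u v : R := \int[leb3]_x (\sum_i u i x * v i x).

Definition vLnorm (p : \bar R) u : \bar R :=
  Lnorm leb3 p (fun x => (Num.sqrt (\sum_i u i x ^+ 2))%:E).

Definition distr_div_free u : Prop :=
  forall eta : space3 R -> R, test_function eta ->
    \int[leb3]_x (\sum_i u i x * partial i eta x) = 0.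

Definition iter_partial (l : seq 'I_3) f : space3 R -> R :=
  iter_derive [seq unit_vector i | i <- l] f.

Definition weak_derivative (l : seq 'I_3) f g : Prop :=
  forall eta : space3 R -> R, test_function eta ->
    \int[leb3]_x (f x * iter_partial l eta x) =
    (-1) ^+ size l * \int[leb3]_x (g x * eta x).

(* Squared L^2 norm of the weak derivative of f along l; it is +oo when f has no
   such derivative in L^2, and otherwise the infimum is over a single value. *)
Definition weak_derivative_sqnorm (l : seq 'I_3) f : \bar R :=
  ereal_inf [set ('N[leb3]_2%:E[EFin \o g] ^+ 2)%E
            | g in [set g | L2 g /\ weak_derivative l f g]].

(* || nabla^k u ||_2^2 *)
Definition nabla_sqnorm (k : nat) u : \bar R :=
  (\sum_(i < 3) \sum_(l : k.-tuple 'I_3) weak_derivative_sqnorm l (u i))%E.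

(* Norm of the Sobolev space H^m; it is +oo outside of H^m. *)
Definition sobolev_norm (m : nat) u : \bar R :=
  ((\sum_(k < m.+1) nabla_sqnorm k u) `^ 2^-1)%E.

End FunctionSpaces.

Section LittlewoodPaley.
Context {R : realType}.
Implicit Types (chi : space3 R -> R) (u : vfield R) (nu : R).

Definition Cintegral (f : space3 R -> R[i]) : R[i] :=
  ((\int[leb3]_x complex.Re (f x))%R +i* (\int[leb3]_x complex.Im (f x))%R)%C.

(* Normalized so that convolution with inverse_fourier g is the Fourier
   multiplier g, for the transform f |-> \int f(x) e^(-i x.xi) dx. *)
Definition inverse_fourier (g : space3 R -> R) : space3 R -> R[i] := fun x =>
  ((2 * pi) ^- 3)%:C%C *
  Cintegral (fun xi => (g xi)%:C%C * (cos (dot x xi) +i* sin (dot x xi))%C).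

Definition convolution (k : space3 R -> R[i]) (f : space3 R -> R) : space3 R -> R[i] :=
  fun x => Cintegral (fun y => k (x - y) * (f y)%:C%C).

Definition lp_cutoff chi : Prop :=
  [/\ test_function chi,
      supp chi `<=` [set xi | enorm xi < 1],
      forall xi, 0 <= chi xi,
      forall xi eta, enorm xi = enorm eta -> chi xi = chi eta &
      forall xi, enorm xi <= 2^-1 -> chi xi = 1].

Definition lambda (q : nat) : R := 2 ^+ q.

Definition phi chi (xi : space3 R) : R := chi (2^-1 *: xi) - chi xi.

Definition phi_q chi (q : nat) (xi : space3 R) : R := phi chi ((lambda q)^-1 *: xi).

Definition lp_block chi (q : nat) u : 'I_3 -> space3 R -> R[i] :=
  fun i => convolution (inverse_fourier (phi_q chi q)) (u i).

Definition lp_block_norm chi (p : \bar R) (q : nat) u : \bar R :=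
  Lnorm leb3 p (fun x =>
    (Num.sqrt (\sum_i (complex.Re (lp_block chi q u i x) ^+ 2 +
                       complex.Im (lp_block chi q u i x) ^+ 2)))%:E).

Definition dissipative_above chi (c0 nu : R) u (q : nat) : Prop :=
  forall p : nat, (q < p)%N ->
    (((lambda p)^-1)%:E * lp_block_norm chi +oo p u < (c0 * nu)%:E)%E.

(* Lambda; the infimum of a nonempty set of powers of 2 is attained, and that of
   the empty set is +oo. *)
Definition dissipation_wavenumber chi c0 nu u : \bar R :=
  ereal_inf [set (lambda q)%:E | q in dissipative_above chi c0 nu u].

(* Q, with the arbitrary value 0 when Lambda is infinite. *)
Definition dissipation_index chi c0 nu u : nat :=
  xget 0%N [set q | (lambda q)%:E = dissipation_wavenumber chi c0 nu u].

End LittlewoodPaley.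

Section NavierStokes.
Context {R : realType}.
Implicit Types (nu T : R) (u : R -> vfield R).

(* Test fields in C_0^oo([0, T] x R^3) are restrictions to [0, T] x R^3 of test
   fields on R x R^3; they are divergence free on [0, T] only. *)
Definition solenoidal_test_field T (phi : 'I_3 -> R * space3 R -> R) : Prop :=
  (forall i, test_function (phi i)) /\
  forall (t : R) x, t \in `[0, T] -> divergence (fun i y => phi i (t, y)) x = 0.

Definition weakly_continuous T u : Prop :=
  (forall t : R, t \in `[0, T] -> vL2 (u t)) /\
  forall w : vfield R, vL2 w ->
    {within `[0, T], continuous (fun t => inner (u t) w)}.

Definition weak_solution nu T (u0 : vfield R) u : Prop :=
  [/\ weakly_continuous T u,
      forall i, u 0 i = u0 i %[ae leb3],
      forall t : R, t \in `[0, T] -> distr_div_free (u t) &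
      forall phi, solenoidal_test_field T phi ->
      forall t : R, t \in `[0, T] ->
        let at_time s i x := phi i (s, x) in
        inner (u t) (at_time t) - inner u0 (at_time 0) =
        \int[leb]_(s in `[0, t])
          (inner (u s) (fun i x => derive1 (fun r => phi i (r, x)) s)
           + nu * inner (u s) (fun i => laplacian (at_time s i))
           + inner (fun i x => \sum_j u s j x * partial j (at_time s i) x) (u s))].

Definition leray_hopf nu T (u0 : vfield R) u : Prop :=
  [/\ weak_solution nu T u0 u,
      (\int[leb]_(s in `[0%R, T]) (sobolev_norm 1 (u s) ^+ 2) < +oo)%E &
      {ae leb, forall t0 : R, t0 \in `]0, T[ -> forall t : R, t \in `]t0, T] ->
        (vLnorm 2%:E (u t) ^+ 2
         + (2 * nu)%:E * \int[leb]_(s in `[t0, t]) nabla_sqnorm 1 (u s)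
         <= vLnorm 2%:E (u t0) ^+ 2)%E}].

Definition regular_on (I : set R) u : Prop :=
  (forall t, I t -> (sobolev_norm 3 (u t) < +oo)%E) /\
  {within I, continuous (fun t => fine (sobolev_norm 3 (u t)))}.

End NavierStokes.

(* Main.v *)
(* Let Y_m(t) be the energy of u(t) - S_m u(t), where S_m truncates to the
   frequencies below lambda_m = 2^m.  Testing the weak formulation with (2 S_m - S_m^2) u
   gives an exact energy identity for the low frequencies; subtracted from the
   Leray-Hopf inequality, it bounds the growth of Y_(m+3) by the dissipation
   - nu lambda_m^2 Y_(m+3) and a flux that, after a commutator estimate, is at most
   a gradient of the low frequencies times Y_m.  By Bernstein's inequality below
   the wavenumber Lambda and the definition of Lambda above it, this gradient is
   at most C (Lambda^(5/2) |u|_2 + c0 nu lambda_m^2), and for small c0 the second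
   term is absorbed by the dissipation.  Since |u_Q|_oo >= c0 nu Lambda when
   Lambda > 1, the intermittency hypothesis bounds the integral of Lambda^(4 - s),
   hence of Lambda^(5/2) as s < 3/2, by the enstrophy, so Gronwall's lemma applies
   to the sums of lambda_m^w Y_m.  Dissipation raises the weight w by two after an
   arbitrarily short time, from w = 1 up to w = 11, which is more than continuity
   in H^3 requires. *)

Require Import Defs.
From HB Require Import structures.
From mathcomp Require Import all_boot all_order all_algebra.
From mathcomp Require Import complex.
From mathcomp Require Import all_classical all_reals all_analysis.
From mathcomp Require Import measurable_realfun ess_sup_inf.
From mathcomp Require Import ring lra.
Set Implicit Arguments.
Unset Strict Implicit.
Unset Printing Implicit Defensive.

Import Order.TTheory GRing.Theory Num.Theory.
Import numFieldNormedType.Exports.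

Local Open Scope classical_set_scope.
Local Open Scope ring_scope.

(** The operator [2 S - S^2] is chosen because [1 - (2 S - S^2) = (1 - S)^2]: as [S] is
    self-adjoint, the energy of [u - S u] is exactly [(u, u)] minus the pairing of [u] with the test
    field. The solution is only weakly continuous, so no energy equality is available for the tail
    itself; the low part alone, smooth in space, is treated exactly, and the Leray-Hopf inequality
    is used from almost every starting time. Comparing [Y_(m+3)] with [Y_m] is the price of an exact
    cancellation: products of two fields with frequencies below [2^m] must be left unchanged by the
    operator at level [m + 3]. Weighted sums therefore pick up a factor [8^w], and [c0] must be
    small against [8^(-11)], the last weight of the bootstrap being 11. Measurability of the
    enstrophy in time is not at hand, so it is compared with real functions through lower integrals.
    Times with [Lambda = oo] have infinite enstrophy, hence form a null set. *)

Lemma eq_ler d (T : porderType d) (x y : T) : x = y -> (x <= y)%O.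
Proof. by move=> ->. Qed.

(** * Real-valued integrals, square-integrable functions and their norm *)

Section RealIntegral.
Context {d} {T : measurableType d} {R : realType}.
Variable mu : {measure set T -> \bar R}.
Implicit Types f g h : T -> R.

Definition intg f : Prop := mu.-integrable setT (EFin \o f).

Lemma intg_meas f : intg f -> measurable_fun setT f.
Proof. by move=> /measurable_int /measurable_EFinP. Qed.

Lemma intg_le f g : measurable_fun setT f -> intg g ->
  (forall x, `|f x| <= g x) -> intg f.
Proof.
move=> mf ig fg; apply: le_integrable ig => //; first exact/measurable_EFinP.
by move=> x _; rewrite lee_fin (le_trans (fg x))// ler_norm.
Qed.

Lemma intg_ext f g : f =1 g -> intg f -> intg g.
Proof. by move=> /funext ->. Qed.

Lemma intgD f g : intg f -> intg g -> intg (fun x => f x + g x).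
Proof. by move=> hf hg; apply: (integrableD _ hf hg). Qed.

Lemma intgB f g : intg f -> intg g -> intg (fun x => f x - g x).
Proof. by move=> hf hg; apply: (integrableB _ hf hg). Qed.

Lemma intgZ k f : intg f -> intg (fun x => k * f x).
Proof. by move=> hf; apply: (integrableZl _ k hf). Qed.

Lemma intgZr k f : intg f -> intg (fun x => f x * k).
Proof. by move=> /(intgZ k); apply: intg_ext => x; rewrite mulrC. Qed.

Lemma intg_abs f : intg f -> intg (fun x => `|f x|).
Proof. exact: integrable_norm. Qed.

Lemma intg0 : intg (fun=> 0).
Proof. exact: integrable0. Qed.

Lemma intg_sum (J : Type) (s : seq J) (F : J -> T -> R) :
  (forall j, intg (F j)) -> intg (fun x => \sum_(j <- s) F j x).
Proof.
move=> hF; elim: s => [|j s IH].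
  by apply: intg_ext intg0 => x; rewrite big_nil.
by apply: intg_ext (intgD (hF j) IH) => x; rewrite big_cons.
Qed.

Lemma intgM_bd f g C : intg f -> measurable_fun setT g ->
  (forall x, `|g x| <= C) -> intg (fun x => f x * g x).
Proof.
move=> hf mg gC.
apply: (intg_le (g := fun x => C * `|f x|)); last first.
- by move=> x; rewrite normrM mulrC ler_wpM2r.
- exact/intgZ/intg_abs.
- by apply: measurable_funM => //; exact: intg_meas.
Qed.

Lemma eqI f g : f =1 g -> \int[mu]_x f x = \int[mu]_x g x.
Proof. by move=> /funext ->. Qed.

Lemma ID f g : intg f -> intg g ->
  \int[mu]_x (f x + g x) = \int[mu]_x f x + \int[mu]_x g x.
Proof. exact: RintegralD. Qed.

Lemma IB f g : intg f -> intg g ->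
  \int[mu]_x (f x - g x) = \int[mu]_x f x - \int[mu]_x g x.
Proof. exact: RintegralB. Qed.

Lemma IZ k f : intg f -> \int[mu]_x (k * f x) = k * \int[mu]_x f x.
Proof. by move=> hf; rewrite RintegralZl. Qed.

Lemma IZr k f : intg f -> \int[mu]_x (f x * k) = (\int[mu]_x f x) * k.
Proof. by move=> hf; rewrite RintegralZr. Qed.

Lemma IN f : intg f -> \int[mu]_x (- f x) = - \int[mu]_x f x.
Proof.
by move=> hf; rewrite -mulN1r -IZ//; apply: eqI => x; rewrite mulN1r.
Qed.

Lemma I0 : \int[mu]_x (0 : R) = 0.
Proof. by rewrite /Rintegral integral0_eq. Qed.

Lemma Isum (J : Type) (s : seq J) (F : J -> T -> R) :
  (forall j, intg (F j)) ->
  \int[mu]_x (\sum_(j <- s) F j x) = \sum_(j <- s) \int[mu]_x F j x.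
Proof.
move=> hF; elim: s => [|j s IH].
  by rewrite big_nil -[RHS]I0; apply: eqI => x; rewrite big_nil.
rewrite big_cons -IH -ID//; last exact: intg_sum.
by apply: eqI => x; rewrite big_cons.
Qed.

Lemma Ile f g : intg f -> intg g -> (forall x, f x <= g x) ->
  \int[mu]_x f x <= \int[mu]_x g x.
Proof. by move=> hf hg fg; apply: le_Rintegral. Qed.

Lemma Iabs f : intg f -> `|\int[mu]_x f x| <= \int[mu]_x `|f x|.
Proof. exact: le_normr_Rintegral. Qed.

Lemma Iabs_le f g : measurable_fun setT f -> intg g ->
  (forall x, `|f x| <= g x) -> `|\int[mu]_x f x| <= \int[mu]_x g x.
Proof.
move=> mf ig fg; have hf := intg_le mf ig fg.
by apply: le_trans (Iabs hf) _; apply: Ile => //; exact: intg_abs.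
Qed.

Lemma I_ge0 f : (forall x, 0 <= f x) -> 0 <= \int[mu]_x f x.
Proof. by move=> f0; exact: Rintegral_ge0. Qed.

Lemma EFinI f : intg f -> (\int[mu]_x f x)%:E = (\int[mu]_x (f x)%:E)%E.
Proof. by move=> hf; rewrite fineK//; exact: integrable_fin_num. Qed.

Lemma intg_ge0P f : measurable_fun setT f -> (forall x, 0 <= f x) ->
  (\int[mu]_x (f x)%:E < +oo)%E -> intg f.
Proof.
move=> mf f0 foo; apply/integrableP; split; first exact/measurable_EFinP.
by under eq_integral => x _ do rewrite /= ger0_norm//.
Qed.

(** Measurability and integrability of the limit are conclusions: most limits below are known only
    as pointwise limits. *)
Lemma Idct (F : nat -> T -> R) f g :
  (forall n, measurable_fun setT (F n)) -> intg g ->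
  (forall x, F n x @[n --> \oo] --> f x) ->
  (forall n x, `|F n x| <= g x) ->
  intg f /\ \int[mu]_x F n x @[n --> \oo] --> \int[mu]_x f x.
Proof.
move=> mF ig Ff Fg.
have mf : measurable_fun setT f.
  by apply: (@measurable_fun_cvg _ _ _ _ F) => // x _.
have fg x : `|f x| <= g x.
  have cv : `|F n x| @[n --> \oo] --> `|f x| by apply: cvg_norm.
  rewrite -(cvg_lim _ cv)//; apply: limr_le; first by apply/cvg_ex; exists `|f x|.
  by apply: nearW => n.
have hf : intg f by apply: intg_le ig fg.
split => //.
have [|||||_ _ cv] := @dominated_convergence _ _ _ mu setT measurableT
  (fun n => EFin \o F n) (EFin \o f) (EFin \o g).
- by move=> n; exact/measurable_EFinP.
- exact/measurable_EFinP.
- by apply: aeW => x _; apply: cvg_EFin; [exact: nearW|exact: Ff].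
- by [].
- by apply: aeW => x n _; exact: Fg.
- by apply: fine_cvg; rewrite fineK//; exact: integrable_fin_num.
Qed.

Definition sqi f : Prop := measurable_fun setT f /\ intg (fun x => f x ^+ 2).

Definition nsq f : R := \int[mu]_x (f x ^+ 2).

Definition N2 f : R := Num.sqrt (nsq f).

Lemma nsq_ge0 f : 0 <= nsq f.
Proof. by apply: I_ge0 => x; exact: sqr_ge0. Qed.

Lemma N2_ge0 f : 0 <= N2 f. Proof. exact: sqrtr_ge0. Qed.

Lemma N2_sqr f : N2 f ^+ 2 = nsq f.
Proof. by rewrite sqr_sqrtr// nsq_ge0. Qed.

Lemma sqi_meas f : sqi f -> measurable_fun setT f. Proof. by case. Qed.

Lemma sqi_mul f g : sqi f -> sqi g -> intg (fun x => f x * g x).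
Proof.
move=> [mf f2] [mg g2]; apply: (intg_le _ (intgD f2 g2)).
  exact: measurable_funM.
move=> x; rewrite normrM -(real_normK (num_real (f x))) -(real_normK (num_real (g x))).
nra.
Qed.

Lemma sqi_le f g : measurable_fun setT f -> sqi g -> (forall x, `|f x| <= `|g x|) -> sqi f.
Proof.
move=> mf [mg g2] fg; split => //; apply: (intg_le _ g2).
  exact: measurable_funX.
move=> x; rewrite normrX -(real_normK (num_real (g x))).
by rewrite lerXn2r.
Qed.

Lemma sqiD f g : sqi f -> sqi g -> sqi (fun x => f x + g x).
Proof.
move=> hf hg; split; first by apply: measurable_funD; apply: sqi_meas.
have := intgD (intgD hf.2 (intgZ 2 (sqi_mul hf hg))) hg.2.
by apply: intg_ext => x; rewrite sqrrD mulr_natl.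
Qed.

Lemma sqiZ k f : sqi f -> sqi (fun x => k * f x).
Proof.
move=> [mf f2]; split; first exact: measurable_funM.
by apply: intg_ext (intgZ (k ^+ 2) f2) => x; rewrite exprMn.
Qed.

Lemma sqi0 : sqi (fun=> 0).
Proof. by split => //; apply: intg_ext intg0 => x; rewrite expr0n. Qed.

Lemma sqi_ext f g : f =1 g -> sqi f -> sqi g.
Proof. by move=> /funext ->. Qed.

Lemma sqiN f : sqi f -> sqi (fun x => - f x).
Proof. by move=> /(sqiZ (-1)); apply: sqi_ext => x; rewrite mulN1r. Qed.

Lemma sqiB f g : sqi f -> sqi g -> sqi (fun x => f x - g x).
Proof. by move=> hf hg; apply: sqiD => //; exact: sqiN. Qed.

Lemma sqi_sum (J : Type) (s : seq J) (F : J -> T -> R) :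
  (forall j, sqi (F j)) -> sqi (fun x => \sum_(j <- s) F j x).
Proof.
move=> hF; elim: s => [|j s IH].
  by apply: sqi_ext sqi0 => x; rewrite big_nil.
by apply: sqi_ext (sqiD (hF j) IH) => x; rewrite big_cons.
Qed.

Lemma sqi_abs f : sqi f -> sqi (fun x => `|f x|).
Proof.
move=> [mf f2]; split; first exact: measurableT_comp.
by apply: intg_ext f2 => x; rewrite real_normK// num_real.
Qed.

Lemma sqiM_bd f g C : sqi f -> measurable_fun setT g ->
  (forall x, `|g x| <= C) -> sqi (fun x => f x * g x).
Proof.
move=> hf mg gC; apply: (sqi_le _ (sqiZ C hf)).
  by apply: measurable_funM => //; exact: sqi_meas.
move=> x; rewrite !normrM mulrC ler_wpM2r//.
by rewrite (le_trans (gC x))// ler_norm.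
Qed.

Lemma nsqZ k f : sqi f -> nsq (fun x => k * f x) = k ^+ 2 * nsq f.
Proof. by move=> [_ f2]; rewrite -IZ//; apply: eqI => x; rewrite exprMn. Qed.

Lemma N2Z k f : sqi f -> N2 (fun x => k * f x) = `|k| * N2 f.
Proof. by move=> hf; rewrite /N2 nsqZ// sqrtrM ?sqr_ge0// sqrtr_sqr. Qed.

Lemma N2N f : N2 (fun x => - f x) = N2 f.
Proof. by congr Num.sqrt; apply: eqI => x; rewrite sqrrN. Qed.

Lemma nsqD f g : sqi f -> sqi g ->
  nsq (fun x => f x + g x) = nsq f + 2 * \int[mu]_x (f x * g x) + nsq g.
Proof.
move=> hf hg; have hfg := sqi_mul hf hg; have [_ f2] := hf; have [_ g2] := hg.
have e : (fun x => (f x + g x) ^+ 2) = fun x => f x ^+ 2 + 2 * (f x * g x) + g x ^+ 2.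
  by apply/funext => x; rewrite sqrrD mulr_natl.
have i2 := intgZ 2 hfg.
by rewrite /nsq e (ID (intgD f2 i2) g2) (ID f2 i2) (IZ _ hfg).
Qed.

(** The quadratic [nsq (f + t g)] is nonnegative for all [t]. It is evaluated at its minimiser, or,
    if [nsq g = 0], at a point where the remaining affine function would be negative unless
    [c = 0]. *)
Lemma cauchy_schwarz f g : sqi f -> sqi g ->
  `|\int[mu]_x (f x * g x)| <= N2 f * N2 g.
Proof.
move=> hf hg; set c := \int[mu]_x _.
have key t : 0 <= nsq f + 2 * (t * c) + t ^+ 2 * nsq g.
  have -> : t * c = \int[mu]_x (f x * (t * g x)).
    by rewrite -IZ; [apply: eqI => x; rewrite mulrCA|exact: sqi_mul].
  by rewrite -nsqZ// -nsqD//; [exact: nsq_ge0|exact: sqiZ].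
rewrite -ler_sqr ?nnegrE ?mulr_ge0 ?N2_ge0//.
rewrite real_normK ?num_real// exprMn !N2_sqr.
have [g0|g0] := eqVneq (nsq g) 0.
  rewrite g0 mulr0; have [->|c0] := eqVneq c 0; first by rewrite expr0n.
  have := key (- (nsq f + 1) / c); rewrite g0 divfK//.
  have := nsq_ge0 f; lra.
have gp : 0 < nsq g by rewrite lt_def g0 nsq_ge0.
have := key (- c / nsq g).
have -> : nsq f + 2 * (- c / nsq g * c) + (- c / nsq g) ^+ 2 * nsq g
  = nsq f - c ^+ 2 / nsq g by field.
by rewrite subr_ge0 ler_pdivrMr.
Qed.

Lemma N2D f g : sqi f -> sqi g -> N2 (fun x => f x + g x) <= N2 f + N2 g.
Proof.
move=> hf hg; rewrite -ler_sqr ?nnegrE ?addr_ge0 ?N2_ge0//.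
rewrite N2_sqr nsqD// sqrrD !N2_sqr.
have := cauchy_schwarz hf hg; have := ler_norm (\int[mu]_x (f x * g x)); lra.
Qed.

Lemma N2B f g : sqi f -> sqi g -> N2 (fun x => f x - g x) <= N2 f + N2 g.
Proof. by move=> hf hg; rewrite -(N2N g); apply: N2D => //; exact: sqiN. Qed.

Lemma N2_le f g : measurable_fun setT f -> sqi g -> (forall x, `|f x| <= `|g x|) ->
  N2 f <= N2 g.
Proof.
move=> mf hg fg; have hf := sqi_le mf hg fg.
rewrite ler_wsqrtr//; apply: Ile; [exact: hf.2|exact: hg.2|] => x.
rewrite -(real_normK (num_real (f x))) -(real_normK (num_real (g x))).
by rewrite lerXn2r.
Qed.

Lemma N2_sum (J : Type) (s : seq J) (F : J -> T -> R) : (forall j, sqi (F j)) ->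
  N2 (fun x => \sum_(j <- s) F j x) <= \sum_(j <- s) N2 (F j).
Proof.
move=> hF; elim: s => [|j s IH].
  rewrite big_nil /N2 /nsq (_ : Rintegral _ _ _ = 0) ?sqrtr0//.
  by rewrite -[RHS]I0; apply: eqI => x; rewrite big_nil expr0n.
rewrite big_cons; apply: le_trans (lerD (lexx _) IH).
rewrite (_ : (fun x => _) = fun x => F j x + \sum_(j <- s) F j x).
  by apply: N2D => //; exact: sqi_sum.
by apply/funext => x; rewrite big_cons.
Qed.

Lemma N2_mulbd f g C : sqi f -> measurable_fun setT g -> 0 <= C ->
  (forall x, `|g x| <= C) -> N2 (fun x => f x * g x) <= C * N2 f.
Proof.
move=> hf mg C0 gC; rewrite -[X in X * _](ger0_norm C0) -N2Z//.
apply: N2_le; first by apply: measurable_funM => //; exact: sqi_meas.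
  exact: sqiZ.
by move=> x; rewrite !normrM mulrC ler_wpM2r// (le_trans (gC x))// ler_norm.
Qed.

End RealIntegral.
Arguments intg {d T R} mu f.
Arguments sqi {d T R} mu f.
Arguments nsq {d T R} mu f.
Arguments N2 {d T R} mu f.

(** * Fubini's theorem for real integrals *)

Section RealFubini.
Context {d1 d2} {T1 : measurableType d1} {T2 : measurableType d2} {R : realType}.
Variable m1 : {sigma_finite_measure set T1 -> \bar R}.
Variable m2 : {sigma_finite_measure set T2 -> \bar R}.
Variable f : T1 * T2 -> R.
Hypothesis mf : measurable_fun setT f.

Lemma intg_prod (g : T1 -> R) : (forall x, intg m2 (fun y => f (x, y))) ->
  (forall x, \int[m2]_y `|f (x, y)| <= g x) -> intg m1 g ->
  intg (m1 \x m2)%E f.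
Proof.
move=> if2 fg ig; apply/integrable12ltyP; first exact/measurable_EFinP.
have : (\int[m1]_x (g x)%:E < +oo)%E by exact: integrable_lty.
apply: le_lt_trans; apply: ge0_le_integral => //.
- by move=> x _; exact: integral_ge0.
- apply: (measurable_fun_fubini_tonelli_F (fun z => `|(f z)%:E|%E)) => //.
  by apply: measurableT_comp => //; exact/measurable_EFinP.
- by apply/measurable_EFinP; exact: intg_meas ig.
- move=> x _; rewrite (_ : (\int[m2]_y _)%E = (\int[m2]_y `|f (x, y)|)%:E) ?lee_fin//.
  by rewrite EFinI//; exact: intg_abs.
Qed.

Hypothesis hf : intg (m1 \x m2)%E f.

(** Only almost every slice is integrable; on the others the real inner integral may be a default
    value. The comparison with the extended-real one is therefore almost everywhere, which suffices
    under the outer integral. *)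
Let F_fin : \forall x \ae m1, ((\int[m2]_y f (x, y))%:E = \int[m2]_y (f (x, y))%:E)%E.
Proof.
have := ae_integrable1 hf; apply: filterS => x hx; exact: EFinI.
Qed.

Let G_fin : \forall y \ae m2, ((\int[m1]_x f (x, y))%:E = \int[m1]_x (f (x, y))%:E)%E.
Proof.
have := ae_integrable2 hf; apply: filterS => x hx; exact: EFinI.
Qed.

Let mF : measurable_fun setT (fun x => (\int[m2]_y f (x, y))).
Proof.
have := measurable_fubini_F hf.
exact: measurableT_comp.
Qed.

Let mG : measurable_fun setT (fun y => (\int[m1]_x f (x, y))).
Proof.
have := measurable_fubini_G hf.
exact: measurableT_comp.
Qed.

Lemma intg_fub1 : intg m1 (fun x => \int[m2]_y f (x, y)).
Proof.
have /integrableP[h1 h2] := integrable_fubini_F hf.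
apply/integrableP; split; first exact/measurable_EFinP.
apply: le_lt_trans h2; apply: eq_ler.
apply: ae_eq_integral => //.
- by apply: measurableT_comp => //; exact/measurable_EFinP.
- exact: measurableT_comp.
- by move: F_fin; apply: filterS => x h _; rewrite -[LHS]/(`|(_)%:E|%E) h.
Qed.

Lemma intg_fub2 : intg m2 (fun y => \int[m1]_x f (x, y)).
Proof.
have mh := measurable_fubini_G hf.
have := integral21_prod_meas1 hf; have := measurable_fubini_G hf.
have : m2.-integrable setT (fubini_G m1 (EFin \o f)).
  apply/integrableP; split => //.
  have /(integrable21ltyP m1 m2 ((measurable_EFinP _ _).2 mf)) h2 := hf.
  apply: le_lt_trans h2; apply: ge0_le_integral => //.
  - exact: measurableT_comp.
  - apply: (measurable_fun_fubini_tonelli_G (fun z => `|(f z)%:E|%E)) => //.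
    by apply: measurableT_comp => //; exact/measurable_EFinP.
  - move=> x _; apply: le_abse_integral => //.
    by apply/measurable_EFinP/measurableT_comp.
move=> /integrableP[_ h2] _ _.
apply/integrableP; split; first exact/measurable_EFinP.
apply: le_lt_trans h2; apply: eq_ler.
apply: ae_eq_integral => //.
- by apply: measurableT_comp => //; exact/measurable_EFinP.
- exact: measurableT_comp.
- by move: G_fin; apply: filterS => x h _; rewrite -[LHS]/(`|(_)%:E|%E) h.
Qed.

Lemma RFubini : \int[m1]_x (\int[m2]_y f (x, y)) = \int[m2]_y (\int[m1]_x f (x, y)).
Proof.
have := Fubini hf.
have e1 : (\int[m1]_x (\int[m2]_y f (x, y))%:E = \int[m1]_x (\int[m2]_y (f (x, y))%:E))%E.
  apply: ae_eq_integral => //; first exact/measurable_EFinP.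
    exact: (measurable_fubini_F hf).
  by move: F_fin; apply: filterS => x -> _.
have e2 : (\int[m2]_x (\int[m1]_y f (y, x))%:E = \int[m2]_x (\int[m1]_y (f (y, x))%:E))%E.
  apply: ae_eq_integral => //; first exact/measurable_EFinP.
    exact: (measurable_fubini_G hf).
  by move: G_fin; apply: filterS => x -> _.
by rewrite {1 3}/Rintegral e1 e2 => ->.
Qed.

End RealFubini.

Notation "''d_' i f" := ('D_(unit_vector i) f) (at level 10, i, f at next level).
Notation "''d_' i f c" := ('D_(unit_vector i) f c) (at level 10, i, f at next level).
Notation "''u_' i" := (unit_vector i) (at level 8, i at level 2).
Notation intgX := (intg leb3).
Notation sqX := (sqi leb3).
Notation nsqX := (nsq leb3).
Notation N2X := (N2 leb3).
Notation vsqX w := (forall i, sqX (w i)).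

(** * Sigma-finite product measures *)

Section SigmaFiniteProduct.
Context {d1 d2} {T1 : measurableType d1} {T2 : measurableType d2} {R : realType}.
Variable m1 : {sigma_finite_measure set T1 -> \bar R}.
Variable m2 : {sigma_finite_measure set T2 -> \bar R}.

(* The library's own sigma-finite instance of [\x] is shadowed by the one for
   subprobabilities, hence this copy of the measure. *)
Definition sfprod := fun A => (m1 \x m2)%E A.

HB.instance Definition _ := Measure.copy sfprod (m1 \x m2)%E.

Lemma sfprod_sigma_finite : sigma_finite setT sfprod.
Proof.
have /sigma_finiteP[F [TF ndF Foo]] := sigma_finiteT m1.
have /sigma_finiteP[G [TG ndG Goo]] := sigma_finiteT m2.
exists (fun n => F n `*` G n) => [|k]; last first.
  have [[mF Fk] [mG Gk]] := (Foo k, Goo k).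
  split; first exact: measurableX.
  by rewrite /sfprod product_measure1E// lte_mul_pinfty// ge0_fin_numE.
apply/esym/seteqP; split => // -[x y] _.
have [n _ Fx] : (\bigcup_n F n) x by rewrite -TF.
have [k _ Gy] : (\bigcup_n G n) y by rewrite -TG.
exists (maxn n k); split => /=.
  by move: x Fx; apply/subsetPset/ndF/leq_maxl.
by move: y Gy; apply/subsetPset/ndG/leq_maxr.
Qed.

HB.instance Definition _ := @Measure_isSigmaFinite.Build _ _ _ sfprod sfprod_sigma_finite.

End SigmaFiniteProduct.

(** * Affine changes of variables, on the line and in space *)

Section Affine1.
Context {R : realType}.
Local Notation mu := (@lebesgue_measure R).

Lemma measurable_affine (a b : R) : measurable_fun setT (fun x : R => a * x + b).
Proof. by apply: measurable_funD. Qed.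

(** Lebesgue measure is determined by its values on the intervals []x, y]], where the rescaled image
    measure is computed directly. For [a < 0] the preimage is half-open on the other side, with the
    same length. *)
Lemma lebesgue_measure_affine (a b : R) (a0 : a != 0) (A : set R) : measurable A ->
  mu A = (`|a|%:E * mu ((fun x => a * x + b)%R @^-1` A))%E.
Proof.
pose c : {nonneg R} := NngNum (normr_ge0 a).
pose phi := ((fun x => a * x + b)%R : measurableTypeR R -> measurableTypeR R).
have mphi : measurable_fun setT phi by exact: measurable_affine.
pose nu := mscale c (pushforward mu phi).
rewrite -[RHS]/(nu mphi A); apply: lebesgue_measure_unique => //.
move=> _ [[x y] _ <-]; rewrite -[RHS]/(`|a|%:E * mu ((fun x => a * x + b)%R @^-1` `]x, y]))%E.
have [ap|an] := ltP 0 a.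
  rewrite (_ : _ @^-1` _ = `](x - b) / a, (y - b) / a]%classic); last first.
    apply/seteqP; split => z /=; rewrite !in_itv/= ltr_pdivrMr// ler_pdivlMr//;
      by rewrite ltrBlDr lerBrDr mulrC.
  rewrite !lebesgue_measure_itv/= !lte_fin ltr_pM2r ?invr_gt0// ltrBlDr subrK.
  case: ifPn => _; last by rewrite mule0.
  by congr EFin; rewrite ger0_norm ?ltW//; field.
have {}an : a < 0 by rewrite lt_def eq_sym a0.
rewrite (_ : _ @^-1` _ = `[(y - b) / a, (x - b) / a[%classic); last first.
  apply/seteqP; split => z /=; rewrite !in_itv/= ler_ndivrMr// ltr_ndivlMr//;
    by rewrite ltrBlDr lerBrDr mulrC andbC.
rewrite !lebesgue_measure_itv/= !lte_fin ltr_nM2r ?invr_lt0// ltrBlDr subrK.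
case: ifPn => _; last by rewrite mule0.
by congr EFin; rewrite ltr0_norm//; field.
Qed.

Lemma ge0_integral_affine (a b : R) (f : R -> \bar R) : a != 0 ->
  measurable_fun setT f -> (forall x, 0 <= f x)%E ->
  (`|a|%:E * \int[mu]_x f (a * x + b)%R = \int[mu]_x f x)%E.
Proof.
move=> a0 mf f0.
pose c : {nonneg R} := NngNum (normr_ge0 a).
pose phi := ((fun x => a * x + b)%R : measurableTypeR R -> measurableTypeR R).
have mphi : measurable_fun setT phi by exact: measurable_affine.
have := @ge0_integral_pushforward _ _ _ _ _ phi mphi mu setT f measurableT mf.
rewrite preimage_setT => <-; last by move=> x _.
have := @ge0_integral_mscale _ _ _ (pushforward mu phi) setT measurableT c f mf (fun x _ => f0 x).
move=> <-; apply: eq_measure_integral => A mA _.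
by rewrite [RHS](lebesgue_measure_affine b a0 mA).
Qed.

End Affine1.

Notation mspace3 R := (measurableTypeR R * measurableTypeR R * measurableTypeR R)%type.

Section Space3.
Context {R : realType}.
Local Notation mu := (@lebesgue_measure R).
Local Notation X := (mspace3 R).
Implicit Types (f g : space3 R -> R) (x y : space3 R).

Definition mfun3 (f : space3 R -> R) : Prop := measurable_fun (setT : set X) f.

Definition leb2s : {sigma_finite_measure set (measurableTypeR R * measurableTypeR R)%type -> \bar R} :=
  sfprod mu mu.

Definition leb3s : {sigma_finite_measure set X -> \bar R} := sfprod leb2s mu.

Lemma ge0_integral3 (f : X -> \bar R) : measurable_fun setT f -> (forall x, 0 <= f x)%E ->
  (\int[leb3]_x f x = \int[mu]_x \int[mu]_y \int[mu]_z f (x, y, z))%E.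
Proof.
move=> mf f0.
rewrite [LHS](@fubini_tonelli1 _ _ _ _ _ leb2s mu)//.
rewrite (@fubini_tonelli1 _ _ _ _ _ mu mu)//=.
  exact: measurable_fun_fubini_tonelli_F.
by move=> x; exact: integral_ge0.
Qed.

Definition aff3 (a : R) (b x : space3 R) : space3 R :=
  (a * x.1.1 + b.1.1, a * x.1.2 + b.1.2, a * x.2 + b.2).

Lemma measurable_x1 : measurable_fun (setT : set X) (fun x : X => x.1.1).
Proof. by apply: measurableT_comp. Qed.
Lemma measurable_x2 : measurable_fun (setT : set X) (fun x : X => x.1.2).
Proof. by apply: measurableT_comp. Qed.
Lemma measurable_x3 : measurable_fun (setT : set X) (fun x : X => x.2).
Proof. exact: measurable_snd. Qed.

Lemma measurable_aff3 a b : measurable_fun (setT : set X) (aff3 a b : X -> X).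
Proof.
have h1 := measurableT_comp (measurable_affine a b.1.1) measurable_x1.
have h2 := measurableT_comp (measurable_affine a b.1.2) measurable_x2.
have h3 := measurableT_comp (measurable_affine a b.2) measurable_x3.
by apply: measurable_fun_pair => //; exact: measurable_fun_pair.
Qed.

(** By Tonelli this is three one-dimensional substitutions, each contributing a factor [|a|]; the
    partial integrals [F1] and [F2] carry the measurability needed for each. *)
Lemma ge0_integral_aff3 (a : R) b (f : X -> \bar R) : a != 0 ->
  measurable_fun setT f -> (forall x, 0 <= f x)%E ->
  ((`|a| ^+ 3)%:E * \int[leb3]_x f (aff3 a b x) = \int[leb3]_x f x)%E.
Proof.
move=> a0 mf f0.
have mfa : measurable_fun setT (f \o aff3 a b) by exact: measurableT_comp (measurable_aff3 a b).
rewrite (ge0_integral3 mf f0) (@ge0_integral3 (f \o aff3 a b)) => [|//|x]; last exact: f0.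
pose F1 (x y : R) := (\int[mu]_z f (x, y, z))%E.
pose F2 (x : R) := (\int[mu]_y F1 x y)%E.
have m1 : measurable_fun setT (fun xy : measurableTypeR R * measurableTypeR R => F1 xy.1 xy.2).
  have := @measurable_fun_fubini_tonelli_F _ _ _ _ _ mu f mf f0.
  by congr (measurable_fun _ _); apply/funext => -[].
have f1 (x y : R) : (0 <= F1 x y)%E by exact: integral_ge0.
have m2 : measurable_fun setT F2.
  by have := @measurable_fun_fubini_tonelli_F _ _ _ _ _ mu _ m1 (fun _ => f1 _ _).
have f2 (x : R) : (0 <= F2 x)%E by exact: integral_ge0.
have na : (0 <= `|a|%:E)%E by rewrite lee_fin.
have mpx (x : R) : measurable_fun setT (fun y : measurableTypeR R => F1 x y).
  by have := measurableT_comp m1 (pair1_measurable x).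
have mpxy (x y : R) : measurable_fun setT (fun z : measurableTypeR R => f (x, y, z)).
  by have := measurableT_comp mf (pair1_measurable (x, y)).
rewrite -[RHS]/(\int[mu]_x F2 x)%E -(ge0_integral_affine b.1.1 a0 m2 f2).
have -> : (\int[mu]_x F2 (a * x + b.1.1)%R = \int[mu]_x (`|a|%:E * \int[mu]_y F1 (a * x + b.1.1)%R (a * y + b.1.2)%R))%E.
  by apply: eq_integral => x _; rewrite (ge0_integral_affine b.1.2 a0 (mpx _) (f1 _)).
have -> : (\int[mu]_x (`|a|%:E * \int[mu]_y F1 (a * x + b.1.1)%R (a * y + b.1.2)%R) =
    \int[mu]_x (`|a|%:E * (`|a|%:E * \int[mu]_y \int[mu]_z f (a * x + b.1.1, a * y + b.1.2, a * z + b.2)%R)))%E.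
  apply: eq_integral => x _; congr (_ * _)%E.
  have e (y : R) : F1 (a * x + b.1.1)%R (a * y + b.1.2)%R = (`|a|%:E * \int[mu]_z f (a * x + b.1.1, a * y + b.1.2, a * z + b.2)%R)%E.
    by rewrite (ge0_integral_affine b.2 a0 (mpxy _ _)).
  under eq_integral => y _ do rewrite e.
  rewrite ge0_integralZl//.
  - have m3 := @measurable_fun_fubini_tonelli_F _ _ _ _ _ mu (f \o aff3 a b) mfa (fun _ => f0 _).
    by have := measurableT_comp m3 (pair1_measurable x).
  - by move=> y _; exact: integral_ge0.
have m3 := @measurable_fun_fubini_tonelli_F _ _ _ _ _ mu (f \o aff3 a b) mfa (fun _ => f0 _).
have p3 xy : (0 <= fubini_F mu (f \o aff3 a b) xy)%E by apply: integral_ge0 => z _ /=.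
have m4 := @measurable_fun_fubini_tonelli_F _ _ _ _ _ mu _ m3 p3.
have p4 (x : R) : (0 <= fubini_F mu (fubini_F mu (f \o aff3 a b)) x)%E by apply: integral_ge0 => z _.
rewrite ge0_integralZl//; last 2 first.
- exact: measurable_funeM.
- by move=> x _; apply: mule_ge0 => //; exact: p4.
rewrite ge0_integralZl//.
  by rewrite !EFinM !muleA.
by move=> x _; exact: (p4 x).
Qed.

Lemma intg_aff3 a b f : a != 0 -> intgX f -> intgX (fun x => f (aff3 a b x)).
Proof.
move=> a0 hf; have mf := intg_meas hf.
apply/integrableP; split.
  by apply/measurable_EFinP; exact: (measurableT_comp mf (measurable_aff3 a b)).
have /integrableP[_ hfoo] := hf.
have := @ge0_integral_aff3 a b (fun x => `|(f x)%:E|%E) a0.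
move=> /(_ _ (fun _ => abse_ge0 _)) h.
move: hfoo; rewrite -h; last by apply: measurableT_comp => //; exact/measurable_EFinP.
apply: contraPT; rewrite -leNgt leye_eq => /eqP e.
by rewrite e gt0_muley// lte_fin exprn_gt0// normr_gt0.
Qed.

Lemma I_aff3 a b f : a != 0 -> intgX f ->
  `|a| ^+ 3 * \int[leb3]_x f (aff3 a b x) = \int[leb3]_x f x.
Proof.
move=> a0 hf; have mf := intg_meas hf; have hfa := intg_aff3 b a0 hf.
apply: EFin_inj; rewrite EFinM !EFinI// integralE [RHS]integralE.
have mE : measurable_fun (setT : set X) (EFin \o f) by exact/measurable_EFinP.
rewrite muleBr//; last first.
  rewrite fin_num_adde_defr//; apply: integrable_pos_fin_num => //.
have ep : ((fun x => (f (aff3 a b x))%:E)^\+ = (fun x => (EFin \o f)^\+ (aff3 a b x)))%E.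
  by apply/funext => x; rewrite !funeposE.
have en : ((fun x => (f (aff3 a b x))%:E)^\- = (fun x => (EFin \o f)^\- (aff3 a b x)))%E.
  by apply/funext => x; rewrite !funenegE.
rewrite ep en; congr (_ - _)%E.
  exact: (@ge0_integral_aff3 a b (EFin \o f)^\+%E a0 (measurable_funepos mE) (funepos_ge0 _)).
exact: (@ge0_integral_aff3 a b (EFin \o f)^\-%E a0 (measurable_funeneg mE) (funeneg_ge0 _)).
Qed.

End Space3.

(** * Measurability, Fubini and an integrable weight in space *)

Section Space3Measure.
Context {R : realType}.
Local Notation mu := (@lebesgue_measure R).
Local Notation X := (mspace3 R).
Implicit Types (f g : space3 R -> R) (x y : space3 R).

Lemma aff3E a b x : aff3 a b x = a *: x + b :> space3 R.
Proof. by []. Qed.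

Lemma intg_shift b f : intgX f -> intgX (fun x => f (x + b)).
Proof.
move=> /(intg_aff3 b (oner_neq0 R)); apply: intg_ext => x.
by rewrite aff3E scale1r.
Qed.

Lemma I_shift b f : intgX f -> \int[leb3]_x f (x + b) = \int[leb3]_x f x.
Proof.
move=> hf; rewrite -(I_aff3 b (oner_neq0 R) hf) normr1 expr1n mul1r.
by apply: eqI => x; rewrite aff3E scale1r.
Qed.

Lemma intg_refl b f : intgX f -> intgX (fun x => f (b - x)).
Proof.
have n1 : (-1 : R) != 0 by rewrite oppr_eq0.
move=> /(intg_aff3 b n1); apply: intg_ext => x.
by rewrite aff3E scaleN1r addrC.
Qed.

Lemma I_refl b f : intgX f -> \int[leb3]_x f (b - x) = \int[leb3]_x f x.
Proof.
have n1 : (-1 : R) != 0 by rewrite oppr_eq0.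
move=> hf; rewrite -(I_aff3 b n1 hf) normrN1 expr1n mul1r.
by apply: eqI => x; rewrite aff3E scaleN1r addrC.
Qed.

Lemma intg_scale a f : a != 0 -> intgX f -> intgX (fun x => f (a *: x)).
Proof.
move=> a0 /(intg_aff3 0 a0); apply: intg_ext => x.
by rewrite aff3E addr0.
Qed.

Lemma I_scale a f : a != 0 -> intgX f ->
  `|a| ^+ 3 * \int[leb3]_x f (a *: x) = \int[leb3]_x f x.
Proof.
move=> a0 hf; rewrite -(I_aff3 0 a0 hf); congr (_ * _).
by apply: eqI => x; rewrite aff3E addr0.
Qed.

Lemma mfun3_comp_fiber (C : countType) (h : X -> C) (g : C -> R) :
  (forall c, measurable (h @^-1` [set c])) -> mfun3 (g \o h).
Proof.
move=> mh _ Y mY; rewrite setTI.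
have -> : (g \o h) @^-1` Y = \bigcup_(c in [set c | Y (g c)]) (h @^-1` [set c]).
  apply/seteqP; split => [x Yx|x [c /= Yc hc]]; last by rewrite hc.
  by exists (h x).
rewrite bigcup_mkcond; apply: countable_bigcupT_measurable => // c.
by case: ifP.
Qed.

(** This links the product topology with the product sigma-algebra: [f] is the pointwise limit of
    its values at the corners of a grid of mesh [1/(n+1)], and these approximations take countably
    many values, each on a measurable union of boxes. *)
Lemma continuous_mfun3 f : continuous f -> mfun3 f.
Proof.
move=> cf.
pose fl (n : nat) (t : R) : int := Num.floor (n.+1%:R * t).
pose h n (x : X) : (int * int) * int := (fl n x.1.1, fl n x.1.2, fl n x.2).
pose e n (c : (int * int) * int) : space3 R :=
  (c.1.1%:~R / n.+1%:R, c.1.2%:~R / n.+1%:R, c.2%:~R / n.+1%:R).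
have mfl n (i : int) : measurable (fl n @^-1` [set i]).
  rewrite (_ : _ @^-1` _ = `[i%:~R / n.+1%:R, (i + 1)%:~R / n.+1%:R[%classic)//.
  apply/seteqP; split => t /=; rewrite in_itv/= ler_pdivrMr// ltr_pdivlMr//.
    by move=> <-; rewrite mulrC floor_itv.
  by rewrite mulrC -floor_eq => /eqP.
have mh n c : measurable (h n @^-1` [set c]).
  have -> : h n @^-1` [set c] = (fun x => x.1.1) @^-1` (fl n @^-1` [set c.1.1]) `&`
      ((fun x => x.1.2) @^-1` (fl n @^-1` [set c.1.2]) `&` (fun x => x.2) @^-1` (fl n @^-1` [set c.2])).
    apply/seteqP; split => [x <- //|x [/= e1 [e2 e3]]].
    by rewrite /h e1 e2 e3; case: (c) => -[].
  apply: measurableI; last apply: measurableI.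
  - by have := measurable_x1 measurableT (mfl n c.1.1); rewrite setTI.
  - by have := measurable_x2 measurableT (mfl n c.1.2); rewrite setTI.
  - by have := measurable_x3 measurableT (mfl n c.2); rewrite setTI.
apply: (@measurable_fun_cvg _ _ _ _ (fun n => (f \o e n) \o h n)).
  by move=> n; apply: mfun3_comp_fiber.
have cfl t : (fl n t)%:~R / n.+1%:R @[n --> \oo] --> t.
  apply/cvgrPdist_le => eps eps0.
  have := near_infty_natSinv_lt (PosNum eps0); apply: filterS => n nle.
  have n0 : 0 < n.+1%:R :> R by [].
  have /andP[h1 h2] := floor_itv (n.+1%:R * t).
  rewrite -[t in t - _](mulfK (lt0r_neq0 n0)) -mulrBl normrM normfV [`|_%:R|]ger0_norm//.
  rewrite ler_pdivrMr// [t * _]mulrC ger0_norm ?subr_ge0//.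
  apply: (@le_trans _ _ 1); first by move: h2; lra.
  by rewrite -ler_pdivrMr// div1r ltW.
move=> x _.
have cx : (e n (h n x) : space3 R) @[n --> \oo] --> (x : space3 R).
  case: x => [[x1 x2] x3].
  exact: (cvg_pair (cvg_pair (cfl x1) (cfl x2)) (cfl x3)).
exact: (cvg_comp _ _ cx (cf x)).
Qed.

Lemma intg_X (F : X * X -> R) (g : X -> R) : measurable_fun setT F ->
  (forall x, intgX (fun y => F (x, y))) ->
  (forall x, \int[leb3]_y `|F (x, y)| <= g x) -> intgX g ->
  intg (leb3s \x leb3s)%E F.
Proof. by move=> mF h1 h2 h3; exact: (@intg_prod _ _ _ _ _ leb3s leb3s F mF g h1 h2 h3). Qed.

Lemma fubini_X (F : X * X -> R) (g : X -> R) : measurable_fun setT F ->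
  (forall x, intgX (fun y => F (x, y))) ->
  (forall x, \int[leb3]_y `|F (x, y)| <= g x) -> intgX g ->
  [/\ \int[leb3]_x (\int[leb3]_y F (x, y)) = \int[leb3]_y (\int[leb3]_x F (x, y)),
      intgX (fun x => \int[leb3]_y F (x, y)) &
      intgX (fun y => \int[leb3]_x F (x, y))].
Proof.
move=> mF h1 h2 h3; have hF := intg_X mF h1 h2 h3; split.
- exact: (@RFubini _ _ _ _ _ leb3s leb3s F hF).
- exact: (@intg_fub1 _ _ _ _ _ leb3s leb3s F hF).
- exact: (@intg_fub2 _ _ _ _ _ leb3s leb3s F mF hF).
Qed.

Lemma measurable_pr1 : measurable_fun (setT : set (X * X)) (fun z : X * X => z.1).
Proof. exact: measurable_fst. Qed.
Lemma measurable_pr2 : measurable_fun (setT : set (X * X)) (fun z : X * X => z.2).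
Proof. exact: measurable_snd. Qed.

Lemma measurable_sub3 : measurable_fun (setT : set (X * X)) (fun z : X * X => (z.1 - z.2 : space3 R) : X).
Proof.
have h1 : measurable_fun (setT : set (X * X)) (fun z => z.1.1.1 - z.2.1.1).
  by apply: measurable_funB; apply: measurableT_comp measurable_x1 _.
have h2 : measurable_fun (setT : set (X * X)) (fun z => z.1.1.2 - z.2.1.2).
  by apply: measurable_funB; apply: measurableT_comp measurable_x2 _.
have h3 : measurable_fun (setT : set (X * X)) (fun z => z.1.2 - z.2.2).
  by apply: measurable_funB; apply: measurableT_comp measurable_x3 _.
by apply: measurable_fun_pair => //; exact: measurable_fun_pair.
Qed.

Lemma ge0_integral_prod3 (p q r : R -> R) (a b c : R) :
  measurable_fun setT p -> measurable_fun setT q -> measurable_fun setT r ->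
  (forall t, 0 <= p t) -> (forall t, 0 <= q t) -> (forall t, 0 <= r t) ->
  (\int[mu]_t (p t)%:E = a%:E -> \int[mu]_t (q t)%:E = b%:E -> \int[mu]_t (r t)%:E = c%:E ->
  \int[leb3]_x (p x.1.1 * q x.1.2 * r x.2)%:E = (a * b * c)%:E)%E.
Proof.
move=> mp mq mr p0 q0 r0 ip iq ir.
rewrite ge0_integral3; last 2 first.
- apply/measurable_EFinP; apply: measurable_funM; first apply: measurable_funM.
  + exact: measurableT_comp mp measurable_x1.
  + exact: measurableT_comp mq measurable_x2.
  + exact: measurableT_comp mr measurable_x3.
- by move=> x; rewrite lee_fin !mulr_ge0.
have e1 (x y : R) : (\int[mu]_z (p x * q y * r z)%:E = (p x * q y * c)%:E)%E.
  under eq_integral => z _ do rewrite EFinM.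
  rewrite ge0_integralZl ?ir//; first exact/measurable_EFinP.
  - by move=> z _; rewrite lee_fin.
  - by rewrite lee_fin mulr_ge0.
have c0 : 0 <= c by rewrite -lee_fin -ir integral_ge0// => z _; rewrite lee_fin.
have b0 : 0 <= b by rewrite -lee_fin -iq integral_ge0// => z _; rewrite lee_fin.
have e2 (x : R) : (\int[mu]_y (p x * q y * c)%:E = (p x * b * c)%:E)%E.
  under eq_integral => z _ do rewrite mulrAC EFinM.
  rewrite ge0_integralZl ?iq//; first by rewrite mulrAC.
  - exact/measurable_EFinP.
  - by move=> z _; rewrite lee_fin.
  - by rewrite lee_fin mulr_ge0.
under eq_integral => x _.
  under eq_integral => y _ do rewrite e1.
  rewrite e2; over.
under eq_integral => z _ do rewrite -mulrA mulrC EFinM.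
rewrite ge0_integralZl ?ip//; first by rewrite -EFinM mulrC mulrA.
- exact/measurable_EFinP.
- by move=> z _; rewrite lee_fin.
- by rewrite lee_fin mulr_ge0.
Qed.

Definition p1 (t : R) : R := (oneDsqr t)^-1.

Lemma p1_ge0 t : 0 <= p1 t. Proof. by rewrite invr_ge0. Qed.
Lemma p1_gt0 t : 0 < p1 t. Proof. by rewrite invr_gt0. Qed.
Lemma p1_le1 t : p1 t <= 1. Proof. exact: oneDsqrV_le1. Qed.
Lemma p1N t : p1 (- t) = p1 t. Proof. by rewrite /p1 /oneDsqr sqrrN. Qed.

Lemma continuous_p1 : continuous p1. Proof. exact: continuous_oneDsqrV. Qed.

Lemma measurable_p1 : measurable_fun setT p1.
Proof. by apply: continuous_measurable_fun; exact: continuous_p1. Qed.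

Lemma integral_p1 : (\int[mu]_t (p1 t)%:E = pi%:E)%E.
Proof.
rewrite ge0_symfun_integralT; last 3 first.
- exact: p1_ge0.
- exact: continuous_p1.
- by move=> t /=; rewrite p1N.
rewrite -set_itvcy integral0y_oneDsqr; congr EFin; by field.
Qed.

(** Peetre's inequality for this weight: [1 + (t + s)^2 <= 3 + 2 t^2] when [|s| <= 1]. *)
Lemma p1_peetre (t s : R) : `|s| <= 1 -> p1 t <= 3 * p1 (t + s).
Proof.
move=> s1; have s2 : s ^+ 2 <= 1 by rewrite -(real_normK (num_real s)) expr_le1.
rewrite ler_pdivlMr ?(lt_le_trans _ (oneDsqr_ge1 _))//.
rewrite mulrC ler_pdivrMr ?(lt_le_trans _ (oneDsqr_ge1 _))// /oneDsqr.
have := sqr_ge0 (t - s).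
have := sqr_ge0 t; lra.
Qed.

(** The weight for all decay estimates. It is a product over the coordinates, rather than a power of
    [1 + |x|^2], so that its integral splits, with value [pi^3], and so that it is the inverse of
    the symbol produced by [1 - d_i^2] in the three directions ([tr_decay]). *)
Definition wP (x : space3 R) : R := p1 x.1.1 * p1 x.1.2 * p1 x.2.

Lemma wP_ge0 x : 0 <= wP x. Proof. by rewrite !mulr_ge0// p1_ge0. Qed.
Lemma wP_gt0 x : 0 < wP x. Proof. by rewrite !mulr_gt0// p1_gt0. Qed.
Lemma wP_le1 x : wP x <= 1.
Proof. by rewrite !mulr_ile1 ?mulr_ge0 ?p1_ge0 ?p1_le1. Qed.
Lemma wPN x : wP (- x) = wP x. Proof. by rewrite /wP !p1N. Qed.

Lemma measurable_wP : mfun3 wP.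
Proof.
apply: measurable_funM; first apply: measurable_funM.
- exact: measurableT_comp measurable_p1 measurable_x1.
- exact: measurableT_comp measurable_p1 measurable_x2.
- exact: measurableT_comp measurable_p1 measurable_x3.
Qed.

Lemma intg_wP : intgX wP.
Proof.
apply: intg_ge0P; [exact: measurable_wP|exact: wP_ge0|].
have m := measurable_p1; have i := integral_p1; have g := p1_ge0.
by rewrite (ge0_integral_prod3 m m m g g g i i i) ltry.
Qed.

Lemma wP_peetre x z : `|z| <= 1 -> wP x <= 27 * wP (x + z).
Proof.
rewrite !prod_normE => z1.
have h1 : `|z.1.1| <= 1 by move: z1; rewrite !ge_max => /andP[/andP[]].
have h2 : `|z.1.2| <= 1 by move: z1; rewrite !ge_max => /andP[/andP[]].
have h3 : `|z.2| <= 1 by move: z1; rewrite !ge_max => /andP[].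
have -> : 27 * wP (x + z) = (3 * p1 (x + z).1.1) * (3 * p1 (x + z).1.2) * (3 * p1 (x + z).2).
  by rewrite /wP; ring.
by rewrite !ler_pM ?mulr_ge0 ?p1_ge0 ?p1_peetre.
Qed.

End Space3Measure.

(** * Smooth functions and directional derivatives *)

Section SmoothCalculus.
Context {R : realType} {W : normedModType R}.
Implicit Types (f g : W -> R) (l : seq W) (x v w : W).

Lemma iter_derive_rcons l v f : iter_derive (rcons l v) f = iter_derive l ('D_v f).
Proof. by rewrite /iter_derive foldr_rcons. Qed.

Lemma iter_derive_cat l1 l2 f : iter_derive (l1 ++ l2) f = iter_derive l1 (iter_derive l2 f).
Proof. by rewrite /iter_derive foldr_cat. Qed.

Lemma smooth_cont f : smooth f -> continuous f.
Proof. by move=> /(_ [::])[]. Qed.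

Lemma smooth_derivable f x v : smooth f -> derivable f x v.
Proof. by move=> /(_ [::])[_]. Qed.

Arguments smooth_derivable : clear implicits.

Lemma smooth_iter l f : smooth f -> smooth (iter_derive l f).
Proof. by move=> sf l'; rewrite -iter_derive_cat. Qed.

Lemma smooth_D v f : smooth f -> smooth ('D_v f).
Proof. exact: (@smooth_iter [:: v]). Qed.

(** Smoothness is proved throughout by exhibiting a class of differentiable functions stable under
    ['D_v], which avoids formulas for iterated derivatives. *)
Lemma smooth_coind (C : (W -> R) -> Prop) :
  (forall f, C f -> continuous f) -> (forall f, C f -> forall x v, derivable f x v) ->
  (forall f v, C f -> C ('D_v f)) -> forall f, C f -> smooth f.
Proof.
move=> c1 c2 c3 f Cf l.
have {Cf} : C (iter_derive l f) by elim: l => //= v l IH; exact: c3.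
by split => [|x v]; [exact: c1|exact: c2].
Qed.

Lemma DD f g x v : derivable f x v -> derivable g x v ->
  'D_v (fun y => f y + g y) x = 'D_v f x + 'D_v g x.
Proof. exact: deriveD. Qed.

Lemma DM f g x v : derivable f x v -> derivable g x v ->
  'D_v (fun y => f y * g y) x = 'D_v f x * g x + f x * 'D_v g x.
Proof.
move=> hf hg; rewrite (deriveM hf hg).
by rewrite addrC; rewrite mulrC.
Qed.

Lemma DZ k f x v : derivable f x v -> 'D_v (fun y => k * f y) x = k * 'D_v f x.
Proof. exact: deriveZ. Qed.

Lemma Dcst (k : R) x v : 'D_v (fun _ : W => k) x = 0.
Proof. exact: derive_cst. Qed.

Lemma DN f x v : derivable f x v -> 'D_v (fun y => - f y) x = - 'D_v f x.
Proof. exact: deriveN. Qed.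

Lemma DB f g x v : derivable f x v -> derivable g x v ->
  'D_v (fun y => f y - g y) x = 'D_v f x - 'D_v g x.
Proof. exact: deriveB. Qed.

Lemma smooth_cst (k : R) : smooth (fun _ : W => k).
Proof.
apply: (@smooth_coind (fun f => exists k, f = fun=> k)); last by exists k.
- by move=> _ [k' ->]; exact: cst_continuous.
- by move=> _ [k' ->] x v.
- by move=> _ v [k' ->]; exists 0; apply/funext => x; rewrite Dcst.
Qed.

Lemma smoothM f g : smooth f -> smooth g -> smooth (fun x => f x * g x).
Proof.
move=> sf sg.
(* Products of two smooth functions are not stable under derivation; their finite sums are. *)
pose C h := exists s : seq ((W -> R) * (W -> R)),
  (forall p, List.In p s -> smooth p.1 /\ smooth p.2) /\ h = fun x => \sum_(p <- s) p.1 x * p.2 x.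
have cons0 (p : (W -> R) * (W -> R)) s : (fun x => \sum_(q <- p :: s) q.1 x * q.2 x) =
    fun x => p.1 x * p.2 x + \sum_(q <- s) q.1 x * q.2 x.
  by apply/funext => x; rewrite big_cons.
have nil0 : (fun x : W => \sum_(q <- ([::] : seq ((W -> R) * (W -> R)))) q.1 x * q.2 x) = (fun=> 0).
  by apply/funext => x; rewrite big_nil.
have der h : C h -> forall x v, derivable h x v.
  move=> [s [hs ->]] x v; elim: s hs => [_|p s IH hs].
    by rewrite nil0; exact: derivable_cst.
  rewrite cons0; have [s1 s2] := hs p (or_introl erefl).
  apply: derivableD; first by apply: derivableM; exact: smooth_derivable.
  by apply: IH => q hq; apply: hs; right.
apply: (@smooth_coind C) => //.
- move=> _ [s [hs ->]]; elim: s hs => [_|p s IH hs].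
    by rewrite nil0; exact: cst_continuous.
  rewrite cons0; have [s1 s2] := hs p (or_introl erefl) => x.
  apply: cvgD; first by apply: cvgM; exact: smooth_cont.
  by apply: IH => q hq; apply: hs; right.
- move=> _ v [s [hs ->]]; elim: s hs => [_|p s IH hs].
    exists [::]; split => //; rewrite !nil0; apply/funext => x; exact: Dcst.
  have [s1 s2] := hs p (or_introl erefl).
  have hs' q : List.In q s -> smooth q.1 /\ smooth q.2 by move=> hq; apply: hs; right.
  have [t [ht et]] := IH hs'.
  exists (('D_v p.1, p.2) :: (p.1, 'D_v p.2) :: t); split.
    case: p s1 s2 {hs} => p1 p2 /= s1 s2 q [<-|[<-|hq]]; last exact: ht.
      by split; [exact: smooth_D|exact: s2].
    by split; [exact: s1|exact: smooth_D].
  apply/funext => x; rewrite cons0 DD.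
  + rewrite !big_cons/= DM; try exact: smooth_derivable.
    by rewrite -addrA; congr (_ + (_ + _)); have := congr1 (fun F => F x) et.
  + by apply: derivableM; exact: smooth_derivable.
  + by apply: der; exists s.
- by exists [:: (f, g)]; split => [p [<-|//]//|]; apply/funext => x; rewrite big_seq1.
Qed.

Lemma smoothD f g : smooth f -> smooth g -> smooth (fun x => f x + g x).
Proof.
move=> sf sg.
apply: (@smooth_coind (fun h => exists f g, [/\ smooth f, smooth g & h = fun x => f x + g x])).
- by move=> _ [f' [g' [h1 h2 ->]]] x; apply: cvgD; exact: smooth_cont.
- by move=> _ [f' [g' [h1 h2 ->]]] x v; apply: derivableD; exact: smooth_derivable.
- move=> _ v [f' [g' [h1 h2 ->]]]; exists ('D_v f'), ('D_v g'); split; try exact: smooth_D.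
  by apply/funext => x; rewrite DD//; exact: smooth_derivable.
- by exists f, g.
Qed.

Lemma smoothZ k f : smooth f -> smooth (fun x => k * f x).
Proof. by move=> sf; apply: smoothM => //; exact: smooth_cst. Qed.

Lemma smooth_ext f g : f =1 g -> smooth f -> smooth g.
Proof. by move=> /funext ->. Qed.

Lemma smoothN f : smooth f -> smooth (fun x => - f x).
Proof. by move=> /(smoothZ (-1)); apply: smooth_ext => x; rewrite mulN1r. Qed.

Lemma smoothB f g : smooth f -> smooth g -> smooth (fun x => f x - g x).
Proof. by move=> sf sg; apply: (smoothD sf); exact: smoothN. Qed.

Lemma smooth_sum (J : Type) (s : seq J) (F : J -> W -> R) : (forall j, smooth (F j)) ->
  smooth (fun x => \sum_(j <- s) F j x).
Proof.
move=> sF; elim: s => [|j s IH].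
  by apply: smooth_ext (smooth_cst 0) => x; rewrite big_nil.
by apply: smooth_ext (smoothD (sF j) IH) => x; rewrite big_cons.
Qed.

Lemma Dsum (J : Type) (s : seq J) (F : J -> W -> R) v x : (forall j, smooth (F j)) ->
  'D_v (fun x => \sum_(j <- s) F j x) x = \sum_(j <- s) 'D_v (F j) x.
Proof.
move=> sF; elim: s => [|j s IH].
  by rewrite big_nil -[RHS](Dcst 0 x v); congr ('D_v _ x); apply/funext => y; rewrite big_nil.
rewrite big_cons -IH -DD; try apply: smooth_derivable => //; last exact: smooth_sum.
by congr ('D_v _ x); apply/funext => y; rewrite big_cons.
Qed.

Lemma smooth_linear (phi : W -> R) : continuous phi -> (forall x v (h : R), phi (h *: v + x) = h * phi v + phi x) ->
  (forall x v, 'D_v phi x = phi v) /\ smooth phi.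
Proof.
move=> cphi lphi.
have qt x v : (fun h => h^-1 *: ((phi \o shift x) (h *: v) - phi x)) @ 0^' --> phi v.
  apply: (@cvg_trans _ ((fun=> phi v) @ 0^')); last exact: cvg_cst.
  apply: near_eq_cvg; near=> h; rewrite /= lphi addrK.
  by rewrite /GRing.scale/= mulKf//; near: h; exact: nbhs_dnbhs_neq.
have dphi x v : 'D_v phi x = phi v by apply: cvg_lim.
split => //.
apply: (@smooth_coind (fun f => f = phi \/ exists k, f = fun=> k)); last by left.
- by move=> _ [->//|[k ->]]; exact: cst_continuous.
- by move=> _ [->|[k ->]] x v; [apply/cvg_ex; exists (phi v)|exact: derivable_cst].
- move=> _ v [->|[k ->]]; right; [exists (phi v)|exists 0]; apply/funext => x.
    by [].
  exact: Dcst.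
Unshelve. all: by end_near. Qed.

Lemma slice_is_derive f x v (t : R) : derivable f (x + t *: v) v ->
  is_derive t 1 (fun s => f (x + s *: v)) ('D_v f (x + t *: v)).
Proof.
have e : (fun h => h^-1 *: (((fun s => f (x + s *: v)) \o shift t) (h *: 1) - f (x + t *: v))) =
    (fun h => h^-1 *: ((f \o shift (x + t *: v)) (h *: v) - f (x + t *: v))).
  apply/funext => h /=; rewrite scalerDl.
  by rewrite [h *: 1]mulr1 addrCA.
by move=> df; apply: DeriveDef; rewrite /derivable /derive e.
Qed.

Lemma MVT_dir f x v : (forall y, derivable f y v) ->
  exists2 t : R, 0 <= t <= 1 & f (x + v) - f x = 'D_v f (x + t *: v).
Proof.
move=> df.
have h t : is_derive t (1 : R) (fun s => f (x + s *: v)) ('D_v f (x + t *: v)).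
  exact: slice_is_derive.
have [|t] := @MVT_segment R (fun s => f (x + s *: v)) (fun t => 'D_v f (x + t *: v)) 0 1 ler01.
  by apply: derivable_within_continuous => t _.
by rewrite scale1r scale0r addr0 subr0 mulr1 => e; exists t.
Qed.

Lemma Dscale f x v (k : R) : (forall y w, derivable f y w) -> 'D_(k *: v) f x = k * 'D_v f x.
Proof.
move=> df.
have h1 := @slice_is_derive f x (k *: v) 0 (df _ _).
have h2 := @slice_is_derive f x v (k * 0) (df _ _).
have h3 : is_derive (0:R) 1 (fun s => k * s) k.
  have := @is_deriveZ _ _ _ (id : R -> R) k 0 1 1 (is_derive_id _ _).
  by rewrite [_ *: _]mulr1.
have h4 := @is_derive1_comp _ (fun s => f (x + s *: v)) (fun s => k * s) 0 _ _ h2 h3.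
have e : (fun s => f (x + s *: (k *: v))) = (fun s => f (x + s *: v)) \o (fun s => k * s).
  by apply/funext => s; rewrite scalerA mulrC.
have [_ h1'] := h1; have [_ h4'] := h4.
by move: h1'; rewrite e h4' mulr0 !scale0r !addr0 => <-; rewrite mulrC.
Qed.

Lemma quotient_shift f (b x v : W) :
  (fun h : R => h^-1 *: (((fun y => f (y + b)) \o shift x) (h *: v) - f (x + b))) =
  (fun h : R => h^-1 *: ((f \o shift (x + b)) (h *: v) - f (x + b))).
Proof. by apply/funext => k /=; rewrite addrA. Qed.

Lemma derivable_shift f (b x v : W) : derivable f (x + b) v -> derivable (fun y => f (y + b)) x v.
Proof. by rewrite /derivable quotient_shift. Qed.

Lemma D_shift f (b x v : W) : 'D_v (fun y => f (y + b)) x = 'D_v f (x + b).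
Proof. by rewrite /derive quotient_shift. Qed.

(** The mean value theorem is applied twice to the second difference, along [v] to
    [f (y + h w) - f y] and then along [w] to ['D_v f]. *)
Lemma mixed_difference f x v w (h : R) : smooth f -> exists p q : R,
  [/\ `|p| <= `|h|, `|q| <= `|h| &
    h * (h * 'D_w ('D_v f) (x + p *: v + q *: w)) =
    f (x + h *: v + h *: w) - f (x + h *: v) - (f (x + h *: w) - f x)].
Proof.
move=> sf; have df u y : derivable f y u by exact: smooth_derivable.
have dg u y : derivable (fun y => f (y + h *: w)) y u by exact: derivable_shift.
have [t t01 ->] := @MVT_dir (fun y => f (y + h *: w) - f y) x (h *: v) (fun y => derivableB (dg _ y) (df _ y)).
rewrite Dscale => [|y u]; last exact: derivableB (dg _ y) (df _ y).
rewrite DB// D_shift.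
have [s s01 ->] := @MVT_dir ('D_v f) (x + t *: (h *: v)) (h *: w)
  (fun y => smooth_derivable _ y _ (smooth_D v sf)).
have bd a : 0 <= a <= 1 -> `|a * h| <= `|h|.
  by move=> /andP[a0 a1]; rewrite normrM (ger0_norm a0) ler_piMl.
exists (t * h), (s * h); rewrite !scalerA Dscale => [|y u].
  by split=> //; exact: bd.
exact/smooth_derivable/smooth_D.
Qed.

(** Schwarz's theorem: the second difference is symmetric in [v] and [w], and its two mean value
    forms are close to the two mixed derivatives at [x] for small [h]. *)
Lemma derive_comm f x v w : smooth f -> 'D_v ('D_w f) x = 'D_w ('D_v f) x.
Proof.
move=> sf; apply/eqP; rewrite -subr_eq0 -normr_le0; apply/ler_addgt0Pl => e e0; rewrite addr0.
have e2 : 0 < e / 2 by rewrite divr_gt0.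
have lim (F : W -> R) a b : continuous F -> exists2 d : R, 0 < d & forall p q : R,
    `|p| <= d -> `|q| <= d -> `|F x - F (x + p *: a + q *: b)| <= e / 2.
  move=> /(_ x)/cvgrPdist_le/(_ _ e2)/nbhs_ballP[d d0 hd].
  exists (d / (`|a| + `|b| + 1)) => [|p q hp hq]; first exact: divr_gt0.
  apply: hd; rewrite -ball_normE /= -addrA opprD addNKr normrN.
  apply: (le_lt_trans (ler_normD _ _)); rewrite !normrZ.
  apply: (le_lt_trans (lerD (ler_wpM2r (normr_ge0 a) hp) (ler_wpM2r (normr_ge0 b) hq))).
  by rewrite -mulrDr mulrAC ltr_pdivrMr// ltr_pM2l// ltrDl.
have [d1 d10 h1] := lim _ w v (smooth_cont (smooth_D v (smooth_D w sf))).
have [d2 d20 h2] := lim _ v w (smooth_cont (smooth_D w (smooth_D v sf))).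
pose h := Num.min d1 d2; have h0 : 0 < h by rewrite lt_min d10.
have [p [q [hp hq]]] := mixed_difference x w v h sf.
have [p' [q' [hp' hq' <-]]] : exists p q : R, [/\ `|p| <= `|h|, `|q| <= `|h| &
    h * (h * 'D_w ('D_v f) (x + p *: v + q *: w)) = f (x + h *: w + h *: v) - f (x + h *: w) - (f (x + h *: v) - f x)].
  have [p' [q' [? ? E]]] := mixed_difference x v w h sf.
  by exists p', q'; split=> //; rewrite E (addrAC x); ring.
move=> /(mulfI (lt0r_neq0 h0))/(mulfI (lt0r_neq0 h0)) E.
rewrite !(ger0_norm (ltW h0)) !le_min in hp hq hp' hq'.
case/andP: hp hq hp' hq' => p1 _ /andP[q1 _] /andP[_ p2] /andP[_ q2].
rewrite [leRHS]splitr; apply: le_trans (ler_distD _ _ _) (lerD (h1 _ _ p1 q1) _).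
by rewrite E distrC h2.
Qed.

End SmoothCalculus.
Arguments smooth_derivable {R W} f x v _.

Section SmoothComp.
Context {R : realType} {W W' : normedModType R}.

Lemma smooth_comp_affine (f : W' -> R) (L : W -> W') (c : W') : smooth f -> continuous L ->
  (forall x v (h : R), L (h *: v + x) = h *: L v + L x) ->
  (forall x v, 'D_v (fun y => f (L y + c)) x = 'D_(L v) f (L x + c)) /\
  smooth (fun y => f (L y + c)).
Proof.
move=> sf cL lL.
have e (g : W' -> R) x v : (fun h => h^-1 *: (((fun y => g (L y + c)) \o shift x) (h *: v) - g (L x + c))) =
    (fun h => h^-1 *: ((g \o shift (L x + c)) (h *: L v) - g (L x + c))).
  by apply/funext => h /=; rewrite lL addrA.
have dE (g : W' -> R) x v : 'D_v (fun y => g (L y + c)) x = 'D_(L v) g (L x + c).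
  by rewrite /derive e.
split; first by move=> x v.
apply: (@smooth_coind _ _ (fun h => exists2 g : W' -> R, smooth g & h = fun y => g (L y + c))); last by exists f.
- move=> _ [g sg ->] x.
  apply: (@continuous_comp _ _ _ (fun y => L y + c) g); last exact: smooth_cont.
  by apply: cvgD; [exact: cL|exact: cvg_cst].
- move=> _ [g sg ->] x v; have := smooth_derivable g (L x + c) (L v) sg.
  by rewrite /derivable -e.
- move=> _ v [g sg ->]; exists ('D_(L v) g); first exact: smooth_D.
  by apply/funext => x.
Qed.

End SmoothComp.

(** * Differentiation under the integral sign *)

Section UnderIntegral.
Context {R : realType} {W : normedModType R}.
Context {d} {Y : measurableType d} (mu : {measure set Y -> \bar R}).
Implicit Types (f : W -> Y -> R) (x v : W).

Lemma slice_quotient (g : W -> R) x v :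
  (fun h : R => h^-1 *: (((fun s : R => g (x + s *: v)) \o shift 0) (h *: (1:R)) - g (x + (0:R) *: v))) =
  (fun h : R => h^-1 *: ((g \o shift x) (h *: v) - g x)).
Proof.
apply/funext => h /=; rewrite scale0r !addr0; congr (_ *: (g _ - _)).
by rewrite [h *: 1]mulr1 addrC.
Qed.

Lemma derivable_slice (g : W -> R) x v :
  derivable (fun s : R => g (x + s *: v)) 0 1 -> derivable g x v.
Proof. by rewrite /derivable slice_quotient. Qed.

Lemma D_slice (g : W -> R) x v : 'D_v g x = 'D_1 (fun s : R => g (x + s *: v)) 0.
Proof. by rewrite /derive slice_quotient. Qed.

Lemma is_derive_slice (g : W -> R) x v (l : R) :
  is_derive (0 : R) (1 : R) (fun s : R => g (x + s *: v)) l -> derivable g x v /\ 'D_v g x = l.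
Proof. by move=> [h1 h2]; rewrite D_slice h2; split => //; exact: derivable_slice. Qed.

(** Along the line through [x] in direction [v] this is the theorem with one real parameter, so that
    a majorant is required for [|t| < 1] only. *)
Lemma D_under_integral f x v (G : Y -> R) :
  (forall t : R, `|t| < 1 -> intg mu (f (x + t *: v))) ->
  (forall y z, derivable (f ^~ y) z v) ->
  (forall (t : R) y, `|t| < 1 -> `|'D_v (f ^~ y) (x + t *: v)| <= G y) ->
  (forall y, 0 <= G y) -> intg mu G ->
  derivable (fun z => \int[mu]_y f z y) x v /\
  'D_v (fun z => \int[mu]_y f z y) x = \int[mu]_y 'D_v (f ^~ y) x.
Proof.
move=> if1 df bd G0 iG.
pose F t y := f (x + t *: v) y.
have dF t y : is_derive t (1:R) (F ^~ y) ('D_v (f ^~ y) (x + t *: v)).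
  exact: (slice_is_derive (df y _)).
have I11 (t : R) : `]-1, 1[%classic t -> `|t| < 1.
  by rewrite ltr_norml.
have I0 : `]-1, 1[%classic (0:R) by rewrite /= in_itv/= ltrN10 ltr01.
have h1 t : `]-1, 1[%classic t -> mu.-integrable setT (EFin \o F t).
  by move=> /I11 ht; exact: if1.
have h2 t y : `]-1, 1[%classic t -> setT y -> derivable (F ^~ y) t 1.
  by [].
have h3 t y : `]-1, 1[%classic t -> setT y -> `|partial1of2 F t y| <= G y.
  by move=> /I11 ht _; rewrite partial1of2E; have [_ ->] := dF t y; exact: bd.
have e1 := derivable_under_integral measurableT I0 h1 h2 G0 iG h3.
have e2 := differentiation_under_integral measurableT I0 h1 h2 G0 iG h3.
split; first exact: (@derivable_slice (fun z => \int[mu]_y f z y) x v).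
rewrite D_slice -derive1E e2; apply: eqI => y; rewrite partial1of2E.
by have [_ ->] := dF 0 y; rewrite scale0r addr0.
Qed.

End UnderIntegral.

(** * Calculus in space and functions with decaying derivatives *)

Section Space3Calculus.
Context {R : realType}.
Local Notation X := (space3 R).
Implicit Types (f g : X -> R) (x y v xi : X).

Lemma dotE x y : dot x y = x.1.1 * y.1.1 + x.1.2 * y.1.2 + x.2 * y.2.
Proof. by rewrite /dot !big_ord_recr big_ord0 /= add0r. Qed.

Lemma dotC x y : dot x y = dot y x.
Proof. by rewrite !dotE; ring. Qed.
Lemma dotDl x y v : dot (x + y) v = dot x v + dot y v.
Proof. by rewrite !dotE; ring. Qed.
Lemma dotZl k x v : dot (k *: x) v = k * dot x v.
Proof. by rewrite !dotE /= /GRing.scale/=; ring. Qed.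
Lemma dotNl x v : dot (- x) v = - dot x v.
Proof. by rewrite -scaleN1r dotZl mulN1r. Qed.
Lemma dotBl x y v : dot (x - y) v = dot x v - dot y v.
Proof. by rewrite dotDl dotNl. Qed.
Lemma dotDr x y v : dot v (x + y) = dot v x + dot v y.
Proof. by rewrite dotC dotDl !(dotC v). Qed.
Lemma dotZr k x v : dot v (k *: x) = k * dot v x.
Proof. by rewrite dotC dotZl (dotC v). Qed.
Lemma dotNr x v : dot v (- x) = - dot v x.
Proof. by rewrite dotC dotNl (dotC v). Qed.
Lemma dotBr x y v : dot v (x - y) = dot v x - dot v y.
Proof. by rewrite dotDr dotNr. Qed.
Lemma dot0l v : dot 0 v = 0.
Proof. by rewrite -(scale0r 0) dotZl mul0r. Qed.

Lemma norm_x1 x : `|x.1.1| <= `|x|.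
Proof. by rewrite !le_max lexx. Qed.
Lemma norm_x2 x : `|x.1.2| <= `|x|.
Proof. by rewrite !le_max lexx orbT. Qed.
Lemma norm_x3 x : `|x.2| <= `|x|.
Proof. by rewrite le_max lexx orbT. Qed.
Lemma norm_le3 x (M : R) : (`|x| <= M) = [&& `|x.1.1| <= M, `|x.1.2| <= M & `|x.2| <= M].
Proof. by rewrite !ge_max andbA. Qed.

Lemma norm_dot x y : `|dot x y| <= 3 * `|x| * `|y|.
Proof.
rewrite dotE; apply: (le_trans (ler_normD _ _)).
have h1 : `|x.1.1 * y.1.1| <= `|x| * `|y| by rewrite normrM ler_pM ?norm_x1.
have h2 : `|x.1.2 * y.1.2| <= `|x| * `|y| by rewrite normrM ler_pM ?norm_x2.
have h3 : `|x.2 * y.2| <= `|x| * `|y| by rewrite normrM ler_pM ?norm_x3.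
have := ler_normD (x.1.1 * y.1.1) (x.1.2 * y.1.2); lra.
Qed.

Lemma continuous_x1 : continuous (fun x : X => x.1.1).
Proof. by move=> x; apply: cvg_comp; [exact: cvg_fst|exact: cvg_fst]. Qed.
Lemma continuous_x2 : continuous (fun x : X => x.1.2).
Proof. by move=> x; apply: cvg_comp; [exact: cvg_fst|exact: cvg_snd]. Qed.
Lemma continuous_x3 : continuous (fun x : X => x.2).
Proof. by move=> x; exact: cvg_snd. Qed.

Lemma continuous_dot v : continuous (dot^~ v).
Proof.
move=> x; rewrite (_ : dot^~ v = fun x => x.1.1 * v.1.1 + x.1.2 * v.1.2 + x.2 * v.2).
  apply: cvgD; first apply: cvgD; apply: cvgM; try exact: cvg_cst.
  - exact: continuous_x1.
  - exact: continuous_x2.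
  - exact: continuous_x3.
by apply/funext => y; rewrite dotE.
Qed.

Lemma smooth_dot v : smooth (dot^~ v).
Proof.
apply: (smooth_linear (@continuous_dot v) _).2 => x' v' h.
by rewrite dotDl dotZl.
Qed.

Lemma unit_dot (i : 'I_3) x : dot 'u_i x = component i x.
Proof.
rewrite dotE /component.
by case: i => -[|[|[|//]]] /= _; rewrite ?mul1r ?mul0r ?add0r ?addr0.
Qed.

Lemma space3_sum x : x = x.1.1 *: 'u_0 + x.1.2 *: 'u_1 + x.2 *: 'u_2%:R.
Proof.
case: x => [[x1 x2] x3].
by congr (_, _, _); rewrite /= /GRing.scale/= ?mulr0 ?mulr1 ?addr0 ?add0r.
Qed.

Lemma smooth_mfun3 f : smooth f -> mfun3 f.
Proof. by move=> /smooth_cont; exact: continuous_mfun3. Qed.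

(** Equivalent to compact support here ([test_functionP]), and easier to propagate through products
    and derivatives. *)
Definition bsupp f : Prop := exists M : R, forall x, f x != 0 -> `|x| <= M.

Lemma compact_supp_sub {W : normedModType R} (f : W -> R) (K : set W) : compact K ->
  (forall x : W, f x != 0 -> K x) -> compact (supp f).
Proof.
move=> cK fK; apply: (subclosed_compact _ cK); first exact: closed_closure.
have clK : closed K by apply: compact_closed.
rewrite (closure_id K).1//; exact: closure_subset.
Qed.

Lemma compact_box (M : R) : compact [set x : X | `|x| <= M].
Proof.
have -> : [set x : X | `|x| <= M] = (`[-M, M]%classic `*` `[-M, M]%classic) `*` `[-M, M]%classic.
  apply/seteqP; split => x /=; rewrite norm_le3 !in_itv/= -!ler_norml.
    lra.
  lra.
by apply: compact_setX; [apply: compact_setX|]; exact: segment_compact.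
Qed.

Lemma bsupp_compact f : bsupp f -> compact (supp f).
Proof. by move=> [M hM]; apply: compact_supp_sub (@compact_box M) _. Qed.

Lemma compact_supp_bound {W : normedModType R} (f : W -> R) : compact (supp f) ->
  exists2 M : R, 0 <= M & forall x : W, f x != 0 -> `|x| <= M.
Proof.
move=> /compact_bounded[M [_ hM]]; exists (`|M| + 1); first by rewrite addr_ge0.
move=> x fx; apply: (hM (`|M| + 1)); first by rewrite ltr_pwDr// ler_norm.
exact: subset_closure.
Qed.

Lemma test_functionP f : test_function f <-> smooth f /\ bsupp f.
Proof.
split=> [[sf /compact_supp_bound[M _ hM]]|[sf /bsupp_compact]] //.
by split => //; exists M.
Qed.

(** A weak form of the Schwartz class: one fixed weight for all derivatives. It contains the test
    functions and their Fourier transforms, and its members are integrable and square integrable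
    together with all derivatives. *)
Definition schw f : Prop :=
  smooth f /\ forall l, exists C : R, forall x, `|iter_derive l f x| <= C * wP x.

Lemma schw_smooth f : schw f -> smooth f. Proof. by case. Qed.

Lemma schw_bound f : schw f -> exists2 C : R, 0 < C & forall x, `|f x| <= C * wP x.
Proof.
move=> [_ /(_ [::])[C hC]]; exists (`|C| + 1); first by rewrite ltr_wpDl.
move=> x; apply: (le_trans (hC x)); rewrite ler_wpM2r ?wP_ge0//.
by rewrite (le_trans (ler_norm _))// lerDl.
Qed.

Lemma schw_iter l f : schw f -> schw (iter_derive l f).
Proof.
move=> [sf hf]; split; first exact: smooth_iter.
by move=> l'; rewrite -iter_derive_cat.
Qed.

Lemma schw_D v f : schw f -> schw ('D_v f).
Proof. exact: (@schw_iter [:: v]). Qed.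

Lemma schw_intg f : schw f -> intgX f.
Proof.
move=> sf; have [C _ hC] := schw_bound sf.
apply: intg_le (intgZ C intg_wP) hC.
exact: smooth_mfun3 (schw_smooth sf).
Qed.

Lemma schw_sqi f : schw f -> sqX f.
Proof.
move=> sf; have [C C0 hC] := schw_bound sf.
have mf : mfun3 f by exact: smooth_mfun3 (schw_smooth sf).
split => //; apply: (@intg_le _ _ _ leb3 _ (fun x => C ^+ 2 * wP x)).
- exact: measurable_funX.
- exact/intgZ/intg_wP.
- move=> x; rewrite normrX (@le_trans _ _ ((C * wP x) ^+ 2))//.
    by apply: lerXn2r (hC x); rewrite nnegrE// (mulr_ge0 (ltW C0))// wP_ge0.
  rewrite exprMn ler_wpM2l ?sqr_ge0// ler_piMl ?wP_ge0 ?wP_le1//.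
Qed.

Lemma schw_ext f g : f =1 g -> schw f -> schw g.
Proof. by move=> /funext ->. Qed.

Lemma iter_deriveD {W : normedModType R} l (f g : W -> R) : smooth f -> smooth g ->
  iter_derive l (fun x : W => f x + g x) = fun x : W => iter_derive l f x + iter_derive l g x.
Proof.
move=> sf sg; elim: l => //= v l ->; apply/funext => x.
by rewrite DD//; exact/smooth_derivable/smooth_iter.
Qed.

Lemma iter_deriveZ {W : normedModType R} l k (f : W -> R) : smooth f ->
  iter_derive l (fun x : W => k * f x) = fun x : W => k * iter_derive l f x.
Proof.
move=> sf; elim: l => //= v l ->; apply/funext => x.
by rewrite DZ//; exact/smooth_derivable/smooth_iter.
Qed.

Lemma schwD f g : schw f -> schw g -> schw (fun x => f x + g x).
Proof.
move=> [sf hf] [sg hg]; split; first exact: smoothD.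
move=> l; have [C hC] := hf l; have [C' hC'] := hg l; exists (C + C') => x.
by rewrite iter_deriveD// mulrDl (le_trans (ler_normD _ _))// lerD.
Qed.

Lemma schwZ k f : schw f -> schw (fun x => k * f x).
Proof.
move=> [sf hf]; split; first exact: smoothZ.
move=> l; have [C hC] := hf l; exists (`|k| * C) => x.
by rewrite iter_deriveZ// normrM -mulrA ler_wpM2l.
Qed.

Lemma schw0 : schw (fun=> 0).
Proof.
split; first exact: smooth_cst.
have h l : iter_derive l (fun _ => 0 : R) = fun=> 0.
  by elim: l => //= v l ->; apply/funext => x; exact: Dcst.
by exists 0 => x; rewrite h normr0 mul0r.
Qed.

Lemma schw_sum (J : Type) (s : seq J) (F : J -> X -> R) : (forall j, schw (F j)) ->
  schw (fun x => \sum_(j <- s) F j x).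
Proof.
move=> sF; elim: s => [|j s IH].
  by apply: schw_ext schw0 => x; rewrite big_nil.
by apply: schw_ext (schwD (sF j) IH) => x; rewrite big_cons.
Qed.

Lemma bsupp_D v f : bsupp f -> bsupp ('D_v f).
Proof.
move=> [M hM]; exists M => x; apply: contraNT; rewrite -ltNge => Mx.
have f0 : \forall y \near x, f y = 0.
  have : \forall y \near x, M < `|y|.
    have cn : (fun y => `|y|) @ x --> `|x| by apply: cvg_norm.
    exact: (cvgr_gt `|x| cn).
  apply: filterS => y My; apply/eqP; apply: contraTT My => /hM.
  lra.
by rewrite (@near_eq_derive _ _ _ f (cst 0))// derive_cst.
Qed.

Lemma bsupp_iter l f : bsupp f -> bsupp (iter_derive l f).
Proof. by move=> bf; elim: l => //= v l; exact: bsupp_D. Qed.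

Lemma bsupp_mul f g : bsupp f -> bsupp (fun x => f x * g x).
Proof. by move=> [M hM]; exists M => x; rewrite mulf_eq0 negb_or => /andP[/hM]. Qed.

Lemma test_schw f : smooth f -> bsupp f -> schw f.
Proof.
move=> sf bf; split => // l.
have sg := smooth_iter l sf; have bg := bsupp_iter l bf.
move: (iter_derive l f) sg bg => {sf bf l} g sg bg.
have [M hM] := bg.
have [C hC] : exists C : R, forall x, `|g x| <= C.
  have cg : {within supp g, continuous g}.
    by apply: continuous_subspaceT; exact: smooth_cont.
  have := compact_bounded (continuous_compact cg (bsupp_compact bg)).
  move=> [C [_ hC]]; exists (`|C| + 1) => x.
  have [->|gx] := eqVneq (g x) 0; first by rewrite normr0.
  apply: (hC (`|C| + 1)); first by rewrite ltr_pwDr// ler_norm.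
  by exists x => //; exact: subset_closure.
have C0 : 0 <= C by apply: le_trans (hC 0).
exists (C * (1 + M ^+ 2) ^+ 3) => x.
have [->|gx] := eqVneq (g x) 0.
  rewrite normr0; apply: mulr_ge0; last exact: wP_ge0.
  by apply: mulr_ge0 => //; apply: exprn_ge0; rewrite addr_ge0 ?sqr_ge0.
rewrite -mulrA; apply: (le_trans (hC x)); rewrite ler_peMr//.
have := hM x gx; rewrite norm_le3 => /and3P[h1 h2 h3].
have P t : `|t| <= M -> 1 <= (1 + M ^+ 2) * p1 t.
  move=> tM; rewrite ler_pdivlMr ?(lt_le_trans _ (oneDsqr_ge1 _))// mul1r.
  by rewrite lerD2l -(real_normK (num_real t)) lerXn2r ?nnegrE// (le_trans _ tM).
rewrite /wP (_ : _ * _ = ((1 + M ^+ 2) * p1 x.1.1) * ((1 + M ^+ 2) * p1 x.1.2) * ((1 + M ^+ 2) * p1 x.2)); last by ring.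
by rewrite -[leLHS](mulr1 1) -[X in X * _ <= _](mulr1 1) !ler_pM ?P.
Qed.

Lemma schw_shift_bound f : schw f -> exists2 C : R, 0 < C & forall x z, `|z| <= 1 -> `|f (x + z)| <= C * wP x.
Proof.
move=> sf; have [C C0 hC] := schw_bound sf; exists (C * 27); first by rewrite mulr_gt0.
move=> x z z1; apply: (le_trans (hC _)); rewrite -mulrA ler_wpM2l ?(ltW C0)//.
have := @wP_peetre R (x + z) (- z); rewrite normrN addrK; exact.
Qed.

(** The increment is split along the three axes. All intermediate points stay within sup-distance 1
    of [x], where the derivatives are bounded by a multiple of [wP x]. *)
Lemma schw_lipschitz f : schw f -> exists2 C : R, 0 < C &
  forall x z, `|z| <= 1 -> `|f (x + z) - f x| <= C * `|z| * wP x.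
Proof.
move=> sf; have smf := schw_smooth sf.
have [C0 p0 h0] := schw_shift_bound (schw_D 'u_0 sf).
have [C1 p1 h1] := schw_shift_bound (schw_D 'u_1 sf).
have [C2 p2 h2] := schw_shift_bound (schw_D ('u_2%:R) sf).
exists (C0 + C1 + C2); first by rewrite !addr_gt0.
move=> x z z1.
have dr y w : derivable f y w by exact: smooth_derivable.
have step k (i : 'I_3) C y : `|k| <= `|z| ->
  (forall t : R, 0 <= t <= 1 -> `|y + (t * k) *: 'u_i - x| <= 1) ->
  (forall x z, `|z| <= 1 -> `|'d_i f (x + z)| <= C * wP x) ->
  `|f (y + k *: 'u_i) - f y| <= C * `|z| * wP x.
  move=> kz hy hC; have [t t01 ->] := @MVT_dir _ _ f y (k *: 'u_i) (fun y => dr y _).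
  rewrite Dscale// normrM scalerA mulrAC mulrC; apply: ler_pM => //.
  have := hC x (y + (t * k) *: 'u_i - x) (hy t t01).
  by rewrite addrCA subrr addr0.
pose a1 := x + z.1.1 *: 'u_0; pose a2 := a1 + z.1.2 *: 'u_1.
have e3 : x + z = a2 + z.2 *: 'u_2%:R.
  by rewrite {1}(space3_sum z) !addrA.
have zz := z1; rewrite norm_le3 in zz; have /and3P[z11 z12 z13] := zz.
have tk (t k : R) : 0 <= t <= 1 -> `|k| <= 1 -> `|t * k| <= 1.
  by move=> /andP[t0 t1] k1; rewrite normrM mulr_ile1// ger0_norm.
have s1 : `|f a1 - f x| <= C0 * `|z| * wP x.
  apply: step h0; first exact: norm_x1.
  move=> t t01; rewrite addrC addKr norm_le3 /= /GRing.scale/= !mulr1 !mulr0 normr0 ler01.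
  by rewrite tk.
have s2 : `|f a2 - f a1| <= C1 * `|z| * wP x.
  apply: step h1; first exact: norm_x2.
  move=> t t01; rewrite -!(addrA x) addrC subrK norm_le3 /= /GRing.scale/= !mulr1 !mulr0.
  by rewrite addr0 add0r addr0 normr0 ler01 z11 tk.
have s3 : `|f (x + z) - f a2| <= C2 * `|z| * wP x.
  rewrite e3; apply: step h2; first exact: norm_x3.
  move=> t t01; rewrite /a2 -!(addrA x) addrC subrK norm_le3 /= /GRing.scale/= !mulr1 !mulr0.
  by rewrite ?(addr0, add0r) z11 z12 tk.
move: s1 s2 s3.
move: (f (x + z)) (f a1) (f a2) (f x) => b1 b2 b3 b4.
have := ler_distD b3 b1 b4; have := ler_distD b2 b3 b4; lra.
Qed.

End Space3Calculus.

(** * The one-dimensional Poisson kernel *)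

Section Poisson1.
Context {R : realType}.
Local Notation mu := (@lebesgue_measure R).
Implicit Types (e c eta y t : R).

Lemma is_derive_compl (f : R -> R) (k c df y : R) : is_derive (c + k * y) (1:R) f df ->
  is_derive y (1:R) (fun t : R => f (c + k * t)) (df * k).
Proof.
move=> hf; have hl : is_derive y 1 (fun t => c + k * t) k.
  by apply: is_derive_eq; rewrite /GRing.scale/=; ring.
exact: (@is_derive1_comp _ f (fun t => c + k * t) y _ _ hf hl).
Qed.

Lemma continuous_compl (f : R -> R) (k c : R) : continuous f -> continuous (fun t : R => f (c + k * t)).
Proof.
move=> cf y; apply: (@continuous_comp _ _ _ (fun t => c + k * t) f); last exact: cf.
by apply: cvgD; [exact: cvg_cst|apply: cvgM; [exact: cvg_cst|exact: cvg_id]].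
Qed.

Lemma continuous_compk (f : R -> R) (k : R) : continuous f -> continuous (fun t : R => f (k * t)).
Proof. by move=> /(@continuous_compl f k 0); under eq_fun do rewrite add0r. Qed.

(** Primitive of [expR (- e * y) * (1 + cos (eta * y))]. Adding 1 to the cosine makes the integrand
    nonnegative, as the fundamental theorem on a half-line requires; the term with 1 is subtracted
    afterwards. *)
Definition half_prim e eta y : R :=
  expR (- e * y) * ((eta * sin (eta * y) - e * cos (eta * y)) / (e ^+ 2 + eta ^+ 2) - e^-1).

Lemma half_prim_derive e eta y : 0 < e ->
  is_derive y (1:R) (half_prim e eta) (expR (- e * y) * (1 + cos (eta * y))).
Proof.
move=> e0.
have h (f : R -> R) (k df : R) : is_derive (k * y) 1 f df ->
    is_derive y 1 (fun t => f (k * t)) (df * k).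
  rewrite -[k * y]add0r => /is_derive_compl.
  by under [X in is_derive _ _ X _]eq_fun do rewrite add0r.
have e2 : e ^+ 2 + eta ^+ 2 != 0 by rewrite gt_eqF// ltr_pwDl ?exprn_gt0// sqr_ge0.
apply: is_derive_eq; rewrite /GRing.scale /=.
by field; rewrite gt_eqF.
Qed.

Lemma continuous_1cosk k : continuous (fun y : R => 1 + cos (k * y)).
Proof. by move=> y; apply: cvgD; [exact: cvg_cst|exact: (continuous_compk (@continuous_cos R))]. Qed.

Lemma half_prim_lim e eta : 0 < e -> half_prim e eta x @[x --> +oo] --> 0.
Proof.
move=> e0.
pose B : R := (`|eta| + e) / (e ^+ 2 + eta ^+ 2) + e^-1.
have d0 : 0 < e ^+ 2 + eta ^+ 2 by rewrite ltr_pwDl ?exprn_gt0// sqr_ge0.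
have ei : 0 <= e^-1 by rewrite invr_ge0 ltW.
have di : 0 <= (e ^+ 2 + eta ^+ 2)^-1 by rewrite invr_ge0 ltW.
have bd y : `|half_prim e eta y| <= expR (- (e * y)) * B.
  rewrite normrM ger0_norm ?expR_ge0// mulNr ler_wpM2l ?expR_ge0//.
  apply: (le_trans (ler_normB _ _)); rewrite [`|e^-1|]ger0_norm// lerD2r.
  rewrite normrM [`|_^-1|]ger0_norm// ler_wpM2r//.
  apply: (le_trans (ler_normB _ _)); rewrite !normrM (ger0_norm (ltW e0)) lerD//.
    by rewrite ler_piMr// sin_max.
  by rewrite ler_piMr ?(ltW e0)// cos_max.
have lim0 : expR (- (e * x)) * B @[x --> +oo] --> 0.
  rewrite -(mul0r B); apply: cvgM; last exact: cvg_cst.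
  apply: (cvg_comp (fun x => e * x) (fun x => expR (- x))); last exact: cvgr_expR.
  by apply: gt0_cvgMry.
move/cvgr0Pnorm_lt : lim0 => lim0; apply/cvgr0Pnorm_lt => eps eps0.
apply: filterS (lim0 eps eps0) => y; apply: le_lt_trans.
by apply: (le_trans (bd y)); exact: ler_norm.
Qed.

Lemma integral_expcos e eta : 0 < e ->
  (\int[mu]_(y in `[0%R, +oo[) (expR (- e * y) * (1 + cos (eta * y)))%:E =
   (e / (e ^+ 2 + eta ^+ 2) + e^-1)%:E)%E.
Proof.
move=> e0.
rewrite (@ge0_continuous_FTC2y R (fun y => expR (- e * y) * (1 + cos (eta * y))) (half_prim e eta) 0 0).
- rewrite /half_prim !mulr0 sin0 cos0 expR0; congr EFin; lra.
- rewrite ?expR_ge0//.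
- apply: continuous_subspaceT => y; apply: cvgM; last exact: continuous_1cosk.
  exact: (continuous_compk (@continuous_expR R)).
- exact: half_prim_lim.
- by [].
- apply: cvg_at_right_filter; apply/differentiable_continuous.
  by apply/derivable1_diffP.
- by move=> y _; rewrite derive1E; have [_ ->] := half_prim_derive eta y e0.
Qed.

(** Poisson kernel: the Fourier transform of [y |-> expR (- e * |y|)] at frequency [eta]. *)
Definition pe e eta : R := 2 * e / (e ^+ 2 + eta ^+ 2).

Lemma continuous_Eabs e : continuous (fun y : R => expR (- e * `|y|)).
Proof.
move=> y; apply: (@continuous_comp _ _ _ (fun y => - e * `|y|) expR); last exact: continuous_expR.
by apply: cvgM; [exact: cvg_cst|exact: cvg_norm cvg_id].
Qed.

Lemma integral_Eabs1 e eta : 0 < e ->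
  (\int[mu]_y (expR (- e * `|y|) * (1 + cos (eta * y)))%:E = (pe e eta + 2 / e)%:E)%E.
Proof.
move=> e0; rewrite ge0_symfun_integralT.
- rewrite -set_itvcy.
  under eq_integral => y.
    rewrite inE/= in_itv/= andbT => y0; rewrite ger0_norm//; over.
  rewrite integral_expcos//; congr EFin; rewrite /pe; ring.
- rewrite ?expR_ge0//.
- by move=> y; apply: cvgM; [exact: continuous_Eabs|exact: continuous_1cosk].
- by move=> y /=; rewrite normrN mulrN cosN.
Qed.

Lemma integral_Eabs e : 0 < e -> (\int[mu]_y (expR (- e * `|y|))%:E = (2 / e)%:E)%E.
Proof.
move=> e0; have := integral_Eabs1 0 e0.
under eq_integral do rewrite mul0r cos0.
rewrite (_ : pe e 0 + 2 / e = 2 * (2 / e)); last first.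
  by rewrite /pe expr0n addr0; field; rewrite gt_eqF.
under eq_integral do rewrite mulrC EFinM.
rewrite ge0_integralZl//; first last.
- by apply/measurable_EFinP; apply: continuous_measurable_fun; exact: continuous_Eabs.
rewrite EFinM => h; have := congr1 (fun z => (2^-1%:E * z)%E) h.
by rewrite !muleA -EFinM ?mulVf ?mul1e.
Qed.

Lemma intg_Eabs e : 0 < e -> intg mu (fun y : R => expR (- e * `|y|)).
Proof.
move=> e0; apply: intg_ge0P; last by rewrite integral_Eabs// ltry.
- by apply: continuous_measurable_fun; exact: continuous_Eabs.
- by [].
Qed.

Lemma intg_poisson1 e eta c : 0 < e -> intg mu (fun y : R => expR (- e * `|y|) * cos (c + eta * y)).
Proof.
move=> e0; apply: (intgM_bd (intg_Eabs e0)).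
  by apply: continuous_measurable_fun; exact: (continuous_compl (@continuous_cos R)).
by move=> y; exact: cos_max.
Qed.

Lemma I1_refl (f : R -> R) : intg mu f -> \int[mu]_y f (- y) = \int[mu]_y f y.
Proof.
move=> hf; have mf := intg_meas hf.
have n1 : (-1 : R) != 0 by rewrite oppr_eq0.
have E (g : R -> \bar R) : measurable_fun setT g -> (forall y, 0 <= g y)%E ->
    (\int[mu]_y g (- y)%R = \int[mu]_y g y)%E.
  move=> mg g0; rewrite -(ge0_integral_affine 0 n1 mg g0) normrN1 mul1e.
  by apply: eq_integral => y _; rewrite mulN1r addr0.
have mE : measurable_fun setT (EFin \o f) by exact/measurable_EFinP.
congr fine; rewrite integralE [RHS]integralE; congr (_ - _)%E.
  rewrite -(E _ (measurable_funepos mE) (funepos_ge0 _)).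
  by apply: eq_integral => y _; rewrite !funeposE.
rewrite -(E _ (measurable_funeneg mE) (funeneg_ge0 _)).
by apply: eq_integral => y _; rewrite !funenegE.
Qed.

Lemma I_poisson1 e eta c : 0 < e ->
  \int[mu]_y (expR (- e * `|y|) * cos (c + eta * y)) = pe e eta * cos c.
Proof.
move=> e0.
have iS : intg mu (fun y => expR (- e * `|y|) * sin (eta * y)).
  apply: (intgM_bd (intg_Eabs e0)); last by move=> y; exact: sin_max.
  apply: continuous_measurable_fun.
  exact: (continuous_compk (@continuous_sin R)).
have iC : intg mu (fun y => expR (- e * `|y|) * cos (eta * y)).
  have := intg_poisson1 eta 0 e0; apply: intg_ext => y; by rewrite add0r.
have -> : (fun y => expR (- e * `|y|) * cos (c + eta * y)) =
    fun y => cos c * (expR (- e * `|y|) * cos (eta * y)) - sin c * (expR (- e * `|y|) * sin (eta * y)).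
  by apply/funext => y; rewrite cosD; ring.
rewrite IB; [|exact: intgZ|exact: intgZ]; rewrite !IZ//.
have -> : \int[mu]_y (expR (- e * `|y|) * sin (eta * y)) = 0.
  have h : \int[mu]_y (expR (- e * `|y|) * sin (eta * y)) = - \int[mu]_y (expR (- e * `|y|) * sin (eta * y)).
    rewrite -{1}I1_refl// -IN//; apply: eqI => y.
    by rewrite normrN mulrN sinN mulrN.
  lra.
have -> : \int[mu]_y (expR (- e * `|y|) * cos (eta * y)) = pe e eta.
  have h := integral_Eabs1 eta e0.
  have h1 : \int[mu]_y (expR (- e * `|y|) + expR (- e * `|y|) * cos (eta * y)) = pe e eta + 2 / e.
    by rewrite -[RHS]/(fine (_%:E)) -h; congr fine; apply: eq_integral => y _; rewrite mulrDr mulr1.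
  move: h1; rewrite ID//; last exact: intg_Eabs.
  rewrite {1}/Rintegral integral_Eabs//= addrC; exact: addIr.
lra.
Qed.

End Poisson1.

(** * Cosine and sine transforms of test functions *)

Section Fourier.
Context {R : realType}.
Local Notation mu := (@lebesgue_measure R).
Local Notation X := (space3 R).
Implicit Types (psi : X -> R) (x y v xi z : X).

Definition tfun psi : Prop := smooth psi /\ bsupp psi.

Lemma tfun_schw psi : tfun psi -> schw psi.
Proof. by case; exact: test_schw. Qed.

Lemma tfun_D v psi : tfun psi -> tfun ('D_v psi).
Proof. by move=> [h1 h2]; split; [exact: smooth_D|exact: bsupp_D]. Qed.

Lemma tfunM psi (g : X -> R) : tfun psi -> smooth g -> tfun (fun x => psi x * g x).
Proof. by move=> [h1 h2] sg; split; [exact: smoothM|exact: bsupp_mul]. Qed.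

Lemma tfunMl psi (g : X -> R) : tfun psi -> smooth g -> tfun (fun x => g x * psi x).
Proof.
move=> tp sg; have [h1 h2] := tfunM tp sg.
by rewrite (_ : (fun x => g x * psi x) = fun x => psi x * g x)//; apply/funext => x; rewrite mulrC.
Qed.

Lemma tfunZ k psi : tfun psi -> tfun (fun x => k * psi x).
Proof. by move=> tp; apply: tfunMl => //; exact: smooth_cst. Qed.

Lemma tfunD psi (g : X -> R) : tfun psi -> tfun g -> tfun (fun x => psi x + g x).
Proof.
move=> [h1 [M hM]] [g1 [N hN]]; split; first exact: smoothD.
exists (Num.max M N) => x fgx; rewrite le_max.
have [p0|/hM->//] := eqVneq (psi x) 0.
by move: fgx; rewrite p0 add0r => /hN ->; rewrite orbT.
Qed.

Lemma tfunN psi : tfun psi -> tfun (fun x => - psi x).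
Proof. by move=> /(tfunZ (-1)); rewrite (_ : (fun x => -1 * psi x) = fun x => - psi x)//; apply/funext => x; rewrite mulN1r. Qed.

Lemma tfunB psi (g : X -> R) : tfun psi -> tfun g -> tfun (fun x => psi x - g x).
Proof. by move=> tp tg; apply: tfunD => //; exact: tfunN. Qed.

Lemma continuous_cosdot c x : continuous (fun xi : X => cos (dot x xi - c)).
Proof.
move=> xi; apply: (@continuous_comp _ _ _ (fun xi => dot x xi - c) cos); last exact: continuous_cos.
apply: cvgB; last exact: cvg_cst.
rewrite (_ : dot x = dot^~ x); first exact: continuous_dot.
by apply/funext => y; rewrite dotC.
Qed.

Lemma intg_cosdot c psi x : intgX psi -> intgX (fun xi => psi xi * cos (dot x xi - c)).
Proof.
move=> ip; apply: (intgM_bd ip) => [|xi]; last exact: cos_max.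
by apply: continuous_mfun3; exact: continuous_cosdot.
Qed.

Lemma intg_cos psi x : intgX psi -> intgX (fun xi => psi xi * cos (dot x xi)).
Proof. by move=> /(intg_cosdot 0 x); apply: intg_ext => xi; rewrite subr0. Qed.

Lemma intg_sin psi x : intgX psi -> intgX (fun xi => psi xi * sin (dot x xi)).
Proof. by move=> /(intg_cosdot (pi / 2) x); apply: intg_ext => xi; rewrite cosBpihalf. Qed.

(* The phase makes the sine transform a case of the cosine one, so that the
   family is stable under differentiation. *)
Definition tr c psi x : R := \int[leb3]_xi (psi xi * cos (dot x xi - c)).
Definition ctr psi x : R := \int[leb3]_xi (psi xi * cos (dot x xi)).
Definition str psi x : R := \int[leb3]_xi (psi xi * sin (dot x xi)).

Lemma ctrE psi : ctr psi = tr 0 psi.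
Proof. by apply/funext => x; apply: eqI => xi; rewrite subr0. Qed.

Lemma strE psi : str psi = tr (pi / 2) psi.
Proof. by apply/funext => x; apply: eqI => xi; rewrite cosBpihalf. Qed.

Lemma trBpi c psi x : intgX psi -> tr (c - pi / 2 - pi / 2) psi x = - tr c psi x.
Proof.
move=> ip; rewrite -IN; last exact: intg_cosdot.
by apply: eqI => xi; rewrite -[RHS]mulrN -cosDpi; congr (_ * cos _); field.
Qed.

Lemma tr_le c psi x : intgX psi -> `|tr c psi x| <= \int[leb3]_xi `|psi xi|.
Proof.
move=> ip; apply: (Iabs_le (intg_meas (intg_cosdot c x ip)) (intg_abs ip)) => xi.
by rewrite normrM ler_piMr// cos_max.
Qed.

Lemma D_cosdot c xi x v : derivable (fun z => cos (dot z xi - c)) x v /\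
  'D_v (fun z => cos (dot z xi - c)) x = dot v xi * cos (dot x xi - (c - pi / 2)).
Proof.
apply: is_derive_slice.
rewrite (_ : (fun s => _) = fun s => cos (dot x xi - c + dot v xi * s)); last first.
  by apply/funext => s; rewrite dotDl dotZl [s * _]mulrC addrAC.
have := @is_derive_compl R cos (dot v xi) (dot x xi - c) _ 0 (is_derive_cos _).
by rewrite mulr0 addr0 -cosDpihalf opprB addrCA addrC mulrC.
Qed.

Lemma smooth_cosdot c v : smooth (fun xi : X => cos (dot v xi - c)).
Proof.
pose C (f : X -> R) := exists p : R * R, f = fun xi => p.1 * cos (dot xi v - p.2).
apply: (@smooth_coind _ _ C).
- move=> _ [p ->] xi; apply: cvgM; [exact: cvg_cst|move: xi].
  rewrite -/(continuous _) (_ : (fun xi => _) = fun xi => cos (dot v xi - p.2)).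
    exact: continuous_cosdot.
  by apply/funext => y; rewrite dotC.
- by move=> _ [p ->] x w; exact: derivableM (derivable_cst _ _ _) (D_cosdot _ v x w).1.
- move=> _ w [p ->]; exists (p.1 * dot w v, p.2 - pi / 2); apply/funext => x.
  by have [c1 c2] := D_cosdot p.2 v x w; rewrite (DZ _ c1) c2 mulrA.
- by exists (1, c); apply/funext => xi; rewrite mul1r dotC.
Qed.

Lemma smooth_dotr v : smooth (dot v).
Proof.
by rewrite (_ : dot v = dot^~ v); [exact: smooth_dot|apply/funext => y; rewrite dotC].
Qed.

Lemma D_tr c psi x v : tfun psi -> derivable (tr c psi) x v /\
  'D_v (tr c psi) x = tr (c - pi / 2) (fun xi => dot v xi * psi xi) x.
Proof.
move=> tp; have ip := schw_intg (tfun_schw tp).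
have ivp := schw_intg (tfun_schw (tfunMl tp (smooth_dotr v))).
have der xi z : 'D_v (fun z => psi xi * cos (dot z xi - c)) z =
    dot v xi * psi xi * cos (dot z xi - (c - pi / 2)).
  by have [d1 d2] := D_cosdot c xi z v; rewrite DZ// d2; ring.
have [|||||h1 h2] := @D_under_integral R X _ _ leb3 (fun z xi => psi xi * cos (dot z xi - c)) x v (fun xi => `|dot v xi * psi xi|).
- by move=> t _; exact: intg_cosdot.
- by move=> xi z; apply: derivableM; [exact: derivable_cst|have [] := D_cosdot c xi z v].
- by move=> t xi _; rewrite der normrM ler_piMr// cos_max.
- by [].
- exact: intg_abs.
by split => //; rewrite h2; apply: eqI => xi.
Qed.

(** By translation invariance the integral of [g (y + z)] over [y] is constant in [z]; its
    derivative at 0 is taken under the integral. *)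
Lemma I_D0 (i : 'I_3) (g : X -> R) : schw g -> \int[leb3]_y 'd_i g y = 0.
Proof.
move=> sg; set e := 'u_i.
have e1 : `|e| <= 1.
  rewrite norm_le3 /=.
  by case: (i) => -[|[|[|//]]] /= _; rewrite ?normr0 ?normr1 ?ler01 ?lexx.
have [C C0 hC] := schw_shift_bound (schw_D e sg).
have ds y z : derivable (fun z => g (y + z)) z e /\ 'D_e (fun z => g (y + z)) z = 'D_e g (y + z).
  have -> : (fun z => g (y + z)) = (fun z => g (z + y)) by apply/funext => w; rewrite addrC.
  rewrite D_shift addrC; split => //; apply: derivable_shift.
  exact: smooth_derivable (schw_smooth sg).
have [|||||_] := @D_under_integral R X _ _ leb3 (fun z y => g (y + z)) 0 e (fun y => C * wP y).
- by move=> t _; apply: intg_shift; exact: schw_intg.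
- by move=> y z; have [] := ds y z.
- move=> t y t1; rewrite (ds _ _).2 add0r; apply: hC.
  by rewrite normrZ mulr_ile1// ltW.
- by move=> y; rewrite mulr_ge0 ?wP_ge0// ltW.
- exact/intgZ/intg_wP.
rewrite (_ : (fun z => _) = fun=> \int[leb3]_y g y); last first.
  by apply/funext => z; rewrite I_shift//; exact: schw_intg.
by rewrite Dcst => ->; apply: eqI => y; rewrite (ds _ _).2 addr0.
Qed.

Lemma tr_D c psi (i : 'I_3) x : tfun psi ->
  tr c ('d_i psi) x = - (component i x * tr (c - pi / 2) psi x).
Proof.
move=> tp; have sc := smooth_cosdot c x; have := I_D0 i (tfun_schw (tfunM tp sc)).
have ip := schw_intg (tfun_schw tp); have iDp := schw_intg (tfun_schw (tfun_D 'u_i tp)).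
have -> : (fun y => 'd_i (fun xi => psi xi * cos (dot x xi - c)) y) = (fun y =>
    'd_i psi y * cos (dot x y - c) + component i x * (psi y * cos (dot x y - (c - pi / 2)))).
  apply/funext => y; rewrite DM; [|exact: smooth_derivable tp.1|exact: smooth_derivable sc].
  rewrite (_ : (fun xi => _) = fun z => cos (dot z x - c)).
    by rewrite (D_cosdot c x y 'u_i).2 unit_dot (dotC y x); ring.
  by apply/funext => z; rewrite dotC.
rewrite ID; [|exact: intg_cosdot|by apply: intgZ; exact: intg_cosdot].
by rewrite (IZ _ (intg_cosdot _ x ip)) => /eqP; rewrite addr_eq0 => /eqP.
Qed.

(** Applying [1 - d_i^2] to [psi] multiplies the transform by [1 + x_i^2]; doing so in the three
    directions multiplies it by [(wP x)^-1], and the transform of the result is bounded by an L^1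
    norm. *)
Lemma tr_decay c psi : tfun psi -> exists C : R, forall x, `|tr c psi x| <= C * wP x.
Proof.
move=> tp.
pose A (i : 'I_3) (f : X -> R) : X -> R := fun xi => f xi - 'd_i ('d_i f) xi.
have tA i f : tfun f -> tfun (A i f).
  by move=> tf; apply: tfunB => //; apply: tfun_D; exact: tfun_D.
have cA i f x : tfun f -> tr c (A i f) x = (1 + component i x ^+ 2) * tr c f x.
  move=> tf; have if1 := schw_intg (tfun_schw tf).
  have tD := tfun_D 'u_i tf; have tDD := tfun_D 'u_i tD.
  rewrite {1}/tr (_ : (fun xi => _) = fun xi => f xi * cos (dot x xi - c) - 'd_i ('d_i f) xi * cos (dot x xi - c)).
    rewrite IB; [|exact: intg_cosdot|by apply: intg_cosdot; exact: schw_intg (tfun_schw tDD)].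
    by rewrite -/(tr c f x) -/(tr c _ x) !tr_D// trBpi//; ring.
  by apply/funext => xi; rewrite mulrBl.
pose g := A 2%:R (A 1 (A 0 psi)).
have t1 := tA 0 _ tp; have t2 := tA 1 _ t1; have tg := tA 2%:R _ t2.
exists (\int[leb3]_xi `|g xi|) => x.
have pos i : 0 < 1 + component i x ^+ 2 by rewrite ltr_wpDr ?sqr_ge0.
have := tr_le c x (schw_intg (tfun_schw tg)); rewrite (cA _ _ _ t2) (cA _ _ _ t1) (cA _ _ _ tp).
rewrite !normrM !(ger0_norm (ltW (pos _))).
have -> : wP x = ((1 + component 2%:R x ^+ 2) * (1 + component 1 x ^+ 2) * (1 + component 0 x ^+ 2))^-1.
  by rewrite !invfM /wP /p1; ring.
by rewrite ler_pdivlMr ?mulr_gt0//; apply: le_trans; apply: eq_ler; ring.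
Qed.

Lemma tr_lipschitz c psi : tfun psi -> exists2 C : R, 0 <= C &
  forall x z, `|tr c psi (x + z) - tr c psi x| <= C * `|z|.
Proof.
move=> tp; have ip := schw_intg (tfun_schw tp); have [_ [M hM]] := tp.
exists (3 * `|M| * \int[leb3]_xi `|psi xi|); first by rewrite !mulr_ge0// I_ge0.
move=> x z; have [t t01 ->] := @MVT_dir _ _ (tr c psi) x z (fun y => (D_tr c y z tp).1).
have iz := schw_intg (tfun_schw (tfunMl tp (smooth_dotr z))).
rewrite (D_tr _ _ _ tp).2; apply: (le_trans (tr_le _ _ iz)).
rewrite mulrAC -IZ; last exact: intg_abs.
apply: Ile; [exact: intg_abs|by apply: intgZ; exact: intg_abs|move=> xi].
have [->|pxi] := eqVneq (psi xi) 0; first by rewrite mulr0 normr0.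
rewrite normrM ler_wpM2r//; apply: (le_trans (norm_dot _ _)).
by rewrite mulrAC ler_wpM2r// ler_wpM2l// (le_trans (hM xi pxi))// ler_norm.
Qed.

Lemma lipschitz_continuous (f : X -> R) (C : R) : 0 <= C ->
  (forall x z, `|f (x + z) - f x| <= C * `|z|) -> continuous f.
Proof.
move=> C0 hf x; apply/cvgrPdist_lt => e e0.
have d0 : 0 < e / (C + 1) by rewrite divr_gt0// ltr_wpDl.
apply: (filterS _ (nbhsx_ballx x _ d0)) => y; rewrite -ball_normE /= => xy.
have := hf x (y - x); rewrite [x + _]addrC subrK distrC => /le_lt_trans; apply.
rewrite distrC; move: xy; rewrite ltr_pdivlMr ?ltr_wpDl// mulrDr mulrC.
by apply: le_lt_trans; rewrite lerDl.
Qed.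

Lemma tr_schw c psi : tfun psi -> schw (tr c psi).
Proof.
pose C (f : X -> R) := exists2 psi : X -> R, tfun psi & exists c, f = tr c psi.
have CD f v : C f -> C ('D_v f).
  move=> [p tp [b ->]]; exists (fun xi => dot v xi * p xi); first exact: tfunMl tp (smooth_dotr v).
  by exists (b - pi / 2); apply/funext => x; rewrite (D_tr b x v tp).2.
have Csm f : C f -> smooth f.
  apply: smooth_coind => [_ [p tp [b ->]]|_ [p tp [b ->]] x v|//].
    by have [K K0 hK] := tr_lipschitz b tp; exact: lipschitz_continuous K0 hK.
  by have [] := D_tr b x v tp.
move=> tp; have Cf : C (tr c psi) by exists psi => //; exists c.
split; first exact: Csm.
by move=> l; have [p tp' [b ->]] : C (iter_derive l (tr c psi)); [elim: l => //= v l; exact: CD|exact: tr_decay].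
Qed.

Lemma ctr_schw psi : tfun psi -> schw (ctr psi).
Proof. by rewrite ctrE; exact: tr_schw. Qed.

Lemma D_ctr psi x v : tfun psi -> derivable (ctr psi) x v /\
  'D_v (ctr psi) x = - str (fun xi => dot v xi * psi xi) x.
Proof.
move=> tp; rewrite ctrE strE; have [d ->] := D_tr 0 x v tp; split=> //.
rewrite -trBpi ?subrr ?addrK//.
by apply/schw_intg/tfun_schw/tfunMl => //; exact: smooth_dotr.
Qed.

Lemma D_str psi x v : tfun psi -> derivable (str psi) x v /\
  'D_v (str psi) x = ctr (fun xi => dot v xi * psi xi) x.
Proof. by move=> tp; have := D_tr (pi / 2) x v tp; rewrite subrr -ctrE -strE. Qed.

Lemma ctr_D psi (i : 'I_3) x : tfun psi -> ctr ('d_i psi) x = component i x * str psi x.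
Proof.
move=> tp; rewrite ctrE strE tr_D// -mulrN.
by rewrite -(subrr (pi / 2)) trBpi ?opprK//; exact/schw_intg/tfun_schw.
Qed.

End Fourier.

(** * Fourier inversion for even test functions *)

Section Inversion.
Context {R : realType}.
Local Notation mu := (@lebesgue_measure R).
Local Notation X := (space3 R).
Implicit Types (psi : X -> R) (x y v xi z zeta eta : X).

Lemma I_prod12 {d1 d2} {T1 : measurableType d1} {T2 : measurableType d2}
    (m1 : {sigma_finite_measure set T1 -> \bar R}) (m2 : {sigma_finite_measure set T2 -> \bar R})
    (f : T1 * T2 -> R) : intg (m1 \x m2)%E f ->
  \int[(m1 \x m2)%E]_z f z = \int[m1]_x (\int[m2]_y f (x, y)).
Proof.
move=> hf; apply: EFin_inj; rewrite EFinI// EFinI; last exact: intg_fub1 hf.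
rewrite -(integral12_prod_meas1 hf); apply/esym; apply: ae_eq_integral => //.
- by apply/measurable_EFinP; exact: intg_meas (intg_fub1 hf).
- exact: measurable_fubini_F hf.
- have := ae_integrable1 hf; apply: filterS => x hx _; exact: EFinI.
Qed.

Lemma I_iter3 (f : X -> R) : intgX f ->
  \int[leb3]_x f x = \int[mu]_x (\int[mu]_y (\int[mu]_z f (x, y, z))).
Proof.
move=> hf.
rewrite [LHS](@I_prod12 _ _ _ _ leb2s mu f hf).
have h1 := @intg_fub1 _ _ _ _ _ leb2s mu f hf.
exact: @I_prod12 _ _ _ _ mu mu _ h1.
Qed.

(** Damping factor for Abel summation; its Fourier transform is the product Poisson kernel [pe3]. *)
Definition E3 (e : R) (y : X) : R :=
  expR (- e * `|y.1.1|) * expR (- e * `|y.1.2|) * expR (- e * `|y.2|).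

Lemma E3_ge0 e y : 0 <= E3 e y.
Proof. by rewrite !mulr_ge0. Qed.

Lemma E3_le1 e y : 0 <= e -> E3 e y <= 1.
Proof.
move=> e0; have h t : expR (- e * `|t|) <= 1.
  by rewrite -expR0 ler_expR mulNr oppr_le0 mulr_ge0.
by rewrite !mulr_ile1.
Qed.

Lemma measurable_E3 e : mfun3 (E3 e).
Proof.
have m := continuous_measurable_fun (@continuous_Eabs R e).
apply: measurable_funM; first apply: measurable_funM.
- exact: measurableT_comp m measurable_x1.
- exact: measurableT_comp m measurable_x2.
- exact: measurableT_comp m measurable_x3.
Qed.

Lemma intg_E3 e : 0 < e -> intgX (E3 e).
Proof.
move=> e0; apply: intg_ge0P; [exact: measurable_E3|exact: E3_ge0|].
have m := continuous_measurable_fun (@continuous_Eabs R e).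
have g (t : R) : 0 <= expR (- e * `|t|) by exact: expR_ge0.
have i := integral_Eabs e0.
by rewrite (ge0_integral_prod3 m m m g g g i i i) ltry.
Qed.

Definition pe3 (e : R) (eta : X) : R := pe e eta.1.1 * pe e eta.1.2 * pe e eta.2.

Lemma measurable_dot :
  measurable_fun (setT : set (mspace3 R * mspace3 R)) (fun z : mspace3 R * mspace3 R => dot z.1 z.2).
Proof.
rewrite (_ : (fun z : X * X => _) = fun z : X * X => z.1.1.1 * z.2.1.1 + z.1.1.2 * z.2.1.2 + z.1.2 * z.2.2); last first.
  by apply/funext => z; rewrite dotE.
have mx (h : X -> R) : mfun3 h ->
    measurable_fun (setT : set (mspace3 R * mspace3 R)) (fun z : mspace3 R * mspace3 R => h z.1 * h z.2).
  by move=> mh; apply: measurable_funM;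
    [exact: measurableT_comp mh measurable_pr1|exact: measurableT_comp mh measurable_pr2].
exact: measurable_funD (measurable_funD (mx _ measurable_x1) (mx _ measurable_x2)) (mx _ measurable_x3).
Qed.

Lemma mfun_cosdot c z : mfun3 (fun y => cos (dot y z + c)).
Proof.
rewrite (_ : (fun y => _) = fun y => cos (dot z y - - c)).
  by apply: continuous_mfun3; exact: continuous_cosdot.
by apply/funext => y; rewrite opprK dotC.
Qed.

Lemma intg_cosdotl c psi z : intgX psi -> intgX (fun y => psi y * cos (dot y z + c)).
Proof.
by move=> ip; apply: (intgM_bd ip) => [|y]; [exact: mfun_cosdot|exact: cos_max].
Qed.

Lemma I_poisson3 e c eta : 0 < e ->
  \int[leb3]_y (E3 e y * cos (dot y eta + c)) = pe3 e eta * cos c.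
Proof.
move=> e0; rewrite I_iter3; last exact: intg_cosdotl (intg_E3 e0).
have s3 (x y : R) : \int[mu]_z (E3 e (x, y, z) * cos (dot (x, y, z) eta + c)) =
    pe e eta.2 * (expR (- e * `|x|) * (expR (- e * `|y|) * cos (c + eta.1.1 * x + eta.1.2 * y))).
  rewrite (_ : (fun z : R => _) = fun z : R => (expR (- e * `|x|) * expR (- e * `|y|)) *
     (expR (- e * `|z|) * cos ((c + eta.1.1 * x + eta.1.2 * y) + eta.2 * z))); last first.
    apply/funext => z; rewrite /E3 (_ : dot _ _ + c = c + eta.1.1 * x + eta.1.2 * y + eta.2 * z); [ring|].
    by rewrite dotE /=; ring.
  by rewrite IZ ?I_poisson1//; [ring|exact: intg_poisson1].
rewrite (_ : (fun x : R => _) = fun x : R => pe e eta.2 * pe e eta.1.2 * (expR (- e * `|x|) * cos (c + eta.1.1 * x))).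
  by rewrite IZ ?I_poisson1//; [rewrite /pe3; ring|exact: intg_poisson1].
apply/funext => x; rewrite (_ : (fun y : R => _) = fun y : R => pe e eta.2 * expR (- e * `|x|) *
    (expR (- e * `|y|) * cos (c + eta.1.1 * x + eta.1.2 * y))).
  by rewrite IZ ?I_poisson1//; [ring|exact: intg_poisson1].
by apply/funext => y; rewrite s3; ring.
Qed.

Lemma pe_scale e (t : R) : 0 < e -> pe e (e * t) = 2 / e * p1 t.
Proof.
move=> e0; rewrite /pe /p1 /oneDsqr.
have : 1 + t ^+ 2 != 0 by rewrite gt_eqF// ltr_wpDr ?sqr_ge0.
move=> h; rewrite (_ : e ^+ 2 + (e * t) ^+ 2 = e ^+ 2 * (1 + t ^+ 2)); last ring.
by field; rewrite h gt_eqF.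
Qed.

Lemma pe_ge0 (e t : R) : 0 < e -> 0 <= pe e t.
Proof. by move=> e0; rewrite divr_ge0 ?addr_ge0 ?sqr_ge0// mulr_ge0// ltW. Qed.

Lemma pe_le (e t : R) : 0 < e -> pe e t <= 2 / e.
Proof.
move=> e0; rewrite -(mulVKf (lt0r_neq0 e0) t) pe_scale// ler_piMr ?p1_le1//.
by rewrite divr_ge0// ltW.
Qed.

Lemma measurable_pe (e : R) : measurable_fun setT (pe e).
Proof.
have [->|e0] := eqVneq e 0.
  rewrite (_ : pe 0 = cst 0)//; apply/funext => t; by rewrite /pe mulr0 mul0r.
apply: continuous_measurable_fun => t; apply: cvgM; first exact: cvg_cst.
apply: cvgV; first by rewrite gt_eqF// ltr_pwDl ?sqr_ge0// exprn_even_gt0.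
by apply: cvgD; [exact: cvg_cst|exact: exprn_continuous].
Qed.

Lemma measurable_pe3 e : mfun3 (pe3 e).
Proof.
apply: measurable_funM; first apply: measurable_funM.
- exact: measurableT_comp (@measurable_pe e) measurable_x1.
- exact: measurableT_comp (@measurable_pe e) measurable_x2.
- exact: measurableT_comp (@measurable_pe e) measurable_x3.
Qed.

Lemma intg_pe3 e psi z : 0 < e -> intgX psi -> intgX (fun xi => psi xi * pe3 e (xi - z)).
Proof.
move=> e0 ip; apply: (intgM_bd (C := (2 / e) * (2 / e) * (2 / e)) ip) => [|y].
  have := measurableT_comp (@measurable_pe3 e) (measurable_aff3 1 (- z)).
  by congr measurable_fun; apply/funext => y /=; rewrite aff3E scale1r.
have h t := pe_le t e0; have g t := pe_ge0 t e0.
rewrite (ger0_norm (mulr_ge0 (mulr_ge0 (g _) (g _)) (g _))).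
exact: ler_pM (mulr_ge0 (g _) (g _)) (g _) (ler_pM (g _) (g _) (h _) (h _)) (h _).
Qed.

Lemma I_wP : \int[leb3]_x wP x = pi ^+ 3 :> R.
Proof.
have m := @measurable_p1 R; have i := @integral_p1 R; have g := @p1_ge0 R.
by rewrite /Rintegral (ge0_integral_prod3 m m m g g g i i i) /=; ring.
Qed.

(** After the substitution [xi = eta / (n+1) + zeta] the kernel becomes [8 wP eta], of integral
    [(2 pi)^3]: an approximate identity. *)
Lemma poisson_approx psi zeta : tfun psi ->
  \int[leb3]_xi (psi xi * pe3 n.+1%:R^-1 (xi - zeta)) @[n --> \oo] --> (2 * pi) ^+ 3 * psi zeta.
Proof.
move=> tp; have sp := tfun_schw tp; have [C C0 hC] := schw_bound sp.
pose G n eta := psi (n.+1%:R^-1 *: eta + zeta) * wP eta.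
have mG n : mfun3 (G n).
  apply: measurable_funM; last exact: measurable_wP.
  have := measurableT_comp (smooth_mfun3 tp.1) (measurable_aff3 n.+1%:R^-1 zeta).
  by [].
have bG n y : `|G n y| <= C * wP y.
  by rewrite normrM (ger0_norm (wP_ge0 _)) ler_wpM2r ?wP_ge0// (le_trans (hC _))// ler_piMr ?(ltW C0)// wP_le1.
have iC : intgX (fun y => C * wP y) by exact/intgZ/intg_wP.
rewrite (_ : (fun n => _) = fun n => 8 * \int[leb3]_eta G n eta); last first.
  apply/funext => n; have e0 : 0 < n.+1%:R^-1 :> R by rewrite invr_gt0.
  rewrite -(I_aff3 zeta (lt0r_neq0 e0) (intg_pe3 zeta e0 (schw_intg sp))) ger0_norm ?(ltW e0)//.
  rewrite (_ : \int[leb3]_y _ = \int[leb3]_y ((2 * n.+1%:R) ^+ 3 * G n y)); last first.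
    apply: eqI => y; rewrite aff3E addrK /pe3 !pe_scale// invrK /G /wP; ring.
  rewrite IZ; last exact: intg_le (mG n) iC (bG n).
  by rewrite mulrA -exprMn mulrCA mulVf ?pnatr_eq0//; ring.
rewrite (_ : (2 * pi) ^+ 3 * psi zeta = 8 * \int[leb3]_eta (psi zeta * wP eta)); last first.
  by rewrite IZ ?I_wP; [ring|exact: intg_wP].
apply: cvgM; first exact: cvg_cst.
apply: (proj2 (@Idct _ _ R leb3 G _ (fun x => C * wP x) mG iC _ bG)) => eta.
apply: cvgM; last exact: cvg_cst.
have c : (n.+1%:R^-1 *: eta + zeta) @[n --> \oo] --> zeta.
  rewrite -[X in _ --> X]add0r; apply: cvgD; last exact: cvg_cst.
  by rewrite -(scale0r eta); apply: cvgZr_tmp; exact: cvg_harmonic.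
exact: @continuous_cvg _ _ _ _ _ (fun n => n.+1%:R^-1 *: eta + zeta) psi zeta (@smooth_cont _ _ psi tp.1 zeta) c.
Qed.

Definition even_fun psi : Prop := forall xi, psi (- xi) = psi xi.

Lemma ctrN psi y : ctr psi (- y) = ctr psi y.
Proof. by apply: eqI => xi; rewrite dotNl cosN. Qed.

Lemma strN psi y : tfun psi -> str psi (- y) = - str psi y.
Proof.
move=> /tfun_schw/schw_intg ip; rewrite -IN; last exact: intg_sin.
by apply: eqI => xi; rewrite dotNl sinN mulrN.
Qed.

Lemma str_even0 psi y : tfun psi -> even_fun psi -> str psi y = 0.
Proof.
move=> /tfun_schw/schw_intg ip ev.
have h := I_refl 0 (intg_sin y ip).
have : str psi y = - str psi y; last by move: (str psi y) => a ha; lra.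
rewrite {1}/str -h -IN; last exact: intg_sin.
by apply: eqI => xi; rewrite sub0r ev dotNr sinN mulrN.
Qed.

(** Abel summation: the integral is damped by [E3], the order of integration exchanged, and the
    damping removed by dominated convergence. Evenness enters because a cosine transform sees only
    the even part of [psi]. *)
Lemma fourier_inversion0 psi zeta d : tfun psi -> even_fun psi ->
  \int[leb3]_y (ctr psi y * cos (dot y zeta + d)) = (2 * pi) ^+ 3 * psi zeta * cos d.
Proof.
move=> tp ev; have ip := schw_intg (tfun_schw tp); have ic := schw_intg (ctr_schw tp).
have e0 n : 0 < n.+1%:R^-1 :> R by rewrite invr_gt0.
have icz := intg_cosdotl d zeta ic.
pose J n := \int[leb3]_y ((ctr psi y * cos (dot y zeta + d)) * E3 n.+1%:R^-1 y).
have lim1 : J n @[n --> \oo] --> \int[leb3]_y (ctr psi y * cos (dot y zeta + d)).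
  apply: (proj2 (@Idct _ _ R leb3 (fun n y => (ctr psi y * cos (dot y zeta + d)) * E3 n.+1%:R^-1 y) _ (fun y => `|ctr psi y|) _ _ _ _)).
  - by move=> n; apply: measurable_funM; [exact: intg_meas icz|exact: measurable_E3].
  - exact: intg_abs.
  - move=> y; rewrite -[X in _ --> X]mulr1; apply: cvgM; first exact: cvg_cst.
    have c1 (t : R) : expR (- n.+1%:R^-1 * `|t|) @[n --> \oo] --> (1:R).
      have c : - n.+1%:R^-1 * `|t| @[n --> \oo] --> 0.
        rewrite -(mul0r `|t|) -oppr0; apply: cvgM; last exact: cvg_cst.
        by apply: cvgN; exact: cvg_harmonic.
      by have := cvg_comp _ _ c (@continuous_expR R 0); rewrite expR0.
    by have := cvgM (cvgM (c1 y.1.1) (c1 y.1.2)) (c1 y.2); rewrite !mulr1 => c3; exact: c3.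
  - move=> n y; rewrite normrM (ger0_norm (E3_ge0 _ _)) normrM -mulrA ler_piMr//.
    by rewrite mulr_ile1 ?E3_ge0 ?cos_max// E3_le1.
pose P n z := \int[leb3]_xi (psi xi * pe3 n.+1%:R^-1 (xi - z)).
(* The product of two cosines yields the frequencies [xi - zeta] and [xi + zeta], so the kernel
   concentrates at both [zeta] and [- zeta]. *)
have JE n : J n = 2^-1 * cos d * (P n zeta + P n (- zeta)).
  rewrite /J /P; move: n.+1%:R^-1 (e0 n) => e e1.
  pose F (z : X * X) := psi z.2 * cos (dot z.1 z.2) * (cos (dot z.1 zeta + d) * E3 e z.1).
  have mF : measurable_fun (setT : set (mspace3 R * mspace3 R)) (F : mspace3 R * mspace3 R -> R).
    apply: measurable_funM; last first.
      exact: measurableT_comp (measurable_funM (mfun_cosdot d zeta) (@measurable_E3 e)) measurable_pr1.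
    apply: measurable_funM; first exact: measurableT_comp (smooth_mfun3 tp.1) measurable_pr2.
    exact: measurableT_comp (continuous_measurable_fun (@continuous_cos R)) measurable_dot.
  have hF y : intgX (fun xi => F (y, xi)) := intgZr (cos (dot y zeta + d) * E3 e y) (intg_cos y ip).
  have bF y : \int[leb3]_xi `|F (y, xi)| <= (\int[leb3]_xi `|psi xi|) * E3 e y.
    rewrite -IZr; last exact: intg_abs.
    apply: Ile; [exact: intg_abs|by apply: intgZr; exact: intg_abs|move=> xi].
    rewrite normrM [X in _ * X]normrM (ger0_norm (E3_ge0 _ _)) normrM -mulrA.
    by rewrite ler_wpM2l// mulrA ler_piMl ?E3_ge0// mulr_ile1 ?cos_max.
  have [eF _ _] := fubini_X mF hF bF (intgZ _ (intg_E3 e1)).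
  rewrite (_ : \int[leb3]_y _ = \int[leb3]_y (\int[leb3]_xi F (y, xi))); last first.
    apply: eqI => y; rewrite /F /= IZr; [exact: esym (mulrA _ _ _)|exact: intg_cos].
  rewrite eF -ID -?IZ; [|exact: intgD (intg_pe3 _ e1 ip) (intg_pe3 _ e1 ip)|exact: intg_pe3..].
  apply: eqI => xi.
  have j1 := intg_cosdotl (- d) (xi - zeta) (intg_E3 e1).
  have j2 := intg_cosdotl d (xi + zeta) (intg_E3 e1).
  have -> : 2^-1 * cos d * (psi xi * pe3 e (xi - zeta) + psi xi * pe3 e (xi - - zeta)) =
      2^-1 * psi xi * (pe3 e (xi - zeta) * cos (- d) + pe3 e (xi + zeta) * cos d).
    by rewrite opprK cosN; ring.
  rewrite -!(I_poisson3 _ _ e1) -(ID j1 j2) -(IZ _ (intgD j1 j2)).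
  apply: eqI => y; rewrite /F dotBr dotDr !(cosD, sinD, sinN, cosN); by field.
have lim2 : J n @[n --> \oo] --> 2^-1 * cos d * ((2 * pi) ^+ 3 * psi zeta + (2 * pi) ^+ 3 * psi (- zeta)).
  rewrite (_ : J = fun n => 2^-1 * cos d * (P n zeta + P n (- zeta))); last first.
    by apply/funext => n.
  by apply: cvgM; [exact: cvg_cst|apply: cvgD; exact: poisson_approx].
have := cvg_unique _ lim1 lim2; rewrite ev => /(_ (@norm_hausdorff _ _)) ->; by field.
Qed.

Lemma fourier_inversion psi zeta c x : tfun psi -> even_fun psi ->
  \int[leb3]_z (ctr psi (x - z) * cos (dot z zeta - c)) = (2 * pi) ^+ 3 * psi zeta * cos (dot x zeta - c).
Proof.
move=> tp ev; rewrite -fourier_inversion0//.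
rewrite -(I_shift (- x) (intg_cosdotl _ zeta (schw_intg (ctr_schw tp)))); apply: eqI => z.
by rewrite -ctrN opprB dotBl; congr (_ * cos _); ring.
Qed.

End Inversion.

(** * Convolution of square-integrable functions with decaying kernels *)

Section Convolution.
Context {R : realType}.
Local Notation X := (space3 R).
Local Notation Y := (mspace3 R).
Implicit Types (k a b f g : X -> R) (x y z v : X).

Lemma wP_peetre_nat (m : nat) x z : `|z| <= m%:R -> wP x <= 27 ^+ m * wP (x + z).
Proof.
elim: m x z => [|m IH] x z hz.
  have /eqP -> : z == 0 by rewrite -normr_eq0 eq_le hz normr_ge0.
  by rewrite mul1r addr0.
pose w := m.+1%:R^-1 *: z.
have hw : `|w| <= 1.
  by rewrite normrZ gtr0_norm ?invr_gt0// mulrC ler_pdivrMr// mul1r.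
have zw : z = w + (z - w) by rewrite addrC subrK.
have hzw : `|z - w| <= m%:R.
  have -> : z - w = m%:R *: w.
    rewrite scalerA -{1}(scale1r z) -scalerBl; congr (_ *: _).
    by field.
  by rewrite normrZ ger0_norm// ler_piMr.
apply: le_trans (wP_peetre x hw) _; rewrite (_ : x + z = (x + w) + (z - w)); last by rewrite -addrA -zw.
rewrite exprS -mulrA ler_pM2l//.
exact: IH.
Qed.

Lemma N2_abs f : N2X (fun x => `|f x|) = N2X f.
Proof. by congr Num.sqrt; apply: eqI => x; rewrite real_normK// num_real. Qed.

(** Such kernels are at once integrable, bounded and square integrable, so convolution with an L^2
    function is defined at every point, bounded, and again in L^2. *)
Definition pkern k : Prop := mfun3 k /\ exists2 C : R, 0 < C & forall x, `|k x| <= C * wP x.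

Lemma schw_pkern k : schw k -> pkern k.
Proof. by move=> sk; split; [exact: smooth_mfun3 (schw_smooth sk)|exact: schw_bound]. Qed.

Lemma pkern_bounded k : pkern k -> exists2 C : R, 0 < C & forall x, `|k x| <= C.
Proof.
move=> [_ [C C0 h]]; exists C => // x; apply: le_trans (h x) _.
by rewrite ler_piMr ?(ltW C0)//; exact: wP_le1.
Qed.

Lemma pkern_intg k : pkern k -> intgX k.
Proof. by move=> [mk [C C0 h]]; apply: (intg_le mk (intgZ C intg_wP)). Qed.

Lemma pkern_sqi k : pkern k -> sqX k.
Proof.
move=> pk; have [C C0 h] := pkern_bounded pk; split; first exact: pk.1.
exact: intgM_bd (pkern_intg pk) pk.1 h.
Qed.

Lemma pkern_abs k : pkern k -> pkern (fun x => `|k x|).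
Proof.
move=> [mk [C C0 h]]; split; first exact: measurableT_comp mk.
by exists C => // x; rewrite normr_id.
Qed.

Lemma pkern_refl k : pkern k -> pkern (fun x => k (- x)).
Proof.
move=> [mk [C C0 h]]; split; last by exists C => // x; rewrite -wPN.
have := measurableT_comp mk (measurable_aff3 (-1) 0).
by congr measurable_fun; apply/funext => y /=; rewrite aff3E scaleN1r addr0.
Qed.

Lemma mfun3_sub k x : mfun3 k -> mfun3 (fun y => k (x - y)).
Proof.
move=> mk; have := measurableT_comp mk (measurable_aff3 (-1) x).
by congr measurable_fun; apply/funext => y /=; rewrite aff3E scaleN1r addrC.
Qed.

Lemma sqi_sub k x : sqX k -> sqX (fun y => k (x - y)).
Proof. by move=> [mk ik]; split; [exact: mfun3_sub|exact: (intg_refl x ik)]. Qed.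

Lemma N2_sub k x : sqX k -> N2X (fun y => k (x - y)) = N2X k.
Proof. by move=> [mk ik]; rewrite /N2 /nsq (I_refl x ik). Qed.

Definition conv k f x : R := \int[leb3]_y (k (x - y) * f y).

Lemma conv_intg k f x : pkern k -> sqX f -> intgX (fun y => k (x - y) * f y).
Proof. by move=> pk sf; apply: sqi_mul => //; exact/sqi_sub/pkern_sqi. Qed.

Lemma conv_le k f x : pkern k -> sqX f -> `|conv k f x| <= N2X k * N2X f.
Proof.
move=> pk sf; rewrite -(N2_sub x (pkern_sqi pk)); apply: cauchy_schwarz => //.
exact/sqi_sub/pkern_sqi.
Qed.

Lemma conv_bounded k f M x : pkern k -> mfun3 f -> (forall y, `|f y| <= M) ->
  `|conv k f x| <= (\int[leb3]_y `|k y|) * M.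
Proof.
move=> pk mf hf; have ik := intg_abs (pkern_intg pk).
rewrite -(I_refl x ik) -IZr; last exact: (intg_refl x ik).
apply: Iabs_le; first by apply: measurable_funM => //; exact: mfun3_sub pk.1.
  by apply: intgZr; exact: (intg_refl x ik).
by move=> y; rewrite normrM ler_wpM2l.
Qed.

Lemma mfun_sub2 k : mfun3 k -> measurable_fun (setT : set (Y * Y)) (fun z : X * X => k (z.1 - z.2)).
Proof. by move=> mk; exact: measurableT_comp mk measurable_sub3. Qed.

Lemma mfun_pr1 k : mfun3 k -> measurable_fun (setT : set (Y * Y)) (fun z : X * X => k z.1).
Proof. by move=> mk; exact: measurableT_comp mk measurable_pr1. Qed.

Lemma mfun_pr2 k : mfun3 k -> measurable_fun (setT : set (Y * Y)) (fun z : X * X => k z.2).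
Proof. by move=> mk; exact: measurableT_comp mk measurable_pr2. Qed.

Lemma conv_abs_intg k f x : pkern k -> sqX f -> intgX (fun y => `|k (x - y) * f y|).
Proof. by move=> pk sf; exact/intg_abs/conv_intg. Qed.

Lemma conv_absE k f x : \int[leb3]_y `|k (x - y) * f y| = conv (fun x => `|k x|) (fun x => `|f x|) x.
Proof. by apply: eqI => y; rewrite normrM. Qed.

(** The factor [wP x] makes the double integral absolutely convergent, so that Fubini gives
    measurability of [wP * conv k f]; the weight is positive and continuous and is divided out. *)
Lemma mfun_conv k f : pkern k -> sqX f -> mfun3 (conv k f).
Proof.
move=> pk sf.
pose F (z : X * X) := wP z.1 * (k (z.1 - z.2) * f z.2).
have mF : measurable_fun (setT : set (Y * Y)) (F : Y * Y -> R).
  apply: measurable_funM; first exact: mfun_pr1 measurable_wP.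
  by apply: measurable_funM; [exact: mfun_sub2 pk.1|exact: mfun_pr2 sf.1].
have hF x : intgX (fun y => F (x, y)) by exact: (intgZ (wP x) (conv_intg x pk sf)).
have [_ i1 _] : [/\ \int[leb3]_x (\int[leb3]_y F (x, y)) = \int[leb3]_y (\int[leb3]_x F (x, y)),
      intgX (fun x => \int[leb3]_y F (x, y)) & intgX (fun y => \int[leb3]_x F (x, y))].
  apply: (fubini_X (g := fun x => (N2X k * N2X f) * wP x) mF hF); last exact/intgZ/intg_wP.
  move=> x; rewrite (_ : (fun y => _) = fun y => wP x * `|k (x - y) * f y|); last first.
    by apply/funext => y; rewrite normrM (ger0_norm (wP_ge0 _)).
  rewrite IZ; last exact: conv_abs_intg.
  rewrite mulrC ler_wpM2r ?wP_ge0// conv_absE; apply: le_trans (ler_norm _) _.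
  by have := conv_le x (pkern_abs pk) (sqi_abs sf); rewrite !N2_abs.
have := measurable_funM (intg_meas i1) (f:=fun x => \int[leb3]_y F (x, y)) (g := fun x => (wP x)^-1).
rewrite (_ : conv k f = (fun x => \int[leb3]_y F (x, y)) \* (fun x => (wP x)^-1)); last first.
  apply/funext => x; rewrite /F /= IZ; last exact: conv_intg.
  by rewrite mulrC mulKf// lt0r_neq0// wP_gt0.
apply.
have c : continuous (fun x => (wP x)^-1).
  move=> x; apply: cvgV; first by rewrite lt0r_neq0// wP_gt0.
  have h (p : X -> R) : continuous p -> continuous (fun x => p1 (p x)).
    by move=> cp y; apply: continuous_comp; [exact: cp|exact: continuous_p1].
  by apply: cvgM; first apply: cvgM; [exact: h continuous_x1 x|exact: h continuous_x2 x|exact: h continuous_x3 x].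
exact: continuous_mfun3 c.
Qed.

(* Cauchy-Schwarz for the weight |k(x - y)|. *)
Lemma young k f : pkern k -> sqX f ->
  sqX (conv k f) /\ N2X (conv k f) <= (\int[leb3]_y `|k y|) * N2X f.
Proof.
move=> pk sf; have ik := intg_abs (pkern_intg pk); have [C C0 hC] := pkern_bounded pk.
set A := \int[leb3]_y `|k y|.
have A0 : 0 <= A by exact: I_ge0.
pose F (z : X * X) := `|k (z.2 - z.1)| * f z.1 ^+ 2.
have mk2 : measurable_fun (setT : set (Y * Y)) (fun z : X * X => k (z.2 - z.1)).
  have := mfun_sub2 (pkern_refl pk).1; congr (measurable_fun _ _).
  by apply/funext => z; rewrite opprB.
have mF : measurable_fun (setT : set (Y * Y)) (F : Y * Y -> R).
  apply: measurable_funM; first exact: measurableT_comp mk2.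
  by apply: measurable_funX; exact: mfun_pr1 sf.1.
have ishift y : intgX (fun x => `|k (x - y)|) by exact: (intg_shift (- y) ik).
have hF y : intgX (fun x => F (y, x)) by exact: (intgZr (f y ^+ 2) (ishift y)).
have IF y : \int[leb3]_x F (y, x) = A * f y ^+ 2.
  rewrite /F /=; have -> : A = \int[leb3]_x `|k (x - y)| by rewrite (I_shift (- y) ik).
    exact: IZr (ishift y).
have [e1 _ i2] : [/\ \int[leb3]_y (\int[leb3]_x F (y, x)) = \int[leb3]_x (\int[leb3]_y F (y, x)),
      intgX (fun y => \int[leb3]_x F (y, x)) & intgX (fun x => \int[leb3]_y F (y, x))].
  apply: (fubini_X (g := fun y => A * f y ^+ 2) mF hF); last exact: intgZ sf.2.
  move=> y; rewrite -IF; apply: Ile => //; first exact: intg_abs.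
  by move=> x; rewrite ger0_norm// mulr_ge0// sqr_ge0.
have ptw x : conv k f x ^+ 2 <= A * \int[leb3]_y F (y, x).
  pose p y := Num.sqrt `|k (x - y)|.
  have mp : mfun3 p.
    apply: measurableT_comp; first exact: continuous_measurable_fun (@sqrt_continuous R).
    by apply: measurableT_comp => //; exact: mfun3_sub x pk.1.
  have sp : sqX p.
    split => //; apply: intg_ext (intg_refl x ik) => y; by rewrite sqr_sqrtr.
  have spf : sqX (fun y => p y * `|f y|).
    apply: sqi_ext (sqiM_bd (C := Num.sqrt C) (sqi_abs sf) mp _); first by move=> y; rewrite mulrC.
    by move=> y; rewrite /p (ger0_norm (sqrtr_ge0 _)); exact: ler_wsqrtr (hC _).
  have h1 : `|conv k f x| <= N2X p * N2X (fun y => p y * `|f y|).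
    apply: le_trans (Iabs (conv_intg x pk sf)) _.
    apply: le_trans (cauchy_schwarz sp spf); apply: le_trans (ler_norm _).
    apply: eq_ler; apply: eqI => y.
    by rewrite mulrA -expr2 sqr_sqrtr// normrM.
  have h2 : `|conv k f x| ^+ 2 <= (N2X p * N2X (fun y => p y * `|f y|)) ^+ 2.
    exact: lerXn2r (normr_ge0 _) (mulr_ge0 (N2_ge0 _ _) (N2_ge0 _ _)) h1.
  rewrite -(real_normK (num_real (conv k f x))); apply: le_trans h2 _.
  rewrite exprMn !N2_sqr; apply: eq_ler; congr (_ * _).
    by rewrite /A -(I_refl x ik); apply: eqI => y; rewrite sqr_sqrtr.
  by apply: eqI => y; rewrite exprMn (sqr_sqrtr (normr_ge0 _)) (real_normK (num_real _)).
have mc := mfun_conv pk sf.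
have ic : intgX (fun x => conv k f x ^+ 2).
  apply: (intg_le (measurable_funX 2 mc) (intgZ A i2)) => x.
  by rewrite ger0_norm ?sqr_ge0.
split; first by split.
have AN := mulr_ge0 A0 (N2_ge0 leb3 f).
rewrite -(@ler_sqr _ (N2X (conv k f)) (A * N2X f) (N2_ge0 _ _) AN) exprMn !N2_sqr.
apply: le_trans (Ile ic (intgZ A i2) ptw) _.
have e2 : \int[leb3]_y (\int[leb3]_x F (y, x)) = A * \int[leb3]_y (f y ^+ 2).
  by rewrite -(IZ A sf.2); apply: eqI => y.
by rewrite (IZ A i2) -e1 e2 mulrA.
Qed.

Lemma sqi_conv k f : pkern k -> sqX f -> sqX (conv k f).
Proof. by move=> pk sf; have [] := young pk sf. Qed.

Lemma N2_conv k f : pkern k -> sqX f ->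
  N2X (conv k f) <= (\int[leb3]_y `|k y|) * N2X f.
Proof. by move=> pk sf; have [] := young pk sf. Qed.

Lemma conv_adjoint k f g : pkern k -> sqX f -> sqX g ->
  \int[leb3]_x (g x * conv k f x) = \int[leb3]_y (f y * conv (fun z => k (- z)) g y).
Proof.
move=> pk sf sg.
pose F (z : X * X) := g z.1 * (k (z.1 - z.2) * f z.2).
have mF : measurable_fun (setT : set (Y * Y)) (F : Y * Y -> R).
  apply: measurable_funM; first exact: mfun_pr1 sg.1.
  by apply: measurable_funM; [exact: mfun_sub2 pk.1|exact: mfun_pr2 sf.1].
have hF x : intgX (fun y => F (x, y)) by exact: (intgZ (g x) (conv_intg x pk sf)).
have [e _ _] : [/\ \int[leb3]_x (\int[leb3]_y F (x, y)) = \int[leb3]_y (\int[leb3]_x F (x, y)),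
      intgX (fun x => \int[leb3]_y F (x, y)) & intgX (fun y => \int[leb3]_x F (x, y))].
  apply: (fubini_X (g := fun x => `|g x| * conv (fun x => `|k x|) (fun x => `|f x|) x) mF hF).
    move=> x; rewrite -conv_absE -IZ; last exact: conv_abs_intg.
    by apply: Ile => [||y]; [exact: intg_abs|exact/intgZ/conv_abs_intg|rewrite /F /= normrM].
  by apply: sqi_mul; [exact: sqi_abs|apply: sqi_conv; [exact: pkern_abs|exact: sqi_abs]].
have -> : \int[leb3]_x (g x * conv k f x) = \int[leb3]_x (\int[leb3]_y F (x, y)).
  by apply: eqI => x; rewrite /F /= IZ//; exact: conv_intg.
rewrite e; apply: eqI => y; rewrite -(IZ (f y) (conv_intg y (pkern_refl pk) sg)).
by apply: eqI => x; rewrite /F opprB; ring.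
Qed.

Lemma conv_assoc a b f x : pkern a -> pkern b -> sqX f ->
  conv a (conv b f) x = conv (conv a b) f x.
Proof.
move=> pa pb sf.
pose F (z : X * X) := a (x - z.1) * (b (z.1 - z.2) * f z.2).
have mF : measurable_fun (setT : set (Y * Y)) (F : Y * Y -> R).
  apply: measurable_funM; first exact: mfun_pr1 (mfun3_sub x pa.1).
  by apply: measurable_funM; [exact: mfun_sub2 pb.1|exact: mfun_pr2 sf.1].
have hF y : intgX (fun z => F (y, z)) by exact: (intgZ (a (x - y)) (conv_intg y pb sf)).
have sab := sqi_conv (pkern_abs pb) (sqi_abs sf).
have [e _ _] : [/\ \int[leb3]_x (\int[leb3]_y F (x, y)) = \int[leb3]_y (\int[leb3]_x F (x, y)),
      intgX (fun x => \int[leb3]_y F (x, y)) & intgX (fun y => \int[leb3]_x F (x, y))].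
  apply: (fubini_X (g := fun y => `|a (x - y)| * conv (fun x => `|b x|) (fun x => `|f x|) y) mF hF).
    move=> y; rewrite -conv_absE -IZ; last exact: conv_abs_intg.
    by apply: Ile => [||z]; [exact: intg_abs|exact/intgZ/conv_abs_intg|rewrite /F /= normrM].
  exact: (conv_intg x (pkern_abs pa) sab).
have -> : conv a (conv b f) x = \int[leb3]_y (\int[leb3]_z F (y, z)).
  by apply: eqI => y; rewrite /F /= IZ//; exact: conv_intg.
rewrite e; apply: eqI => z.
have i1 : intgX (fun y => a (x - z - y) * b y) := conv_intg (x - z) pa (pkern_sqi pb).
have i2 := intg_shift (- z) i1.
rewrite /F /= /conv -(I_shift (- z) i1) -IZr//.
by apply: eqI => y; rewrite opprB addrA subrK; ring.
Qed.

Lemma convDr k f g x : pkern k -> sqX f -> sqX g ->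
  conv k (fun y => f y + g y) x = conv k f x + conv k g x.
Proof.
move=> pk sf sg; rewrite -ID; [|exact: conv_intg|exact: conv_intg].
by apply: eqI => y; rewrite mulrDr.
Qed.

Lemma convBr k f g x : pkern k -> sqX f -> sqX g ->
  conv k (fun y => f y - g y) x = conv k f x - conv k g x.
Proof.
move=> pk sf sg; rewrite -IB; [|exact: conv_intg|exact: conv_intg].
by apply: eqI => y; rewrite mulrBr.
Qed.

Lemma convBl a b f x : pkern a -> pkern b -> sqX f ->
  conv (fun y => a y - b y) f x = conv a f x - conv b f x.
Proof.
move=> pa pb sf; rewrite -IB; [|exact: conv_intg|exact: conv_intg].
by apply: eqI => y; rewrite mulrBl.
Qed.

Lemma convZl k (c : R) f x : pkern k -> sqX f -> conv (fun y => c * k y) f x = c * conv k f x.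
Proof.
by move=> pk sf; rewrite -IZ; [apply: eqI => y; rewrite mulrA|exact: conv_intg].
Qed.

Lemma conv_suml (J : Type) (s : seq J) (K : J -> X -> R) f x :
  (forall j, pkern (K j)) -> sqX f ->
  conv (fun y => \sum_(j <- s) K j y) f x = \sum_(j <- s) conv (K j) f x.
Proof.
move=> pK sf; rewrite -Isum; last by move=> j; exact: conv_intg.
by apply: eqI => y; rewrite mulr_suml.
Qed.

(** By Peetre's inequality, iterated [m >= |v|] times, the shifted kernels with [|t| < 1] are
    dominated by a single multiple of [wP (x - y)], which is integrable against [f]. *)
Lemma D_conv k f x v : schw k -> sqX f ->
  derivable (conv k f) x v /\ 'D_v (conv k f) x = conv ('D_v k) f x.
Proof.
move=> sk sf; have pk := schw_pkern sk; have pD := schw_pkern (schw_D v sk).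
have [C C0 hC] := pD.2.
have [m hm] : exists m : nat, `|v| <= m%:R.
  exists (Num.bound `|v|); apply: ltW; exact: archi_boundP.
have dk y z w : derivable (fun z => k (z - y) * f y) z w /\
    'D_w (fun z => k (z - y) * f y) z = 'D_w k (z - y) * f y.
  have d1 : derivable (fun z => k (z - y)) z w.
    by apply: derivable_shift; exact: smooth_derivable (schw_smooth sk).
  split; first by apply: derivableM; [exact: d1|exact: derivable_cst].
  rewrite (_ : (fun z => _) = fun z => f y * k (z - y)); last by apply/funext => ?; rewrite mulrC.
  by rewrite DZ// D_shift mulrC.
have [|||||h1 h2] := @D_under_integral R X _ _ leb3 (fun x y => k (x - y) * f y) x v
  (fun y => C * 27 ^+ m * (wP (x - y) * `|f y|)).
- by move=> t _; exact: conv_intg.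
- by move=> y z; exact: (dk y z v).1.
- move=> t y t1; rewrite (dk _ _ _).2 normrM mulrA ler_wpM2r//.
  apply: le_trans (hC _) _; rewrite -mulrA ler_pM2l//.
  have -> : x - y = (x + t *: v - y) + - (t *: v) by rewrite addrAC addrK.
  apply: wP_peetre_nat; rewrite normrN normrZ; apply: le_trans _ hm.
  by rewrite ler_piMl// ltW.
- move=> y; apply: mulr_ge0; last by rewrite mulr_ge0// wP_ge0.
  by apply: mulr_ge0; [exact: ltW|exact: exprn_ge0].
- apply: intgZ; apply: conv_intg (sqi_abs sf); split; first exact: measurable_wP.
  by exists 1 => // z; rewrite mul1r ger0_norm// wP_ge0.
split => //; rewrite h2; apply: eqI => y; exact: (dk _ _ _).2.
Qed.

Lemma continuous_conv k f : schw k -> sqX f -> continuous (conv k f).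
Proof.
move=> sk sf; have pk := schw_pkern sk; have [C C0 hC] := schw_lipschitz sk.
have pP : pkern wP.
  split; first exact: measurable_wP.
  by exists 1 => // z; rewrite mul1r ger0_norm// wP_ge0.
pose A := N2X wP * N2X f; pose B := N2X k * N2X f.
have A0 : 0 <= A by rewrite mulr_ge0// N2_ge0.
have B0 : 0 <= B by rewrite mulr_ge0// N2_ge0.
apply: (@lipschitz_continuous _ _ (C * A + 2 * B)).
  by rewrite addr_ge0// mulr_ge0// ltW.
move=> x z; have [z1|z1] := leP `|z| 1; last first.
  apply: le_trans (ler_normB _ _) _.
  have h1 := conv_le (x + z) pk sf; have h2 := conv_le x pk sf.
  apply: (@le_trans _ _ (2 * B)); first by rewrite mulrDl mul1r lerD.
  rewrite -[X in X <= _]mulr1; apply: ler_pM => //; [by rewrite mulr_ge0|by rewrite lerDr mulr_ge0// ltW|exact: ltW].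
have hA : \int[leb3]_y (wP (x - y) * `|f y|) <= A.
  apply: le_trans (ler_norm _) _.
  by have := conv_le x pP (sqi_abs sf); rewrite N2_abs.
have iA := conv_intg x pP (sqi_abs sf).
apply: (@le_trans _ _ (C * `|z| * A)); last first.
  by rewrite mulrAC ler_wpM2r// lerDl mulr_ge0.
apply: le_trans (ler_wpM2l _ hA); last by rewrite mulr_ge0// ltW.
rewrite -(IZ _ iA) -(IB (conv_intg (x + z) pk sf) (conv_intg x pk sf)).
apply: Iabs_le; first by apply: intg_meas; apply: intgB; exact: conv_intg.
  exact: intgZ.
move=> y; rewrite -mulrBl normrM mulrA ler_wpM2r//.
by rewrite addrAC; exact: hC.
Qed.

Lemma smooth_conv k f : schw k -> sqX f -> smooth (conv k f).
Proof.
move=> sk sf.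
apply: (@smooth_coind _ _ (fun h => exists2 k, schw k & h = conv k f)); last by exists k.
- by move=> _ [h sh ->]; exact: continuous_conv.
- by move=> _ [h sh ->] x v; exact: (D_conv x v sh sf).1.
- move=> _ v [h sh ->]; exists ('D_v h); first exact: schw_D.
  by apply/funext => x; exact: (D_conv x v sh sf).2.
Qed.

Lemma DE_conv k f v : schw k -> sqX f -> 'D_v (conv k f) = conv ('D_v k) f.
Proof. by move=> sk sf; apply/funext => x; exact: (D_conv x v sk sf).2. Qed.

Lemma iter_derive_conv l k f : schw k -> sqX f ->
  iter_derive l (conv k f) = conv (iter_derive l k) f.
Proof.
move=> sk sf; elim: l => [//|v l IH] /=; rewrite IH DE_conv//; exact: schw_iter.
Qed.

End Convolution.

(** * Fourier multipliers with even symbols, and Bernstein's inequalities *)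

Section Multipliers.
Context {R : realType}.
Local Notation X := (space3 R).
Local Notation Y := (mspace3 R).
Implicit Types (k f g al be psi : X -> R) (x y z v w xi : X).

Definition c3 : R := ((2 * pi) ^+ 3)^-1.

Lemma c3_gt0 : 0 < c3.
Proof. by rewrite invr_gt0 exprn_gt0// mulr_gt0// pi_gt0. Qed.

(** For an even symbol this is the inverse Fourier transform, the sine part being zero. *)
Definition kern al x : R := c3 * ctr al x.

Lemma schw_kern al : tfun al -> schw (kern al).
Proof. by move=> ta; apply: schwZ; exact: ctr_schw ta. Qed.

Lemma pkern_kern al : tfun al -> pkern (kern al).
Proof. by move=> ta; exact/schw_pkern/schw_kern. Qed.

Lemma kernN al x : kern al (- x) = kern al x.
Proof. by rewrite /kern ctrN. Qed.

Lemma kern_inversion al xi c x : tfun al -> even_fun al ->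
  \int[leb3]_y (kern al (x - y) * cos (dot y xi - c)) = al xi * cos (dot x xi - c).
Proof.
move=> ta ea; have h := fourier_inversion xi c x ta ea.
have i1 := intg_cosdotl (- c) xi (intg_refl x (schw_intg (ctr_schw ta))).
have -> : al xi * cos (dot x xi - c) = c3 * ((2 * pi) ^+ 3 * al xi * cos (dot x xi - c)).
  rewrite -(mulrA _ (al xi)) mulKf// lt0r_neq0// -invr_gt0; exact: c3_gt0.
rewrite -h -IZ//; apply: eqI => y; exact: esym (mulrA _ _ _).
Qed.

(** The second kernel is a superposition of cosines, and each cosine is an eigenfunction of
    convolution with the first, with eigenvalue [al xi], by inversion. *)
Lemma conv_kern al be x : tfun al -> even_fun al -> tfun be ->
  conv (kern al) (kern be) x = kern (fun xi => al xi * be xi) x.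
Proof.
move=> ta ea tb; have pa := pkern_kern ta.
have ib := schw_intg (tfun_schw tb).
pose F (z : X * X) := (kern al (x - z.1) * (c3 * be z.2)) * cos (dot z.1 z.2).
have mF : measurable_fun (setT : set (Y * Y)) (F : Y * Y -> R).
  apply: measurable_funM; first apply: measurable_funM.
  - exact: mfun_pr1 (mfun3_sub x pa.1).
  - by apply: measurable_funM => //; exact: mfun_pr2 (smooth_mfun3 tb.1).
  exact: measurableT_comp (continuous_measurable_fun (@continuous_cos R)) measurable_dot.
have hF y : intgX (fun xi => F (y, xi)).
  apply: intg_ext (intgZ (kern al (x - y) * c3) (intg_cos y ib)) => xi.
  by rewrite /F; ring.
have [e _ _] : [/\ \int[leb3]_y (\int[leb3]_xi F (y, xi)) = \int[leb3]_xi (\int[leb3]_y F (y, xi)),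
      intgX (fun y => \int[leb3]_xi F (y, xi)) & intgX (fun xi => \int[leb3]_y F (y, xi))].
  apply: (fubini_X (g := fun y => `|kern al (x - y)| * (c3 * \int[leb3]_xi `|be xi|)) mF hF).
    move=> y; rewrite mulrA -IZ; last exact: intg_abs.
    apply: Ile; [exact: intg_abs|exact/intgZ/intg_abs|move=> xi].
    rewrite !normrM (ger0_norm (ltW c3_gt0)) mulrA ler_piMr ?cos_max//.
    by rewrite !mulr_ge0// ltW// c3_gt0.
  apply: intgZr; exact: (intg_refl x (intg_abs (pkern_intg pa))).
have -> : conv (kern al) (kern be) x = \int[leb3]_y (\int[leb3]_xi F (y, xi)).
  apply: eqI => y; rewrite mulrA -IZ; last exact: intg_cos.
  by apply: eqI => xi; rewrite /F; ring.
have iab := intg_cos x (schw_intg (tfun_schw (tfunMl tb ta.1))).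
rewrite e (_ : kern (fun xi => al xi * be xi) x = \int[leb3]_xi (c3 * (al xi * be xi * cos (dot x xi)))); last first.
  by rewrite (IZ c3 iab).
apply: eqI => xi.
rewrite (_ : (fun y => _) = fun y => (c3 * be xi) * (kern al (x - y) * cos (dot y xi - 0))); last first.
  by apply/funext => y; rewrite /F subr0; ring.
rewrite IZ; last exact: intg_cosdotl (intg_refl x (pkern_intg pa)).
by rewrite (kern_inversion xi 0 x ta ea) subr0; ring.
Qed.

(** Even symbols have real even kernels, hence give commuting self-adjoint operators. *)
Definition etf al : Prop := tfun al /\ even_fun al.

Lemma etfM al be : etf al -> etf be -> etf (fun xi => al xi * be xi).
Proof.
move=> [ta ea] [tb eb]; split; first by apply: tfunM => //; exact: tb.1.
by move=> xi; rewrite ea eb.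
Qed.

Lemma etfB al be : etf al -> etf be -> etf (fun xi => al xi - be xi).
Proof. by move=> [ta ea] [tb eb]; split; [exact: tfunB|move=> xi; rewrite ea eb]. Qed.

Lemma etfZ (c : R) al : etf al -> etf (fun xi => c * al xi).
Proof. by move=> [ta ea]; split; [exact: tfunZ|move=> xi; rewrite ea]. Qed.

Definition op al f : X -> R := conv (kern al) f.

Lemma op_op al be f : etf al -> etf be -> sqX f ->
  op al (op be f) = op (fun xi => al xi * be xi) f.
Proof.
move=> ha hb sf; apply/funext => x; rewrite /op conv_assoc//; [|exact: pkern_kern ha.1|exact: pkern_kern hb.1].
congr (conv _ f x); apply/funext => y; exact: conv_kern ha.1 ha.2 hb.1.
Qed.

Lemma sqi_op al f : etf al -> sqX f -> sqX (op al f).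
Proof. by move=> ha; apply: sqi_conv; exact: pkern_kern ha.1. Qed.

Lemma op_sym al f g : etf al -> sqX f -> sqX g ->
  \int[leb3]_x (g x * op al f x) = \int[leb3]_x (f x * op al g x).
Proof.
move=> ha sf sg; rewrite (conv_adjoint (pkern_kern ha.1) sf sg).
by rewrite (_ : (fun z => kern al (- z)) = kern al)//; apply/funext => z; exact: kernN.
Qed.

Lemma kernD al be : tfun al -> tfun be ->
  kern (fun xi => al xi + be xi) = fun x => kern al x + kern be x.
Proof.
move=> ta tb; apply/funext => x; rewrite -mulrDr -ID.
- by congr (_ * _); apply: eqI => xi; rewrite mulrDl.
- exact/intg_cos/schw_intg/tfun_schw.
- exact/intg_cos/schw_intg/tfun_schw.
Qed.

Lemma kernZ (c : R) al : tfun al -> kern (fun xi => c * al xi) = fun x => c * kern al x.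
Proof.
move=> ta; have ia := schw_intg (tfun_schw ta).
apply/funext => x; rewrite mulrCA -(IZ c (intg_cos x ia)).
by congr (_ * _); apply: eqI => xi; rewrite mulrA.
Qed.

Lemma kernB al be : tfun al -> tfun be ->
  kern (fun xi => al xi - be xi) = fun x => kern al x - kern be x.
Proof.
move=> ta tb; rewrite (_ : (fun xi => _) = fun xi => al xi + (-1) * be xi); last first.
  by apply/funext => xi; rewrite mulN1r.
rewrite kernD ?kernZ//; last exact: tfunZ.
by apply/funext => x; rewrite mulN1r.
Qed.

Lemma opB al be f x : etf al -> etf be -> sqX f ->
  op (fun xi => al xi - be xi) f x = op al f x - op be f x.
Proof.
move=> ha hb sf; rewrite /op (kernB ha.1 hb.1) convBl//; [exact: pkern_kern ha.1|exact: pkern_kern hb.1].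
Qed.

Lemma opZ (c : R) al f x : etf al -> sqX f ->
  op (fun xi => c * al xi) f x = c * op al f x.
Proof.
by move=> ha sf; rewrite /op (kernZ c ha.1) convZl//; exact: pkern_kern ha.1.
Qed.

Lemma D_kern al v : tfun al ->
  'D_v (kern al) = fun x => - (c3 * str (fun xi => dot v xi * al xi) x).
Proof.
move=> ta; apply/funext => x; have [d e] := D_ctr x v ta.
by rewrite DZ// e mulrN.
Qed.

Lemma DD_kern al v w : tfun al ->
  'D_w ('D_v (kern al)) = fun x => - kern (fun xi => dot w xi * (dot v xi * al xi)) x.
Proof.
move=> ta; rewrite D_kern//; apply/funext => x.
have t2 : tfun (fun xi => dot v xi * al xi) by apply: tfunMl => //; exact: smooth_dotr.
have [d e] := D_str x w t2.
rewrite DN; last by apply: derivableM; [exact: derivable_cst|exact: d].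
by rewrite DZ// e.
Qed.

Lemma dotxx xi : dot xi xi = \sum_(i < 3) dot 'u_i xi * dot 'u_i xi.
Proof. by apply: eq_bigr => i _; rewrite unit_dot. Qed.

Lemma laplacian_kern al x : tfun al ->
  \sum_(i < 3) 'd_i ('d_i (kern al)) x =
  - kern (fun xi => dot xi xi * al xi) x.
Proof.
move=> ta.
have t2 i : tfun (fun xi => dot 'u_i xi * (dot 'u_i xi * al xi)).
  by apply: tfunMl; [apply: tfunMl => //; exact: smooth_dotr|exact: smooth_dotr].
rewrite (eq_bigr (fun i => - kern (fun xi => dot 'u_i xi * (dot 'u_i xi * al xi)) x)); last first.
  by move=> i _; exact: (congr1 (@^~ x) (DD_kern 'u_i 'u_i ta)).
rewrite sumrN; congr (- _); rewrite -mulr_sumr -Isum; last first.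
  by move=> i; apply: intg_cos; apply/schw_intg/tfun_schw.
congr (_ * _); apply: eqI => xi; rewrite dotxx -!mulr_suml; congr (_ * _).
by rewrite mulr_suml; apply: eq_bigr => i _; rewrite mulrA.
Qed.

Definition dil (s : R) psi xi : R := psi (s^-1 *: xi).

Lemma smooth_dil (s : R) psi : smooth psi ->
  (forall x v, 'D_v (fun y => psi (s *: y)) x = s * 'D_v psi (s *: x)) /\
  smooth (fun y => psi (s *: y)).
Proof.
move=> sp; have [||h1 h2] := @smooth_comp_affine R X X psi (fun y => s *: y) 0 sp.
- exact: (@scaler_continuous R X s).
- by move=> x v h; rewrite scalerDr !scalerA mulrC.
rewrite (_ : (fun y => psi (s *: y)) = fun y => psi (s *: y + 0)); last first.
  by apply/funext => y; rewrite addr0.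
split => // x v; rewrite h1 addr0 Dscale// => y w; exact: smooth_derivable.
Qed.

Lemma iter_derive_dil (s : R) psi l : smooth psi ->
  iter_derive l (fun y => psi (s *: y)) = fun y => s ^+ size l * iter_derive l psi (s *: y).
Proof.
move=> sp; elim: l => [|v l IH] /=; first by apply/funext => y; rewrite mul1r.
rewrite IH; apply/funext => x; have [h1 h2] := smooth_dil s (smooth_iter l sp).
by rewrite DZ ?h1 ?exprSr ?mulrA//; exact: smooth_derivable h2.
Qed.

Lemma etf_dil (s : R) psi : 0 < s -> etf psi -> etf (dil s psi).
Proof.
move=> s0 [[sp [M bp]] ep]; split; last by move=> xi; rewrite /dil scalerN.
split; first exact: (smooth_dil s^-1 sp).2.
exists (s * M) => xi /bp; rewrite normrZ gtr0_norm ?invr_gt0// mulrC ler_pdivrMr//.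
lra.
Qed.

Lemma kern_dil (s : R) psi x : 0 < s -> tfun psi ->
  kern (dil s psi) x = s ^+ 3 * kern psi (s *: x).
Proof.
move=> s0 tp; have s1 : s^-1 != 0 by rewrite invr_eq0 lt0r_neq0.
have ic := intg_cos (s *: x) (schw_intg (tfun_schw tp)).
rewrite mulrCA; congr (_ * _); rewrite /ctr -(I_scale s1 ic).
rewrite (ger0_norm (ltW _)) ?invr_gt0// mulrA -exprMn divff ?lt0r_neq0// expr1n mul1r.
apply: eqI => xi; rewrite dotZl dotZr mulrA divff ?mul1r ?lt0r_neq0//.
Qed.

Definition N1 k : R := \int[leb3]_x `|k x|.

Lemma N1_ge0 k : 0 <= N1 k.
Proof. exact: I_ge0. Qed.

Lemma N1_scale (s : R) k : 0 < s -> intgX k -> N1 (fun x => s ^+ 3 * k (s *: x)) = N1 k.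
Proof.
move=> s0 ik; rewrite /N1 -(I_scale (lt0r_neq0 s0) (intg_abs ik)) (gtr0_norm s0) -IZ.
  by apply: eqI => x; rewrite normrM ger0_norm// exprn_ge0// ltW.
exact: intg_scale (lt0r_neq0 s0) (intg_abs ik).
Qed.

Lemma nsq_scale (s : R) k : 0 < s -> sqX k ->
  nsqX (fun x => s ^+ 3 * k (s *: x)) = s ^+ 3 * nsqX k.
Proof.
move=> s0 [_ ik]; rewrite /nsq -(I_scale (lt0r_neq0 s0) ik) (gtr0_norm s0) mulrA -IZ.
  by apply: eqI => x; rewrite exprMn.
exact: intg_scale (lt0r_neq0 s0) ik.
Qed.

Lemma iter_derive_kern_dil (s : R) psi l : 0 < s -> tfun psi ->
  iter_derive l (kern (dil s psi)) =
  fun x => s ^+ size l * (s ^+ 3 * iter_derive l (kern psi) (s *: x)).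
Proof.
move=> s0 tp; have sk := schw_smooth (schw_kern tp).
rewrite (_ : kern (dil s psi) = fun x => s ^+ 3 * kern psi (s *: x)); last first.
  by apply/funext => x; exact: kern_dil.
rewrite (iter_deriveZ l (s ^+ 3) (smooth_dil s sk).2) iter_derive_dil//.
by apply/funext => x; ring.
Qed.

(** Dilating the symbol by [s] preserves the L^1 norm of the kernel, and each derivative brings out
    a factor [s]; the rest is Young's inequality. *)
Lemma bernstein2 (s : R) psi l f : 0 < s -> etf psi -> sqX f ->
  N2X (conv (iter_derive l (kern (dil s psi))) f) <=
  s ^+ size l * N1 (iter_derive l (kern psi)) * N2X f.
Proof.
move=> s0 ep sf; have sk := schw_iter l (schw_kern ep.1).
have sk' := schw_iter l (schw_kern (etf_dil s0 ep).1).
apply: le_trans (N2_conv (schw_pkern sk') sf) _; rewrite ler_wpM2r ?N2_ge0//.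
rewrite -(N1_scale s0 (schw_intg sk)) -IZ.
  apply: eq_ler; apply: eqI => x.
  by rewrite iter_derive_kern_dil ?normrM ?(ger0_norm (exprn_ge0 _ (ltW s0)))//; exact: ep.1.
apply: intg_abs; apply: intgZ; exact: intg_scale (lt0r_neq0 s0) (schw_intg sk).
Qed.

Lemma bernstein_oo (s : R) psi l f M x : 0 < s -> etf psi -> mfun3 f ->
  (forall y, `|f y| <= M) ->
  `|conv (iter_derive l (kern (dil s psi))) f x| <=
  s ^+ size l * N1 (iter_derive l (kern psi)) * M.
Proof.
move=> s0 ep mf bf; have sk := schw_iter l (schw_kern ep.1).
have sk' := schw_iter l (schw_kern (etf_dil s0 ep).1).
have M0 : 0 <= M by apply: le_trans (bf 0).
apply: le_trans (conv_bounded x (schw_pkern sk') mf bf) _; rewrite ler_wpM2r//.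
rewrite -(N1_scale s0 (schw_intg sk)) -IZ.
  apply: eq_ler; apply: eqI => y.
  by rewrite iter_derive_kern_dil ?normrM ?(ger0_norm (exprn_ge0 _ (ltW s0)))//; exact: ep.1.
apply: intg_abs; apply: intgZ; exact: intg_scale (lt0r_neq0 s0) (schw_intg sk).
Qed.

(** From L^2 to the sup norm one pays the L^2 norm of the kernel, which scales like [s ^ (3/2)], the
    square root below. *)
Lemma bernstein_2oo (s : R) psi l f x : 0 < s -> etf psi -> sqX f ->
  `|conv (iter_derive l (kern (dil s psi))) f x| <=
  s ^+ size l * Num.sqrt (s ^+ 3) * N2X (iter_derive l (kern psi)) * N2X f.
Proof.
move=> s0 ep sf; have sk := schw_iter l (schw_kern ep.1).
have sk' := schw_iter l (schw_kern (etf_dil s0 ep).1).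
apply: le_trans (conv_le x (schw_pkern sk') sf) _; rewrite ler_wpM2r ?N2_ge0//.
rewrite iter_derive_kern_dil//; last exact: ep.1.
have ss : sqX (fun x => s ^+ 3 * iter_derive l (kern psi) (s *: x)).
  apply: sqiZ; split; last exact: intg_scale (lt0r_neq0 s0) (schw_sqi sk).2.
  exact: smooth_mfun3 (smooth_dil s (schw_smooth sk)).2.
rewrite (N2Z _ ss) (ger0_norm (exprn_ge0 _ (ltW s0))) -!mulrA.
by rewrite /N2 (nsq_scale s0 (schw_sqi sk)) sqrtrM// exprn_ge0// ltW.
Qed.

End Multipliers.

(** * Division of a symbol by the square of the frequency *)

Section Division.
Context {R : realType}.
Local Notation X := (space3 R).
Implicit Types (f g al be psi : X -> R) (x y z v w xi : X).

Lemma D_inv g x v : smooth g -> (forall y, 0 < g y) ->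
  derivable (fun y => (g y)^-1) x v /\
  'D_v (fun y => (g y)^-1) x = - ((g x)^-1 ^+ 2 * 'D_v g x).
Proof.
move=> sg g0; have d := smooth_derivable g x v sg; have n0 := lt0r_neq0 (g0 x).
split; first exact: derivableV.
by rewrite deriveV// /GRing.scale/= mulNr exprVn.
Qed.

Lemma D_invX g (k : nat) x v : smooth g -> (forall y, 0 < g y) ->
  derivable (fun y => (g y)^-1 ^+ k) x v /\
  'D_v (fun y => (g y)^-1 ^+ k) x = - (k%:R * (g x)^-1 ^+ k.+1 * 'D_v g x).
Proof.
move=> sg g0; have [d1 e1] := D_inv x v sg g0.
elim: k => [|k [d e]].
  by split; [exact: derivable_cst|rewrite (Dcst 1) !mul0r oppr0].
rewrite (_ : (fun y => _) = fun y => (g y)^-1 * (g y)^-1 ^+ k); last first.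
  by apply/funext => y; rewrite exprS.
split; first exact: derivableM d1 d.
rewrite (DM d1 d) e e1 !exprS; ring.
Qed.

(** The quotients [h / g^k] with [h] smooth form a class stable under derivation. *)
Lemma smooth_inv g : smooth g -> (forall y, 0 < g y) -> smooth (fun y => (g y)^-1).
Proof.
move=> sg g0.
have cg : continuous (fun y => (g y)^-1).
  by move=> y; apply: cvgV; [exact: lt0r_neq0|exact: smooth_cont].
apply: (@smooth_coind _ _ (fun f => exists h (k : nat), smooth h /\ f = fun y => h y * (g y)^-1 ^+ k)).
- move=> _ [h [k [sh ->]]] y; apply: cvgM; first exact: smooth_cont.
  exact: cvg_comp _ _ (cg y) (@exprn_continuous R k _).
- move=> _ [h [k [sh ->]]] x v; apply: derivableM; first exact: smooth_derivable.
  exact: (D_invX k x v sg g0).1.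
- move=> _ v [h [k [sh ->]]].
  exists (fun y => 'D_v h y * g y - k%:R * (h y * 'D_v g y)), k.+1; split.
    exact: smoothB (smoothM (smooth_D v sh) sg) (smoothZ k%:R (smoothM sh (smooth_D v sg))).
  apply/funext => x; have [d e] := D_invX k x v sg g0.
  rewrite (DM (smooth_derivable h x v sh) d) e exprS; have := lt0r_neq0 (g0 x).
  move: ('D_v h x) ('D_v g x) (h x) (g x) => a b c q q0; rewrite !exprVn.
  by field; rewrite expf_neq0.
- by exists (fun=> 1), 1%N; split; [exact: smooth_cst|apply/funext => y; rewrite mul1r].
Qed.

Lemma dot_gt0 xi : xi != 0 -> 0 < dot xi xi.
Proof.
move=> x0; rewrite lt_neqAle dotE !addr_ge0 ?sqr_ge0// andbT eq_sym.
apply: contra_neq x0 => /eqP; rewrite !paddr_eq0 ?addr_ge0 ?sqr_ge0// !sqrf_eq0.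
by case: xi => [[a b] c] /= /andP[/andP[/eqP-> /eqP->] /eqP->].
Qed.

Lemma enorm_ge0 xi : 0 <= enorm xi. Proof. exact: sqrtr_ge0. Qed.

Lemma enormZ (s : R) xi : 0 <= s -> enorm (s *: xi) = s * enorm xi.
Proof.
by move=> s0; rewrite /enorm dotZl dotZr mulrA sqrtrM ?sqr_ge0// sqrtr_sqr ger0_norm.
Qed.

Lemma enorm0 : enorm (0 : X) = 0.
Proof. by rewrite /enorm dot0l sqrtr0. Qed.

Lemma enormN xi : enorm (- xi) = enorm xi.
Proof. by rewrite /enorm dotNl dotNr opprK. Qed.

(* [|xi|^2] is replaced by a positive smooth function equal to it on the
   support of [psi]. *)
Lemma division (chi : X -> R) psi (r : R) : lp_cutoff chi -> etf psi -> 0 < r ->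
  (forall xi, enorm xi < r -> psi xi = 0) ->
  exists2 be, etf be & forall xi, dot xi xi * be xi = psi xi.
Proof.
move=> [/test_functionP tchi schi chi0 rad chi1] [tp ep] r0 psi0.
pose q xi := dot xi xi + chi (r^-1 *: xi).
have sq : smooth q.
  apply: smoothD; last exact: (smooth_dil r^-1 tchi.1).2.
  rewrite (_ : (fun xi => _) = fun xi => \sum_(i < 3) dot 'u_i xi * dot 'u_i xi); last first.
    by apply/funext => xi; exact: dotxx.
  by apply: smooth_sum => i; apply: smoothM; exact: smooth_dotr.
have q0 xi : 0 < q xi.
  have [->|x0] := eqVneq xi 0.
    by rewrite /q dot0l add0r scaler0 chi1 ?ltr01// enorm0 invr_ge0.
  by rewrite ltr_wpDr// dot_gt0.
exists (fun xi => psi xi * (q xi)^-1).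
  split; first by apply: tfunM => //; exact: smooth_inv.
  move=> xi; rewrite ep /q dotNl dotNr opprK scalerN; congr (_ * (_ + _)^-1).
  by apply: rad; rewrite enormN.
move=> xi; have [e|e] := ltP (enorm xi) r; first by rewrite psi0// mul0r mulr0.
have c0 : chi (r^-1 *: xi) = 0.
  have [//|c] := eqVneq (chi (r^-1 *: xi)) 0; exfalso; move: e; apply/negP.
  have sc : supp chi (r^-1 *: xi) by apply: subset_closure.
  have /= := schi _ sc.
  by rewrite enormZ ?invr_ge0 ?(ltW r0)// mulrC ltr_pdivrMr// mul1r -ltNge.
rewrite /q c0 addr0 mulrCA.
have [->|x0] := eqVneq xi 0; last by rewrite divff ?mulr1// lt0r_neq0// dot_gt0.
by rewrite psi0 ?mul0r// enorm0.
Qed.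

End Division.

(** * Density of continuous functions in the square-integrable ones *)

Section Density.
Context {R : realType}.
Local Notation X := (space3 R).
Local Notation Y := (mspace3 R).
Implicit Types (f g h k psi : X -> R) (x y z : X) (A B : set X).

Lemma nsq_dct (F : nat -> X -> R) g : (forall n, mfun3 (F n)) -> sqX g ->
  (forall x, F n x @[n --> \oo] --> (0 : R)) -> (forall n x, `|F n x| <= `|g x|) ->
  nsqX (F n) @[n --> \oo] --> (0 : R).
Proof.
move=> mF [mg ig] F0 Fg.
have c x : F n x ^+ 2 @[n --> \oo] --> 0.
  rewrite -(mul0r 0) (_ : (fun n => F n x ^+ 2) = fun n => F n x * F n x); first exact: cvgM.
  by [].
have le n x : `|F n x ^+ 2| <= g x ^+ 2.
  rewrite normrX -(real_normK (num_real (g x))).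
  exact: lerXn2r (normr_ge0 _) (normr_ge0 _) (Fg n x).
have := proj2 (@Idct _ _ R leb3 (fun n x => F n x ^+ 2) (fun=> 0) (fun x => g x ^+ 2)
  (fun n => measurable_funX 2 (mF n)) ig c le).
by rewrite I0.
Qed.

Lemma N2_dct (F : nat -> X -> R) g : (forall n, mfun3 (F n)) -> sqX g ->
  (forall x, F n x @[n --> \oo] --> (0 : R)) -> (forall n x, `|F n x| <= `|g x|) ->
  N2X (F n) @[n --> \oo] --> (0 : R).
Proof.
move=> mF sg F0 Fg; have c := nsq_dct mF sg F0 Fg.
have := cvg_comp _ _ c (@sqrt_continuous R 0); rewrite sqrtr0; exact.
Qed.

(** On this class frequency truncations converge at every point, with a uniform bound; integrability
    then supplies the majorants in [Sop_cbi] and [low_frequency_lim]. *)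
Definition cbi g : Prop := [/\ continuous g, intgX g & exists C : R, forall x, `|g x| <= C].

Lemma cbi_sqi g : cbi g -> sqX g.
Proof.
move=> [cg ig [C hC]]; split; first exact: continuous_mfun3.
exact: intgM_bd ig (continuous_mfun3 cg) hC.
Qed.

Definition cdense f : Prop := sqX f /\
  forall e : R, 0 < e -> exists2 g, cbi g & N2X (fun x => f x - g x) <= e.

Lemma cdense_lim f : sqX f ->
  (forall e : R, 0 < e -> exists2 g, cdense g & N2X (fun x => f x - g x) <= e) -> cdense f.
Proof.
move=> sf h; split => // e e0; have e2 : 0 < e / 2 by rewrite divr_gt0.
have [g [sg hg] fg] := h _ e2; have [g' cg gg] := hg _ e2; exists g' => //.
have sg' := cbi_sqi cg.
rewrite (_ : (fun x => _) = fun x => (f x - g x) + (g x - g' x)); last first.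
  by apply/funext => x; rewrite addrA subrK.
apply: le_trans (N2D (sqiB sf sg) (sqiB sg sg')) _.
lra.
Qed.

Lemma cdenseD f g : cdense f -> cdense g -> cdense (fun x => f x + g x).
Proof.
move=> [sf hf] [sg hg]; split; first exact: sqiD.
move=> e e0; have e2 : 0 < e / 2 by rewrite divr_gt0.
have [f' cf ff] := hf _ e2; have [g' cg gg] := hg _ e2.
have sf' := cbi_sqi cf; have sg' := cbi_sqi cg.
exists (fun x => f' x + g' x).
  case: cf cg => [c1 i1 [C1 b1]] [c2 i2 [C2 b2]]; split.
  - by move=> x; apply: cvgD; [exact: c1|exact: c2].
  - exact: intgD.
  - by exists (C1 + C2) => x; apply: le_trans (ler_normD _ _) _; exact: lerD.
rewrite (_ : (fun x => _) = fun x => (f x - f' x) + (g x - g' x)); last first.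
  by apply/funext => x; rewrite opprD addrACA.
apply: le_trans (N2D (sqiB sf sf') (sqiB sg sg')) _.
lra.
Qed.

Lemma cdenseMb f h : cdense f -> continuous h -> (exists C : R, forall x, `|h x| <= C) ->
  cdense (fun x => f x * h x).
Proof.
move=> [sf hf] ch [C hC]; have mh := continuous_mfun3 ch.
have C0 : 0 <= C by apply: le_trans (hC 0).
have C1 : 0 < C + 1 by rewrite ltr_wpDl.
split; first exact: sqiM_bd sf mh hC.
move=> e e0; have [f' cf ff] := hf _ (divr_gt0 e0 C1); have sf' := cbi_sqi cf.
exists (fun x => f' x * h x).
  case: cf => [c1 i1 [D b1]]; split.
  - by move=> x; apply: cvgM; [exact: c1|exact: ch].
  - exact: intgM_bd i1 mh hC.
  - by exists (D * C) => x; rewrite normrM; apply: ler_pM.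
rewrite (_ : (fun x => _) = fun x => (f x - f' x) * h x); last first.
  by apply/funext => x; rewrite mulrBl.
apply: le_trans (N2_mulbd (sqiB sf sf') mh C0 hC) _.
rewrite mulrC; apply: (@le_trans _ _ (e / (C + 1) * (C + 1))); last by rewrite divfK// lt0r_neq0.
by apply: ler_pM => //; [exact: N2_ge0|rewrite lerDl].
Qed.

Lemma cdenseZ f (c : R) : cdense f -> cdense (fun x => f x * c).
Proof.
move=> hf; apply: (@cdenseMb f (fun=> c)) => //; first exact: cst_continuous.
by exists `|c|.
Qed.

Lemma cdense_dct f (F : nat -> X -> R) g : sqX f -> (forall n, cdense (F n)) -> sqX g ->
  (forall x, F n x @[n --> \oo] --> f x) -> (forall n x, `|f x - F n x| <= `|g x|) -> cdense f.
Proof.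
move=> sf hF sg F0 Fg; apply: cdense_lim => // e e0.
have c : N2X (fun x => f x - F n x) @[n --> \oo] --> 0.
  apply: (@N2_dct (fun n x => f x - F n x) g) => //.
    by move=> n; apply: measurable_funB; [exact: sf.1|exact: (hF n).1.1].
  by move=> x; rewrite -(subrr (f x)); apply: cvgB; [exact: cvg_cst|exact: F0].
have [n hn] : exists n, N2X (fun x => f x - F n x) <= e.
  move/cvgrPdist_le : c => /(_ _ e0) [n _ /(_ n (leqnn n))].
  by rewrite sub0r normrN ger0_norm ?N2_ge0//; exists n.
by exists (F n).
Qed.

(* The measurable sets whose indicators are multipliers of the closure of the
   continuous functions form a sigma-algebra. *)
Definition multset A : Prop := measurable (A : set Y) /\
  forall f, cdense f -> cdense (fun x => f x * \1_A x).

Lemma multset_sigma : sigma_algebra setT multset.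
Proof.
split.
- split => // f hf; apply: (@cdenseMb f (fun x => \1_set0 x)) => //.
    by rewrite indic0; exact: cst_continuous.
  by exists 0 => x; rewrite indic0 normr0.
- move=> A [mA hA]; rewrite setTD; split; first exact: measurableC.
  move=> f hf; have h := cdenseD hf (cdenseZ (-1) (hA _ hf)).
  apply: (eq_rect _ cdense h); apply/funext => x.
  by rewrite !indicE in_setC; case: (x \in A) => /=; ring.
- move=> A hA.
  have hU n : multset (\bigcup_(i < n) A i).
    elim: n => [|n [mn hn]].
      rewrite bigcup_mkord big_ord0; split => // f hf; apply: (@cdenseMb f (fun x => \1_set0 x)) => //.
        by rewrite indic0; exact: cst_continuous.
      by exists 0 => x; rewrite indic0 normr0.
    have [mA An] := hA n; rewrite bigcup_mkord big_ord_recr -bigcup_mkord.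
    split; first exact: measurableU.
    move=> f hf; have h1 := hn _ hf; have h2 := An _ hf; have h3 := cdenseZ (-1) (An _ h1).
    apply: (eq_rect _ cdense (cdenseD (cdenseD h1 h2) h3)); apply/funext => x.
    rewrite !indicE in_setU; case: (x \in _) => /=; ring.
  have mU : measurable (\bigcup_n A n : set Y) by apply: bigcupT_measurable => n; exact: (hA n).1.
  split => // f hf.
  apply: (@cdense_dct _ (fun n x => f x * \1_(\bigcup_(i < n) A i) x) f).
  + apply: (sqiM_bd hf.1); first exact: measurable_indic.
    by move=> x; rewrite indicE; case: (x \in _); rewrite ?normr1 ?normr0.
  + by move=> n; exact: (hU n).2.
  + exact: hf.1.
  + move=> x; apply: cvgM; first exact: cvg_cst.
    have [[n _ An]|nx] := pselect ((\bigcup_n A n) x).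
      rewrite [X in _ --> X]indicE mem_set; last by exists n.
      apply: cvg_near_cst; exists n.+1 => // m nm.
      by rewrite indicE mem_set//; exists n.
    rewrite [X in _ --> X]indicE memNset//; apply: cvg_near_cst; exists 0%N => // m _.
    by rewrite indicE memNset// => -[i _ Ai]; apply: nx; exists i.
  + move=> n x; rewrite -mulrBr normrM ler_piMr// !indicE.
    by case: (x \in _); case: (x \in _); rewrite ?subrr ?subr0 ?sub0r ?normrN ?normr1 ?normr0.
Qed.

(** The indicator is the pointwise limit of the continuous ramps [r n], equal to 0 where [p <= a]
    and to 1 where [p >= a + 1/n]. *)
Lemma multset_gt (p : X -> R) (a : R) : continuous p -> multset [set x | a < p x].
Proof.
move=> cp; have mp := continuous_mfun3 cp.
have mA : measurable ([set x | a < p x] : set Y).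
  rewrite (_ : [set x | a < p x] = setT `&` p @^-1` `]a, +oo[%classic); first by apply: mp.
  by apply/seteqP; split => x /=; rewrite in_itv/= andbT; [move=> h|case].
split => // f hf.
pose r n x : R := Num.min 1 (Num.max 0 (n%:R * (p x - a))).
have r0 n x : 0 <= r n x by rewrite le_min ler01 le_max lexx.
have r1 n x : r n x <= 1 by rewrite ge_min lexx.
apply: (@cdense_dct _ (fun n x => f x * r n x) f).
- apply: (sqiM_bd hf.1); first exact: measurable_indic.
  by move=> x; rewrite indicE; case: (x \in _); rewrite ?normr1 ?normr0.
- move=> n; apply: cdenseMb => //; last by exists 1 => x; rewrite ger0_norm.
  have ct : continuous (fun x => n%:R * (p x - a)).
    by move=> x; apply: cvgM; [exact: cvg_cst|apply: cvgB; [exact: cp|exact: cvg_cst]].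
  have c0 (c : R) : continuous (fun _ : X => c) by move=> x; exact: cvg_cst.
  exact: (fun x => continuous_min (c0 1 x) (continuous_max (c0 0 x) (ct x))).
- exact: hf.1.
- move=> x; apply: cvgM; first exact: cvg_cst.
  have [ax|ax] := ltP a (p x).
    rewrite indicE mem_set//; apply: cvg_near_cst.
    exists (Num.bound (p x - a)^-1) => // n hn.
    have d0 : 0 < p x - a by rewrite subr_gt0.
    have hn1 : 1 <= n%:R * (p x - a).
      rewrite -ler_pdivrMr// mul1r; apply: ltW; apply: lt_le_trans (archi_boundP _) _.
        by rewrite invr_ge0 ltW.
      by rewrite ler_nat.
    by rewrite /r max_r ?min_l// (le_trans _ hn1).
  rewrite indicE memNset; last by apply/negP; rewrite -leNgt.
  apply: cvg_near_cst; exists 0%N => // n _.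
  by rewrite /r max_l ?min_r// mulr_ge0_le0// subr_le0.
- move=> n x; rewrite -mulrBr normrM ler_piMr// indicE.
  case: (x \in _); rewrite ?sub0r ?normrN.
    by rewrite ger0_norm ?subr_ge0// lerBlDr lerDl.
  by rewrite ger0_norm.
Qed.

Lemma multsetI A B : multset A -> multset B -> multset (A `&` B).
Proof.
move=> [mA hA] [mB hB]; split; first exact: measurableI.
move=> f hf; apply: (eq_rect _ cdense (hB _ (hA _ hf))); apply/funext => x.
by rewrite !indicE in_setI; case: (x \in A) => /=; ring.
Qed.

(** The half-spaces of [multset_gt] for the three coordinates generate the product sigma-algebra;
    the argument lifts from one coordinate to two and to three through rectangles. *)
Lemma multset_all A : measurable (A : set Y) -> multset A.
Proof.
have pre (T : Type) (p : X -> T) : sigma_algebra setT [set B | multset (p @^-1` B)].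
  have [h0 hC hU] := multset_sigma; split => /=.
  - by [].
  - by move=> B hB; exact: hC.
  - by move=> F hF; exact: hU.
have base (p : X -> R) (B : set (measurableTypeR R)) : continuous p -> measurable B -> multset (p @^-1` B).
  move=> cp mB; have {mB} : (@RGenOInfty.G R).-sigma.-measurable B by rewrite -RGenOInfty.measurableE.
  apply: (smallest_sub (pre _ p)) => _ [a ->]; rewrite /=.
  rewrite (_ : p @^-1` _ = [set x | a < p x]); first exact: multset_gt.
  by apply/seteqP; split => x /=; rewrite in_itv/= andbT.
have base2 (B : set (measurableTypeR R * measurableTypeR R)) : measurable B -> multset ((fun x => x.1) @^-1` B).
  rewrite measurable_prod_measurableType; apply: (smallest_sub (pre _ _)).
  move=> _ [B1 m1 [B2 m2 <-]].
  exact: multsetI (base _ _ continuous_x1 m1) (base _ _ continuous_x2 m2).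
rewrite measurable_prod_measurableType; apply: (smallest_sub multset_sigma).
move=> _ [B1 m1 [B2 m2 <-]].
exact: multsetI (base2 _ m1) (base _ _ continuous_x3 m2).
Qed.

Lemma cbi_wP : cbi (@wP R).
Proof.
have h (p : X -> R) : continuous p -> continuous (fun x => p1 (p x)).
  by move=> cp y; apply: continuous_comp; [exact: cp|exact: continuous_p1].
split; last by exists 1 => x; rewrite ger0_norm ?wP_ge0// wP_le1.
  by move=> x; apply: cvgM; first apply: cvgM; [exact: h continuous_x1 x|exact: h continuous_x2 x|exact: h continuous_x3 x].
exact: intg_wP.
Qed.

Lemma cdense_wP : cdense (@wP R).
Proof.
split; first exact: cbi_sqi cbi_wP.
exists wP; first exact: cbi_wP.
rewrite (_ : (fun x => _) = fun=> 0); last by apply/funext => x; rewrite subrr.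
by rewrite /N2 /nsq (_ : (fun x => _) = fun=> 0) ?I0 ?sqrtr0 ?ltW//; rewrite expr0n.
Qed.

(* Binary expansion of [q]. *)
Lemma cdense_unit q : mfun3 q -> (forall x, 0 <= q x <= 1) -> cdense (fun x => wP x * q x).
Proof.
move=> mq q01.
have [s hs] : exists s : nat -> X -> R, forall n, [/\ mfun3 (s n), cdense (fun x => wP x * s n x) &
    forall x, 0 <= q x - s n x <= 2^-1 ^+ n].
  suff st n (s : X -> R) : [/\ mfun3 s, cdense (fun x => wP x * s x) & forall x, 0 <= q x - s x <= 2^-1 ^+ n] ->
    exists s' : X -> R, [/\ mfun3 s', cdense (fun x => wP x * s' x) & forall x, 0 <= q x - s' x <= 2^-1 ^+ n.+1].
    have h0 : [/\ mfun3 (fun _ => 0 : R), cdense (fun x => wP x * 0) &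
        forall x, 0 <= q x - 0 <= 2^-1 ^+ 0].
      split; [exact: measurable_cst|exact: cdenseZ 0 cdense_wP|by move=> x; rewrite subr0].
    pose T n := {s : X -> R | [/\ mfun3 s, cdense (fun x => wP x * s x) & forall x, 0 <= q x - s x <= 2^-1 ^+ n]}.
    pose F := fix F n : T n := match n with
      | 0%N => exist _ (fun _ => 0 : R) h0
      | n.+1 => let: exist s h := F n in let c := cid (st n s h) in exist _ (projT1 c) (projT2 c) end.
    by exists (fun n => sval (F n)) => n; exact: svalP (F n).
  move=> [ms cs hs].
  pose A := [set x | 2^-1 ^+ n.+1 < q x - s x].
  have mA : measurable (A : set Y).
    rewrite (_ : A = setT `&` (fun x => q x - s x) @^-1` `]2^-1 ^+ n.+1, +oo[%classic).
      by apply: measurable_funB.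
    by apply/seteqP; split => x /=; rewrite in_itv/= andbT; [move=> h|case].
  exists (fun x => s x + 2^-1 ^+ n.+1 * \1_A x); split.
  - apply: measurable_funD => //; apply: measurable_funM => //.
  - have [_ hA] := multset_all mA.
    apply: (eq_rect _ cdense (cdenseD cs (cdenseZ (2^-1 ^+ n.+1) (hA _ cdense_wP)))).
    by apply/funext => x; ring.
  - move=> x; have /andP[h1 h2] := hs x; rewrite indicE.
    have e : 2^-1 ^+ n = 2^-1 ^+ n.+1 + 2^-1 ^+ n.+1 :> R.
      by rewrite exprS; field.
    have [xA|xA] := pselect (A x).
      rewrite mem_set//; move: xA; rewrite /A /= => xA.
      lra.
    rewrite memNset// mulr0 addr0 h1; by rewrite leNgt; apply/negP.
apply: (@cdense_dct _ (fun n x => wP x * s n x) wP).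
- apply: (sqiM_bd (C := 1) (cbi_sqi cbi_wP)) => //.
  by move=> x; have /andP[h1 h2] := q01 x; rewrite ger0_norm.
- by move=> n; have [] := hs n.
- exact: cbi_sqi cbi_wP.
- move=> x; apply: cvgM; first exact: cvg_cst.
  have c : q x - s n x @[n --> \oo] --> 0.
    apply: (@squeeze_cvgr _ _ _ _ (fun=> 0) (fun n => 2^-1 ^+ n)).
    + by apply: nearW => n; have [_ _ /(_ x)] := hs n.
    + exact: cvg_cst.
    + apply: cvg_expr; rewrite ger0_norm; lra.
  rewrite -[X in _ --> X]subr0 (_ : (fun n => s n x) = fun n => q x - (q x - s n x)).
    by apply: cvgB; [exact: cvg_cst|exact: c].
  by apply/funext => n; rewrite subKr.
- move=> n x; rewrite -mulrBr normrM ler_piMr// ger0_norm; have [_ _ /(_ x)/andP[h1 h2]] := hs n => //.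
  by apply: le_trans h2 _; rewrite exprn_ile1; lra.
Qed.

(** Truncation of [f] between [-(n+1) wP] and [(n+1) wP] is eventually equal to [f] at each point,
    and it is a combination of [wP] and of [wP q] with [0 <= q <= 1]. *)
Lemma cdense_all f : sqX f -> cdense f.
Proof.
move=> sf.
pose g n x := Num.max (- n.+1%:R * wP x) (Num.min (n.+1%:R * wP x) (f x)).
have mw := @measurable_wP R.
have mg n : mfun3 (g n).
  apply: measurable_maxr; first exact: measurable_funM.
  apply: measurable_minr; [exact: measurable_funM|exact: sf.1].
have gb n x : `|g n x| <= n.+1%:R * wP x.
  have p : 0 <= n.+1%:R * wP x :> R by rewrite mulr_ge0// wP_ge0.
  rewrite ler_norml -mulNr /g le_max lexx /= ge_max ge_min lexx /= andbT.
  lra.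
have gf n x : `|f x - g n x| <= `|f x|.
  have p : 0 <= n.+1%:R * wP x :> R by rewrite mulr_ge0// wP_ge0.
  rewrite /g mulNr; move: (n.+1%:R * wP x) p (f x) => a a0 t; clear -a0.
  rewrite /Num.max /Num.min.
  case: (ltP a t) => h1; case: ltP => h2; rewrite ?subrr ?normr0// ?ler_norml; case: (ler0P t) => h3; apply/andP; split; lra.
apply: (@cdense_dct _ g f) => //.
- move=> n; pose q x := (g n x / (n.+1%:R * wP x) + 1) / 2.
  have p x : 0 < n.+1%:R * wP x :> R by rewrite mulr_gt0// wP_gt0.
  have cq : cdense (fun x => wP x * q x).
    apply: cdense_unit.
      apply: measurable_funM => //; apply: measurable_funD => //.
      have c : continuous (fun x => (n.+1%:R * wP x)^-1).
        move=> x; apply: cvgV; first by rewrite lt0r_neq0.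
        by apply: cvgM; [exact: cvg_cst|case: cbi_wP => + _ _; exact].
      by apply: measurable_funM; [exact: mg|exact: continuous_mfun3 c].
    move=> x; have := gb n x; rewrite ler_norml /q => /andP[h1 h2].
    have l1 : -1 <= g n x / (n.+1%:R * wP x) by rewrite ler_pdivlMr// mulN1r.
    have l2 : g n x / (n.+1%:R * wP x) <= 1 by rewrite ler_pdivrMr// mul1r.
    by move: (g n x / _) l1 l2 => t l1 l2; lra.
  have h := cdenseD (cdenseZ (2 * n.+1%:R) cq) (cdenseZ (- n.+1%:R) cdense_wP).
  apply: (eq_rect _ cdense h); apply/funext => x.
  rewrite /q; have := lt0r_neq0 (wP_gt0 x).
  have : n.+1%:R != 0 :> R by rewrite pnatr_eq0.
  move: (n.+1%:R) (wP x) (g n x) => a b c a0 b0; by field; rewrite b0.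
- move=> x; apply: cvg_near_cst; exists (Num.bound (`|f x| / wP x)) => // n hn.
  have h : `|f x| <= n.+1%:R * wP x.
    rewrite -ler_pdivrMr ?wP_gt0//; apply: ltW; apply: lt_le_trans (archi_boundP _) _.
      by rewrite divr_ge0// wP_ge0.
    by rewrite ler_nat; apply: leqW.
  rewrite /g mulNr; move: h; rewrite ler_norml => /andP[h1 h2].
  by rewrite min_r// max_r.
Qed.

End Density.

Lemma lim_eq {R : realType} (u v : nat -> R) (a b : R) : (forall n, u n = v n) ->
  u n @[n --> \oo] --> a -> v n @[n --> \oo] --> b -> a = b.
Proof. by move=> /funext <- h1 h2; exact: (cvg_unique (@norm_hausdorff _ _) h1 h2). Qed.

Lemma cvg0_le {R : realType} (u : nat -> R) (e : R) : u n @[n --> \oo] --> (0 : R) -> 0 < e ->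
  exists N, forall n, (N <= n)%N -> `|u n| <= e.
Proof.
move=> c e0; move/cvgrPdist_le : c => /(_ _ e0) [N _ hN]; exists N => n /hN.
by rewrite sub0r normrN.
Qed.

Lemma le_cvg0 {R : realType} (u : nat -> R) :
  (forall e : R, 0 < e -> exists N, forall n, (N <= n)%N -> `|u n| <= e) -> u n @[n --> \oo] --> (0 : R).
Proof.
move=> h; apply/cvgrPdist_le => e e0; have [N hN] := h e e0; exists N => // n /hN.
by rewrite sub0r normrN.
Qed.

Section SquareIntegrable.
Context {R : realType}.
Local Notation X := (space3 R).
Implicit Types (f g : X -> R) (u : vfield R).

Lemma Lnorm2E f : sqX f -> ('N[leb3]_2%:E[EFin \o f] = (N2X f)%:E)%E.
Proof.
move=> [mf iF]; rewrite unlock.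
have -> : (\int[leb3]_x (`|(EFin \o f) x| `^ 2) = (nsqX f)%:E)%E.
  rewrite EFinI//; apply: eq_integral => x _ /=.
  by rewrite powR_mulrn// real_normK// num_real.
by rewrite poweR_EFin powR12_sqrt//; exact: nsq_ge0.
Qed.

Lemma sqi_L2 f : L2 f <-> sqX f.
Proof.
split.
  move=> h; split; last exact: Lfun2_integrable_sqr h.
  by move: h; rewrite /L2 => /andP[/[!inE]/= h _].
move=> sf; apply/andP; split; rewrite inE /=; first exact: sf.1.
by rewrite /finite_norm Lnorm2E// ltry.
Qed.

End SquareIntegrable.

(** * Smooth functions with bounded and square-integrable derivatives *)

Section Regular.
Context {R : realType}.
Local Notation X := (space3 R).
Local Notation Y := (mspace3 R).
Implicit Types (f g h k psi B : X -> R) (x y z v : X).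

Lemma iter_derive_local {W : normedModType R} l (f g : W -> R) (U : set W) : open U ->
  (forall y : W, U y -> f y = g y) -> forall y : W, U y -> iter_derive l f y = iter_derive l g y.
Proof.
move=> oU fg; elim: l => [|v l IH] y Uy; first exact: fg.
apply: near_eq_derive; have : \near y, U y by exact: open_nbhs_nbhs.
by apply: filterS => z; exact: IH.
Qed.

(* The constant depends on the first factor only through bounds for its
   derivatives. *)
Lemma leibniz_bound l (K : seq X -> R) : exists (C : R) (ls : seq (seq X)), 0 <= C /\
  forall f B, smooth f -> smooth B -> (forall m x, `|iter_derive m f x| <= K m) ->
  forall x, `|iter_derive l (fun y => f y * B y) x| <= C * \sum_(m <- ls) `|iter_derive m B x|.
Proof.
elim/last_ind: l K => [|l v IH] K.
  exists `|K [::]|, [:: [::]]; split => // f B sf sB hK x; rewrite big_seq1 normrM ler_wpM2r//.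
  exact: le_trans (hK [::] x) (ler_norm _).
have [C1 [l1 [C10 h1]]] := IH (fun m => K (rcons m v)); have [C2 [l2 [C20 h2]]] := IH K.
exists (C1 + C2), (l1 ++ [seq rcons m v | m <- l2]); split; first exact: addr_ge0.
move=> f B sf sB hK x; rewrite iter_derive_rcons.
have -> : 'D_v (fun y => f y * B y) = fun y => 'D_v f y * B y + f y * 'D_v B y.
  by apply/funext => y; rewrite DM//; exact: smooth_derivable.
rewrite iter_deriveD; [|exact: smoothM (smooth_D v sf) sB|exact: smoothM sf (smooth_D v sB)].
apply: le_trans (ler_normD _ _) _; rewrite mulrDl; apply: lerD.
  apply: le_trans (h1 _ _ (smooth_D v sf) sB _ x) _.
    by move=> m y; rewrite -iter_derive_rcons.
  rewrite ler_wpM2l// big_cat/= lerDl; apply: sumr_ge0 => *; exact: normr_ge0.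
apply: le_trans (h2 _ _ sf (smooth_D v sB) hK x) _.
rewrite ler_wpM2l// big_cat/= big_map -[leLHS]add0r lerD//.
  by apply: sumr_ge0 => *.
by under [leRHS]eq_bigr do rewrite iter_derive_rcons.
Qed.

(** The enlarged class of test functions. It contains [op al f] for [f] in L^2, which has no compact
    support, and it is stable under products. *)
Definition reg B : Prop := smooth B /\ forall l, sqX (iter_derive l B) /\
  exists C : R, forall x, `|iter_derive l B x| <= C.

Lemma reg_smooth B : reg B -> smooth B. Proof. by case. Qed.

Lemma reg_sqi B : reg B -> sqX B. Proof. by move=> [_ /(_ [::])[]]. Qed.

Lemma reg_bounded B : reg B -> exists C : R, forall x, `|B x| <= C.
Proof. by move=> [_ /(_ [::])[]]. Qed.

Lemma reg_iter l B : reg B -> reg (iter_derive l B).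
Proof.
move=> [sB hB]; split; first exact: smooth_iter.
by move=> m; have := hB (m ++ l); rewrite iter_derive_cat.
Qed.

Lemma reg_D v B : reg B -> reg ('D_v B).
Proof. exact: (@reg_iter [:: v]). Qed.

Lemma regD f g : reg f -> reg g -> reg (fun x => f x + g x).
Proof.
move=> [sf hf] [sg hg]; split; first exact: smoothD.
move=> l; rewrite iter_deriveD//; have [s1 [C1 b1]] := hf l; have [s2 [C2 b2]] := hg l.
split; first exact: sqiD.
by exists (C1 + C2) => x; apply: le_trans (ler_normD _ _) _; apply: lerD.
Qed.

Lemma regZ (c : R) f : reg f -> reg (fun x => c * f x).
Proof.
move=> [sf hf]; split; first exact: smoothZ.
move=> l; rewrite iter_deriveZ//; have [s1 [C1 b1]] := hf l.
split; first exact: sqiZ.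
by exists (`|c| * C1) => x; rewrite normrM ler_wpM2l.
Qed.

Lemma cvg_sumr (J : Type) (s : seq J) (T : Type) (FF : set_system T) (HF : Filter FF)
    (F : J -> T -> R) (l : J -> R) :
  (forall j, F j t @[t --> FF] --> l j) -> \sum_(j <- s) F j t @[t --> FF] --> \sum_(j <- s) l j.
Proof.
move=> h; elim: s => [|j s IH].
  rewrite big_nil (_ : (fun t => _) = fun=> 0); first exact: cvg_cst.
  by apply/funext => t; rewrite big_nil.
rewrite big_cons (_ : (fun t => _) = fun t => F j t + \sum_(j <- s) F j t); first exact: cvgD (h j) IH.
by apply/funext => t; rewrite big_cons.
Qed.

Lemma bounds_exist B (P : seq X -> R -> Prop) : (forall l, exists C : R, P l C) ->
  exists K : seq X -> R, forall l, P l (K l).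
Proof. by move=> h; exists (fun l => projT1 (cid (h l))) => l; exact: projT2 (cid (h l)). Qed.

Lemma sqi_sum_abs (s : seq (seq X)) B (C : R) : reg B ->
  sqX (fun x => C * \sum_(m <- s) `|iter_derive m B x|).
Proof.
by move=> [_ hB]; apply/sqiZ/sqi_sum => m; apply: sqi_abs; have [] := hB m.
Qed.

Lemma bounded_sum_abs (s : seq (seq X)) B (C : R) : 0 <= C -> reg B ->
  exists D : R, forall x, C * \sum_(m <- s) `|iter_derive m B x| <= D.
Proof.
move=> C0 [_ hB]; elim: s => [|m s [D hD]].
  by exists 0 => x; rewrite big_nil mulr0.
have [_ [E hE]] := hB m; exists (C * E + D) => x.
by rewrite big_cons mulrDr lerD// ler_wpM2l.
Qed.

Lemma regM f g : reg f -> reg g -> reg (fun x => f x * g x).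
Proof.
move=> rf rg; split; first exact: smoothM (reg_smooth rf) (reg_smooth rg).
have [K hK] := bounds_exist f (fun l => (rf.2 l).2).
move=> l; have [C [ls [C0 h]]] := leibniz_bound l K.
have {}h := h f g (reg_smooth rf) (reg_smooth rg) hK.
have [D hD] := bounded_sum_abs ls C0 rg.
split; last by exists D => x; apply: le_trans (h x) _.
have sm := smoothM (reg_smooth rf) (reg_smooth rg).
apply: (sqi_le (smooth_mfun3 (smooth_iter l sm)) (sqi_sum_abs ls C rg)) => x.
exact: le_trans (h x) (ler_norm _).
Qed.

Lemma schw_reg k : schw k -> reg k.
Proof.
move=> sk; split; first exact: schw_smooth.
move=> l; have sl := schw_iter l sk; split; first exact: schw_sqi.
have [C _ hC] := pkern_bounded (schw_pkern sl); by exists C.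
Qed.

Lemma reg_sum (J : Type) (s : seq J) (F : J -> X -> R) : (forall j, reg (F j)) ->
  reg (fun x => \sum_(j <- s) F j x).
Proof.
move=> hF; elim: s => [|j s IH].
  by rewrite (_ : (fun x => _) = fun=> 0); [exact/schw_reg/schw0|apply/funext => x; rewrite big_nil].
rewrite (_ : (fun x => _) = fun x => F j x + \sum_(j <- s) F j x); first exact: regD.
by apply/funext => x; rewrite big_cons.
Qed.

Lemma conv_reg k f : schw k -> sqX f -> reg (conv k f).
Proof.
move=> sk sf; split; first exact: smooth_conv.
move=> l; rewrite iter_derive_conv//; have pl := schw_pkern (schw_iter l sk).
split; first exact: sqi_conv.
by exists (N2X (iter_derive l k) * N2X f) => x; exact: conv_le.
Qed.

Lemma iter_derive_refl l k x : smooth k ->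
  iter_derive l (fun y => k (x - y)) = fun y => (-1) ^+ size l * iter_derive l k (x - y).
Proof.
move=> sk.
have aff h : smooth h -> (forall y v, 'D_v (fun y => h (x - y)) y = - 'D_v h (x - y)) /\
    smooth (fun y => h (x - y)).
  move=> sh; have [||h1 h2] := @smooth_comp_affine R X X h (fun y => - y) x sh.
  - by move=> y; apply: cvgN; exact: cvg_id.
  - by move=> y v c; rewrite opprD scalerN.
  rewrite (_ : (fun y => h (x - y)) = fun y => h (- y + x)); last first.
    by apply/funext => y; rewrite addrC.
  split => // y v; rewrite h1 addrC -[- v]scaleN1r Dscale ?mulN1r//.
  by move=> *; exact: smooth_derivable.
elim: l => [|v l IH] /=; first by apply/funext => y; rewrite mul1r.
have [a1 a2] := aff _ (smooth_iter l sk).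
rewrite IH; apply/funext => y; rewrite DZ; last exact: smooth_derivable a2.
by rewrite a1 exprS; ring.
Qed.

Lemma reg_refl k x : schw k -> reg (fun y => k (x - y)).
Proof.
move=> sk; have ss := schw_smooth sk.
split.
  have [||_] := @smooth_comp_affine R X X k (fun y => - y) x ss.
  - by move=> y; apply: cvgN.
  - by move=> y v c; rewrite opprD scalerN.
  by apply: smooth_ext => y; rewrite addrC.
move=> l; rewrite iter_derive_refl//; have pl := schw_pkern (schw_iter l sk).
split; first exact/sqiZ/sqi_sub/pkern_sqi.
have [C _ hC] := pkern_bounded pl; exists C => y.
by rewrite normrM normrX normrN1 expr1n mul1r.
Qed.

End Regular.

(** * Truncation in space and in frequency *)

Section Cutoff.
Context {R : realType} (chi : space3 R -> R) (hchi : lp_cutoff chi).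
Local Notation X := (space3 R).
Local Notation Y := (mspace3 R).
Implicit Types (f g h k psi B : X -> R) (x y z v xi : X).

Lemma etf_chi : etf chi.
Proof.
case: hchi => /test_functionP h _ _ rad _; split => // xi; apply: rad; exact: enormN.
Qed.

Lemma chi_eq0 xi : 1 <= enorm xi -> chi xi = 0.
Proof.
case: hchi => _ s _ _ _ h; have [//|c] := eqVneq (chi xi) 0.
have /s : supp chi xi by apply: subset_closure.
by rewrite /= ltNge h.
Qed.

Lemma chi_eq1 xi : enorm xi <= 2^-1 -> chi xi = 1.
Proof. by case: hchi => _ _ _ _; exact. Qed.

Definition chis (s : R) := dil s chi.

Lemma etf_chis (s : R) : 0 < s -> etf (chis s).
Proof. by move=> s0; exact: etf_dil etf_chi. Qed.

Lemma chis_eq0 (s : R) xi : 0 < s -> s <= enorm xi -> chis s xi = 0.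
Proof.
move=> s0 h; rewrite /chis /dil chi_eq0// enormZ ?invr_ge0 ?(ltW s0)//.
by rewrite mulrC ler_pdivlMr// mul1r.
Qed.

Lemma chis_eq1 (s : R) xi : 0 < s -> enorm xi <= s / 2 -> chis s xi = 1.
Proof.
move=> s0 h; rewrite /chis /dil chi_eq1// enormZ ?invr_ge0 ?(ltW s0)//.
by rewrite mulrC ler_pdivrMr// mulrC.
Qed.

Lemma chisM (s s' : R) xi : 0 < s -> 2 * s <= s' -> chis s xi * chis s' xi = chis s xi.
Proof.
move=> s0 ss; have s'0 : 0 < s' by rewrite (lt_le_trans _ ss)// mulr_gt0.
have [h|h] := leP s (enorm xi); first by rewrite chis_eq0// mul0r.
rewrite (@chis_eq1 s') ?mulr1//.
lra.
Qed.

Lemma enorm_le xi : enorm xi <= 2 * `|xi|.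
Proof.
have h0 : 0 <= 2 * `|xi| by rewrite mulr_ge0.
rewrite -(ger0_norm h0) -sqrtr_sqr ler_wsqrtr// dotE.
have q t : `|t| <= `|xi| -> t ^+ 2 <= `|xi| ^+ 2.
  by move=> h; rewrite -(real_normK (num_real t)); exact: lerXn2r (normr_ge0 _) (normr_ge0 _) h.
have := q _ (norm_x1 xi); have := q _ (norm_x2 xi); have := q _ (norm_x3 xi).
by have := sqr_ge0 `|xi|; lra.
Qed.

Lemma lambda_gt0 n : 0 < lambda n :> R.
Proof. by rewrite exprn_gt0. Qed.

Lemma lambda_ge1 n : 1 <= lambda n :> R.
Proof. by rewrite exprn_ege1// ler1n. Qed.

Lemma lambdaS n : lambda n.+1 = 2 * lambda n :> R.
Proof. exact: exprS. Qed.

Lemma lambda_ge n : n%:R <= lambda n :> R.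
Proof.
elim: n => [|n IH]//.
rewrite lambdaS -natr1 mulrDl mul1r lerD//; exact: lambda_ge1.
Qed.

(** Here [chis] is a cutoff in physical space. Near a given point it equals 1 for large [n], and its
    derivatives are bounded uniformly in [n], so Leibniz' rule gives one majorant [G]. This carries
    identities from test functions to [reg]. *)
Lemma truncation B : reg B ->
  (forall n, test_function (fun x => chis (lambda n) x * B x)) /\
  forall l, (forall x, exists N, forall n, (N <= n)%N ->
      iter_derive l (fun x => chis (lambda n) x * B x) x = iter_derive l B x) /\
    exists G, [/\ sqX G, forall x, 0 <= G x, exists D : R, forall x, G x <= D &
      forall n x, `|iter_derive l (fun x => chis (lambda n) x * B x) x| <= G x].
Proof.
move=> rB; split.
  move=> n; apply/test_functionP; exact: tfunM (etf_chis (lambda_gt0 n)).1 (reg_smooth rB).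
split.
  move=> x; exists (Num.bound (4 * (`|x| + 1))) => n hn.
  have big : 4 * (`|x| + 1) <= lambda n.
    apply: le_trans (lambda_ge n); apply: ltW; apply: lt_le_trans (archi_boundP _) _.
      by [].
    by rewrite ler_nat.
  apply: (@iter_derive_local R X l _ _ (ball x 1)); [exact: ball_open|move=> y xy|exact: ballxx].
  rewrite chis_eq1 ?mul1r ?lambda_gt0//; apply: le_trans (enorm_le y) _.
  have : `|y| <= `|x| + 1.
    move: xy; rewrite -ball_normE /= distrC => /ltW xy.
    by rewrite -lerBlDl; apply: le_trans (lerB_dist _ _) xy.
  lra.
have [K hK] : exists K : seq X -> R, forall m n x, `|iter_derive m (chis (lambda n)) x| <= K m.
  have sc := tfun_schw etf_chi.1.
  apply: (@bounds_exist R chi (fun m C => forall n x, `|iter_derive m (chis (lambda n)) x| <= C)) => m.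
  have [C C0 hC] := pkern_bounded (schw_pkern (schw_iter m sc)); exists C => n x.
  rewrite iter_derive_dil; last exact: etf_chi.1.1.
  rewrite normrM -[leRHS]mul1r; apply: ler_pM => //.
  rewrite normrX exprn_ile1// ger0_norm ?invr_ge0 ?(ltW (lambda_gt0 n))//.
  by rewrite invf_le1 ?lambda_gt0// lambda_ge1.
have [C [ls [C0 h]]] := leibniz_bound l K.
exists (fun x => C * \sum_(m <- ls) `|iter_derive m B x|); split.
- exact: sqi_sum_abs.
- by move=> x; apply: mulr_ge0 => //; apply: sumr_ge0 => *.
- exact: bounded_sum_abs.
- move=> n; apply: h; [exact: (etf_chis (lambda_gt0 n)).1.1|exact: reg_smooth|by move=> m].
Qed.

Lemma test_pairing_lim f l B : sqX f -> reg B ->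
  \int[leb3]_x (f x * iter_derive l (fun x => chis (lambda n) x * B x) x) @[n --> \oo] -->
  \int[leb3]_x (f x * iter_derive l B x).
Proof.
move=> sf rB; have [tB hB] := truncation rB; have [lB [G [sG G0 _ hG]]] := hB l.
apply: proj2 (@Idct _ _ R leb3 (fun n x => f x * iter_derive l (fun x => chis (lambda n) x * B x) x) _ (fun x => `|f x| * G x) _ _ _ _).
- move=> n; apply: measurable_funM; first exact: sf.1.
  by apply: smooth_mfun3; apply: smooth_iter; case: (tB n).
- by apply: sqi_mul => //; exact: sqi_abs.
- move=> x; apply: cvgM; first exact: cvg_cst.
  have [N hN] := lB x; apply: cvg_near_cst; exists N => // n Nn.
- by move=> n x; rewrite normrM ler_wpM2l.
Qed.

(** The distributional condition tested on the larger class; [distr_div_divf] shows that nothing is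
    added. [wder] plays the same role for weak derivatives. *)
Definition divf (u : vfield R) : Prop := forall B, reg B ->
  \sum_i \int[leb3]_x (u i x * 'd_i B x) = 0.

Lemma distr_div_divf (u : vfield R) : vsqX u -> distr_div_free u -> divf u.
Proof.
move=> su du B rB.
have [tB hB] := truncation rB.
have e n : \sum_i \int[leb3]_x (u i x * 'd_i (fun x => chis (lambda n) x * B x) x) = 0.
  rewrite -Isum; first exact: du (tB n).
  move=> i; have /test_functionP tn := tB n; apply: sqi_mul => //.
  exact: schw_sqi (tfun_schw (tfun_D _ tn)).
have c : \sum_i \int[leb3]_x (u i x * 'd_i (fun x => chis (lambda n) x * B x) x) @[n --> \oo] -->
    \sum_i \int[leb3]_x (u i x * 'd_i B x).
  apply: cvg_sumr => i; exact: @test_pairing_lim (u i) [:: 'u_i] B (su i) rB.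
exact: lim_eq e c (@cvg_cst _ 0 nat \oo _).
Qed.

Definition wder (l : seq 'I_3) f g : Prop := forall B, reg B ->
  \int[leb3]_x (f x * iter_partial l B x) = (-1) ^+ size l * \int[leb3]_x (g x * B x).

Lemma weak_derivative_wder l f g : sqX f -> sqX g -> weak_derivative l f g -> wder l f g.
Proof.
move=> sf sg h B rB; have [tB _] := truncation rB.
have c1 := @test_pairing_lim f [seq 'u_i | i <- l] B sf rB.
have c2 := @test_pairing_lim g [::] B sg rB.
apply: (lim_eq (fun n => h _ (tB n)) c1); apply: cvgM; [exact: cvg_cst|exact: c2].
Qed.

Lemma wder_weak_derivative l f g : wder l f g -> weak_derivative l f g.
Proof. by move=> h eta /test_functionP/tfun_schw/schw_reg; exact: h. Qed.

Lemma divf_conv (u : vfield R) k x : vsqX u -> divf u -> schw k ->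
  \sum_i conv ('d_i k) (u i) x = 0.
Proof.
move=> su du sk; have := du _ (reg_refl x sk).
rewrite (eq_bigr (fun i => - conv ('d_i k) (u i) x)); last first.
  move=> i _; have e :=
    iter_derive_refl [:: 'u_i] x (schw_smooth sk).
  rewrite -(IN (conv_intg x (schw_pkern (schw_D _ sk)) (su i))).
  apply: eqI => y; transitivity (u i y * ((-1) ^+ 1 * 'd_i k (x - y))).
    exact: (congr1 (fun h => u i y * h y) e).
  lra.
by rewrite sumrN => /eqP; rewrite oppr_eq0 => /eqP.
Qed.

(** The reflected translate [y |-> k (x - y)] belongs to [reg]; the signs of reflection and of
    integration by parts cancel. *)
Lemma wder_conv l f g k x : sqX f -> sqX g -> wder l f g -> schw k ->
  conv (iter_partial l k) f x = conv k g x.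
Proof.
move=> sf sg h sk; have := h _ (reg_refl x sk).
rewrite /iter_partial iter_derive_refl; last exact: schw_smooth.
rewrite size_map => e.
have e1 : \int[leb3]_y (f y * ((-1) ^+ size l * iter_derive [seq 'u_i | i <- l] k (x - y))) =
    (-1) ^+ size l * conv (iter_partial l k) f x.
  rewrite -IZ; last exact: conv_intg (schw_pkern (schw_iter _ sk)) sf.
  by apply: eqI => y; rewrite /iter_partial; ring.
have e2 : \int[leb3]_y (g y * k (x - y)) = conv k g x by apply: eqI => y; rewrite mulrC.
move: e; rewrite e1 e2 => /(congr1 (fun t => (-1) ^+ size l * t)).
by rewrite !mulrA -exprD addnn -mul2n exprM sqrrN expr1n expr1n !mul1r.
Qed.

Definition Sop (n : nat) f : X -> R := op (chis (lambda n)) f.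

Lemma etf_chil n : etf (chis (lambda n)).
Proof. exact: etf_chis (lambda_gt0 n). Qed.

Lemma sqi_Sop n f : sqX f -> sqX (Sop n f).
Proof. exact: sqi_op (etf_chil n). Qed.

Lemma reg_Sop n f : sqX f -> reg (Sop n f).
Proof. exact: conv_reg (schw_kern (etf_chil n).1). Qed.

Lemma N2_Sop n f : sqX f -> N2X (Sop n f) <= N1 (kern chi) * N2X f.
Proof.
by move=> sf; have := @bernstein2 R (lambda n) chi [::] f (lambda_gt0 n) etf_chi sf; rewrite mul1r.
Qed.

(** After rescaling, a fixed kernel acts on [g (x - z / lambda n)], and its integral is [psi 0] by
    inversion at frequency 0. *)
Lemma op_cbi psi g x : etf psi -> cbi g ->
  op (dil (lambda n) psi) g x @[n --> \oo] --> psi 0 * g x.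
Proof.
move=> ep [cg ig [C hC]]; have pk := pkern_kern ep.1.
have mg := continuous_mfun3 cg; have sg : sqX g by split => //; exact: intgM_bd ig mg hC.
have E n : op (dil (lambda n) psi) g x = \int[leb3]_z (kern psi z * g (x - (lambda n)^-1 *: z)).
  have l0 := lambda_gt0 n; have a0 : - (lambda n)^-1 != 0 :> R by rewrite oppr_eq0 invr_eq0 lt0r_neq0.
  have i1 : intgX (fun y => kern (dil (lambda n) psi) (x - y) * g y).
    exact: conv_intg (pkern_kern (etf_dil l0 ep).1) sg.
  rewrite /op /conv -(I_aff3 x a0 i1) -IZ; last exact: (intg_aff3 x a0 i1).
  apply: eqI => z; rewrite aff3E kern_dil//; last exact: ep.1.
  rewrite normrN gtr0_norm ?invr_gt0// scaleNr opprD opprK addrCA subrr addr0.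
  rewrite scalerA divff ?lt0r_neq0// scale1r [- _ + x]addrC mulrA mulrA -exprMn mulVf ?lt0r_neq0//.
  lra.
rewrite (_ : (fun n => _) = fun n => \int[leb3]_z (kern psi z * g (x - (lambda n)^-1 *: z))); last first.
  by apply/funext => n.
have -> : psi 0 * g x = \int[leb3]_z (kern psi z * g x).
  rewrite IZr; last exact: pkern_intg.
  congr (_ * _); have := kern_inversion 0 0 0 ep.1 ep.2.
  rewrite dot0l subr0 cos0 mulr1 => <-; apply: eqI => y.
  by rewrite sub0r kernN dotC dot0l subr0 cos0 mulr1.
apply: proj2 (@Idct _ _ R leb3 (fun n z => kern psi z * g (x - (lambda n)^-1 *: z)) _ (fun z => `|kern psi z| * C) _ _ _ _).
- move=> n; apply: measurable_funM; first exact: pk.1.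
  have := measurableT_comp mg (measurable_aff3 (- (lambda n)^-1) x).
  by congr measurable_fun; apply/funext => y /=; rewrite aff3E scaleNr addrC.
- by apply: intgZr; exact/intg_abs/pkern_intg.
- move=> z; apply: cvgM; first exact: cvg_cst.
  have c : (x - (lambda n)^-1 *: z) @[n --> \oo] --> x.
    rewrite -[X in _ --> X]subr0; apply: cvgB; first exact: cvg_cst.
    rewrite -(scale0r z); apply: cvgZr_tmp.
    rewrite (_ : (fun n => (lambda n)^-1) = fun n => 2^-1 ^+ n); last first.
      by apply/funext => n; rewrite exprVn.
    by apply: cvg_expr; rewrite ger0_norm; lra.
  exact: @continuous_cvg _ _ _ _ _ (fun n => x - (lambda n)^-1 *: z) g x (cg x) c.
- by move=> n z; rewrite normrM ler_wpM2l.
Qed.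

(** By self-adjointness the square expands to the integral of [g] times [g - 2 S g + S^2 g], which
    tends to 0 boundedly at every point. The integrable factor [g] gives the majorant, although the
    functions [Sop n g] have no evident common one in L^2. *)
Lemma Sop_cbi g : cbi g -> nsqX (fun x => g x - Sop n g x) @[n --> \oo] --> (0 : R).
Proof.
move=> cg; have sg := cbi_sqi cg; have [_ ig [C hC]] := cg.
have A0 := N1_ge0 (kern chi); set A := N1 (kern chi) in A0.
pose chi2 xi := chi xi * chi xi.
have e2 := etfM etf_chi etf_chi.
have S2 n : Sop n (Sop n g) = op (dil (lambda n) chi2) g.
  by rewrite /Sop op_op//; exact: etf_chil.
have chi0 : chi 0 = 1 by rewrite chi_eq1// enorm0.
have mg := sg.1.
have b1 n x : `|Sop n g x| <= A * C.
  by have := @bernstein_oo R (lambda n) chi [::] g C x (lambda_gt0 n) etf_chi mg hC; rewrite mul1r.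
have b2 n x : `|op (dil (lambda n) chi2) g x| <= N1 (kern chi2) * C.
  by have := @bernstein_oo R (lambda n) chi2 [::] g C x (lambda_gt0 n) e2 mg hC; rewrite mul1r.
have sS n := sqi_Sop n sg.
have sSS n := sqi_op (etf_dil (lambda_gt0 n) e2) sg.
have E n : nsqX (fun x => g x - Sop n g x) =
    \int[leb3]_x (g x * (g x - 2 * Sop n g x + op (dil (lambda n) chi2) g x)).
  have h : \int[leb3]_x (Sop n g x * Sop n g x) = \int[leb3]_x (g x * op (dil (lambda n) chi2) g x).
    by rewrite -S2 -(op_sym (etf_chil n) (sS n) sg).
  have i1 := sqi_mul sg sg; have i2 := sqi_mul sg (sS n); have i3 := sqi_mul sg (sSS n).
  have i4 := sqi_mul (sS n) (sS n).
  rewrite /nsq (_ : (fun x => (_ - _) ^+ 2) = fun x => (g x * g x + (-2) * (g x * Sop n g x)) + Sop n g x * Sop n g x); last first.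
    by apply/funext => x; ring.
  rewrite [RHS](_ : _ = \int[leb3]_x ((g x * g x + (-2) * (g x * Sop n g x)) + g x * op (dil (lambda n) chi2) g x)); last first.
    by apply: eqI => x; ring.
  have i5 := intgD i1 (intgZ (-2) i2).
  have E2 := ID i5 i3; rewrite -h in E2.
  exact: etrans (ID i5 i4) (esym E2).
rewrite (_ : (fun n => _) = fun n => \int[leb3]_x (g x * (g x - 2 * Sop n g x + op (dil (lambda n) chi2) g x))); last first.
  by apply/funext => n.
rewrite -(@I0 _ _ R leb3).
apply: proj2 (@Idct _ _ R leb3 (fun n x => g x * (g x - 2 * Sop n g x + op (dil (lambda n) chi2) g x)) _ (fun x => `|g x| * (C + 2 * (A * C) + N1 (kern chi2) * C)) _ _ _ _).
- move=> n; apply: measurable_funM => //; apply: measurable_funD; last exact: (sSS n).1.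
  apply: measurable_funB => //; exact: (sqiZ 2 (sS n)).1.
- by apply: intgZr; exact: intg_abs.
- move=> x; rewrite -[X in _ --> X](mulr0 (g x)); apply: cvgM; first exact: cvg_cst.
  have c1 := @op_cbi chi g x etf_chi cg; have c2 := @op_cbi chi2 g x e2 cg.
  rewrite chi0 mul1r in c1; rewrite /chi2 chi0 !mul1r in c2.
  have -> : 0 = g x - 2 * g x + g x by ring.
  apply: cvgD; last exact: c2.
  by apply: cvgB; [exact: cvg_cst|apply: cvgM; [exact: cvg_cst|exact: c1]].
- move=> n x; rewrite normrM ler_wpM2l//; apply: le_trans (ler_normD _ _) _; apply: lerD; last exact: b2.
  apply: le_trans (ler_normB _ _) _; apply: lerD => //.
  by rewrite normrM ger0_norm// ler_wpM2l.
Qed.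

(** Density of [cbi] together with the bound [N2_Sop], uniform in [n]. *)
Lemma Sop_lim f : sqX f -> N2X (fun x => f x - Sop n f x) @[n --> \oo] --> (0 : R).
Proof.
move=> sf; have A0 := N1_ge0 (kern chi); set A := N1 (kern chi) in A0.
apply: le_cvg0 => e e0.
have B0 : 0 < A + 2 by rewrite ltr_wpDl.
have e1 : 0 < e / (A + 2) by rewrite divr_gt0.
have [_ /(_ _ e1)[g cg hg]] := cdense_all sf; have sg := cbi_sqi cg.
have c := cvg_comp _ _ (Sop_cbi cg) (@sqrt_continuous R 0); rewrite sqrtr0 in c.
have [N hN] := cvg0_le c e1; exists N => n /hN /= h.
rewrite (ger0_norm (N2_ge0 _ _)); have {}h := le_trans (ler_norm _) h.
have sfg := sqiB sf sg.
have e3 x : f x - Sop n f x = ((f x - g x) - Sop n (fun y => f y - g y) x) + (g x - Sop n g x).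
  rewrite /Sop /op convBr//; [ring|exact: pkern_kern (etf_chil n).1].
rewrite (_ : (fun x => f x - _) = fun x => ((f x - g x) - Sop n (fun y => f y - g y) x) + (g x - Sop n g x)); last first.
  by apply/funext => x.
apply: le_trans (N2D (sqiB sfg (sqi_Sop n sfg)) (sqiB sg (sqi_Sop n sg))) _.
have h2 := N2B sfg (sqi_Sop n sfg).
have h3 := N2_Sop n sfg; rewrite -/A in h3.
have h4 : A * N2X (fun x => f x - g x) <= A * (e / (A + 2)) by rewrite ler_wpM2l.
have h5 : e = e / (A + 2) + A * (e / (A + 2)) + e / (A + 2).
  by field; rewrite lt0r_neq0.
rewrite [leRHS]h5; apply: lerD; last exact: h.
lra.
Qed.

(** Each value of [Sop n f] is a pairing of [f] with a function of class [reg], hence 0, while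
    [Sop n f] converges to [f]. *)
Lemma wder0_unique f : sqX f -> (forall eta, test_function eta -> \int[leb3]_x (f x * eta x) = 0) ->
  nsqX f = 0.
Proof.
move=> sf h.
have w : wder [::] f (fun=> 0).
  apply: weak_derivative_wder => //; first exact: sqi0.
  move=> eta te; rewrite (h _ te) mul1r (_ : (fun x => _) = fun=> 0) ?I0//.
  by apply/funext => x; rewrite mul0r.
have S0 n x : Sop n f x = 0.
  rewrite /Sop /op (wder_conv x sf _ w (schw_kern (etf_chil n).1)); last exact: sqi0.
  by rewrite /conv (_ : (fun y => _) = fun=> 0) ?I0//; apply/funext => y; rewrite mulr0.
have c := Sop_lim sf.
have e : (fun n => N2X (fun x => f x - Sop n f x)) = fun=> N2X f.
  by apply/funext => n; congr N2; apply/funext => x; rewrite S0 subr0.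
rewrite e in c; have c' : (fun _ => N2X f) n @[n --> \oo] --> N2X f by exact: cvg_cst.
have e0 := lim_eq (fun=> erefl) c c'.
by rewrite -N2_sqr -e0 expr0n.
Qed.

End Cutoff.

(** * Integration by parts, low frequencies, double curls *)

Section RegularFields.
Context {R : realType} (chi : space3 R -> R) (hchi : lp_cutoff chi).
Local Notation X := (space3 R).
Local Notation Y := (mspace3 R).
Implicit Types (f g h k psi B al be : X -> R) (x y z v xi : X) (i j : 'I_3).

(** With a test function in place of [g] the product has compact support and its derivative
    integrates to 0; truncation then extends the identity to [g]. *)
Lemma D_ibp f g i : reg f -> reg g ->
  \int[leb3]_x (f x * 'd_i g x) = - \int[leb3]_x ('d_i f x * g x).
Proof.
move=> rf rg.
suff w : wder [:: i] f ('d_i f) by rewrite -mulN1r; exact: w rg.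
apply: (weak_derivative_wder hchi); [exact: reg_sqi|exact: reg_sqi (reg_D _ rf)|].
move=> eta /test_functionP [se be]; rewrite mulN1r.
have tp : tfun (fun x => f x * eta x).
  by apply: tfunMl; [split|exact: reg_smooth].
have i1 : intgX (fun x => f x * 'd_i eta x).
  apply: schw_intg; apply: tfun_schw; apply: tfunMl; [exact: tfun_D|exact: reg_smooth].
have i2 : intgX (fun x => 'd_i f x * eta x).
  apply: schw_intg; apply: tfun_schw; apply: tfunMl; [by split|exact: reg_smooth (reg_D _ rf)].
have := I_D0 i (tfun_schw tp).
rewrite (_ : (fun x => 'd_i _ x) = fun x => 'd_i f x * eta x + f x * 'd_i eta x); last first.
  by apply/funext => x; rewrite DM//; [exact: smooth_derivable (reg_smooth rf)|exact: smooth_derivable se].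
by rewrite (ID i2 i1) addrC => /eqP; rewrite addr_eq0 => /eqP.
Qed.

Lemma conv_D_swap k f i x : schw k -> reg f ->
  conv ('d_i k) f x = conv k ('d_i f) x.
Proof.
move=> sk rf.
have w : wder [:: i] f ('d_i f).
  by move=> B rB; rewrite mulN1r; exact: D_ibp.
exact: wder_conv x (reg_sqi rf) (reg_sqi (reg_D _ rf)) w sk.
Qed.

Lemma D_op_swap al f i : etf al -> reg f ->
  'd_i (op al f) = op al ('d_i f).
Proof.
move=> ea rf; have sk := schw_kern ea.1.
rewrite (DE_conv _ sk (reg_sqi rf)); apply/funext => x; exact: conv_D_swap.
Qed.

Lemma op_reg al f : etf al -> sqX f -> reg (op al f).
Proof. by move=> ea; exact: conv_reg (schw_kern ea.1). Qed.

(** The multiplier is self-adjoint and commutes with derivatives, so it can be moved onto the test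
    function. *)
Lemma divf_op al (u : vfield R) : etf al -> vsqX u -> divf u ->
  divf (fun i => op al (u i)).
Proof.
move=> ea su du B rB; rewrite -[RHS](du _ (op_reg ea (reg_sqi rB))).
apply: eq_bigr => i _; have sD := reg_sqi (reg_D 'u_i rB).
transitivity (\int[leb3]_x (u i x * op al ('d_i B) x)).
  by rewrite (op_sym ea sD (su i)); apply: eqI => x; rewrite mulrC.
apply: eqI => x; exact: (congr1 (fun h => u i x * h x) (esym (D_op_swap i ea rB))).
Qed.

(* Kernels of low frequency vanish weakly on L^2, by density of L^1. *)
Lemma low_frequency_lim f w : sqX f -> sqX w ->
  \int[leb3]_x (w x * op (chis chi (lambda m)^-1) f x) @[m --> \oo] --> (0 : R).
Proof.
move=> sf sw; have ec := etf_chi hchi.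
pose A := N1 (kern chi) * N2X f; pose D := N2X (kern chi) * N2X f.
have A0 : 0 <= A by rewrite mulr_ge0 ?N1_ge0 ?N2_ge0.
have D0 : 0 <= D by rewrite mulr_ge0 ?N2_ge0.
have l0 m : 0 < (lambda m)^-1 :> R by rewrite invr_gt0 lambda_gt0.
have em m := etf_chis hchi (l0 m).
apply: le_cvg0 => e e0.
have A1 : 0 < 2 * (A + 1) by rewrite mulr_gt0// ltr_wpDl.
have [_ /(_ _ (divr_gt0 e0 A1))[g cg hg]] := cdense_all sw; have sg := cbi_sqi cg.
have [_ ig _] := cg.
have lim : (lambda m)^-1 * (D * N1 g) @[m --> \oo] --> 0.
  rewrite -(mul0r (D * N1 g)); apply: cvgM; last exact: cvg_cst.
  rewrite (_ : (fun n => (lambda n)^-1) = fun n => 2^-1 ^+ n); last first.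
    by apply/funext => n; rewrite exprVn.
  by apply: cvg_expr; rewrite ger0_norm; lra.
have [N hN] := cvg0_le lim (divr_gt0 e0 (ltr0n _ 2)); exists N => m /hN h1.
have sE := sqi_op (em m) sf.
have bE x : `|op (chis chi (lambda m)^-1) f x| <= (lambda m)^-1 * D.
  have := @bernstein_2oo R (lambda m)^-1 chi [::] f x (l0 m) ec sf; rewrite mul1r -mulrA.
  move=> h; apply: le_trans h _; rewrite ler_wpM2r//.
  have l1 : (lambda m)^-1 <= 1 :> R by rewrite invf_le1 ?lambda_gt0// lambda_ge1.
  rewrite -[leRHS](ger0_norm (ltW (l0 m))) -sqrtr_sqr ler_wsqrtr// [leLHS]exprS ler_piMl//.
  exact: exprn_ge0 (ltW (l0 m)).
have sd := sqiB sw sg.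
rewrite (_ : (fun x => _) = fun x => (w x - g x) * op (chis chi (lambda m)^-1) f x + g x * op (chis chi (lambda m)^-1) f x); last first.
  by apply/funext => x; rewrite -mulrDl subrK.
rewrite (ID (sqi_mul sd sE) (sqi_mul sg sE)) (splitr e); apply: le_trans (ler_normD _ _) _.
apply: lerD.
  apply: le_trans (cauchy_schwarz sd sE) _.
  have h2 : N2X (op (chis chi (lambda m)^-1) f) <= A.
    by have := @bernstein2 R (lambda m)^-1 chi [::] f (l0 m) ec sf; rewrite mul1r.
  apply: le_trans (ler_pM (N2_ge0 _ _) (N2_ge0 _ _) hg h2) _.
  have -> : e / (2 * (A + 1)) * A = e / 2 * (A / (A + 1)).
    lra.
  by rewrite ler_piMr ?divr_ge0 ?ltW// ltr_pdivrMr ?ltr_wpDl// mul1r ltrDl.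
apply: le_trans h1; apply: le_trans (ler_norm _).
rewrite mulrA [_ * N1 g]mulrC -IZr; last exact: intg_abs.
apply: Iabs_le; [exact: intg_meas (sqi_mul sg sE)|by apply: intgZr; exact: intg_abs|move=> x].
by rewrite normrM ler_wpM2l.
Qed.

(* [curl curl B], written componentwise. *)
Definition ccurl (b : 'I_3 -> X -> R) : vfield R := fun i x =>
  \sum_j ('d_i ('d_j (b j)) x -
          'd_j ('d_j (b i)) x).

Lemma D_ccurl (b : vfield R) i v x : (forall j : 'I_3, smooth (b j)) -> 'D_v (ccurl b i) x =
  \sum_j ('D_v ('d_i ('d_j (b j))) x -
          'D_v ('d_j ('d_j (b i))) x).
Proof.
move=> sB.
have s1 (w w' : X) j : smooth ('D_w ('D_w' (b j))) by do 2! apply: smooth_D.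
rewrite Dsum; last by move=> j; exact: smoothB.
by apply: eq_bigr => j _; rewrite DB//; exact: smooth_derivable.
Qed.

Lemma smooth_ccurl (b : vfield R) i : (forall j : 'I_3, smooth (b j)) -> smooth (ccurl b i).
Proof.
move=> sB; apply: smooth_sum => j; apply: smoothB; do 2! apply: smooth_D; exact: sB.
Qed.

Lemma div_ccurl (b : vfield R) x : (forall j : 'I_3, smooth (b j)) -> divergence (ccurl b) x = 0.
Proof.
move=> sB; rewrite /divergence.
rewrite (eq_bigr (fun i => \sum_j ('d_i ('d_i ('d_j (b j))) x -
          'd_i ('d_j ('d_j (b i))) x))); last first.
  by move=> i _; exact: D_ccurl.
rewrite (eq_bigr (fun i => \sum_j 'd_i ('d_i ('d_j (b j))) x -
          \sum_j 'd_i ('d_j ('d_j (b i))) x)); last first.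
  by move=> i _; rewrite sumrB.
rewrite sumrB [X in X - _]exchange_big; apply/eqP; rewrite subr_eq0; apply/eqP.
apply: eq_bigr => i _; apply: eq_bigr => j _.
have sD := smooth_D 'u_j (sB i).
have e : ('d_j ('d_i (b i)) : X -> R) = 'd_i ('d_j (b i)).
  by apply/funext => y; exact: derive_comm _ _ _ (sB i).
transitivity ('d_j ('d_i ('d_j (b i))) x).
  exact: (congr1 (fun h => 'd_j h x) e).
exact: derive_comm _ _ _ sD.
Qed.

End RegularFields.

(** * Integrals over time intervals *)

Section TimeIntegral.
Context {R : realType}.
Implicit Types (f g : R -> R) (a b c t : R).

(** Integrating over the whole line against an indicator lets the general integral lemmas apply, and
    half-open intervals add up without overlap. *)
Definition Ig a b f : Prop := intg leb (fun s : R => \1_`]a, b]%classic s * f s).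
Definition It a b f : R := \int[leb]_s (\1_`]a, b]%classic s * f s).

Lemma measurable_itv1 a b : measurable_fun setT (\1_`]a, b]%classic : measurableTypeR R -> R).
Proof. by []. Qed.

Lemma itv1E a b t : \1_`]a, b]%classic t = (a < t <= b)%R%:R :> R.
Proof. by rewrite indicE mem_setE. Qed.

Lemma itv1_split a b c t : a <= b -> b <= c ->
  \1_`]a, c]%classic t = \1_`]a, b]%classic t + \1_`]b, c]%classic t :> R.
Proof.
rewrite !itv1E.
case: (ltP a t) => h1; case: (leP t b) => h2; case: (leP t c) => h3; rewrite ?addr0 ?add0r//.
- lra.
- lra.
Qed.

Lemma intgMl_itv a b f : intg leb f -> Ig a b f.
Proof.
move=> h; apply: intg_ext (intgM_bd h (@measurable_itv1 a b) _) => s; first by rewrite mulrC.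
by rewrite itv1E; case: (_ && _); rewrite ?normr1 ?normr0.
Qed.

Lemma Ig_sub a b a' b' f : a <= a' -> b' <= b -> Ig a b f -> Ig a' b' f.
Proof.
move=> aa bb h; have := intgMl_itv a' b' h; apply: intg_ext => s.
rewrite !itv1E; case: (ltP a' s) => h1; case: (leP s b') => h2; rewrite ?mul0r// mul1r.
by rewrite (le_lt_trans aa h1) (le_trans h2 bb).
Qed.

Lemma It_add a b c f : a <= b -> b <= c -> Ig a c f -> It a c f = It a b f + It b c f.
Proof.
move=> ab bc h; rewrite -(ID (Ig_sub (lexx a) bc h) (Ig_sub ab (lexx c) h)).
by apply: eqI => s; rewrite (itv1_split s ab bc) mulrDl.
Qed.

Lemma It_le a b f g : Ig a b f -> Ig a b g -> (forall s, a < s <= b -> f s <= g s) ->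
  It a b f <= It a b g.
Proof.
move=> hf hg h; apply: Ile => // s; rewrite itv1E; case: (boolP (a < s <= b)) => hs.
  by rewrite !mul1r h.
by rewrite !mul0r.
Qed.

Lemma It_ext a b f g : (forall s, a < s <= b -> f s = g s) -> It a b f = It a b g.
Proof.
move=> h; apply: eqI => s; rewrite itv1E; case: (boolP (a < s <= b)) => hs; last by rewrite !mul0r.
by rewrite h.
Qed.

Lemma Ig_ext a b f g : (forall s, a < s <= b -> f s = g s) -> Ig a b f -> Ig a b g.
Proof.
move=> h; apply: intg_ext => s; rewrite itv1E; case: (boolP (a < s <= b)) => hs; last by rewrite !mul0r.
by rewrite h.
Qed.

Lemma It_D a b f g : Ig a b f -> Ig a b g -> It a b (fun s => f s + g s) = It a b f + It a b g.
Proof. by move=> hf hg; rewrite -ID//; apply: eqI => s; rewrite mulrDr. Qed.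

Lemma It_B a b f g : Ig a b f -> Ig a b g -> It a b (fun s => f s - g s) = It a b f - It a b g.
Proof. by move=> hf hg; rewrite -IB//; apply: eqI => s; rewrite mulrBr. Qed.

Lemma It_Z a b k f : Ig a b f -> It a b (fun s => k * f s) = k * It a b f.
Proof. by move=> hf; rewrite -IZ//; apply: eqI => s; rewrite mulrCA. Qed.

Lemma IgD a b f g : Ig a b f -> Ig a b g -> Ig a b (fun s => f s + g s).
Proof. by move=> hf hg; apply: intg_ext (intgD hf hg) => s; rewrite mulrDr. Qed.

Lemma IgZ a b k f : Ig a b f -> Ig a b (fun s => k * f s).
Proof. by move=> hf; apply: intg_ext (intgZ k hf) => s; rewrite mulrCA. Qed.

Lemma Ig_le a b f g : measurable_fun setT f -> Ig a b g -> (forall s, a < s <= b -> `|f s| <= g s) ->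
  Ig a b f.
Proof.
move=> mf hg h; apply: (intg_le _ hg).
  by apply: measurable_funM.
move=> s; rewrite itv1E; case: (boolP (a < s <= b)) => hs; last by rewrite !mul0r normr0.
by rewrite !mul1r h.
Qed.

Lemma It_ge0 a b f : (forall s, a < s <= b -> 0 <= f s) -> 0 <= It a b f.
Proof.
move=> h; apply: I_ge0 => s; rewrite itv1E; case: (boolP (a < s <= b)) => hs; last by rewrite mul0r.
by rewrite mul1r h.
Qed.

Lemma Ig_cst a b (k : R) : Ig a b (fun=> k).
Proof.
have i1 : intg leb (\1_`]a, b]%classic : R -> R).
  apply: intg_ge0P; [exact: measurable_itv1|by move=> s|].
  rewrite -[X in (X < _)%E]/(\int[lebesgue_measure]_x (\1_`]a, b]%classic x)%:E)%E integral_indic//= setIT.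
  by rewrite lebesgue_measure_itv/=; case: ifP => _; rewrite ltry.
exact: (intgZr k i1).
Qed.

Lemma It_cst a b (k : R) : a <= b -> It a b (fun=> k) = k * (b - a).
Proof.
move=> ab; have i1 := Ig_cst a b 1.
have i1' : intg leb (\1_`]a, b]%classic : R -> R) by apply: intg_ext i1 => s; rewrite mulr1.
rewrite /It (IZr k i1') mulrC; congr (_ * _).
apply: EFin_inj; rewrite EFinI//.
rewrite -[LHS]/(\int[lebesgue_measure]_x (\1_`]a, b]%classic x)%:E)%E integral_indic//= setIT.
rewrite lebesgue_measure_itv/= lte_fin; case: ltP => // ba.
by have -> : b = a; [apply/eqP; rewrite eq_le ba|rewrite subrr].
Qed.

Lemma It_dct a b (F : nat -> R -> R) f g : (forall n, measurable_fun setT (F n)) -> Ig a b g ->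
  (forall s, a < s <= b -> F n s @[n --> \oo] --> f s) ->
  (forall n s, a < s <= b -> `|F n s| <= g s) ->
  Ig a b f /\ It a b (F n) @[n --> \oo] --> It a b f.
Proof.
move=> mF hg c h.
apply: (@Idct _ _ R leb (fun n s => \1_`]a, b]%classic s * F n s) _ (fun s => \1_`]a, b]%classic s * g s)) => //.
- by move=> n; apply: measurable_funM; [exact: measurable_itv1|exact: mF].
- move=> s; rewrite itv1E; case: (boolP (a < s <= b)) => hs.
    by apply: cvgM; [exact: cvg_cst|exact: c].
  by under eq_fun do rewrite mul0r; rewrite mul0r; exact: cvg_cst.
- move=> n s; rewrite itv1E; case: (boolP (a < s <= b)) => hs; last by rewrite !mul0r normr0.
  by rewrite !mul1r h.
Qed.

Lemma It_itv a b f : Ig a b f -> \int[leb]_(s in `[a, b]) f s = It a b f.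
Proof.
move=> h; have e1 : \int[leb]_(s in `]a, b]) f s = It a b f.
  rewrite Rintegral_mkcond; apply: eqI => s; rewrite patchE indicE.
  by case: (s \in _); rewrite ?mul1r ?mul0r.
rewrite -e1; apply/esym; apply: Rintegral_itv_obnd_cbnd.
have m : measurable (`]a, b]%classic : set (measurableTypeR R)) by exact: measurable_itv.
apply: (proj2 (@integrable_mkcond _ _ R leb _ (EFin \o f) m)).
apply: eq_integrable h => // s _ /=; rewrite patchE indicE.
by case: (s \in _); rewrite ?mul1r ?mul0r.
Qed.

End TimeIntegral.

(** * Weakly continuous paths and measurability in time *)

Section Paths.
Context {R : realType}.
Local Notation X := (space3 R).
Implicit Types (f g w K : X -> R) (s t : R) (x y : X) (i j : 'I_3).

(** Paths are indexed by all real times; a solution on [[0, T]] is extended by constants ([vpath]),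
    so that continuity is not relative to an interval. *)
Definition wpath (p : R -> X -> R) : Prop := (forall t, sqX (p t)) /\
  forall w, sqX w -> continuous (fun t => \int[leb3]_x (p t x * w x)).

Lemma wpathD p q : wpath p -> wpath q -> wpath (fun t x => p t x + q t x).
Proof.
move=> [sp cp] [sq cq]; split; first by move=> t; exact: sqiD.
move=> w sw; rewrite (_ : (fun t => _) = fun t => \int[leb3]_x (p t x * w x) + \int[leb3]_x (q t x * w x)).
  by move=> t; apply: cvgD; [exact: cp|exact: cq].
apply/funext => t; rewrite -(ID (sqi_mul (sp t) sw) (sqi_mul (sq t) sw)).
by apply: eqI => x; rewrite mulrDl.
Qed.

(* Weak convergence makes a nonnegative quadratic form lower semicontinuous. *)
Lemma quad_measurable0 p K (C : R) : wpath p -> mfun3 K -> (forall x, 0 <= K x <= C) ->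
  measurable_fun setT (fun t : R => \int[leb3]_x (p t x ^+ 2 * K x)).
Proof.
move=> [sp cp] mK hK.
have bK x : `|K x| <= C by have /andP[h1 h2] := hK x; rewrite ger0_norm.
pose F t := \int[leb3]_x (p t x ^+ 2 * K x).
have iF t := intgM_bd (sp t).2 mK bK.
have sK t := sqiM_bd (sp t) mK bK.
have low t t0 : 2 * \int[leb3]_x (p t x * (p t0 x * K x)) - F t0 <= F t.
  have i1 := sqi_mul (sp t) (sK t0).
  rewrite lerBlDr -(IZ 2 i1) -(ID (iF t) (iF t0)); apply: Ile.
  - exact: intgZ.
  - exact: intgD.
  move=> x; have /andP[K0 _] := hK x.
  have h : 0 <= (p t x - p t0 x) ^+ 2 * K x by rewrite mulr_ge0// sqr_ge0.
  lra.
have lsc : lower_semicontinuous (EFin \o F).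
  apply/lower_semicontinuousP => a; rewrite openE => t0 /=; rewrite lte_fin => h.
  have c := cp _ (sK t0) t0.
  have e : \int[leb3]_x (p t0 x * (p t0 x * K x)) = F t0 by apply: eqI => x; rewrite mulrA.
  rewrite /continuous_at e in c.
  have e0 : 0 < (F t0 - a) / 2 by rewrite divr_gt0// subr_gt0.
  move/cvgrPdist_lt : c => /(_ _ e0); apply: filterS => t /=.
  rewrite lte_fin; have := low t t0.
  move: h; move: (\int[leb3]_x _) (F t0) (F t) => u v w h h1; rewrite ltr_norml => /andP[h2 h3].
  lra.
by have /measurable_EFinP := lower_semicontinuous_measurable lsc.
Qed.

Lemma quad_measurable p K (C : R) : wpath p -> mfun3 K -> (forall x, `|K x| <= C) ->
  measurable_fun setT (fun t : R => \int[leb3]_x (p t x ^+ 2 * K x)).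
Proof.
move=> wp mK hK; have [sp _] := wp.
have h1 : measurable_fun setT (fun t => \int[leb3]_x (p t x ^+ 2 * (K x + C))).
  apply: (@quad_measurable0 p _ (C + C)) => //; first exact: measurable_funD.
  by move=> x; have := hK x; rewrite ler_norml => /andP[a b]; lra.
have C0 : 0 <= C by apply: le_trans (hK 0).
have h2 : measurable_fun setT (fun t => \int[leb3]_x (p t x ^+ 2 * C)).
  by apply: (@quad_measurable0 p _ C wp (measurable_cst _)) => x; rewrite C0 lexx.
apply: eq_measurable_fun (measurable_funB h1 h2) => t _ /=.
have mC : mfun3 (fun x => K x + C) by exact: measurable_funD.
have i1 : intgX (fun x => p t x ^+ 2 * (K x + C)).
  apply: (intgM_bd (C := C + C) (sp t).2 mC) => x; apply: le_trans (ler_normD _ _) _.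
  by rewrite (ger0_norm C0) lerD2r.
by rewrite -(IB i1 (intgZr C (sp t).2)); apply: eqI => x; ring.
Qed.

(** Polarisation of [quad_measurable]. Products of weakly continuous paths need not be weakly
    continuous, so measurability in time is all that remains. *)
Lemma bilinear_measurable p q K (C : R) : wpath p -> wpath q -> mfun3 K -> (forall x, `|K x| <= C) ->
  measurable_fun setT (fun t : R => \int[leb3]_x (p t x * q t x * K x)).
Proof.
move=> wp wq mK hK; have [sp _] := wp; have [sq _] := wq.
have h0 := quad_measurable (wpathD wp wq) mK hK.
have h1 := quad_measurable wp mK hK; have h2 := quad_measurable wq mK hK.
have h : measurable_fun setT (fun t => 2^-1 * (\int[leb3]_x ((p t x + q t x) ^+ 2 * K x) -
    \int[leb3]_x (p t x ^+ 2 * K x) - \int[leb3]_x (q t x ^+ 2 * K x))).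
  by apply: measurable_funM => //; do 2! apply: measurable_funB => //.
apply: eq_measurable_fun h => t _.
have i1 := intgM_bd (sp t).2 mK hK; have i2 := intgM_bd (sq t).2 mK hK.
have i3 := intgM_bd (sqiD (sp t) (sq t)).2 mK hK.
have i4 := intgB i3 i1.
have e1 := IB i3 i1; have e2 := IB i4 i2; have e3 := IZ 2^-1 (intgB i4 i2).
rewrite -e1 -e2 -e3; apply: eqI => x; by field.
Qed.

Lemma linear_measurable p w : wpath p -> sqX w ->
  measurable_fun setT (fun t : R => \int[leb3]_x (p t x * w x)).
Proof. by move=> [_ cp] sw; apply: continuous_measurable_fun; exact: cp. Qed.

Lemma nsq_measurable p : wpath p -> measurable_fun setT (fun t : R => nsqX (p t)).
Proof.
move=> wp; have h := @quad_measurable p (fun=> 1) 1 wp.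
have := h _ _; rewrite (_ : (fun t => \int[leb3]_x (p t x ^+ 2 * 1)) = fun t => nsqX (p t)).
  by apply => [|x]; [exact: measurable_cst|rewrite normr1].
by apply/funext => t; apply: eqI => x; rewrite mulr1.
Qed.

End Paths.

(** * The weak formulation on stationary test fields *)

Section WeakFormulation.
Context {R : realType} (chi : space3 R -> R) (hchi : lp_cutoff chi).
Local Notation X := (space3 R).
Implicit Types (s t : R) (x y v : X) (i j : 'I_3) (ps : vfield R).

Definition flux (u : vfield R) (ps : vfield R) : R :=
  \sum_i \sum_j \int[leb3]_x (u i x * u j x * 'd_j (ps i) x).

Definition visc (u : vfield R) (ps : vfield R) : R :=
  \sum_i \int[leb3]_x (u i x * laplacian (ps i) x).

Definition pair (u : vfield R) (ps : vfield R) : R :=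
  \sum_i \int[leb3]_x (u i x * ps i x).

Lemma inner_pair (u ps : vfield R) : vsqX u -> vsqX ps ->
  inner u ps = pair u ps.
Proof. by move=> su sp; rewrite /inner Isum// => i; exact: sqi_mul. Qed.

Lemma test_reg (f : X -> R) : test_function f -> reg f.
Proof. by move=> /test_functionP/tfun_schw/schw_reg. Qed.

Lemma laplacian_reg (f : X -> R) : reg f -> reg (laplacian f).
Proof. by move=> rf; apply: reg_sum => i; do 2! apply: reg_D. Qed.

Lemma flux_intg (u : vfield R) i j (K : X -> R) : vsqX u -> reg K ->
  intgX (fun x => u i x * u j x * K x).
Proof.
move=> su rK; have [C hC] := reg_bounded rK.
exact: intgM_bd (sqi_mul (su i) (su j)) (smooth_mfun3 (reg_smooth rK)) hC.
Qed.

Lemma inner_flux (u ps : vfield R) : vsqX u -> (forall i, reg (ps i)) ->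
  inner (fun i x => \sum_j u j x * partial j (ps i) x) u = flux u ps.
Proof.
move=> su rp; rewrite /inner Isum; last first.
  move=> i; have h j := flux_intg i j su (reg_D 'u_j (rp i)).
  apply: intg_ext (intg_sum (index_enum 'I_3) h) => x; rewrite mulr_suml.
  by apply: eq_bigr => j _; rewrite /partial; ring.
apply: eq_bigr => i _; have h j := flux_intg i j su (reg_D 'u_j (rp i)).
rewrite -(Isum _ h); apply: eqI => x; rewrite mulr_suml.
by apply: eq_bigr => j _; rewrite /partial; ring.
Qed.

Section TimeCutoff.
Variable T : R.
Hypothesis T0 : 0 < T.

(** A cutoff in time obtained from [chi] along an axis. It equals 1 for [|r| <= 2 T], so a
    stationary field times [tcut] has compact support in space-time and vanishing time derivative on
    [[0, T]]. *)
Definition tcut (r : R) : R := chi (((4 * T)^-1 * r) *: 'u_0).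

Lemma enorm_e1 (r : R) : enorm (r *: 'u_0 : X) = `|r|.
Proof.
rewrite /enorm dotE /= /GRing.scale/= !mulr1 !mulr0 !addr0; exact: sqrtr_sqr.
Qed.

Lemma tcut1 (r : R) : `|r| <= 2 * T -> tcut r = 1.
Proof.
have T4 : 0 < 4 * T by rewrite mulr_gt0.
move=> h; rewrite /tcut (chi_eq1 hchi)// enorm_e1 normrM gtr0_norm ?invr_gt0//.
by rewrite mulrC ler_pdivrMr; lra.
Qed.

Lemma tcut_supp (r : R) : tcut r != 0 -> `|r| <= 4 * T.
Proof.
have T4 : 0 < 4 * T by rewrite mulr_gt0.
move=> h; apply/negP => rT; move/negP: h; apply; apply/eqP.
apply: (chi_eq0 hchi); rewrite enorm_e1 normrM gtr0_norm ?invr_gt0// mulrC ler_pdivlMr//.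
lra.
Qed.

Definition spacetime (f : X -> R) (z : R * X) : R := tcut z.1 * f z.2.

Lemma test_spacetime f : test_function f -> test_function (spacetime f).
Proof.
move=> /test_functionP [sf [M hM]].
have [sc _] := (etf_chi hchi).1; split.
  apply: smoothM.
    have [||_] := @smooth_comp_affine R (R * X)%type X chi (fun z => ((4 * T)^-1 * z.1) *: 'u_0) 0 sc.
    - move=> z; apply: cvgZr_tmp; apply: cvgM; [exact: cvg_cst|exact: cvg_fst].
    - by move=> z w h; rewrite /= scalerA -scalerDl; congr (_ *: _); rewrite /GRing.scale/=; ring.
    by apply: smooth_ext => z; rewrite addr0.
  have [||_] := @smooth_comp_affine R (R * X)%type X f (fun z => z.2) 0 sf.
  - by move=> z; exact: cvg_snd.
  - by [].
  by apply: smooth_ext => z; rewrite addr0.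
apply: (@compact_supp_sub R (R * X)%type _ (`[- (4 * T), 4 * T]%classic `*` [set x : X | `|x| <= M])).
  by apply: compact_setX; [exact: segment_compact|exact: compact_box].
move=> z; rewrite mulf_eq0 negb_or => /andP[/tcut_supp h1 /hM h2]; split => //=.
by rewrite in_itv/= -ler_norml.
Qed.

End TimeCutoff.

(** The initial datum enters through the constant [c] alone, since only differences between two
    times are used later. *)
Lemma weak_test nu T (u0 : vfield R) (u : R -> vfield R) ps : 0 < T -> weak_solution nu T u0 u ->
  (forall i, test_function (ps i)) -> (forall x, divergence ps x = 0) ->
  exists c : R, forall t, 0 <= t <= T -> pair (u t) ps - c =
    \int[leb]_(s in `[0, t]) (nu * visc (u s) ps + flux (u s) ps).
Proof.
move=> T0 [[L2u cu] u00 du weak] tp dp.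
have sqi_u s : 0 <= s <= T -> forall i, sqX (u s i).
  by move=> sT i; apply/sqi_L2; apply: L2u; rewrite in_itv.
have rps i : reg (ps i) := test_reg (tp i).
have hphi : solenoidal_test_field T (fun i => spacetime T (ps i)).
  split; first by move=> i; exact: test_spacetime.
  move=> s x sT; rewrite /divergence (eq_bigr (fun i : 'I_3 => tcut T s * partial i (ps i) x)).
    by rewrite -mulr_sumr; have := dp x; rewrite /divergence => ->; rewrite mulr0.
  move=> i _; rewrite /partial /spacetime /= DZ//.
  exact: smooth_derivable (reg_smooth (rps i)).
have tc s : 0 <= s <= T -> tcut T s = 1.
  by move=> /andP[s0 sT]; apply: tcut1 => //; rewrite ger0_norm//; move: sT T0; lra.
have at1 s : 0 <= s <= T -> (fun i x => spacetime T (ps i) (s, x)) = ps.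
  by move=> sT; apply/funext => i; apply/funext => x; rewrite /spacetime /= tc// mul1r.
exists (inner u0 ps) => t tT.
have z0 : 0 <= (0 : R) <= T by rewrite lexx ltW.
have tI : t \in `[0, T] by rewrite in_itv.
have := weak _ hphi t tI; rewrite /= (at1 t tT) (at1 0 z0).
rewrite (inner_pair (sqi_u _ tT) (fun i => reg_sqi (rps i))) => ->.
apply: eq_Rintegral => s; rewrite inE /= in_itv/= => /andP[s0 st].
have sT : 0 <= s <= T by rewrite s0 (le_trans st)//; case/andP: tT.
have -> : inner (u s) (fun i x => (fun r : R => spacetime T (ps i) (r, x))^`()%classic s) = 0.
  rewrite /inner (_ : (fun x => _) = fun=> 0) ?I0//; apply/funext => x; apply: big1 => i _.
  rewrite derive1E (_ : 'D_1 _ s = 0) ?mulr0//.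
  rewrite -(Dcst (ps i x) s 1); apply: near_eq_derive.
  have sl : s < 2 * T by case/andP: sT => _ sT; lra.
  have sl' : - (2 * T) < s by move: s0 T0; lra.
  near=> r; rewrite /spacetime tcut1 ?mul1r// ler_norml; apply/andP; split; apply: ltW.
    by near: r; apply: (cvgr_gt s).
  by near: r; apply: (cvgr_lt s).
rewrite add0r; congr (_ * _ + _).
  rewrite inner_pair; [|exact: sqi_u|].
    apply: eq_bigr => i _; apply: eqI => x; congr (_ * laplacian _ x).
    by apply/funext => y; have := congr1 (fun h => h i y) (at1 s sT).
  move=> i; rewrite (_ : (fun x => _) = ps i); last first.
    by apply/funext => y; have := congr1 (fun h => h i y) (at1 s sT).
  exact: reg_sqi (laplacian_reg (rps i)).
transitivity (inner (fun i x => \sum_j u s j x * partial j (ps i) x) (u s)); last first.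
  exact: inner_flux (sqi_u _ sT) rps.
exact: (congr1 (fun p => inner (fun i x => \sum_j u s j x * partial j (p i) x) (u s)) (at1 s sT)).
Unshelve. all: end_near.
Qed.

Definition nsq3 (w : vfield R) : R := \sum_i nsqX (w i).

Lemma nsq3_ge0 w : 0 <= nsq3 w.
Proof. by apply: sumr_ge0 => i _; exact: nsq_ge0. Qed.

Lemma nsq_le3 (w : vfield R) i : nsqX (w i) <= nsq3 w.
Proof.
rewrite /nsq3 (bigD1 i)//= lerDl; apply: sumr_ge0 => j _; exact: nsq_ge0.
Qed.

Lemma N2_le_en (w : vfield R) i : N2X (w i) <= 1 + nsq3 w.
Proof.
have := nsq_le3 w i; rewrite -N2_sqr.
nra.
Qed.

Lemma N2M_le_en (w : vfield R) i j : N2X (w i) * N2X (w j) <= 1 + nsq3 w.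
Proof.
have := nsq_le3 w i; have := nsq_le3 w j; rewrite -!N2_sqr.
nra.
Qed.

(** The convergence of test fields under which the weak identity passes to the limit: weak in L^2
    for the linear terms, pointwise and bounded for the quadratic one. Norm convergence would be too
    much to ask, both for vanishing low frequencies and along weakly continuous paths. *)
Definition rconv (Bn : nat -> X -> R) (B : X -> R) : Prop := [/\ forall n, reg (Bn n), reg B &
  forall l, [/\ forall f, sqX f ->
      \int[leb3]_x (f x * iter_derive l (Bn n) x) @[n --> \oo] --> \int[leb3]_x (f x * iter_derive l B x),
    forall x, iter_derive l (Bn n) x @[n --> \oo] --> iter_derive l B x &
    exists D : R, forall n, N2X (iter_derive l (Bn n)) <= D /\ forall x, `|iter_derive l (Bn n) x| <= D]].

Lemma rconv_cst B : reg B -> rconv (fun=> B) B.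
Proof.
move=> rB; split => // l; split.
- by move=> f _; exact: cvg_cst.
- by move=> x; exact: cvg_cst.
- have [sl [C hC]] := rB.2 l; exists (Num.max (N2X (iter_derive l B)) C) => n.
  by split; [rewrite le_max lexx|move=> x; rewrite le_max hC orbT].
Qed.

Lemma rconv_D v Bn B : rconv Bn B -> rconv (fun n => 'D_v (Bn n)) ('D_v B).
Proof.
move=> [rn rB h]; split; [by move=> n; exact: reg_D|exact: reg_D|move=> l].
have [h1 h2 [D hD]] := h (rcons l v); rewrite iter_derive_rcons in h1 h2.
split.
- by move=> f sf; have := h1 f sf; under eq_fun do rewrite iter_derive_rcons.
- by move=> x; have := h2 x; under eq_fun do rewrite iter_derive_rcons.
- by exists D => n; have := hD n; rewrite iter_derive_rcons.
Qed.

Lemma rconvD An A Bn B : rconv An A -> rconv Bn B ->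
  rconv (fun n x => An n x + Bn n x) (fun x => A x + B x).
Proof.
move=> [ra rA ha] [rb rB hb]; split; [by move=> n; exact: regD|exact: regD|move=> l].
have [a1 a2 [Da hDa]] := ha l; have [b1 b2 [Db hDb]] := hb l.
have e n : iter_derive l (fun x => An n x + Bn n x) = fun x => iter_derive l (An n) x + iter_derive l (Bn n) x.
  by apply: iter_deriveD; exact: reg_smooth.
have e0 : iter_derive l (fun x => A x + B x) = fun x => iter_derive l A x + iter_derive l B x.
  by apply: iter_deriveD; exact: reg_smooth.
split.
- move=> f sf; rewrite e0 (_ : (fun n => _) = fun n => \int[leb3]_x (f x * iter_derive l (An n) x) + \int[leb3]_x (f x * iter_derive l (Bn n) x)).
    have i1 := sqi_mul sf (rA.2 l).1; have i2 := sqi_mul sf (rB.2 l).1.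
    rewrite (_ : \int[leb3]_x _ = \int[leb3]_x (f x * iter_derive l A x) + \int[leb3]_x (f x * iter_derive l B x)).
      by apply: cvgD; [exact: a1|exact: b1].
    by rewrite -(ID i1 i2); apply: eqI => x; rewrite mulrDr.
  apply/funext => n; have i1 := sqi_mul sf ((ra n).2 l).1; have i2 := sqi_mul sf ((rb n).2 l).1.
  by rewrite -(ID i1 i2); apply: eqI => x; rewrite e mulrDr.
- by move=> x; rewrite e0; under eq_fun do rewrite e; apply: cvgD.
- exists (Da + Db) => n; have [n1 p1] := hDa n; have [n2 p2] := hDb n; rewrite e; split.
    by apply: le_trans (N2D ((ra n).2 l).1 ((rb n).2 l).1) _; exact: lerD.
  by move=> x; apply: le_trans (ler_normD _ _) _; exact: lerD.
Qed.

Lemma rconvN Bn B : rconv Bn B -> rconv (fun n x => (-1) * Bn n x) (fun x => (-1) * B x).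
Proof.
move=> [rb rB hb]; split; [by move=> n; exact: regZ|exact: regZ|move=> l].
have [b1 b2 [Db hDb]] := hb l.
have e n : iter_derive l (fun x => (-1) * Bn n x) = fun x => (-1) * iter_derive l (Bn n) x.
  by apply: iter_deriveZ; exact: reg_smooth.
have e0 : iter_derive l (fun x => (-1) * B x) = fun x => (-1) * iter_derive l B x.
  by apply: iter_deriveZ; exact: reg_smooth.
split.
- move=> f sf; rewrite e0 (_ : (fun n => _) = fun n => (-1) * \int[leb3]_x (f x * iter_derive l (Bn n) x)).
    rewrite (_ : \int[leb3]_x _ = (-1) * \int[leb3]_x (f x * iter_derive l B x)).
      by apply: cvgM; [exact: cvg_cst|exact: b1].
    by rewrite -(IZ (-1) (sqi_mul sf (rB.2 l).1)); apply: eqI => x; rewrite mulrCA.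
  by apply/funext => n; rewrite -(IZ (-1) (sqi_mul sf ((rb n).2 l).1)); apply: eqI => x; rewrite e mulrCA.
- by move=> x; rewrite e0; under eq_fun do rewrite e; apply: cvgM; [exact: cvg_cst|exact: b2].
- exists Db => n; have [n2 p2] := hDb n; rewrite e; split; first by rewrite (N2Z (-1) ((rb n).2 l).1) normrN1 mul1r.
  by move=> x; rewrite normrM normrN1 mul1r.
Qed.

Lemma rconv_sum (J : Type) (s : seq J) (F : J -> nat -> X -> R) (G : J -> X -> R) :
  (forall j : J, rconv (F j) (G j)) -> rconv (fun n x => \sum_(j <- s) F j n x) (fun x => \sum_(j <- s) G j x).
Proof.
move=> h; elim: s => [|j s IH].
  rewrite (_ : (fun n => _) = fun _ _ => 0); last by apply/funext => n; apply/funext => x; rewrite big_nil.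
  rewrite (_ : (fun x => _) = fun=> 0); last by apply/funext => x; rewrite big_nil.
  by apply: rconv_cst; apply: schw_reg; exact: schw0.
rewrite (_ : (fun n => _) = fun n x => F j n x + \sum_(j <- s) F j n x); last first.
  by apply/funext => n; apply/funext => x; rewrite big_cons.
rewrite (_ : (fun x => _) = fun x => G j x + \sum_(j <- s) G j x); last by apply/funext => x; rewrite big_cons.
exact: rconvD.
Qed.

Lemma rconv_ext An Bn A B : (forall n, An n = Bn n) -> A = B -> rconv An A -> rconv Bn B.
Proof. by move=> /funext <- <-. Qed.

Lemma rconv_truncation B : reg B -> rconv (fun n x => chis chi (lambda n) x * B x) B.
Proof.
move=> rB; have [tB hB] := truncation hchi rB; split => //; first by move=> n; exact: test_reg.
move=> l; have [lB [G [sG G0 [D hD] hG]]] := hB l; split.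
- by move=> f sf; exact: test_pairing_lim.
- by move=> x; have [N hN] := lB x; apply: cvg_near_cst; exists N => // n Nn.
- exists (Num.max (N2X G) D) => n; split=> [|x]; rewrite le_max.
    rewrite N2_le//; first by apply: smooth_mfun3; apply: smooth_iter; exact: reg_smooth (test_reg (tB n)).
    by move=> x; rewrite (ger0_norm (G0 x)).
  by rewrite (le_trans (hG n x) (hD x)) orbT.
Qed.

Lemma rconv_ccurl (bn : nat -> vfield R) (b : vfield R) i :
  (forall j, rconv (fun n => bn n j) (b j)) -> rconv (fun n => ccurl (bn n) i) (ccurl b i).
Proof.
move=> h; apply: rconv_sum => j.
have h1 := rconv_D 'u_i (rconv_D 'u_j (h j)).
have h2 := rconvN (rconv_D 'u_j (rconv_D 'u_j (h i))).
apply: rconv_ext (rconvD h1 h2).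
  by move=> n; apply/funext => x; rewrite mulN1r.
by apply/funext => x; rewrite mulN1r.
Qed.

End WeakFormulation.

(** * The weak identity tested on truncations of divergence-free fields *)

Section WeakIdentity.
Context {R : realType} (chi : space3 R -> R) (hchi : lp_cutoff chi).
Local Notation X := (space3 R).
Implicit Types (s t : R) (x y : X) (i j : 'I_3) (ps w : vfield R).

Lemma flux_le w ps (D : R) : vsqX w -> (forall i, reg (ps i)) ->
  (forall i j x, `|'d_j (ps i) x| <= D) ->
  `|flux w ps| <= \sum_(i < 3) \sum_(j < 3) D * (1 + nsq3 w).
Proof.
move=> sw rp hD; have D0 : 0 <= D by apply: le_trans (hD 0 0 0).
apply: le_trans (ler_norm_sum _ _ _) _; apply: ler_sum => i _.
apply: le_trans (ler_norm_sum _ _ _) _; apply: ler_sum => j _.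
have i1 := intg_abs (sqi_mul (sw i) (sw j)).
apply: (@le_trans _ _ (D * \int[leb3]_x `|w i x * w j x|)).
  rewrite -(IZ D i1); apply: Iabs_le; [|exact: intgZ|move=> x].
    exact: intg_meas (flux_intg i j sw (reg_D 'u_j (rp i))).
  by rewrite normrM mulrC ler_wpM2r.
rewrite ler_wpM2l//; apply: le_trans (N2M_le_en w i j).
have -> : \int[leb3]_x `|w i x * w j x| = \int[leb3]_x (`|w i x| * `|w j x|).
  by apply: eqI => x; rewrite normrM.
apply: le_trans (ler_norm _) _; rewrite -(N2_abs (w i)) -(N2_abs (w j)).
by apply: cauchy_schwarz; exact: sqi_abs.
Qed.

Lemma visc_le w ps (D : R) : vsqX w -> (forall i, reg (ps i)) ->
  (forall i, N2X (laplacian (ps i)) <= D) ->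
  `|visc w ps| <= \sum_(i < 3) D * (1 + nsq3 w).
Proof.
move=> sw rp hD; apply: le_trans (ler_norm_sum _ _ _) _; apply: ler_sum => i _.
apply: le_trans (cauchy_schwarz (sw i) (reg_sqi (laplacian_reg (rp i)))) _.
by rewrite mulrC; apply: ler_pM; [exact: N2_ge0|exact: N2_ge0|exact: hD|exact: N2_le_en].
Qed.

Variables (nu T : R) (v : R -> vfield R).
Hypothesis (nu0 : 0 < nu).
Hypothesis wv : forall i, wpath (fun t => v t i).
Hypothesis hE : Ig 0 T (fun s => nsq3 (v s)).

Let sv t i : sqX (v t i) := (wv i).1 t.

Definition rhs ps s : R := nu * visc (v s) ps + flux (v s) ps.

Definition wid ps : Prop := forall t1 t2, 0 <= t1 -> t1 <= t2 -> t2 <= T ->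
  pair (v t2) ps - pair (v t1) ps = It t1 t2 (rhs ps).

Lemma rhs_measurable ps : (forall i, reg (ps i)) -> measurable_fun setT (rhs ps).
Proof.
move=> rp; apply: measurable_funD.
  apply: measurable_funM => //; apply: measurable_sum => i.
  exact: linear_measurable (wv i) (reg_sqi (laplacian_reg (rp i))).
apply: measurable_sum => i; apply: measurable_sum => j.
have rD := reg_D 'u_j (rp i); have [C hC] := reg_bounded rD.
exact: bilinear_measurable (wv i) (wv j) (smooth_mfun3 (reg_smooth rD)) hC.
Qed.

Definition en s : R := 1 + nsq3 (v s).

Lemma Ig_en : Ig 0 T en.
Proof. exact: IgD (Ig_cst 0 T 1) hE. Qed.

Lemma rhs_le ps (D : R) s : 0 <= D -> (forall i, reg (ps i)) -> (forall i, N2X (laplacian (ps i)) <= D) ->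
  (forall i j x, `|'d_j (ps i) x| <= D) ->
  `|rhs ps s| <= ((nu * 3 + 9) * D) * en s.
Proof.
move=> D0 rp h1 h2; apply: le_trans (ler_normD _ _) _.
have f1 := flux_le (sv s) rp h2; have f2 := visc_le (sv s) rp h1.
rewrite normrM (gtr0_norm nu0).
have e1 : \sum_(i < 3) D * (1 + nsq3 (v s)) = 3 * D * en s.
  by rewrite !big_ord_recl big_ord0 /en; ring.
have e2 : \sum_(i < 3) \sum_(j < 3) D * (1 + nsq3 (v s)) = 9 * D * en s.
  by rewrite !big_ord_recl !big_ord0 /en; ring.
rewrite e1 in f2.
have := ler_wpM2l (ltW nu0) f2.
lra.
Qed.

Lemma reg_bound2 ps : (forall i, reg (ps i)) -> exists D : R, [/\ 0 <= D, forall i, N2X (laplacian (ps i)) <= D &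
  forall i j x, `|'d_j (ps i) x| <= D].
Proof.
move=> rp.
have [C hC] : exists C : 'I_3 -> 'I_3 -> R, forall i j x, `|'d_j (ps i) x| <= C i j.
  exists (fun i j => projT1 (cid (reg_bounded (reg_D 'u_j (rp i))))) => i j x.
  exact: projT2 (cid (reg_bounded (reg_D 'u_j (rp i)))) x.
have C0 i j : 0 <= C i j by apply: le_trans (hC i j 0).
exists (\sum_i N2X (laplacian (ps i)) + \sum_i \sum_j C i j).
have s1 : 0 <= \sum_i N2X (laplacian (ps i)) by apply: sumr_ge0 => i _; exact: N2_ge0.
have s2 : 0 <= \sum_i \sum_j C i j by apply: sumr_ge0 => i _; apply: sumr_ge0.
split; first exact: addr_ge0.
- move=> i; apply: (@le_trans _ _ (\sum_i N2X (laplacian (ps i)))); last by rewrite lerDl.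
  rewrite (bigD1 i)//= lerDl.
  by apply: sumr_ge0 => j _; exact: N2_ge0.
- move=> i j x; apply: le_trans (hC i j x) _; apply: (@le_trans _ _ (\sum_i \sum_j C i j)); last by rewrite lerDr.
  rewrite (bigD1 i)//= (bigD1 j)//= -addrA lerDl addr_ge0//.
    exact: sumr_ge0.
  by apply: sumr_ge0 => k _; apply: sumr_ge0.
Qed.

Lemma Ig_rhs ps t1 t2 : 0 <= t1 -> t2 <= T -> (forall i, reg (ps i)) -> Ig t1 t2 (rhs ps).
Proof.
move=> t10 t2T rp; apply: Ig_sub t10 t2T _.
have [D [D0 h1 h2]] := reg_bound2 rp.
apply: (Ig_le (rhs_measurable rp) (IgZ ((nu * 3 + 9) * D) Ig_en)) => s _; exact: rhs_le.
Qed.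

Lemma rconv_laplacian (Bn : nat -> X -> R) (B : X -> R) : rconv Bn B -> rconv (fun n => laplacian (Bn n)) (laplacian B).
Proof.
move=> h; apply: (@rconv_sum _ _ _ (fun i n => 'd_i ('d_i (Bn n)))
   (fun i => 'd_i ('d_i B))) => i.
by do 2! apply: rconv_D.
Qed.

Lemma rhs_lim (pn : nat -> vfield R) ps s : (forall i, rconv (fun n => pn n i) (ps i)) ->
  rhs (pn n) s @[n --> \oo] --> rhs ps s.
Proof.
move=> h; apply: cvgD.
  apply: cvgM; first exact: cvg_cst.
  apply: cvg_sumr => i; have [_ _ /(_ [::])[c _ _]] := rconv_laplacian (h i).
  exact: c (sv s i).
apply: cvg_sumr => i; apply: cvg_sumr => j.
have [rn rB /(_ [::])[_ c [D hD]]] := rconv_D 'u_j (h i).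
apply: proj2 (@Idct _ _ R leb3 (fun n x => v s i x * v s j x * 'd_j (pn n i) x) _ (fun x => `|v s i x * v s j x| * D) _ _ _ _).
- move=> n; apply: measurable_funM; last exact: smooth_mfun3 (reg_smooth (rn n)).
  exact: measurable_funM (sv s i).1 (sv s j).1.
- exact/intgZr/intg_abs/sqi_mul.
- by move=> x; apply: cvgM; [exact: cvg_cst|exact: c].
- by move=> n x; rewrite normrM ler_wpM2l//; have [_] := hD n; apply.
Qed.

(** The uniform bounds in [rconv] give the majorant [en] in time, up to a constant; at each time
    [rhs] converges by [rhs_lim]. *)
Lemma wid_lim (pn : nat -> vfield R) ps : (forall i, rconv (fun n => pn n i) (ps i)) ->
  (forall n, wid (pn n)) -> wid ps.
Proof.
move=> h hw t1 t2 t10 t12 t2T.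
have rn n i : reg (pn n i) by case: (h i).
have c1 t : pair (v t) (pn n) @[n --> \oo] --> pair (v t) ps.
  by apply: cvg_sumr => i; have [_ _ /(_ [::])[c _ _]] := h i; exact: c (sv t i).
have hD1 i : exists D : R, forall n, N2X (laplacian (pn n i)) <= D.
  by have [_ _ /(_ [::])[_ _ [D hD]]] := rconv_laplacian (h i); exists D => n; case: (hD n).
have hD2 i j : exists D : R, forall n x, `|'d_j (pn n i) x| <= D.
  by have [_ _ /(_ [::])[_ _ [D hD]]] := rconv_D 'u_j (h i); exists D => n; case: (hD n).
have [C1 hC1] : exists C : 'I_3 -> R, forall i n, N2X (laplacian (pn n i)) <= C i.
  by exists (fun i => projT1 (cid (hD1 i))) => i; exact: projT2 (cid (hD1 i)).
have [C2 hC2] : exists C : 'I_3 -> 'I_3 -> R, forall i j n x, `|'d_j (pn n i) x| <= C i j.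
  by exists (fun i j => projT1 (cid (hD2 i j))) => i j; exact: projT2 (cid (hD2 i j)).
have C10 i := le_trans (N2_ge0 _ _) (hC1 i 0%N).
have C20 i j := le_trans (normr_ge0 _) (hC2 i j 0%N 0).
pose D := \sum_i C1 i + \sum_i \sum_j C2 i j.
have s1 : 0 <= \sum_i C1 i by apply: sumr_ge0.
have s2 : 0 <= \sum_i \sum_j C2 i j by apply: sumr_ge0 => i _; apply: sumr_ge0.
have D0 : 0 <= D by exact: addr_ge0.
have b1 n i : N2X (laplacian (pn n i)) <= D.
  apply: le_trans (hC1 i n) _; apply: (@le_trans _ _ (\sum_i C1 i)); last by rewrite lerDl.
  by rewrite (bigD1 i)//= lerDl; apply: sumr_ge0.
have b2 n i j x : `|'d_j (pn n i) x| <= D.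
  apply: le_trans (hC2 i j n x) _; apply: (@le_trans _ _ (\sum_i \sum_j C2 i j)); last by rewrite lerDr.
  rewrite (bigD1 i)//= (bigD1 j)//= -addrA lerDl addr_ge0//.
    exact: sumr_ge0.
  by apply: sumr_ge0 => k _; apply: sumr_ge0.
have [_ c2] := @It_dct R t1 t2 (fun n => rhs (pn n)) (rhs ps) (fun s => ((nu * 3 + 9) * D) * en s)
  (fun n => rhs_measurable (rn n)) (Ig_sub t10 t2T (IgZ _ Ig_en))
  (fun s _ => rhs_lim h) (fun n s _ => rhs_le s D0 (rn n) (b1 n) (b2 n)).
exact: lim_eq (fun n => hw n t1 t2 t10 t12 t2T) (cvgB (c1 t2) (c1 t1)) c2.
Qed.

Hypothesis hweak : forall ps, (forall i, test_function (ps i)) -> (forall x, divergence ps x = 0) ->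
  exists c : R, forall t, 0 <= t <= T -> pair (v t) ps - c = \int[leb]_(s in `[0, t]) rhs ps s.

Lemma wid_test ps : (forall i, test_function (ps i)) -> (forall x, divergence ps x = 0) -> wid ps.
Proof.
move=> tp dp t1 t2 t10 t12 t2T; have [c hc] := hweak tp dp.
have rp i := test_reg (tp i).
have h1 : 0 <= t1 <= T by rewrite t10 (le_trans t12).
have h2 : 0 <= t2 <= T by rewrite (le_trans t10).
have i2 := Ig_rhs (lexx 0) t2T rp; have i1 := Ig_rhs (lexx 0) (le_trans t12 t2T) rp.
have := hc _ h1; have := hc _ h2; rewrite (It_itv i1) (It_itv i2) (It_add t10 t12 i2).
lra.
Qed.

(** Cutting off a field in space destroys its divergence condition. The cutoff is therefore applied
    to the potential [b], since any double curl is divergence free. *)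
Lemma wid_ccurl (b : vfield R) : (forall i, reg (b i)) -> wid (ccurl b).
Proof.
move=> rb; pose bn n : vfield R := fun i x => chis chi (lambda n) x * b i x.
apply: (@wid_lim (fun n => ccurl (bn n))) => [i|n].
  by apply: rconv_ccurl => j; exact: rconv_truncation.
have tb i : test_function (bn n i) by have [+ _] := truncation hchi (rb i); exact.
have sb i := reg_smooth (test_reg (tb i)).
have tt i : tfun (bn n i) by apply/test_functionP.
apply: wid_test => [i|x]; last exact: div_ccurl.
apply/test_functionP; split; first exact: smooth_ccurl.
have h : tfun (ccurl (bn n) i).
  rewrite /ccurl; elim: index_enum => [|j r IH].
    split; first by apply: smooth_ext (smooth_cst 0) => x; rewrite big_nil.
    by exists 0 => x; rewrite big_nil eqxx.
  rewrite (_ : (fun x => _) = fun x => ('d_i ('d_j (bn n j)) x -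
          'd_j ('d_j (bn n i)) x) + \sum_(j <- r) ('d_i ('d_j (bn n j)) x -
          'd_j ('d_j (bn n i)) x)); last by apply/funext => x; rewrite big_cons.
  by apply: tfunD => //; apply: tfunB; do 2! apply: tfun_D.
exact: h.2.
Qed.

Lemma wid_ext ps ps' : ps = ps' -> wid ps -> wid ps'.
Proof. by move=> ->. Qed.

(* [S_n w - S_eps w = curl curl (kappa * w)] with
   [kappa^ = (chi_n - chi_eps) / |xi|^2]. *)
Lemma wid_band w n m : vsqX w -> divf w ->
  wid (fun i x => Sop chi n (w i) x - op (chis chi (lambda m)^-1) (w i) x).
Proof.
move=> sw dw; have lm : 0 < (lambda m)^-1 :> R by rewrite invr_gt0 lambda_gt0.
have em := etf_chis hchi lm; have en' := etf_chil hchi n.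
have [|be eb hb] := division hchi (etfB en' em) (divr_gt0 lm (ltr0n _ 2)).
  move=> xi h; have l1 : (lambda m)^-1 <= 1 :> R by rewrite invf_le1 ?lambda_gt0// lambda_ge1.
  have h' := ltW h; rewrite (chis_eq1 hchi lm h') (chis_eq1 hchi (lambda_gt0 n)) ?subrr//.
  apply: le_trans h' _; rewrite ler_pM2r ?invr_gt0//; exact: le_trans l1 (lambda_ge1 n).
have sk := schw_kern eb.1.
apply: wid_ext (wid_ccurl (fun i => conv_reg sk (sw i))).
apply/funext => i; apply/funext => x; rewrite /ccurl sumrB.
have e1 : \sum_j 'd_i ('d_j (conv (kern be) (w j))) x = 0.
  have d0 : (fun y => \sum_j 'd_j (conv (kern be) (w j)) y) = fun=> 0.
    apply/funext => y; rewrite -[RHS](divf_conv y sw dw sk).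
    by apply: eq_bigr => j _; exact: (D_conv y 'u_j sk (sw j)).2.
  have sF (j : 'I_3) : smooth ('d_j (conv (kern be) (w j))).
    by apply: smooth_D; exact: smooth_conv.
  rewrite -(Dsum (index_enum 'I_3) 'u_i x sF).
  by rewrite d0 (Dcst 0).
have e2 j : 'd_j ('d_j (conv (kern be) (w i))) x =
    conv ('d_j ('d_j (kern be))) (w i) x.
  have := congr1 (@^~ x) (iter_derive_conv [:: 'u_j; 'u_j] sk (sw i)).
  by [].
have pD (j : 'I_3) : pkern ('d_j ('d_j (kern be))).
  by apply: schw_pkern; do 2! apply: schw_D.
have e4 : \sum_j 'd_j ('d_j (conv (kern be) (w i))) x =
    conv (fun y => \sum_j 'd_j ('d_j (kern be)) y) (w i) x.
  by rewrite (conv_suml (index_enum 'I_3) x pD (sw i)); apply: eq_bigr => j _.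
have e3 : (fun y => \sum_j 'd_j ('d_j (kern be)) y) = fun y => (-1) * kern (fun xi => chis chi (lambda n) xi - chis chi (lambda m)^-1 xi) y.
  apply/funext => y; rewrite (laplacian_kern y eb.1) mulN1r; congr (- kern _ y).
  by apply/funext => xi.
have e5 := etrans (congr1 (fun k => conv k (w i) x) e3)
  (convZl (-1) x (pkern_kern (etfB en' em).1) (sw i)).
apply: (etrans (congr2 (fun a b : R => a - b) e1 (etrans e4 e5))).
rewrite sub0r mulN1r opprK.
exact: opB x en' em (sw i).
Qed.

(** Bernstein yields a factor [(lambda m)^-1] in the sup norm, and in L^2 for derivatives. Without
    derivatives the functions are only bounded in L^2, and the convergence is the weak one of
    [low_frequency_lim]. *)
Lemma rconv_low (f : X -> R) : sqX f -> rconv (fun m => op (chis chi (lambda m)^-1) f) (fun=> 0).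
Proof.
move=> sf; have ec := etf_chi hchi.
have lm m : 0 < (lambda m)^-1 :> R by rewrite invr_gt0 lambda_gt0.
have l1 m : (lambda m)^-1 <= 1 :> R by rewrite invf_le1 ?lambda_gt0// lambda_ge1.
have em m := etf_chis hchi (lm m).
have z l : iter_derive l (fun _ => 0 : R) = fun=> 0.
  by elim: l => [//|y l IH] /=; rewrite IH; apply/funext => x; exact: (Dcst 0).
have lim0 (c : R) : (lambda m)^-1 * c @[m --> \oo] --> 0.
  rewrite -(mul0r c); apply: cvgM; last exact: cvg_cst.
  rewrite (_ : (fun n => (lambda n)^-1) = fun n => 2^-1 ^+ n); last first.
    by apply/funext => n; rewrite exprVn.
  by apply: cvg_expr; rewrite ger0_norm; lra.
have dE l m : iter_derive l (op (chis chi (lambda m)^-1) f) = conv (iter_derive l (kern (dil (lambda m)^-1 chi))) f.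
  exact: iter_derive_conv (schw_kern (em m).1) sf.
split; [by move=> m; exact: op_reg|by apply: schw_reg; exact: schw0|move=> l].
set A := N1 (iter_derive l (kern chi)) * N2X f.
set D := N2X (iter_derive l (kern chi)) * N2X f.
have A0 : 0 <= A by rewrite mulr_ge0 ?N1_ge0 ?N2_ge0.
have D0 : 0 <= D by rewrite mulr_ge0 ?N2_ge0.
have bA m : N2X (iter_derive l (op (chis chi (lambda m)^-1) f)) <= (lambda m)^-1 ^+ size l * A.
  by rewrite dE mulrA; exact: bernstein2.
have bD m x : `|iter_derive l (op (chis chi (lambda m)^-1) f) x| <= (lambda m)^-1 * D.
  rewrite dE; apply: le_trans (bernstein_2oo l x (lm m) ec sf) _; rewrite -mulrA ler_wpM2r//.
  apply: (@le_trans _ _ (1 * (lambda m)^-1)); last by rewrite mul1r.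
  apply: ler_pM; [exact: exprn_ge0 (ltW (lm m))|exact: sqrtr_ge0|exact: exprn_ile1 (ltW (lm m)) (l1 m)|].
  rewrite -[leRHS](ger0_norm (ltW (lm m))) -sqrtr_sqr ler_wsqrtr// [leLHS]exprS ler_piMl ?l1//.
  exact: exprn_ge0 (ltW (lm m)).
split.
- move=> g sg; rewrite z (_ : \int[leb3]_x (g x * 0) = 0); last first.
    by rewrite (_ : (fun x => _) = fun=> 0) ?I0//; apply/funext => x; rewrite mulr0.
  case: l => [|y l] in A D A0 D0 bA bD dE *; first exact: low_frequency_lim.
  apply: le_cvg0 => e e0; have [N hN] := cvg0_le (lim0 (N2X g * A)) e0; exists N => m /hN h.
  apply: le_trans h; apply: le_trans (ler_norm _); have sE := (op_reg (em m) sf).2 (y :: l).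
  apply: le_trans (cauchy_schwarz sg sE.1) _; rewrite mulrCA ler_wpM2l ?N2_ge0//.
  apply: le_trans (bA m) _; rewrite ler_wpM2r//= exprS ler_piMr ?(ltW (lm m))//.
  exact: exprn_ile1 (ltW (lm m)) (l1 m).
- move=> x; rewrite z; apply: le_cvg0 => e e0; have [N hN] := cvg0_le (lim0 D) e0.
  by exists N => m /hN h; apply: le_trans (bD m x) (le_trans (ler_norm _) h).
- exists (A + D) => m; split.
    apply: le_trans (bA m) _; apply: (@le_trans _ _ (1 * A)); last by rewrite mul1r lerDl.
    by rewrite ler_wpM2r//; exact: exprn_ile1 (ltW (lm m)) (l1 m).
  move=> x; apply: le_trans (bD m x) _; apply: (@le_trans _ _ (1 * D)); last by rewrite mul1r lerDr.
  by rewrite ler_wpM2r.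
Qed.

(** The division in [wid_band] requires a gap at the origin of frequency space; the gap closes as
    [m] grows, by [rconv_low]. *)
Lemma wid_Sop w n : vsqX w -> divf w -> wid (fun i => Sop chi n (w i)).
Proof.
move=> sw dw.
apply: (@wid_lim (fun m i x => Sop chi n (w i) x - op (chis chi (lambda m)^-1) (w i) x)).
  move=> i; have h1 := rconv_cst (reg_Sop hchi n (sw i)); have h2 := rconvN (rconv_low (sw i)).
  apply: rconv_ext (rconvD h1 h2); last by apply/funext => x; rewrite mulr0 addr0.
  by move=> m; apply/funext => x; rewrite mulN1r.
by move=> m; exact: wid_band.
Qed.

End WeakIdentity.

(** * Energy identity for the low frequencies *)

Section EnergyIdentity.
Context {R : realType} (chi : space3 R -> R) (hchi : lp_cutoff chi).
Local Notation X := (space3 R).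
Implicit Types (s t : R) (x y : X) (i j : 'I_3) (ps w : vfield R) (al : X -> R).

Definition opv al w : vfield R := fun i => op al (w i).

Variables (nu T : R) (v : R -> vfield R).
Hypothesis (nu0 : 0 < nu).
Hypothesis wv : forall i, wpath (fun t => v t i).
Hypothesis hE : Ig 0 T (fun s => nsq3 (v s)).
Hypothesis dv : forall t, divf (v t).
Hypothesis hweak : forall ps, (forall i, test_function (ps i)) -> (forall x, divergence ps x = 0) ->
  exists c : R, forall t, 0 <= t <= T -> pair (v t) ps - c = \int[leb]_(s in `[0, t]) rhs nu v ps s.

Let sv t i : sqX (v t i) := (wv i).1 t.

Lemma wid_opv al n w : etf al -> (forall xi, al xi * chis chi (lambda n) xi = al xi) ->
  vsqX w -> divf w -> wid nu T v (opv al w).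
Proof.
move=> ea an sw dw.
have h := wid_Sop hchi nu0 wv hE hweak n (fun i => sqi_op ea (sw i)) (divf_op hchi ea sw dw).
apply: wid_ext h; apply/funext => i; rewrite /Sop (op_op (etf_chil hchi n) ea (sw i)).
by congr (op _ (w i)); apply/funext => xi; rewrite mulrC.
Qed.

(** Evaluating a convolution at a point is pairing with an L^2 function, so weak convergence of
    [v (r n)] becomes pointwise convergence of all derivatives after smoothing. *)
Lemma rconv_path al i (r : nat -> R) t (M : R) : etf al -> (forall n, N2X (v (r n) i) <= M) ->
  r n @[n --> \oo] --> t -> rconv (fun n => op al (v (r n) i)) (op al (v t i)).
Proof.
move=> ea hM rt; have sk := schw_kern ea.1.
split; [by move=> n; exact: op_reg|exact: op_reg|move=> l].
have e s : iter_derive l (op al (v s i)) = conv (iter_derive l (kern al)) (v s i).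
  exact: iter_derive_conv.
have sl := schw_iter l sk; have pl := schw_pkern sl.
have cont (w : X -> R) : sqX w -> \int[leb3]_x (v (r n) i x * w x) @[n --> \oo] --> \int[leb3]_x (v t i x * w x).
  move=> sw; exact: @continuous_cvg _ _ _ _ _ r (fun s => \int[leb3]_x (v s i x * w x)) t ((wv i).2 w sw t) rt.
split.
- move=> f sf; rewrite e (conv_adjoint pl (sv t i) sf).
  rewrite (_ : (fun n => _) = fun n => \int[leb3]_y (v (r n) i y * conv (fun z => iter_derive l (kern al) (- z)) f y)).
    exact: cont (sqi_conv (pkern_refl pl) sf).
  by apply/funext => n; rewrite e (conv_adjoint pl (sv _ i) sf).
- move=> x; rewrite e.
  have cE s : conv (iter_derive l (kern al)) (v s i) x = \int[leb3]_y (v s i y * iter_derive l (kern al) (x - y)).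
    by apply: eqI => y; rewrite mulrC.
  rewrite cE (_ : (fun n => _) = fun n => \int[leb3]_y (v (r n) i y * iter_derive l (kern al) (x - y))).
    exact: cont (sqi_sub x (pkern_sqi pl)).
  by apply/funext => n; rewrite e.
- have M0 := le_trans (N2_ge0 _ _) (hM 0%N).
  exists ((N1 (iter_derive l (kern al)) + N2X (iter_derive l (kern al))) * M) => n; rewrite e; split.
    apply: le_trans (N2_conv pl (sv _ i)) _; apply: ler_pM => //; [exact: N1_ge0|exact: N2_ge0|].
    by rewrite lerDl N2_ge0.
  move=> x; apply: le_trans (conv_le x pl (sv _ i)) _; apply: ler_pM => //; [exact: N2_ge0|exact: N2_ge0|].
  by rewrite lerDr N1_ge0.
Qed.

Lemma opv_bound al (M : R) : etf al -> exists2 D : R, 0 <= D & forall w,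
  vsqX w -> (forall i, N2X (w i) <= M) ->
  (forall i, N2X (laplacian (opv al w i)) <= D) /\
  forall i j x, `|'d_j (opv al w i) x| <= D.
Proof.
move=> ea; have sk := schw_kern ea.1.
have sj j := schw_D 'u_j sk; have sjj j := schw_D 'u_j (sj j).
pose D1 := \sum_j N1 ('d_j ('d_j (kern al))).
pose D2 := \sum_j N2X ('d_j (kern al)).
have D10 : 0 <= D1 by apply: sumr_ge0 => j _; exact: N1_ge0.
have D20 : 0 <= D2 by apply: sumr_ge0 => j _; exact: N2_ge0.
exists ((D1 + D2) * `|M|); first by rewrite mulr_ge0// addr_ge0.
move=> w sw hM.
have hM' i := le_trans (hM i) (ler_norm M).
split.
- move=> i; apply: (@le_trans _ _ (D1 * `|M|)); last by rewrite ler_wpM2r// lerDl.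
  rewrite (_ : laplacian (opv al w i) = fun x => \sum_j conv ('d_j ('d_j (kern al))) (w i) x); last first.
    apply/funext => x; apply: eq_bigr => j _.
    have := congr1 (@^~ x) (iter_derive_conv [:: 'u_j; 'u_j] sk (sw i)).
    by [].
  apply: le_trans (N2_sum (index_enum 'I_3) (fun j => sqi_conv (schw_pkern (sjj j)) (sw i))) _.
  rewrite mulr_suml; apply: ler_sum => j _; apply: le_trans (N2_conv (schw_pkern (sjj j)) (sw i)) _.
  by rewrite ler_wpM2l ?N1_ge0.
- move=> i j x; apply: (@le_trans _ _ (D2 * `|M|)); last by rewrite ler_wpM2r// lerDr.
  rewrite (D_conv x 'u_j sk (sw i)).2; apply: le_trans (conv_le x (schw_pkern (sj j)) (sw i)) _.
  apply: ler_pM; [exact: N2_ge0|exact: N2_ge0| |exact: hM'].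
  by rewrite /D2 (bigD1 j)//= lerDl; apply: sumr_ge0 => k _; exact: N2_ge0.
Qed.

Lemma pair_opv_sym al w w' : etf al -> vsqX w -> vsqX w' ->
  pair w (opv al w') = pair w' (opv al w).
Proof. by move=> ea sw sw'; apply: eq_bigr => i _; exact: op_sym. Qed.

Lemma partition_index (d : R) (N : nat) t0 s : 0 < d -> t0 < s -> s <= t0 + N%:R * d ->
  exists k : 'I_N, t0 + k%:R * d < s <= t0 + k.+1%:R * d.
Proof.
move=> d0 t0s; elim: N => [|N IH].
  lra.
have [h|h] := leP s (t0 + N%:R * d).
  by have [k hk] := IH h; exists (widen_ord (leqnSn N) k).
by exists ord_max; rewrite h.
Qed.

(** The test field moves with the solution, for which no time derivative is available. With
    [A = opv al] self-adjoint, [(v', A v') - (v, A v) = (v' - v, A v) + (v' - v, A v')], and each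
    term is the weak identity for a frozen field. These increments telescope over a partition of
    [[t0, t1]], and the mesh tends to 0 by dominated convergence. *)
Lemma energy_identity al n t0 t1 (M : R) : etf al -> (forall xi, al xi * chis chi (lambda n) xi = al xi) ->
  0 <= t0 -> t0 <= t1 -> t1 <= T -> (forall s i, t0 <= s <= t1 -> N2X (v s i) <= M) ->
  Ig t0 t1 (fun s => 2 * rhs nu v (opv al (v s)) s) /\
  pair (v t1) (opv al (v t1)) - pair (v t0) (opv al (v t0)) = It t0 t1 (fun s => 2 * rhs nu v (opv al (v s)) s).
Proof.
move=> ea an t00 t01 t1T hM.
have wd s := wid_opv ea an (sv s) (dv s).
have ro s i := op_reg ea (sv s i).
have [D D0 hD] := opv_bound M ea.
pose d N : R := (t1 - t0) / N.+1%:R.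
pose s_ N k : R := t0 + k%:R * d N.
have d0 N : 0 <= d N by rewrite divr_ge0// subr_ge0.
have s0 N : s_ N 0%N = t0 by rewrite /s_ mul0r addr0.
have sN N : s_ N N.+1 = t1.
  have n0 : N.+1%:R != 0 :> R by rewrite pnatr_eq0.
  rewrite /s_ /d mulrC (divfK n0) addrC; exact: subrK.
have sS N k : s_ N k <= s_ N k.+1 by rewrite lerD2l ler_wpM2r// ler_nat.
have sge N k : t0 <= s_ N k by rewrite lerDl mulr_ge0.
have sle N k : (k <= N.+1)%N -> s_ N k <= t1.
  by move=> kN; rewrite -(sN N) lerD2l ler_wpM2r// ler_nat.
pose P N k := opv al (v (s_ N k)).
(* On each cell the test fields are frozen at both endpoints; both endpoints converge to [s], whence
   the factor 2 in the limit. *)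
pose F N s := \sum_(k < N.+1) \1_`]s_ N k, s_ N k.+1]%classic s * (rhs nu v (P N k) s + rhs nu v (P N k.+1) s).
have IP N k k' : (k <= N)%N -> Ig (s_ N k) (s_ N k.+1) (rhs nu v (P N k')).
  move=> kN; apply: (Ig_rhs nu0 wv hE (le_trans t00 (sge N k)) (le_trans (sle N k.+1 kN) t1T)).
  exact: ro.
have IF N : pair (v t1) (opv al (v t1)) - pair (v t0) (opv al (v t0)) = It t0 t1 (F N).
  have -> : It t0 t1 (F N) = \sum_(k < N.+1) It (s_ N k) (s_ N k.+1) (fun s => rhs nu v (P N k) s + rhs nu v (P N k.+1) s).
    rewrite /It -Isum; last first.
      by move=> k; apply: IgD; apply: IP; rewrite -ltnS.
    apply: eqI => s; rewrite mulr_sumr; apply: eq_bigr => k _; rewrite mulrA.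
    rewrite !itv1E; case: (boolP (s_ N k < s <= s_ N k.+1)) => h; rewrite ?mulr0//.
    case/andP: h => h1 h2; rewrite (le_lt_trans (sge N k) h1) (le_trans h2 (sle N k.+1 (ltn_ord k))).
    by rewrite mul1r.
  rewrite -{1}(sN N) -{1}(sN N) -{1}(s0 N) -{1}(s0 N).
  pose g k := pair (v (s_ N k)) (P N k).
  have -> : pair (v (s_ N N.+1)) (opv al (v (s_ N N.+1))) - pair (v (s_ N 0%N)) (opv al (v (s_ N 0%N))) = \sum_(0 <= k < N.+1) (g k.+1 - g k).
    by rewrite telescope_sumr.
  rewrite big_mkord; apply: eq_bigr => k _.
  have kN : (k <= N)%N by rewrite -ltnS.
  rewrite It_D; [|exact: IP|exact: IP].
  have a := wd (s_ N k) _ _ (le_trans t00 (sge N k)) (sS N k) (le_trans (sle N k.+1 kN) t1T).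
  have b := wd (s_ N k.+1) _ _ (le_trans t00 (sge N k)) (sS N k) (le_trans (sle N k.+1 kN) t1T).
  apply: (etrans _ (congr2 +%R a b)).
  have c := pair_opv_sym ea (sv (s_ N k)) (sv (s_ N k.+1)).
  have E (p q r r' : R) : r = r' -> p - q = (r' - q) + (p - r) by move=> ->; ring.
  exact: E c.
have mF N : measurable_fun setT (F N).
  apply: measurable_sum => k; apply: measurable_funM; first exact: measurable_itv1.
  by apply: measurable_funD; apply: (rhs_measurable nu wv); exact: ro.
pose C := (nu * 3 + 9) * D.
have FE N s : t0 < s <= t1 -> exists k : 'I_N.+1, s_ N k < s <= s_ N k.+1 /\
    F N s = rhs nu v (P N k) s + rhs nu v (P N k.+1) s.
  move=> /andP[h1 h2]; have dp : 0 < d N by rewrite divr_gt0// subr_gt0 (lt_le_trans h1).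
  have h3 : s <= t0 + N.+1%:R * d N by rewrite -/(s_ N N.+1) sN.
  have [k hk] := partition_index dp h1 h3; exists k.
  rewrite /F (bigD1 k)//= itv1E hk mul1r big1 ?addr0// => j jk.
  rewrite itv1E; case: (boolP (s_ N j < s <= s_ N j.+1)) => [/andP[g1 g2]|]; last by rewrite mul0r.
  case/andP: hk => k1 k2; exfalso; move/negP: jk; apply; apply/eqP/val_inj => /=.
  have mono a b : (s_ N a < s_ N b) -> (a < b)%N.
    rewrite ltrD2l ltr_pM2r// ltr_nat; exact.
  have a1 := mono j k.+1 (lt_le_trans g1 k2).
  have a2 := mono k j.+1 (lt_le_trans k1 g2).
  by apply/eqP; rewrite eqn_leq; move: a1 a2; rewrite !ltnS => -> ->.
have bM s : t0 <= s <= t1 -> (forall i, N2X (laplacian (opv al (v s) i)) <= D) /\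
  forall i j x, `|'d_j (opv al (v s) i) x| <= D.
  by move=> hs; apply: hD => [i|i]; [exact: sv|exact: hM].
have sI N k : (k <= N.+1)%N -> t0 <= s_ N k <= t1 by move=> kN; rewrite sge sle.
have bF N s : t0 < s <= t1 -> `|F N s| <= 2 * C * en v s.
  move=> hs; have [k [_ ->]] := FE N s hs; apply: le_trans (ler_normD _ _) _.
  have kN := ltn_ord k.
  have [a1 a2] := bM _ (sI N k (ltnW kN)); have [b1 b2] := bM _ (sI N k.+1 kN).
  have h1 := rhs_le nu0 wv s D0 (ro _) a1 a2; have h2 := rhs_le nu0 wv s D0 (ro _) b1 b2.
  have -> : 2 * C * en v s = C * en v s + C * en v s by ring.
  exact: lerD h1 h2.
have cF s : t0 < s <= t1 -> F N s @[N --> \oo] --> 2 * rhs nu v (opv al (v s)) s.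
  move=> hs.
  have [k hk] : exists k : forall N, 'I_N.+1, forall N, s_ N (k N) < s <= s_ N (k N).+1 /\
      F N s = rhs nu v (P N (k N)) s + rhs nu v (P N (k N).+1) s.
    by exists (fun N => projT1 (cid (FE N s hs))) => N; exact: projT2 (cid (FE N s hs)).
  rewrite (_ : (fun N => F N s) = fun N => rhs nu v (P N (k N)) s + rhs nu v (P N (k N).+1) s); last first.
    by apply/funext => N; exact: (hk N).2.
  rewrite mulrDl mul1r.
  have dlim : d N @[N --> \oo] --> 0.
    by rewrite -(mulr0 (t1 - t0)); apply: cvgM; [exact: cvg_cst|exact: cvg_harmonic].
  have lim (r : nat -> R) : (forall N, `|r N - s| <= d N) -> r N @[N --> \oo] --> s.
    move=> h; apply/cvgrPdist_le => e e0; have [N0 hN] := cvg0_le dlim e0; exists N0 => // N /hN h2.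
    by rewrite distrC; apply: le_trans (h N) (le_trans (ler_norm _) h2).
  have sd N : s_ N (k N).+1 = s_ N (k N) + d N by rewrite /s_ -natr1 mulrDl mul1r addrA.
  have l1 : s_ N (k N) @[N --> \oo] --> s.
    apply: lim => N; have [/andP[h1 h2] _] := hk N; rewrite sd in h2; rewrite ler_norml.
    lra.
  have l2 : s_ N (k N).+1 @[N --> \oo] --> s.
    apply: lim => N; have [/andP[h1 h2] _] := hk N; rewrite sd in h2; rewrite sd ler_norml.
    lra.
  apply: cvgD; apply: (rhs_lim wv) => i; apply: (rconv_path ea) => // N; apply: hM; apply: sI.
    exact: ltnW (ltn_ord (k N)).
  by [].
have [i1 c1] := It_dct mF (Ig_sub t00 t1T (IgZ (2 * C) (Ig_en hE))) cF bF.
split => //; apply: lim_eq IF _ c1; exact: cvg_cst.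
Qed.

End EnergyIdentity.

(** * Energy and dissipation of the high frequencies *)

Section HighFrequency.
Context {R : realType} (chi : space3 R -> R) (hchi : lp_cutoff chi).
Local Notation X := (space3 R).
Implicit Types (s t : R) (x y xi : X) (i j : 'I_3) (f w : X -> R) (g : vfield R) (n m p : nat).

(** [1 - rho1 = (1 - chi)^2], which is what makes [nsq_high] an identity. Moreover [rho1] equals 1
    wherever [chi] does, and has no larger support. *)
Definition rho1 xi : R := 2 * chi xi - chi xi * chi xi.
Definition rho n : X -> R := dil (lambda n) rho1.
Definition Rop n f : X -> R := op (rho n) f.

Lemma etf_rho1 : etf rho1.
Proof. exact: etfB (etfZ 2 (etf_chi hchi)) (etfM (etf_chi hchi) (etf_chi hchi)). Qed.

Lemma etf_rho n : etf (rho n).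
Proof. exact: etf_dil (lambda_gt0 n) etf_rho1. Qed.

Lemma rho_chis n xi : rho n xi * chis chi (lambda n.+1) xi = rho n xi.
Proof.
have h := @chisM R chi hchi (lambda n) (lambda n.+1) xi (lambda_gt0 n).
rewrite lambdaS in h.
rewrite mulrBl -mulrA -[_ * _ * chis chi (lambda n.+1) xi]mulrA.
by rewrite lambdaS h.
Qed.

Lemma chis_rho m n xi : (m < n)%N -> chis chi (lambda m) xi * rho n xi = chis chi (lambda m) xi.
Proof.
move=> mn; have l : 2 * lambda m <= lambda n :> R.
  by rewrite -lambdaS ler_weXn2l// ler1n.
have h := chisM hchi xi (lambda_gt0 m) l.
rewrite mulrBr mulrCA h mulrA !h.
lra.
Qed.

Lemma RopE n f x : sqX f -> Rop n f x = 2 * Sop chi n f x - Sop chi n (Sop chi n f) x.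
Proof.
move=> sf; have ec := etf_chil hchi n.
rewrite /Sop (op_op ec ec sf) -(opZ 2 x ec sf) -(opB x (etfZ 2 ec) (etfM ec ec) sf).
by [].
Qed.

Lemma sqi_Rop n f : sqX f -> sqX (Rop n f).
Proof. exact: sqi_op (etf_rho n). Qed.

Lemma nsq_high n f : sqX f ->
  nsqX (fun x => f x - Sop chi n f x) = nsqX f - \int[leb3]_x (f x * Rop n f x).
Proof.
move=> sf; have sS := sqi_Sop hchi n sf; have sSS := sqi_Sop hchi n sS.
have i1 := sf.2; have i2 := sqi_mul sf sS; have i3 := sqi_mul sf sSS; have i4 := sqi_mul sS sS.
have h : \int[leb3]_x (Sop chi n f x * Sop chi n f x) = \int[leb3]_x (f x * Sop chi n (Sop chi n f) x).
  exact: esym (op_sym (etf_chil hchi n) sS sf).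
have e1 : \int[leb3]_x (f x * Rop n f x) = 2 * \int[leb3]_x (f x * Sop chi n f x) - \int[leb3]_x (f x * Sop chi n (Sop chi n f) x).
  rewrite -(IZ 2 i2) -(IB (intgZ 2 i2) i3); apply: eqI => x; rewrite (RopE n x sf); ring.
have e2 : nsqX (fun x => f x - Sop chi n f x) = nsqX f - 2 * \int[leb3]_x (f x * Sop chi n f x) + \int[leb3]_x (Sop chi n f x * Sop chi n f x).
  rewrite -(IZ 2 i2) -(IB i1 (intgZ 2 i2)) -(ID (intgB i1 (intgZ 2 i2)) i4).
  by apply: eqI => x; ring.
have E (p q r s t z : R) : z = p - 2 * q + s -> t = 2 * q - r -> s = r -> z = p - t.
  by move=> -> -> ->; ring.
exact: E e2 e1 h.
Qed.

Lemma Sop_low m n f : (m < n)%N -> sqX f -> Sop chi m (Sop chi n f) = Sop chi m f.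
Proof.
move=> mn sf; rewrite /Sop (op_op (etf_chil hchi m) (etf_chil hchi n) sf); congr (op _ f).
apply/funext => xi; apply: (chisM hchi xi (lambda_gt0 m)).
by rewrite -lambdaS ler_weXn2l// ler1n.
Qed.

Lemma Sop_high m n f : (m < n)%N -> sqX f -> Sop chi n (Sop chi m f) = Sop chi m f.
Proof.
move=> mn sf; rewrite /Sop (op_op (etf_chil hchi n) (etf_chil hchi m) sf); congr (op _ f).
apply/funext => xi; rewrite mulrC; apply: (chisM hchi xi (lambda_gt0 m)).
by rewrite -lambdaS ler_weXn2l// ler1n.
Qed.

Lemma Rop_low m n f : (m < n)%N -> sqX f -> Rop n (Sop chi m f) = Sop chi m f.
Proof.
move=> mn sf; rewrite /Rop (op_op (etf_rho n) (etf_chil hchi m) sf); congr (op _ f).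
by apply/funext => xi; rewrite mulrC chis_rho.
Qed.

Definition grad f g : Prop := (forall j, sqX (g j)) /\ forall j, wder [:: j] f (g j).

Lemma conv_grad k f g j x : sqX f -> grad f g -> schw k ->
  conv ('d_j k) f x = conv k (g j) x.
Proof. by move=> sf [sg wg] sk; exact: wder_conv x sf (sg j) (wg j) sk. Qed.

Lemma grad_high n f g : sqX f -> grad f g ->
  grad (fun x => f x - Sop chi n f x) (fun j x => g j x - Sop chi n (g j) x).
Proof.
move=> sf [sg wg]; split.
  by move=> j; apply: sqiB => //; exact: sqi_Sop.
move=> j B rB; have rD := reg_D 'u_j rB; have ec := etf_chil hchi n.
have sS := sqi_Sop hchi n sf; have sSg := sqi_Sop hchi n (sg j).
have sB := reg_sqi rB; have sD := reg_sqi rD.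
have w1 := wg j B rB; have w2 := wg j _ (op_reg ec sB).
have e1 : \int[leb3]_x ((f x - Sop chi n f x) * 'd_j B x) =
   \int[leb3]_x (f x * 'd_j B x) - \int[leb3]_x (f x * op (chis chi (lambda n)) ('d_j B) x).
  rewrite (op_sym ec sD sf) -(IB (sqi_mul sf sD) (sqi_mul sD sS)); apply: eqI => x; ring.
have e2 : \int[leb3]_x ((g j x - Sop chi n (g j) x) * B x) =
   \int[leb3]_x (g j x * B x) - \int[leb3]_x (g j x * op (chis chi (lambda n)) B x).
  rewrite (op_sym ec sB (sg j)) -(IB (sqi_mul (sg j) sB) (sqi_mul sB sSg)); apply: eqI => x; ring.
have e3 : \int[leb3]_x (f x * op (chis chi (lambda n)) ('d_j B) x) =
  \int[leb3]_x (f x * 'd_j (op (chis chi (lambda n)) B) x).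
  apply: eqI => x; exact: (congr1 (fun h => f x * h x) (esym (D_op_swap hchi j ec rB))).
by rewrite e1 e2 e3 w1 w2; ring.
Qed.

Lemma D_kernN (al : X -> R) v x : tfun al -> 'D_v (kern al) (- x) = - 'D_v (kern al) x.
Proof.
move=> ta; have e z : 'D_v (kern al) z = - (c3 * str (fun xi => dot v xi * al xi) z).
  exact: (congr1 (@^~ z) (D_kern v ta)).
have tt : tfun (fun xi => dot v xi * al xi) by apply: tfunMl; [exact: ta|exact: smooth_dotr].
by rewrite !e (strN x tt); ring.
Qed.

(** One of the two derivatives of the kernel passes to the right-hand factor; the other is moved to
    the left one by adjunction, and the sign comes from the oddness of the differentiated kernel. *)
Lemma visc_grad n f g : sqX f -> grad f g ->
  \int[leb3]_x (f x * laplacian (Rop n f) x) = - \sum_j \int[leb3]_x (g j x * Rop n (g j) x).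
Proof.
move=> sf gg; have [sg wg] := gg; have er := etf_rho n; have sk := schw_kern er.1.
have sD j := schw_D 'u_j sk.
rewrite -sumrN.
have e j x : 'd_j ('d_j (Rop n f)) x = conv ('d_j (kern (rho n))) (g j) x.
  rewrite -(conv_grad j x sf gg (sD j)).
  by have := congr1 (@^~ x) (iter_derive_conv [:: 'u_j; 'u_j] sk sf).
have i1 j : intgX (fun x => f x * conv ('d_j (kern (rho n))) (g j) x).
  exact: sqi_mul sf (sqi_conv (schw_pkern (sD j)) (sg j)).
transitivity (\sum_j \int[leb3]_x (f x * conv ('d_j (kern (rho n))) (g j) x)).
  rewrite -(Isum _ i1); apply: eqI => x; rewrite mulr_sumr; apply: eq_bigr => j _.
  exact: (congr1 (fun c => f x * c) (e j x)).
apply: eq_bigr => j _; rewrite (conv_adjoint (schw_pkern (sD j)) (sg j) sf) -(IN (sqi_mul (sg j) (sqi_Rop n (sg j)))).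
apply: eqI => x.
have -> : (fun z => 'd_j (kern (rho n)) (- z)) = fun z => (-1) * 'd_j (kern (rho n)) z.
  by apply/funext => z; rewrite (D_kernN _ _ er.1) mulN1r.
rewrite (convZl (-1) x (schw_pkern (sD j)) sf) (conv_grad j x sf gg sk) mulN1r mulrN.
by [].
Qed.

(** The full enstrophy minus the dissipation counted in the low-frequency identity is exactly the
    enstrophy of the high part: this is the dissipation left to the tail after subtraction. *)
Lemma visc_lower n f g : sqX f -> grad f g ->
  \sum_j nsqX (g j) + \int[leb3]_x (f x * laplacian (Rop n f) x) =
  \sum_j nsqX (fun x => g j x - Sop chi n (g j) x).
Proof.
move=> sf gg; have [sg _] := gg; rewrite (visc_grad n sf gg) -sumrB.
by apply: eq_bigr => j _; rewrite nsq_high.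
Qed.

(* The Littlewood-Paley block of a function from its gradient:
   [phi_p = - lam_p^-2 sum_j (i xi_j) (i xi_j beta_p)]. *)
Lemma block_grad : exists2 C : R, 0 < C & forall p f g, sqX f -> grad f g ->
  N2X (fun x => Sop chi p.+1 f x - Sop chi p f x) <= C * (lambda p)^-1 * \sum_j N2X (g j).
Proof.
have ec := etf_chi hchi.
pose ph xi := dil 2 chi xi - chi xi.
have eph := etfB (etf_dil (ltr0n _ 2) ec) ec.
have [|be eb hb] := division hchi eph (divr_gt0 ltr01 (ltr0n R 2)).
  move=> xi; rewrite div1r => /ltW h; rewrite /ph (chi_eq1 hchi h).
  have h2 : enorm xi <= 2 / 2 by apply: le_trans h _; lra.
  by have := chis_eq1 hchi (ltr0n R 2) h2; rewrite /chis => ->; rewrite subrr.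
pose C := 1 + \sum_j N1 ('d_j (kern be)).
have C0 : 0 < C by rewrite ltr_wpDr// sumr_ge0// => j _; exact: N1_ge0.
exists C => // p f g sf gg; have [sg _] := gg.
have lp : 0 < lambda p :> R := lambda_gt0 p; have l0 := lt0r_neq0 lp.
pose bp := dil (lambda p) be.
have ebp : etf bp := etf_dil lp eb; have skp := schw_kern ebp.1.
have sD j := schw_D 'u_j skp.
have e xi : chis chi (lambda p.+1) xi - chis chi (lambda p) xi = ((lambda p)^-1 ^+ 2) * (dot xi xi * bp xi).
  have := hb ((lambda p)^-1 *: xi); rewrite /ph /bp /chis /dil dotZl dotZr scalerA lambdaS invfM => <-.
  lra.
have E x : Sop chi p.+1 f x - Sop chi p f x = - ((lambda p)^-1 ^+ 2) * \sum_j conv ('d_j (kern bp)) (g j) x.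
  have pj j : pkern ('d_j ('d_j (kern bp))) := schw_pkern (schw_D _ (sD j)).
  rewrite -(opB x (etf_chil hchi p.+1) (etf_chil hchi p) sf).
  rewrite (_ : (fun xi => _) = fun xi => ((lambda p)^-1 ^+ 2) * (dot xi xi * bp xi)); last by apply/funext.
  have td : etf (fun xi => dot xi xi * bp xi).
    split; last by move=> xi; rewrite dotNl dotNr opprK ebp.2.
    apply: tfunMl; first exact: ebp.1.
    rewrite (_ : (fun xi => _) = fun xi => \sum_(i < 3) dot 'u_i xi * dot 'u_i xi); last first.
      by apply/funext => xi; exact: dotxx.
    by apply: smooth_sum => i; apply: smoothM; exact: smooth_dotr.
  rewrite (opZ _ x td sf) mulNr -mulrN; congr (_ * _).
  have e3 : kern (fun xi => dot xi xi * bp xi) = fun y => (-1) * \sum_j 'd_j ('d_j (kern bp)) y.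
    by apply/funext => y; have := laplacian_kern y ebp.1 => ->; rewrite mulN1r opprK.
  have pS : pkern (fun y => \sum_j 'd_j ('d_j (kern bp)) y).
    by apply: schw_pkern; apply: schw_sum => j; exact: schw_D.
  rewrite /op e3 (convZl (-1) x pS sf) mulN1r (conv_suml (index_enum 'I_3) x pj sf); congr (- _).
  by apply: eq_bigr => j _; exact: conv_grad.
rewrite (_ : (fun x => _) = fun x => - ((lambda p)^-1 ^+ 2) * \sum_j conv ('d_j (kern bp)) (g j) x); last first.
  by apply/funext => x.
have sc j := sqi_conv (schw_pkern (sD j)) (sg j).
rewrite (N2Z _ (sqi_sum _ sc)) normrN normrX (ger0_norm (ltW _)) ?invr_gt0//.
have h : N2X (fun x => \sum_j conv ('d_j (kern bp)) (g j) x) <= lambda p * (C * \sum_j N2X (g j)).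
  apply: le_trans (N2_sum _ sc) _; rewrite mulr_sumr mulr_sumr; apply: ler_sum => j _.
  have := bernstein2 [:: 'u_j] lp eb (sg j); rewrite -mulrA => h; apply: le_trans h _.
  rewrite ler_wpM2l ?(ltW lp)// ler_wpM2r ?N2_ge0// /C (bigD1 j)//=.
  rewrite [leRHS]addrCA lerDl addr_ge0// sumr_ge0// => i _; exact: N1_ge0.
apply: le_trans (ler_wpM2l _ h) _; first by rewrite exprn_ge0// invr_ge0 ltW.
have e4 (a b c : R) : a != 0 -> a^-1 ^+ 2 * (a * (b * c)) = b * a^-1 * c by move=> a0; field.
by rewrite (e4 _ _ _ l0).
Qed.

(** Since [S_n S_(n+1) = S_n], the high part [w] satisfies [S_n w = 0]; it is thus the sum of its
    blocks from level [n] on, and [block_grad] bounds these by a geometric series. The truncations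
    converge to [w] by [Sop_lim]. *)
Lemma reverse_bernstein : exists2 C : R, 0 < C & forall n f g, sqX f -> grad f g ->
  N2X (fun x => f x - Sop chi n.+1 f x) <=
    C * (lambda n.+1)^-1 * \sum_j N2X (fun x => g j x - Sop chi n.+1 (g j) x).
Proof.
have [C C0 hC] := block_grad; exists (4 * C); first by rewrite mulr_gt0.
move=> n f g sf gg.
have sw := sqiB sf (sqi_Sop hchi n.+1 sf); have gw := grad_high n.+1 sf gg.
set w := (fun x => f x - Sop chi n.+1 f x) in sw gw *.
set G := \sum_j _.
have G0 : 0 <= G by apply: sumr_ge0 => j _; exact: N2_ge0.
have w0 : Sop chi n w = fun=> 0.
  apply/funext => x; rewrite /Sop /op (convBr x (pkern_kern (etf_chil hchi n).1) sf (sqi_Sop hchi n.+1 sf)).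
  rewrite -/(op (chis chi (lambda n)) (Sop chi n.+1 f)) -/(Sop chi n (Sop chi n.+1 f)) (Sop_low (ltnSn n) sf).
  exact: subrr.
have bound N : N2X (Sop chi (n + N) w) <= 2 * C * (lambda n)^-1 * (1 - 2^-1 ^+ N) * G.
  elim: N => [|N IH].
    rewrite addn0 w0 subrr mulr0 mul0r /N2 /nsq (_ : (fun x => _) = fun=> 0) ?I0 ?sqrtr0//.
    by rewrite expr0n.
  have h := hC (n + N)%N w _ sw gw.
  rewrite addnS (_ : Sop chi (n + N).+1 w = fun x => (Sop chi (n + N).+1 w x - Sop chi (n + N) w x) + Sop chi (n + N) w x); last first.
    by apply/funext => x; rewrite subrK.
  apply: le_trans (N2D (sqiB (sqi_Sop hchi _ sw) (sqi_Sop hchi _ sw)) (sqi_Sop hchi _ sw)) _.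
  apply: le_trans (lerD h IH) _; rewrite -mulrDl.
  have E (a b c : R) : c * (a * b) + 2 * c * a * (1 - b) = 2 * c * a * (1 - 2^-1 * b) by field.
  by rewrite /lambda exprD invfM -!exprVn exprS E.
have lim := Sop_lim hchi sw.
have le N : N2X w <= N2X (fun x => w x - Sop chi (n + N) w x) + 2 * C * (lambda n)^-1 * G.
  have sS := sqi_Sop hchi (n + N) sw.
  rewrite {1}(_ : w = fun x => (w x - Sop chi (n + N) w x) + Sop chi (n + N) w x); last first.
    by apply/funext => x; rewrite subrK.
  apply: le_trans (N2D (sqiB sw sS) sS) _; rewrite lerD2l; apply: le_trans (bound N) _.
  have a1 : 1 - 2^-1 ^+ N <= 1 :> R by rewrite lerBlDr lerDl.
  have a2 : 0 <= 2 * C * (lambda n)^-1.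
    by rewrite mulr_ge0 ?invr_ge0 ?(ltW (lambda_gt0 n))// mulr_ge0// ltW.
  exact: ler_wpM2r G0 _ _ (ler_piMr a2 a1).
have -> : 4 * C * (lambda n.+1)^-1 = 2 * C * (lambda n)^-1.
  by rewrite lambdaS; field; exact: lt0r_neq0 (lambda_gt0 n).
apply/ler_addgt0Pl => e e0; have [N hN] := cvg0_le lim e0.
apply: le_trans (le N) _; rewrite lerD2r; apply: le_trans (ler_norm _) (hN _ _); exact: leq_addl.
Qed.

End HighFrequency.

(** * Spectral localisation of products *)

Section Localisation.
Context {R : realType} (chi : space3 R -> R) (hchi : lp_cutoff chi).
Local Notation X := (space3 R).
Local Notation Y := (mspace3 R).
Implicit Types (x y z xi zeta : X) (f g w m al : X -> R).

Lemma superpose x m (P : X * X -> R) w (V C : R) : intgX m ->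
  measurable_fun (setT : set (Y * Y)) (P : Y * Y -> R) -> mfun3 w ->
  (forall z, intgX (fun y => P (z, y) * w y)) ->
  (forall z, \int[leb3]_y `|P (z, y) * w y| <= C) ->
  (forall y, w y != 0 -> \int[leb3]_z (m z * P (z, y)) = V * P (x, y)) ->
  (forall y, intgX (fun z => m z * P (z, y))) ->
  \int[leb3]_z (m z * \int[leb3]_y (P (z, y) * w y)) = V * \int[leb3]_y (P (x, y) * w y).
Proof.
move=> im mP mw iP bP hV iV.
pose F (z : X * X) := m z.1 * (P z * w z.2).
have mF : measurable_fun (setT : set (Y * Y)) (F : Y * Y -> R).
  apply: measurable_funM; first exact: mfun_pr1 (intg_meas im).
  by apply: measurable_funM; [exact: mP|exact: mfun_pr2 mw].
have hF z := intgZ (m z) (iP z).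
have [e _ _] : [/\ \int[leb3]_z (\int[leb3]_y F (z, y)) = \int[leb3]_y (\int[leb3]_z F (z, y)),
      intgX (fun z => \int[leb3]_y F (z, y)) & intgX (fun y => \int[leb3]_z F (z, y))].
  apply: (fubini_X (g := fun z => `|m z| * C) mF hF); last exact/intgZr/intg_abs.
  move=> z; rewrite (_ : \int[leb3]_y `|F (z, y)| = `|m z| * \int[leb3]_y `|P (z, y) * w y|).
    by rewrite ler_wpM2l.
  rewrite -(IZ `|m z| (intg_abs (iP z))); apply: eqI => y; exact: normrM.
transitivity (\int[leb3]_z (\int[leb3]_y F (z, y))).
  by apply: eqI => z; rewrite -(IZ (m z) (iP z)).
rewrite e -(IZ V (iP x)); apply: eqI => y.
have -> : \int[leb3]_z (m z * (P (z, y) * w y)) = (\int[leb3]_z (m z * P (z, y))) * w y.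
  by rewrite -(IZr (w y) (iV y)); apply: eqI => z; rewrite mulrA.
have [->|w0] := eqVneq (w y) 0; first by rewrite !mulr0.
by rewrite (hV y w0) mulrA.
Qed.

Lemma enorm_add (s : R) xi zeta : enorm xi < s -> enorm zeta < s -> enorm (xi + zeta) <= 2 * s.
Proof.
move=> h1 h2; have s0 : 0 <= s by apply: le_trans (ltW h1); exact: enorm_ge0.
have q z : enorm z < s -> dot z z <= s ^+ 2.
  move=> h; rewrite -[leLHS]sqr_sqrtr; first exact: lerXn2r (sqrtr_ge0 _) s0 (ltW h).
  by rewrite dotE !addr_ge0// sqr_ge0.
have s20 : 0 <= 2 * s by rewrite mulr_ge0.
rewrite -(ger0_norm s20) -sqrtr_sqr ler_wsqrtr//.
have p : 0 <= dot (xi - zeta) (xi - zeta) by rewrite dotE !addr_ge0// sqr_ge0.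
have := q _ h1; have := q _ h2; move: p; rewrite !dotBl !dotBr !dotDl !dotDr.
lra.
Qed.

Variables (al : X -> R) (s : R).
Hypothesis eal : etf al.
Hypothesis s0 : 0 < s.
Hypothesis al1 : forall xi, enorm xi <= 2 * s -> al xi = 1.

Let a := chis chi s.
Let ea : etf a := etf_chis hchi s0.
Let k := kern a.
Let pk : pkern k := pkern_kern ea.1.
Let pal : pkern (kern al) := pkern_kern eal.1.

Let a_supp xi : a xi != 0 -> enorm xi < s.
Proof.
by move=> h; rewrite ltNge; apply/negP => h2; move: h; rewrite /a (chis_eq0 hchi s0 h2) eqxx.
Qed.

Let kE z y : k (z - y) = \int[leb3]_xi (cos (dot z xi - dot y xi) * (c3 * a xi)).
Proof.
rewrite /k /kern -(IZ c3 (intg_cos (z - y) (schw_intg (tfun_schw ea.1)))).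
by apply: eqI => xi; rewrite dotBl; ring.
Qed.

Let ical y z : intgX (fun xi => cos (dot z xi - dot y xi) * (c3 * a xi)).
Proof.
apply: intg_ext (intgZ c3 (intg_cos (z - y) (schw_intg (tfun_schw ea.1)))) => xi.
by rewrite dotBl; ring.
Qed.

Let bcal y z : \int[leb3]_xi `|cos (dot z xi - dot y xi) * (c3 * a xi)| <= c3 * N1 a.
Proof.
have ia := intg_abs (schw_intg (tfun_schw ea.1)).
rewrite -(IZ c3 ia); apply: Ile; [exact/intg_abs/ical|exact: intgZ|move=> xi].
by rewrite !normrM (ger0_norm (ltW c3_gt0)) mulrCA ler_wpM2l ?(ltW c3_gt0)// ler_piMl// cos_max.
Qed.

Let ialcos x zeta c : intgX (fun z => kern al (x - z) * cos (dot z zeta - c)).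
Proof. exact: intg_cosdotl (intg_refl x (pkern_intg pal)). Qed.

Let mca : mfun3 (fun xi => c3 * a xi).
Proof. by apply: measurable_funM => //; exact: smooth_mfun3 ea.1.1. Qed.

Let mcos y : measurable_fun (setT : set (Y * Y)) (fun z : Y * Y => cos (dot z.1 z.2 - dot y z.2)).
Proof.
apply: (measurableT_comp (continuous_measurable_fun (@continuous_cos R))).
by apply: measurable_funB measurable_dot _; exact: mfun_pr2 (smooth_mfun3 (smooth_dotr y)).
Qed.

(** The kernel [k] is a superposition of waves of frequency below [s]; times a wave of frequency
    [zeta] it has frequencies below [2 s], where [al = 1], so convolution with [kern al] changes
    nothing. [loc2] and [loc3] replace the remaining wave by a translate of [k] and then one kernel
    by a convolution. *)
Let loc1 x zeta c y : enorm zeta < s ->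
  \int[leb3]_z (kern al (x - z) * cos (dot z zeta - c) * k (z - y)) =
  cos (dot x zeta - c) * k (x - y).
Proof.
move=> hz; rewrite kE.
have mc xi : mfun3 (fun z => cos (dot z xi - dot y xi)) := mfun_cosdot _ _.
rewrite -(@superpose x (fun z => kern al (x - z) * cos (dot z zeta - c))
  (fun z : X * X => cos (dot z.1 z.2 - dot y z.2)) (fun xi => c3 * a xi) (cos (dot x zeta - c)) (c3 * N1 a)) //.
- by apply: eqI => z; rewrite kE.
- exact: ical.
- exact: bcal.
- move=> xi; rewrite mulf_eq0 negb_or => /andP[_ /a_supp hxi].
  have E z : kern al (x - z) * cos (dot z zeta - c) * cos (dot z xi - dot y xi) =
    2^-1 * (kern al (x - z) * cos (dot z (zeta + xi) - (c + dot y xi))) +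
    2^-1 * (kern al (x - z) * cos (dot z (zeta - xi) - (c - dot y xi))).
    have -> : dot z (zeta + xi) - (c + dot y xi) = (dot z zeta - c) + (dot z xi - dot y xi).
      by rewrite dotDr; ring.
    have -> : dot z (zeta - xi) - (c - dot y xi) = (dot z zeta - c) - (dot z xi - dot y xi).
      by rewrite dotBr; ring.
    move: (dot z zeta - c) (dot z xi - dot y xi) (kern al _) => p q r.
    by rewrite cosD cosB; field.
  transitivity (\int[leb3]_z (2^-1 * (kern al (x - z) * cos (dot z (zeta + xi) - (c + dot y xi))) +
    2^-1 * (kern al (x - z) * cos (dot z (zeta - xi) - (c - dot y xi))))).
    by apply: eqI => z.
  have j1 := ialcos x (zeta + xi) (c + dot y xi); have j2 := ialcos x (zeta - xi) (c - dot y xi).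
  rewrite (ID (intgZ 2^-1 j1) (intgZ 2^-1 j2)) (IZ 2^-1 j1) (IZ 2^-1 j2).
  rewrite !(kern_inversion _ _ _ eal.1 eal.2) !al1; first last.
  + exact: enorm_add.
  + by apply: enorm_add => //; rewrite enormN.
  have -> : dot x (zeta + xi) - (c + dot y xi) = (dot x zeta - c) + (dot x xi - dot y xi).
    by rewrite dotDr; ring.
  have -> : dot x (zeta - xi) - (c - dot y xi) = (dot x zeta - c) - (dot x xi - dot y xi).
    by rewrite dotBr; ring.
  move: (dot x zeta - c) (dot x xi - dot y xi) => p q.
  by rewrite cosD cosB; field.
- move=> xi; apply: (intgM_bd (ialcos x zeta c) (mc xi)) => z; exact: cos_max.
Qed.

Let ialk x y : intgX (fun z => kern al (x - z) * k (z - y)).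
Proof.
apply: sqi_mul; first exact: sqi_sub (pkern_sqi pal).
have [mk ik] := pkern_sqi pk; split; last exact: (intg_shift (- y) ik).
have := measurableT_comp mk (measurable_aff3 1 (- y)).
by congr measurable_fun; apply/funext => z /=; rewrite aff3E scale1r.
Qed.

Let loc2 x y y' :
  \int[leb3]_z (kern al (x - z) * k (z - y) * k (z - y')) = k (x - y) * k (x - y').
Proof.
rewrite (kE x y').
rewrite -(@superpose x (fun z => kern al (x - z) * k (z - y))
  (fun z : X * X => cos (dot z.1 z.2 - dot y' z.2)) (fun xi => c3 * a xi) (k (x - y)) (c3 * N1 a)) //.
- by apply: eqI => z; rewrite (kE z y').
- exact: ical.
- exact: bcal.
- move=> xi; rewrite mulf_eq0 negb_or => /andP[_ /a_supp hxi].
  rewrite [RHS]mulrC -(loc1 x (dot y' xi) y hxi); apply: eqI => z; exact: mulrAC.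
- by move=> xi; have := intg_cosdotl (- dot y' xi) xi (ialk x y).
Qed.

Let bconv f z : sqX f -> \int[leb3]_y `|k (z - y) * f y| <= N2X k * N2X f.
Proof.
move=> sf; rewrite conv_absE; apply: le_trans (ler_norm _) _.
by have := conv_le z (pkern_abs pk) (sqi_abs sf); rewrite !N2_abs.
Qed.

Let loc3 x y f : sqX f ->
  \int[leb3]_z (kern al (x - z) * k (z - y) * conv k f z) = k (x - y) * conv k f x.
Proof.
move=> sf; have [C C0 hC] := pkern_bounded pk.
rewrite -(@superpose x (fun z => kern al (x - z) * k (z - y))
  (fun z : X * X => k (z.1 - z.2)) f (k (x - y)) (N2X k * N2X f)) //.
- exact: mfun_sub2 pk.1.
- exact: sf.1.
- by move=> z; exact: conv_intg.
- by move=> z; exact: bconv.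
- by move=> y' _; exact: loc2.
- move=> y'; apply: (intgM_bd (ialk x y)) => [|z]//.
  have := measurableT_comp pk.1 (measurable_aff3 1 (- y')).
  by congr measurable_fun; apply/funext => z /=; rewrite aff3E scale1r.
Qed.

(* The spectrum of a product lies in the sum of the spectra. *)
Lemma product_localisation f g x : sqX f -> sqX g ->
  op al (fun z => op a f z * op a g z) x = op a f x * op a g x.
Proof.
move=> sf sg; have [C C0 hC] := pkern_bounded pk.
have sG := sqi_conv pk sg.
have im := conv_intg x pal sG.
have e := @superpose x (fun z => kern al (x - z) * conv k g z)
  (fun z : X * X => k (z.1 - z.2)) f (conv k g x) (N2X k * N2X f) im (mfun_sub2 pk.1) sf.1
  (fun z => conv_intg z pk sf) (fun z => bconv z sf).
rewrite [RHS]mulrC -[RHS]e.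
- by apply: eqI => z; rewrite -mulrA; congr (_ * _); exact: mulrC.
- move=> y _; rewrite mulrC -(loc3 x y sg); apply: eqI => z; exact: mulrAC.
- move=> y; apply: (intgM_bd im) => [|z]//.
  have := measurableT_comp pk.1 (measurable_aff3 1 (- y)).
  by congr measurable_fun; apply/funext => z /=; rewrite aff3E scale1r.
Qed.

End Localisation.

(** * Commutator estimate *)

Section Commutator.
Context {R : realType} (chi : space3 R -> R) (hchi : lp_cutoff chi).
Local Notation X := (space3 R).
Implicit Types (x y z : X) (i j k : 'I_3) (f g h L al : X -> R).

Lemma lip_components L (A : R) x y : smooth L -> (forall k z, `|'d_k L z| <= A) ->
  `|L x - L y| <= A * \sum_(k < 3) `|component k (x - y)|.
Proof.
move=> sL hA.
have step z c k : `|L (z + c *: 'u_k) - L z| <= A * `|c|.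
  have [t _ ->] := @MVT_dir _ _ L z (c *: 'u_k) (fun y => smooth_derivable L y _ sL).
  rewrite Dscale; last by move=> *; exact: smooth_derivable.
  by rewrite normrM mulrC ler_wpM2r.
pose v := x - y.
have e : x = y + v.1.1 *: 'u_0 + v.1.2 *: 'u_1 + v.2 *: 'u_2%:R.
  by rewrite -!addrA [v.1.1 *: _ + _]addrA -space3_sum addrC subrK.
have E : L x - L y = (L (y + v.1.1 *: 'u_0 + v.1.2 *: 'u_1 + v.2 *: 'u_2%:R) - L (y + v.1.1 *: 'u_0 + v.1.2 *: 'u_1)) +
  (L (y + v.1.1 *: 'u_0 + v.1.2 *: 'u_1) - L (y + v.1.1 *: 'u_0)) + (L (y + v.1.1 *: 'u_0) - L y).
  by rewrite {1}e; ring.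
have -> : \sum_(k < 3) `|component k (x - y)| = `|v.2| + `|v.1.2| + `|v.1.1|.
  rewrite !big_ord_recl big_ord0; ring.
rewrite E !mulrDr; apply: le_trans (ler_normD _ _) _; apply: lerD => //.
by apply: le_trans (ler_normD _ _) _; apply: lerD.
Qed.

(** A first moment of the differentiated kernel. The weight [x_k] and the derivative scale
    oppositely, so it does not depend on the dilation ([moment_dil]) and the commutator costs no
    power of the frequency. *)
Definition moment al j k : R := N1 (fun x => component k x * 'd_j (kern al) x).

Lemma moment_pkern al j k : tfun al -> pkern (fun x => component k x * 'd_j (kern al) x).
Proof.
move=> ta; have tt : tfun (fun xi => dot 'u_j xi * al xi) by apply: tfunMl => //; exact: smooth_dotr.
have h := schw_pkern (schwZ (-1) (schw_kern (tfun_D 'u_k tt))).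
rewrite (_ : (fun x => component k x * _) = fun x => (-1) * kern ('d_k (fun xi => dot 'u_j xi * al xi)) x)//.
apply/funext => x; have e : 'd_j (kern al) x = - (c3 * str (fun xi => dot 'u_j xi * al xi) x).
  exact: (congr1 (@^~ x) (D_kern 'u_j ta)).
by rewrite e /kern (ctr_D k x tt); ring.
Qed.

Lemma component_scale (s : R) k x : component k (s *: x) = s * component k x.
Proof. by rewrite -!unit_dot dotZr. Qed.

Lemma moment_dil al j k (s : R) : 0 < s -> etf al -> moment (dil s al) j k = moment al j k.
Proof.
move=> s0 ea; have h := pkern_intg (moment_pkern j k ea.1).
rewrite -[RHS](N1_scale s0 h); congr N1; apply/funext => x.
have e := congr1 (@^~ x) (iter_derive_kern_dil [:: 'u_j] s0 ea.1).
rewrite /= in e; rewrite e component_scale; ring.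
Qed.

(** The differentiated kernel [K] is odd, so convolution with it is antisymmetric and twice the
    integral equals the integral of [h] times the commutator of [L] with [K] applied to [h]. In the
    commutator the difference [L x - L y] is at most [A] times the components of [x - y], which
    leaves the moments of [K]. *)
Lemma commutator_bound al j h L (A : R) : etf al -> sqX h -> reg L ->
  (forall k z, `|'d_k L z| <= A) ->
  `|\int[leb3]_x (h x * L x * conv ('d_j (kern al)) h x)| <=
  A * (\sum_(k < 3) moment al j k) * nsqX h.
Proof.
move=> ea sh rL hA; have sL := reg_smooth rL; have [C hC] := reg_bounded rL.
have A0 : 0 <= A by apply: le_trans (hA 0 0).
have pK := schw_pkern (schw_D 'u_j (schw_kern ea.1)).
set K := 'd_j (kern al) in pK *.
have mL := smooth_mfun3 sL.
have shL := sqiM_bd sh mL hC.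
set I := \int[leb3]_x _.
have Kodd : (fun z => K (- z)) = fun z => (-1) * K z.
  by apply/funext => z; rewrite mulN1r; exact: D_kernN ea.1.
have adj : I = - \int[leb3]_x (h x * conv K (fun y => h y * L y) x).
  rewrite /I (conv_adjoint pK sh shL) Kodd -(IN (sqi_mul sh (sqi_conv pK shL))); apply: eqI => x.
  by rewrite (convZl (-1) x pK shL) mulN1r mulrN.
pose M x := A * \sum_(k < 3) `|component k x * K x|.
have pM : pkern M.
  have pk k := pkern_abs (moment_pkern j k ea.1).
  split; first by apply: measurable_funM => //; apply: measurable_sum => k; exact: (pk k).1.
  have [B hB] : exists B : 'I_3 -> R, forall k x, `|component k x * K x| <= B k * wP x.
    have E k : exists B : R, forall x, `|component k x * K x| <= B * wP x.
      by have [_ [B _ hB]] := moment_pkern j k ea.1; exists B.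
    by exists (fun k => projT1 (cid (E k))) => k; exact: projT2 (cid (E k)).
  exists (A * (\sum_(k < 3) `|B k|) + 1).
    by rewrite ltr_wpDl// mulr_ge0// sumr_ge0.
  move=> x; rewrite ger0_norm; last by rewrite mulr_ge0// sumr_ge0.
  apply: (@le_trans _ _ (A * (\sum_(k < 3) `|B k|) * wP x)); last by rewrite ler_wpM2r ?wP_ge0// lerDl.
  rewrite -mulrA ler_wpM2l// mulr_suml; apply: ler_sum => k _.
  by apply: le_trans (hB k x) _; rewrite ler_wpM2r ?wP_ge0// ler_norm.
have N1M : N1 M = A * (\sum_(k < 3) moment al j k).
  have ik k := intg_abs (pkern_intg (moment_pkern j k ea.1)).
  rewrite -(Isum _ ik) -(IZ A (intg_sum _ ik)); apply: eqI => x.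
  by rewrite ger0_norm// mulr_ge0// sumr_ge0.
have i1 := sqi_mul shL (sqi_conv pK sh); have i2 := sqi_mul sh (sqi_conv pK shL).
have I2 : 2 * I = \int[leb3]_x (h x * L x * conv K h x - h x * conv K (fun y => h y * L y) x).
  by rewrite (IB i1 i2) -/I ?adj; ring.
have ptw x : `|h x * L x * conv K h x - h x * conv K (fun y => h y * L y) x| <= `|h x| * conv M (fun y => `|h y|) x.
  have c1 := conv_intg x pK sh; have c2 := conv_intg x pK shL; have c3' := conv_intg x pM (sqi_abs sh).
  have -> : h x * L x * conv K h x - h x * conv K (fun y => h y * L y) x =
    h x * \int[leb3]_y (L x * (K (x - y) * h y) - K (x - y) * (h y * L y)).
    by rewrite (IB (intgZ (L x) c1) c2) (IZ (L x) c1) -/(conv K h x) -/(conv K (fun y => h y * L y) x); ring.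
  rewrite normrM ler_wpM2l//; apply: Iabs_le; [exact: intg_meas (intgB (intgZ (L x) c1) c2)|exact: c3'|move=> y].
  have -> : L x * (K (x - y) * h y) - K (x - y) * (h y * L y) = ((L x - L y) * K (x - y)) * h y by ring.
  rewrite normrM ler_wpM2r// normrM; apply: le_trans (ler_wpM2r (normr_ge0 _) (lip_components x y sL hA)) _.
  rewrite -mulrA ler_wpM2l// mulr_suml; apply: ler_sum => k _; by rewrite normrM.
have sM := sqi_conv pM (sqi_abs sh).
have b : `|2 * I| <= N1 M * nsqX h.
  rewrite I2; apply: le_trans (Iabs_le (intg_meas (intgB i1 i2)) (sqi_mul (sqi_abs sh) sM) ptw) _.
  apply: le_trans (ler_norm _) _; apply: le_trans (cauchy_schwarz (sqi_abs sh) sM) _.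
  apply: le_trans (ler_wpM2l (N2_ge0 _ _) (N2_conv pM (sqi_abs sh))) _.
  by rewrite N2_abs mulrCA -expr2 N2_sqr.
rewrite -N1M; apply: le_trans b; rewrite normrM (ger0_norm (ler0n R 2)) mulrDl mul1r lerDl.
by [].
Qed.

End Commutator.

(** * Bound for the energy flux through a frequency *)

Section FluxBound.
Context {R : realType} (chi : space3 R -> R) (hchi : lp_cutoff chi).
Local Notation X := (space3 R).
Implicit Types (x y : X) (i j k : 'I_3) (w : vfield R) (m n : nat).

Definition high m w : vfield R := fun i x => w i x - Sop chi m (w i) x.

Lemma sqi_high m w i : vsqX w -> sqX (high m w i).
Proof. by move=> sw; apply: sqiB => //; exact: sqi_Sop. Qed.

Lemma divfB (u v : vfield R) : vsqX u -> vsqX v ->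
  divf u -> divf v -> divf (fun i x => u i x - v i x).
Proof.
move=> su sv du dv B rB.
transitivity (\sum_i \int[leb3]_x (u i x * 'd_i B x) -
  \sum_i \int[leb3]_x (v i x * 'd_i B x)); last by rewrite (du B rB) (dv B rB) subrr.
rewrite -sumrB.
apply: eq_bigr => i _; have sD := reg_sqi (reg_D 'u_i rB).
rewrite -(IB (sqi_mul (su i) sD) (sqi_mul (sv i) sD)); apply: eqI => x; exact: mulrBl.
Qed.

Lemma divf_high m w : vsqX w -> divf w -> divf (high m w).
Proof.
move=> sw dw; have h := divf_op hchi (etf_chil hchi m) sw dw.
exact: divfB sw (fun i => sqi_Sop hchi m (sw i)) dw h.
Qed.

Lemma intg3 (p q r : X -> R) : sqX p -> sqX q -> reg r -> intgX (fun x => p x * q x * r x).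
Proof.
move=> sp sq rr; have [C hC] := reg_bounded rr.
exact: intgM_bd (sqi_mul sp sq) (smooth_mfun3 (reg_smooth rr)) hC.
Qed.

Lemma I_sum7 (f1 f2 f3 f4 f5 f6 f7 : X -> R) : intgX f1 -> intgX f2 -> intgX f3 ->
  intgX f4 -> intgX f5 -> intgX f6 -> intgX f7 ->
  \int[leb3]_x (f1 x + ((f2 x + f3 x) + ((f4 x + f5 x) + (f6 x + f7 x)))) =
  \int[leb3]_x f1 x + ((\int[leb3]_x f2 x + \int[leb3]_x f3 x) +
   ((\int[leb3]_x f4 x + \int[leb3]_x f5 x) + (\int[leb3]_x f6 x + \int[leb3]_x f7 x))).
Proof.
move=> i1 i2 i3 i4 i5 i6 i7.
by rewrite (ID i1 (intgD (intgD i2 i3) (intgD (intgD i4 i5) (intgD i6 i7))))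
  (ID (intgD i2 i3) (intgD (intgD i4 i5) (intgD i6 i7))) (ID (intgD i4 i5) (intgD i6 i7))
  (ID i2 i3) (ID i4 i5) (ID i6 i7).
Qed.

Lemma I3_le (p q r : X -> R) (A : R) : sqX p -> sqX q -> reg r -> 0 <= A ->
  (forall x, `|r x| <= A) -> `|\int[leb3]_x (p x * q x * r x)| <= A * (N2X p * N2X q).
Proof.
move=> sp sq rr A0 hr; have i1 := sqi_mul (sqi_abs sp) (sqi_abs sq).
apply: (@le_trans _ _ (A * \int[leb3]_x (`|p x| * `|q x|))).
  rewrite -(IZ A i1); apply: Iabs_le; [exact: intg_meas (intg3 sp sq rr)|exact: intgZ|move=> x].
  by rewrite !normrM mulrC ler_wpM2r.
rewrite ler_wpM2l//; apply: le_trans (ler_norm _) _; rewrite -(N2_abs p) -(N2_abs q).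
by apply: cauchy_schwarz; exact: sqi_abs.
Qed.

(* Both factors have spectrum in a ball where [rho] is 1. *)
Lemma Rop_low_product m (f : X -> R) (g : X -> R) j x : sqX f -> sqX g ->
  Rop chi m.+3 (fun z => Sop chi m f z * 'd_j (Sop chi m g) z) x =
  Sop chi m f x * 'd_j (Sop chi m g) x.
Proof.
move=> sf sg; have s0 := @lambda_gt0 R m.+1.
have al1 xi : enorm xi <= 2 * lambda m.+1 -> rho chi m.+3 xi = 1.
  move=> h; have e : chis chi (lambda m.+3) xi = 1.
    apply: (chis_eq1 hchi (lambda_gt0 _)); apply: le_trans h _.
    by rewrite !lambdaS; lra.
  by rewrite /rho /dil /rho1 -/(dil (lambda m.+3) chi xi) -/(chis chi (lambda m.+3) xi) e; ring.
have sF := sqi_Sop hchi m sf; have rG := reg_Sop hchi m sg.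
have rD := reg_D 'u_j rG.
have h := product_localisation hchi (etf_rho hchi m.+3) s0 al1 x sF (reg_sqi rD).
have e1 : op (chis chi (lambda m.+1)) (Sop chi m f) = Sop chi m f := Sop_high hchi (ltnSn m) sf.
have e2 : op (chis chi (lambda m.+1)) ('d_j (Sop chi m g)) = 'd_j (Sop chi m g).
  rewrite -(D_op_swap hchi j (etf_chil hchi m.+1) rG).
  by have := Sop_high hchi (ltnSn m) sg; rewrite /Sop => ->.
by rewrite e1 e2 in h.
Qed.

(** For each pair of indices the summands bound, in this order, the terms [a], the one in [H], [Rh]
    and [dl], and the commutator term [c] of [flux_component]. *)
Definition flux_const : R :=
  \sum_(i < 3) \sum_(j < 3) (1 + N1 (kern (rho1 chi)) + \sum_(k < 3) moment (rho1 chi) j k).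

Lemma flux_const_ge0 : 0 <= flux_const.
Proof.
apply: sumr_ge0 => i _; apply: sumr_ge0 => j _; rewrite !addr_ge0 ?N1_ge0//.
by apply: sumr_ge0 => k _; exact: N1_ge0.
Qed.

(** Split [w_i = l + h], [w_j = L + H] and [Rop w_i = l + Rh] into low and high parts. The terms [d]
    and [p] are transport of [l^2 / 2] by a divergence-free field and vanish. Integration by parts
    turns [e] and [g] into terms with [Rh] and [dl], and the one from [g] cancels [b] by
    localisation. What remains is quadratic in the high part: [a] and the term from [e] directly,
    [c] through the commutator, since there the gradient must fall on [L]. *)
Lemma flux_component m w i (A : R) : vsqX w -> divf w -> 0 <= A ->
  (forall i j x, `|'d_j (Sop chi m (w i)) x| <= A) ->
  (forall i j x, `|'d_j (Rop chi m.+3 (w i)) x| <= A) ->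
  `|\sum_j \int[leb3]_x (w i x * w j x * 'd_j (Rop chi m.+3 (w i)) x)| <=
  \sum_(j < 3) (1 + N1 (kern (rho1 chi)) + \sum_(k < 3) moment (rho1 chi) j k) * (A * nsq3 (high m w)).
Proof.
move=> sw dw A0 hS hR.
have G (S z z' : R) : 0 <= S -> z <= z' -> A * S * z <= S * (A * z').
  by move=> S0 zz; rewrite mulrA [S * A]mulrC; apply: ler_wpM2l zz; exact: mulr_ge0.
have G2 (a r B z z' : R) : 0 <= a -> 0 <= B -> r <= B * z -> z * a <= z' -> A * (a * r) <= B * (A * z').
  move=> a0 B0 rz za; apply: (@le_trans _ _ (A * (a * (B * z)))).
    by rewrite ler_wpM2l// ler_wpM2l.
  have -> : A * (a * (B * z)) = B * (A * (z * a)) by ring.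
  by rewrite ler_wpM2l// ler_wpM2l.
pose l := Sop chi m (w i); pose h := high m w i.
pose L j := Sop chi m (w j); pose H j := high m w j.
pose Rh := Rop chi m.+3 h.
have sl : sqX l := sqi_Sop hchi m (sw i).
have sh : sqX h := sqi_high m i sw.
have sL j : sqX (L j) := sqi_Sop hchi m (sw j).
have sH j : sqX (H j) := sqi_high m j sw.
have rl : reg l := reg_Sop hchi m (sw i).
have rL j : reg (L j) := reg_Sop hchi m (sw j).
have er := etf_rho hchi m.+3.
have rRh : reg Rh := op_reg er sh.
have sRh := reg_sqi rRh.
have rRf : reg (Rop chi m.+3 (w i)) := op_reg er (sw i).
have dH : divf H := divf_high m sw dw.
have dL : divf L := divf_op hchi (etf_chil hchi m) sw dw.
pose dl j := 'd_j l; pose dR j := 'd_j Rh.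
have rdl j : reg (dl j) := reg_D _ rl.
have rdR j : reg (dR j) := reg_D _ rRh.
have mlt : (m < m.+3)%N by rewrite !ltnS -addn2 leq_addr.
have eRf x : Rop chi m.+3 (w i) x = l x + Rh x.
  have e1 : w i = fun y => l y + h y by apply/funext => y; rewrite /h /high addrC subrK.
  have pk := pkern_kern er.1.
  have e2 : Rop chi m.+3 l = l := Rop_low hchi mlt (sw i).
  rewrite {1}e1 /Rop /op (convDr x pk sl sh) -/(op (rho chi m.+3) l) -/(Rop chi m.+3 l) e2.
  by [].
have eD j x : 'd_j (Rop chi m.+3 (w i)) x = dl j x + dR j x.
  have -> : Rop chi m.+3 (w i) = fun x => l x + Rh x by apply/funext.
  exact: DD (smooth_derivable l x _ (reg_smooth rl)) (smooth_derivable Rh x _ (reg_smooth rRh)).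
pose a j := \int[leb3]_x (h x * H j x * 'd_j (Rop chi m.+3 (w i)) x).
pose b j := \int[leb3]_x (h x * L j x * dl j x).
pose c j := \int[leb3]_x (h x * L j x * dR j x).
pose d j := \int[leb3]_x (H j x * l x * dl j x).
pose e j := \int[leb3]_x (H j x * l x * dR j x).
pose p j := \int[leb3]_x (L j x * l x * dl j x).
pose g j := \int[leb3]_x (L j x * l x * dR j x).
have split7 j : \int[leb3]_x (w i x * w j x * 'd_j (Rop chi m.+3 (w i)) x) =
    a j + ((b j + c j) + ((d j + e j) + (p j + g j))).
  have ia := intg3 sh (sH j) (reg_D 'u_j rRf).
  have ib := intg3 sh (sL j) (rdl j); have ic := intg3 sh (sL j) (rdR j).
  have id := intg3 (sH j) sl (rdl j); have ie := intg3 (sH j) sl (rdR j).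
  have ip := intg3 (sL j) sl (rdl j); have ig := intg3 (sL j) sl (rdR j).
  apply: (etrans _ (I_sum7 ia ib ic id ie ip ig)).
  apply: eqI => x; rewrite eD.
  have -> : w i x = l x + h x by rewrite /h /high addrC subrK.
  have -> : w j x = L j x + H j x by rewrite /H /high addrC subrK.
  clear => *; ring.
have sq0 (u : vfield R) : (forall j, sqX (u j)) -> divf u -> \sum_j \int[leb3]_x (u j x * l x * dl j x) = 0.
  move=> su du.
  have E j : \int[leb3]_x (u j x * 'd_j (fun y => l y * l y) x) = 2 * \int[leb3]_x (u j x * l x * dl j x).
    rewrite -(IZ 2 (intg3 (su j) sl (rdl j))); apply: eqI => x.
    have sm := smooth_derivable l x 'u_j (reg_smooth rl).
    rewrite (DM sm sm) -/(dl j x); move: (dl j x) => t; ring.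
  have h2 : \sum_j \int[leb3]_x (u j x * 'd_j (fun y => l y * l y) x) =
      2 * \sum_j \int[leb3]_x (u j x * l x * dl j x).
    by rewrite mulr_sumr; apply: eq_bigr => j _; exact: E.
  have /eqP := etrans (esym h2) (du _ (regM rl rl)).
  by rewrite mulf_eq0 pnatr_eq0 => /eqP.
have ibp (u : vfield R) : (forall j, sqX (u j)) -> divf u ->
    \sum_j \int[leb3]_x (u j x * l x * dR j x) = - \sum_j \int[leb3]_x (u j x * Rh x * dl j x).
  move=> su du.
  have E j : \int[leb3]_x (u j x * 'd_j (fun y => l y * Rh y) x) =
      \int[leb3]_x (u j x * l x * dR j x) + \int[leb3]_x (u j x * Rh x * dl j x).
    rewrite -(ID (intg3 (su j) sl (rdR j)) (intg3 (su j) sRh (rdl j))); apply: eqI => x.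
    rewrite (DM (smooth_derivable l x _ (reg_smooth rl)) (smooth_derivable Rh x _ (reg_smooth rRh))).
    by rewrite -/(dl j x) -/(dR j x); ring.
  have h2 : \sum_j \int[leb3]_x (u j x * 'd_j (fun y => l y * Rh y) x) =
      \sum_j \int[leb3]_x (u j x * l x * dR j x) + \sum_j \int[leb3]_x (u j x * Rh x * dl j x).
    by rewrite -big_split; apply: eq_bigr => j _; exact: E.
  have /eqP := etrans (esym h2) (du _ (regM rl rRh)).
  by rewrite addr_eq0 => /eqP.
(* The low-low product [L_j dl_j] is fixed by [Rop m.+3], which self-adjointness moves onto [h]. *)
have loc j : b j = \int[leb3]_x (L j x * Rh x * dl j x).
  have sG : sqX (fun x => L j x * dl j x).
    have [C hC] := reg_bounded (rdl j).
    exact: sqiM_bd (sL j) (smooth_mfun3 (reg_smooth (rdl j))) hC.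
  transitivity (\int[leb3]_x (h x * Rop chi m.+3 (fun z => L j z * dl j z) x)).
    by apply: eqI => x; rewrite (Rop_low_product m j x (sw j) (sw i)) mulrA.
  rewrite (op_sym er sG sh); apply: eqI => x; rewrite -/(Rop chi m.+3 h) -/Rh; ring.
have total : \sum_j \int[leb3]_x (w i x * w j x * 'd_j (Rop chi m.+3 (w i)) x) =
    \sum_j (a j + c j - \int[leb3]_x (H j x * Rh x * dl j x)).
  rewrite (eq_bigr _ (fun j _ => split7 j)) !big_split /=.
  have d0 := sq0 H sH dH; have p0 := sq0 L sL dL; have e1 := ibp H sH dH; have g1 := ibp L sL dL.
  have b1 : \sum_j b j = \sum_j \int[leb3]_x (L j x * Rh x * dl j x) by apply: eq_bigr => j _; exact: loc.
  have E (sa sb sc sd se sp sg se' sb' : R) : sd = 0 -> sp = 0 -> se = - se' -> sg = - sb' -> sb = sb' ->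
    sa + (sb + sc + (sd + se + (sp + sg))) = sa + sc - se' by move=> -> -> -> -> ->; ring.
  by rewrite (E _ _ _ _ _ _ _ _ _ d0 p0 e1 g1 b1) sumrN.
rewrite total; apply: le_trans (ler_norm_sum _ _ _) _; apply: ler_sum => j _.
set Y := nsq3 (high m w).
have hH : N2X h * N2X (H j) <= Y.
  have q (s t u : R) : s ^+ 2 <= u -> t ^+ 2 <= u -> s * t <= u.
    nra.
  by apply: q; rewrite N2_sqr; exact: (nsq_le3 (high m w)).
have ba : `|a j| <= A * Y.
  have h1 := I3_le sh (sH j) (reg_D 'u_j rRf) A0 (hR i j).
  by apply: le_trans h1 _; rewrite ler_wpM2l.
have bc : `|c j| <= (\sum_(k < 3) moment (rho1 chi) j k) * (A * Y).
  have h1 := commutator_bound j er sh (rL j) (fun k z => hS j k z).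
  have h2 : c j = \int[leb3]_x (h x * L j x * conv ('d_j (kern (rho chi m.+3))) h x).
    apply: eqI => x; congr (_ * _); exact: (D_conv x 'u_j (schw_kern er.1) sh).2.
  rewrite h2; apply: le_trans h1 _.
  have E k : moment (rho chi m.+3) j k = moment (rho1 chi) j k.
    exact: (moment_dil j k (lambda_gt0 m.+3) (etf_rho1 hchi)).
  have E2 : \sum_(k < 3) moment (rho chi m.+3) j k = \sum_(k < 3) moment (rho1 chi) j k.
    by apply: eq_bigr => k _.
  apply: (le_trans (y := A * (\sum_(k < 3) moment (rho1 chi) j k) * nsqX h)).
    apply: eq_ler; exact: (congr1 (fun z => A * z * nsqX h) E2).
  have S0 : 0 <= \sum_(k < 3) moment (rho1 chi) j k by apply: sumr_ge0 => k _; exact: N1_ge0.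
  exact: G S0 (nsq_le3 (high m w) i).
have be : `|\int[leb3]_x (H j x * Rh x * dl j x)| <= N1 (kern (rho1 chi)) * (A * Y).
  have h1 := I3_le (sH j) sRh (rdl j) A0 (hS i j).
  have h3 : N2X Rh <= N1 (kern (rho1 chi)) * N2X h.
    by have := bernstein2 [::] (lambda_gt0 m.+3) (etf_rho1 hchi) sh; rewrite mul1r.
  apply: le_trans h1 _; exact: G2 (N2_ge0 _ _) (N1_ge0 _) h3 hH.
apply: le_trans (ler_normB _ _) _; rewrite !mulrDl mul1r.
apply: le_trans (lerD (ler_normD _ _) (lexx _)) _.
by rewrite [leRHS]addrAC; apply: lerD => //; apply: lerD.
Qed.

Lemma flux_bound m w (A : R) : vsqX w -> divf w -> 0 <= A ->
  (forall i j x, `|'d_j (Sop chi m (w i)) x| <= A) ->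
  (forall i j x, `|'d_j (Rop chi m.+3 (w i)) x| <= A) ->
  `|flux w (opv (rho chi m.+3) w)| <= flux_const * (A * nsq3 (high m w)).
Proof.
move=> sw dw A0 hS hR; apply: le_trans (ler_norm_sum _ _ _) _.
rewrite mulr_suml; apply: ler_sum => i _.
by rewrite mulr_suml; exact: flux_component.
Qed.

End FluxBound.

(** * Comparison of lower integrals *)

Section MonotoneIntegral.
Import HBNNSimple.
Context d (T : measurableType d) (R : realType) (mu : {measure set T -> \bar R}).
Implicit Types (D : set T) (f g : T -> \bar R).

(* No measurability is needed: the library's integral of a nonnegative function
   is a supremum over simple functions, that is, a lower integral. *)
Lemma lower_integral_le D f g : (forall x, D x -> (0 <= f x)%E) -> (forall x, D x -> (f x <= g x)%E) ->
  (\int[mu]_(x in D) f x <= \int[mu]_(x in D) g x)%E.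
Proof.
move=> f0 fg; rewrite integral_mkcond [leRHS]integral_mkcond.
have r0 (h : T -> \bar R) : (forall x, D x -> (0 <= h x)%E) -> forall x, (0 <= (h \_ D) x)%E.
  by move=> h0 x; rewrite patchE; case: ifPn => // /[!inE]; exact: h0.
have g0 x : D x -> (0 <= g x)%E by move=> Dx; exact: le_trans (f0 x Dx) (fg x Dx).
rewrite (ge0_integralTE mu (r0 f f0)) (ge0_integralTE mu (r0 g g0)).
apply: le_ereal_sup => _ [h hf <-]; exists h => // x; apply: le_trans (hf x) _.
by rewrite !patchE; case: ifPn => // /[!inE]; exact: fg.
Qed.

(** A simple function below [C f] is [C] times a simple function below [f]. It is applied to the
    enstrophy as a function of time. *)
Lemma lower_integral_scale D f (C : R) : 0 < C -> (forall x, D x -> (0 <= f x)%E) ->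
  (\int[mu]_(x in D) (C%:E * f x) <= C%:E * \int[mu]_(x in D) f x)%E.
Proof.
move=> C0 f0; rewrite integral_mkcond [X in (_ <= _ * X)%E]integral_mkcond.
have r0 (h : T -> \bar R) : (forall x, D x -> (0 <= h x)%E) -> forall x, (0 <= (h \_ D) x)%E.
  by move=> h0 x; rewrite patchE; case: ifPn => // /[!inE]; exact: h0.
have Cf0 x : D x -> (0 <= C%:E * f x)%E by move=> Dx; apply: mule_ge0; [exact: ltW|exact: f0].
rewrite (ge0_integralTE mu (r0 _ Cf0)); apply: ub_ereal_sup => _ [h hf <-].
rewrite -integralT_nnsfun.
have -> : (\int[mu]_x (h x)%:E = \int[mu]_x (C%:E * (C^-1 * h x)%:E))%E.
  by apply: eq_integral => x _; rewrite -EFinM mulrA divff ?lt0r_neq0// mul1r.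
rewrite ge0_integralZl//; last 3 first.
- by apply/measurable_EFinP; exact: measurable_funM.
- by move=> x _; rewrite lee_fin mulr_ge0// invr_ge0 ltW.
- by rewrite ltW.
rewrite lee_pmul2l//; apply: lower_integral_le => x _.
  by rewrite lee_fin mulr_ge0// invr_ge0 ltW.
have := hf x; rewrite !patchE; case: ifPn => Dx.
  by rewrite EFinM lee_pdivrMl.
rewrite lee_fin => h0; rewrite lee_fin; have /eqP -> : h x == 0 by rewrite eq_le h0 /=.
lra.
Qed.

End MonotoneIntegral.

(** * Sobolev norms through weak derivatives *)

Section WeakNorm.
Context {R : realType} (chi : space3 R -> R) (hchi : lp_cutoff chi).
Local Notation X := (space3 R).
Implicit Types (s t : R) (i j : 'I_3) (f g : X -> R) (w : vfield R).

Lemma Lnorm2_sqr g : sqX g -> ('N[leb3]_2%:E[EFin \o g] ^+ 2 = (nsqX g)%:E)%E.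
Proof. by move=> sg; rewrite Lnorm2E// -N2_sqr. Qed.

Lemma weak_derivative_sqnorm_ge0 l f : (0 <= weak_derivative_sqnorm l f)%E.
Proof.
by apply: le_ereal_inf_tmp => _ [g _ <-]; apply: expe_ge0; exact: Lnorm_ge0.
Qed.

(** Two weak derivatives have the same pairings with test functions, so their difference has norm 0
    by [wder0_unique], and the infimum is over one value. *)
Lemma weak_derivative_sqnormE l f g : sqX f -> sqX g -> wder l f g ->
  weak_derivative_sqnorm l f = (nsqX g)%:E.
Proof.
move=> sf sg wg.
rewrite /weak_derivative_sqnorm (_ : [set _ | _ in _] = [set (nsqX g)%:E]) ?ereal_inf1//.
apply/seteqP; split => [_ [h [/sqi_L2 sh wh] <-]|_ ->]; last first.
  by exists g; [split; [exact/sqi_L2|exact: wder_weak_derivative]|exact: Lnorm2_sqr].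
rewrite Lnorm2_sqr//=; congr (_%:E).
have z : nsqX (fun x => g x - h x) = 0.
  apply: (wder0_unique hchi (sqiB sg sh)) => eta te.
  have se := reg_sqi (test_reg te).
  have e1 := wder_weak_derivative wg te; have e2 := wh _ te.
  have i1 := sqi_mul sg se; have i2 := sqi_mul sh se.
  rewrite (_ : \int[leb3]_x _ = \int[leb3]_x (g x * eta x) - \int[leb3]_x (h x * eta x)).
    move: e2; rewrite e1 => /(congr1 (fun r => (-1) ^+ size l * r)).
    by rewrite !mulrA -!expr2 sqrr_sign !mul1r => ->; rewrite subrr.
  by rewrite -(IB i1 i2); apply: eqI => x; rewrite mulrBl.
have z' : nsqX (fun x => h x - g x) = 0.
  by rewrite -[RHS]z; apply: eqI => x; rewrite -sqrrN opprB.
have N0 : N2X (fun x => g x - h x) = 0 by rewrite /N2 z sqrtr0.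
have N0' : N2X (fun x => h x - g x) = 0 by rewrite /N2 z' sqrtr0.
have l1 : N2X g <= N2X h.
  rewrite -[leRHS]add0r -N0; apply: le_trans (N2D (sqiB sg sh) sh).
  by apply: eq_ler; congr N2; apply/funext => x; rewrite subrK.
have l2 : N2X h <= N2X g.
  rewrite -[leRHS]add0r -N0'; apply: le_trans (N2D (sqiB sh sg) sg).
  by apply: eq_ler; congr N2; apply/funext => x; rewrite subrK.
by rewrite -!N2_sqr; congr (_ ^+ 2); apply/eqP; rewrite eq_le l2.
Qed.

Lemma weak_derivative_sqnorm_fin l f : sqX f -> (weak_derivative_sqnorm l f < +oo)%E ->
  exists2 g, sqX g & wder l f g.
Proof.
move=> sf; rewrite /weak_derivative_sqnorm.
have [->|] := eqVneq [set ('N[leb3]_2%:E[EFin \o g] ^+ 2)%E | g in [set g | L2 g /\ weak_derivative l f g]] set0.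
  by rewrite ereal_inf0.
move=> /set0P[_ [g [/sqi_L2 sg wg] _]] _; exists g; [exact: sg|exact: (weak_derivative_wder hchi sf sg wg)].
Qed.

Lemma wder_nil f : wder [::] f f.
Proof. by move=> B rB; rewrite mul1r. Qed.

Lemma nabla_sqnorm0 w : vsqX w -> nabla_sqnorm 0 w = (nsq3 w)%:E.
Proof.
move=> sw; rewrite -sumEFin; apply: eq_bigr => i _.
rewrite (big_pred1 [tuple]) => [|l]; last by apply/esym/eqP; exact: tuple0.
exact: weak_derivative_sqnormE (sw i) (sw i) (wder_nil _).
Qed.

Lemma nabla_sqnorm_ge0 k w : (0 <= nabla_sqnorm k w)%E.
Proof. by apply: sume_ge0 => i _; apply: sume_ge0 => l _; exact: weak_derivative_sqnorm_ge0. Qed.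

Lemma nabla_sqnorm1 w : vsqX w -> (nabla_sqnorm 1 w < +oo)%E ->
  exists2 g : 'I_3 -> vfield R, forall i, grad (w i) (g i) &
    nabla_sqnorm 1 w = (\sum_i \sum_j nsqX (g i j))%:E.
Proof.
move=> sw fin.
have fin1 i (l : 1.-tuple 'I_3) : (weak_derivative_sqnorm l (w i) < +oo)%E.
  apply: le_lt_trans fin; rewrite /nabla_sqnorm (bigD1 i)//= (bigD1 l)//= -addeA leeDl//.
  apply: adde_ge0; first by apply: sume_ge0 => k _; exact: weak_derivative_sqnorm_ge0.
  by apply: sume_ge0 => k _; apply: sume_ge0 => m _; exact: weak_derivative_sqnorm_ge0.
have h i j : {g | sqX g & wder [:: j] (w i) g}.
  have [g sg wg] := cid2 (weak_derivative_sqnorm_fin (sw i) (fin1 i [tuple j])); by exists g.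
exists (fun i j => s2val (h i j)) => [i|].
  by split => j; [exact: s2valP (h i j)|exact: s2valP' (h i j)].
rewrite -sumEFin; apply: eq_bigr => i _; rewrite -sumEFin.
rewrite (reindex (fun j => [tuple j])); last first.
  exists (fun l => thead l) => [j _|l _]//.
  by apply: val_inj => /=; case: l => -[|k [|]].
apply: eq_bigr => j _.
exact: weak_derivative_sqnormE (sw i) (s2valP (h i j)) (s2valP' (h i j)).
Qed.

End WeakNorm.

(** Admissible starting times of the Leray-Hopf inequality; almost every time in []0, T[] is one
    ([energy_time_ae]). *)
Definition energy_time {R : realType} (nu T : R) (v : R -> vfield R) (t0 : R) : Prop := 0 < t0 < T /\ forall t, t0 < t <= T ->
  ((nsq3 (v t))%:E + (2 * nu)%:E * \int[leb]_(s in `[t0, t]) nabla_sqnorm 1 (v s)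
     <= (nsq3 (v t0))%:E)%E.

(** * Extension of a Leray-Hopf solution to all real times *)

Section ClampedPath.
Context {R : realType} (chi : space3 R -> R) (hchi : lp_cutoff chi).
Local Notation X := (space3 R).
Implicit Types (s t : R) (i j : 'I_3).

(** Composition with this retraction turns continuity within [[0, T]] into continuity on the
    line. *)
Definition clamp (T t : R) : R := Num.max 0 (Num.min t T).

Lemma clamp_itv (T t : R) : 0 < T -> 0 <= clamp T t <= T.
Proof.
by move=> T0; rewrite le_max lexx/= ge_max (ltW T0)/= ge_min lexx orbT.
Qed.

Lemma clamp_id (T t : R) : 0 <= t <= T -> clamp T t = t.
Proof. by move=> /andP[t0 tT]; rewrite /clamp min_l// max_r. Qed.

Lemma continuous_clamp (T : R) : continuous (clamp T).
Proof.
move=> t.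
have c1 : {for t, continuous (fun s => Num.min s T)}.
  apply: (@continuous_min R R (fun s => s) (fun=> T)); [exact: cvg_id|exact: cvg_cst].
by apply: (@continuous_max R R (fun=> 0) (fun s => Num.min s T) t _ c1); exact: cvg_cst.
Qed.

Lemma within_clamp (T : R) (f : R -> R) : 0 < T -> {within `[0, T], continuous f} ->
  continuous (fun t => f (clamp T t)).
Proof.
move=> T0 /subspace_continuousP cf t.
have tI : `[0, T]%classic (clamp T t) by rewrite /=; exact: clamp_itv.
apply: cvg_comp (cf _ tI); move=> A; rewrite /= => nA.
have h s : `[0, T]%classic (clamp T s) by rewrite /=; exact: clamp_itv.
have H : \forall s \near t, `[0, T]%classic (clamp T s) -> A (clamp T s) := @continuous_clamp T t _ nA.
by apply: filterS H => s; apply.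
Qed.

Variables (nu T : R) (u0 : vfield R) (u : R -> vfield R).
Hypotheses (nu0 : 0 < nu) (T0 : 0 < T) (hu : leray_hopf nu T u0 u).

Definition vpath t : vfield R := u (clamp T t).

Lemma vpath_id t : 0 <= t <= T -> vpath t = u t.
Proof. by move=> h; rewrite /vpath clamp_id. Qed.

Lemma vpath_wpath i : wpath (fun t => vpath t i).
Proof.
have [[[L2u cu] _ _ _] _ _] := hu.
have su t j : sqX (vpath t j).
  by apply/sqi_L2; apply: L2u; exact: clamp_itv.
split => // w sw.
pose w3 : vfield R := fun j x => if j == i then w x else 0.
have sw3 j : sqX (w3 j) by rewrite /w3; case: (j == i) => //; exact: sqi0.
have := within_clamp T0 (cu w3 (fun j => (sqi_L2 (w3 j)).2 (sw3 j))).
rewrite (_ : (fun t => inner (u (clamp T t)) w3) = fun t => \int[leb3]_x (vpath t i x * w x))//.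
apply/funext => t; apply: eqI => x; rewrite (bigD1 i)//= /w3 eqxx big1 ?addr0// => j /negbTE ->.
lra.
Qed.

Lemma vpath_sqi t i : sqX (vpath t i). Proof. exact: (vpath_wpath i).1. Qed.

Lemma vpath_divf t : divf (vpath t).
Proof.
have [[_ _ du _] _ _] := hu.
apply: (distr_div_divf hchi (vpath_sqi t)); apply: du; exact: clamp_itv.
Qed.

Lemma vpath_weak ps : (forall i, test_function (ps i)) -> (forall x, divergence ps x = 0) ->
  exists c : R, forall t, 0 <= t <= T -> pair (vpath t) ps - c = \int[leb]_(s in `[0, t]) rhs nu vpath ps s.
Proof.
move=> tp dp; have [hw _ _] := hu; have [c hc] := weak_test hchi T0 hw tp dp.
exists c => t tT; rewrite (vpath_id tT) (hc t tT); apply: eq_Rintegral => s; rewrite inE /= in_itv /= => /andP[s0 st].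
have sT : 0 <= s <= T by rewrite s0 (le_trans st); case/andP: tT.
by rewrite /rhs (vpath_id sT).
Qed.

Lemma sobolev1_ge (w : vfield R) : (nabla_sqnorm 0 w + nabla_sqnorm 1 w <= sobolev_norm 1 w ^+ 2)%E.
Proof.
rewrite /sobolev_norm !big_ord_recl big_ord0 adde0 /=.
have := adde_ge0 (nabla_sqnorm_ge0 0 w) (nabla_sqnorm_ge0 1 w).
move: (nabla_sqnorm 0 w + nabla_sqnorm 1 w)%E => [r| |]//.
  by rewrite poweR_EFin => r0; rewrite powR12_sqrt// -EFinM -expr2 sqr_sqrtr.
by rewrite poweRyr.
Qed.

Lemma enstrophy_fin : (\int[leb]_(s in `[0%R, T]) nabla_sqnorm 1 (vpath s) < +oo)%E.
Proof.
have [_ h _] := hu; apply: le_lt_trans h; apply: lower_integral_le => s sT.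
  exact: nabla_sqnorm_ge0.
rewrite vpath_id//; apply: le_trans (sobolev1_ge _).
by rewrite leeDr// nabla_sqnorm_ge0.
Qed.

Lemma indicE_itv (a b : R) (f : R -> R) : (\int[leb]_(s in `]a, b]) (f s)%:E = \int[leb]_s (\1_`]a, b]%classic s * f s)%:E)%E.
Proof.
rewrite integral_mkcond; apply: eq_integral => s _; rewrite patchE indicE.
by case: (s \in _); rewrite ?mul1r ?mul0r.
Qed.

Lemma itv_sub_integral (a b : R) (f : R -> \bar R) : (forall s, (0 <= f s)%E) ->
  (\int[leb]_(s in `]a, b]) f s <= \int[leb]_(s in `[a, b]) f s)%E.
Proof.
move=> f0; rewrite integral_mkcond [leRHS]integral_mkcond; apply: lower_integral_le => s _.
  by rewrite patchE; case: ifP.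
rewrite !patchE !mem_setE !in_itv; case: ifP => [/= /andP[/ltW -> ->]//|_].
by case: ifP.
Qed.

Lemma vpath_energy : Ig 0 T (fun s => nsq3 (vpath s)).
Proof.
have m : measurable_fun setT (fun s => nsq3 (vpath s)).
  by apply: measurable_sum => i; exact: nsq_measurable (vpath_wpath i).
apply: intg_ge0P.
- by apply: measurable_funM.
- by move=> s; rewrite mulr_ge0 ?nsq3_ge0.
rewrite -indicE_itv; have [_ h _] := hu.
apply: le_lt_trans h; apply: le_trans (itv_sub_integral _ _ _) _; first by move=> s; rewrite lee_fin nsq3_ge0.
apply: lower_integral_le => s sT; first by rewrite lee_fin nsq3_ge0.
rewrite -(nabla_sqnorm0 hchi (vpath_sqi s)) vpath_id//; apply: le_trans (sobolev1_ge _).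
by rewrite leeDl// nabla_sqnorm_ge0.
Qed.

Lemma vLnorm2_sqr (w : vfield R) : vsqX w -> (vLnorm 2%:E w ^+ 2 = (nsq3 w)%:E)%E.
Proof.
move=> sw.
have i1 : intgX (fun x => \sum_i w i x ^+ 2).
  exact: (intg_sum (index_enum 'I_3) (fun i => (sw i).2)).
have p x : 0 <= \sum_i w i x ^+ 2 by apply: sumr_ge0 => i _; exact: sqr_ge0.
have sq : sqX (fun x => Num.sqrt (\sum_i w i x ^+ 2)).
  split; first by apply: measurableT_comp (intg_meas i1); apply: continuous_measurable_fun; exact: sqrt_continuous.
  by apply: intg_ext i1 => x; rewrite sqr_sqrtr.
rewrite (Lnorm2_sqr sq); congr (_%:E).
rewrite /nsq3 -(Isum _ (fun i => (sw i).2)); apply: eqI => x; by rewrite sqr_sqrtr.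
Qed.

Lemma energy_time_ae : {ae leb, forall t0 : R, 0 < t0 < T -> energy_time nu T vpath t0}.
Proof.
have [_ _ h] := hu; move: h; apply: (@filterS _ _ (ae_filter_ringOfSetsType leb)) => t0 h t0T; split => // t /andP[t0t tT].
have /andP[t00 _] := t0T.
have I1 : 0 <= t <= T by rewrite (le_trans (ltW t00) (ltW t0t)).
have I0 : 0 <= t0 <= T by rewrite (ltW t00) (le_trans (ltW t0t) tT).
have i0 : t0 \in `]0, T[ by rewrite in_itv.
have i1 : t \in `]t0, T] by rewrite in_itv/= t0t.
have := h i0 t i1.
rewrite -(vpath_id I1) -(vpath_id I0) (vLnorm2_sqr (vpath_sqi t)) (vLnorm2_sqr (vpath_sqi t0)).
have -> : (\int[leb]_(s in `[t0, t]) nabla_sqnorm 1 (u s))%E = (\int[leb]_(s in `[t0, t]) nabla_sqnorm 1 (vpath s))%E; last by [].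
apply: eq_integral => s; rewrite inE /= in_itv/= => /andP[s0 st]; rewrite vpath_id//.
lra.
Qed.

End ClampedPath.

(** * Integral inequality for the energy of the high frequencies *)

Section TailArithmetic.
Variable R : realType.
Implicit Types a b c d e f p q r k l y : R.

Lemma sqr_sum3 p q r : (p + (q + r)) ^+ 2 <= 3 * (p ^+ 2 + (q ^+ 2 + r ^+ 2)).
Proof.
have h1 := sqr_ge0 (p - q); have h2 := sqr_ge0 (q - r); have h3 := sqr_ge0 (p - r).
lra.
Qed.

Lemma sqr_sum_ord3 (F : 'I_3 -> R) : (\sum_j F j) ^+ 2 <= 3 * \sum_j F j ^+ 2.
Proof. by rewrite !big_ord_recl !big_ord0 !addr0; exact: sqr_sum3. Qed.

Lemma tail_arith1 p q r : - (r * q) <= p -> -1 * (2 * r * q) <= 2 * p.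
Proof.
lra.
Qed.

Lemma tail_arith3 a b c l p y : 0 < c -> 0 < l -> a + b = p -> y <= (c * l^-1) ^+ 2 * (3 * p) ->
  - b + (3 * c ^+ 2)^-1 * l ^+ 2 * y <= a.
Proof.
move=> c0 l0 h hy.
have h1 : (3 * c ^+ 2)^-1 * l ^+ 2 * y <= p.
  have k0 : 0 < (3 * c ^+ 2)^-1 * l ^+ 2 by rewrite mulr_gt0 ?invr_gt0 ?mulr_gt0.
  apply: (le_trans (ler_wpM2l (ltW k0) hy)); apply: eq_ler.
  by field; rewrite !lt0r_neq0.
lra.
Qed.

Lemma tail_arith2 a b c d e f p q r k l y : a + 2 * k * (d + r * l * y) <= b ->
  e - f = p - 2 * k * d -> - q <= p ->
  a - e + 2 * k * r * l * y <= b - f + q.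
Proof.
lra.
Qed.

End TailArithmetic.

Section Tail.
Context {R : realType} (chi : space3 R -> R) (hchi : lp_cutoff chi).
Local Notation X := (space3 R).
Implicit Types (s t : R) (x y xi : X) (i j : 'I_3) (w : vfield R) (al : X -> R) (m n : nat).

Lemma wpath_op al (p : R -> X -> R) : etf al -> wpath p -> wpath (fun t => op al (p t)).
Proof.
move=> ea [sp cp]; split; first by move=> t; exact: sqi_op.
move=> w sw; rewrite (_ : (fun t => _) = fun t => \int[leb3]_x (p t x * op al w x)).
  exact: cp (sqi_op ea sw).
by apply/funext => t; rewrite (op_sym ea sw (sp t)); apply: eqI => x; rewrite mulrC.
Qed.

Lemma wpath_high m (p : R -> X -> R) : wpath p -> wpath (fun t x => p t x - Sop chi m (p t) x).
Proof.
move=> wp; have [sq cq] := wpath_op (etf_chil hchi m) wp; have [sp cp] := wp.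
split; first by move=> t; exact: sqiB (sp t) (sq t).
move=> w sw; rewrite (_ : (fun t => _) = fun t => \int[leb3]_x (p t x * w x) - \int[leb3]_x (Sop chi m (p t) x * w x)).
  by move=> t; apply: cvgB; [exact: cp|exact: cq].
apply/funext => t; rewrite -(IB (sqi_mul (sp t) sw) (sqi_mul (sq t) sw)).
by apply: eqI => x; rewrite mulrBl.
Qed.

Definition lapal al xi : R := dot xi xi * al xi.

Lemma etf_lapal al : etf al -> etf (lapal al).
Proof.
move=> [ta ea]; split.
  have sd : smooth (fun xi => \sum_(k < 3) dot 'u_k xi * dot 'u_k xi).
    by apply: smooth_sum => k; apply: smoothM; exact: smooth_dotr.
  rewrite (_ : lapal al = fun xi => (\sum_(k < 3) dot 'u_k xi * dot 'u_k xi) * al xi).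
    exact: tfunMl.
  by apply/funext => xi; rewrite /lapal dotxx.
move=> xi; rewrite /lapal ea.
by rewrite !dotE; ring.
Qed.

Lemma laplacian_op al (f : X -> R) x : etf al -> sqX f -> laplacian (op al f) x = - op (lapal al) f x.
Proof.
move=> ea sf; have sk := schw_kern ea.1.
have sD j := schw_D 'u_j (schw_D 'u_j sk).
transitivity (\sum_j conv ('d_j ('d_j (kern al))) f x).
  apply: eq_bigr => j _.
  exact: (congr1 (@^~ x) (iter_derive_conv [:: 'u_j; 'u_j] sk sf)).
have e1 := conv_suml (index_enum 'I_3) x (fun j => schw_pkern (sD j)) sf.
rewrite -e1 (_ : (fun y => \sum_(j < 3) _) = fun y => (-1) * kern (lapal al) y).
  by rewrite (convZl (-1) x (pkern_kern (etf_lapal ea).1) sf) mulN1r.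
by apply/funext => y; rewrite laplacian_kern ?mulN1r//; exact: ea.1.
Qed.

(** The damping rate of a tail relative to [nu lambda^2]. The 3 is the Cauchy-Schwarz constant for
    the sum over three partial derivatives; only [chi] enters. *)
Definition tail_rate : R := (3 * s2val (cid2 (reverse_bernstein hchi)) ^+ 2)^-1.

Lemma tail_rate_gt0 : 0 < tail_rate.
Proof. by rewrite invr_gt0 mulr_gt0// exprn_gt0// (s2valP (cid2 (reverse_bernstein hchi))). Qed.

Variables (nu T : R) (v : R -> vfield R).
Hypothesis (nu0 : 0 < nu).
Hypothesis wv : forall i, wpath (fun t => v t i).
Hypothesis hE : Ig 0 T (fun s => nsq3 (v s)).
Hypothesis dv : forall t, divf (v t).
Hypothesis hweak : forall ps, (forall i, test_function (ps i)) -> (forall x, divergence ps x = 0) ->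
  exists c : R, forall t, 0 <= t <= T -> pair (v t) ps - c = \int[leb]_(s in `[0, t]) rhs nu v ps s.

Let sv t i : sqX (v t i) := (wv i).1 t.

Definition tail m t : R := nsq3 (high chi m (v t)).

Lemma tail_ge0 m t : 0 <= tail m t. Proof. exact: nsq3_ge0. Qed.

Lemma tail_measurable m : measurable_fun setT (tail m).
Proof. by apply: measurable_sum => i; exact: nsq_measurable (wpath_high m (wv i)). Qed.

Lemma tailE m t : tail m t = nsq3 (v t) - pair (v t) (opv (rho chi m) (v t)).
Proof.
rewrite -sumrB; apply: eq_bigr => i _.
exact: (nsq_high hchi m (sv t i)).
Qed.

Definition tail_const : R := (1 + N1 (kern chi)) ^+ 2.

Lemma tail_le m t : tail m t <= tail_const * nsq3 (v t).
Proof.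
rewrite mulr_sumr; apply: ler_sum => i _.
have N0 := N1_ge0 (kern chi).
have h : N2X (high chi m (v t) i) <= (1 + N1 (kern chi)) * N2X (v t i).
  apply: le_trans (N2B (sv t i) (sqi_Sop hchi m (sv t i))) _.
  by rewrite mulrDl mul1r lerD2l; exact: N2_Sop.
rewrite -!N2_sqr -exprMn lerXn2r// nnegrE ?N2_ge0// mulr_ge0 ?N2_ge0//; exact: addr_ge0.
Qed.

Lemma Ig_tail m a b : 0 <= a -> b <= T -> Ig a b (tail m).
Proof.
move=> a0 bT; apply: Ig_sub a0 bT _.
apply: (Ig_le (tail_measurable m) (IgZ tail_const hE)) => s _.
by rewrite ger0_norm ?tail_ge0//; exact: tail_le.
Qed.

Definition dissip n s : R := - visc (v s) (opv (rho chi n) (v s)).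

Lemma dissipE n s : dissip n s = \sum_i \int[leb3]_x (v s i x * op (lapal (rho chi n)) (v s i) x).
Proof.
rewrite /dissip -sumrN; apply: eq_bigr => i _.
have i1 := sqi_mul (sv s i) (sqi_op (etf_lapal (etf_rho hchi n)) (sv s i)).
apply/eqP; rewrite eqr_oppLR -mulN1r; apply/eqP.
rewrite -(IZ (-1) i1); apply: eqI => x; rewrite (laplacian_op x (etf_rho hchi n) (sv s i)); ring.
Qed.

Lemma Ig_dissip n a b : 0 <= a -> b <= T -> Ig a b (dissip n).
Proof.
move=> a0 bT; apply: Ig_sub a0 bT _.
have er := etf_lapal (etf_rho hchi n).
have m : measurable_fun setT (dissip n).
  rewrite (_ : dissip n = fun s => \sum_i \int[leb3]_x (v s i x * op (lapal (rho chi n)) (v s i) x)).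
    apply: measurable_sum => i.
    have := @bilinear_measurable R _ _ (fun=> 1) 1 (wv i) (wpath_op er (wv i)) (measurable_cst _) _.
    rewrite normr1 => /(_ (fun _ => lexx _)); congr measurable_fun; apply/funext => s.
    by apply: eqI => x; rewrite mulr1.
  by apply/funext => s; exact: dissipE.
apply: (Ig_le m (IgZ (N1 (kern (lapal (rho chi n)))) hE)) => s _.
rewrite dissipE; apply: le_trans (ler_norm_sum _ _ _) _; rewrite mulr_sumr; apply: ler_sum => i _.
apply: le_trans (cauchy_schwarz (sv s i) (sqi_op er (sv s i))) _.
rewrite -N2_sqr mulrCA ler_wpM2l ?N2_ge0//.
exact: N2_conv (schw_pkern (schw_kern er.1)) (sv s i).
Qed.

(** By [visc_lower] the enstrophy exceeds the low-frequency dissipation by the enstrophy of the high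
    part, to which reverse Bernstein applies. When weak gradients are missing the right side is
    infinite. *)
Lemma enstrophy_lower n s :
  ((dissip n.+1 s + tail_rate * lambda n.+1 ^+ 2 * tail n.+1 s)%:E <= nabla_sqnorm 1 (v s))%E.
Proof.
have C0 := s2valP (cid2 (reverse_bernstein hchi)); have hC := s2valP' (cid2 (reverse_bernstein hchi)).
set C := s2val _ in C0 hC *.
case: (ltP (nabla_sqnorm 1 (v s)) +oo%E) => [fin|]; last first.
  by rewrite leye_eq => /eqP ->; rewrite leey.
have [g hg ->] := nabla_sqnorm1 hchi (sv s) fin.
rewrite /dissip mulr_sumr -sumrN -big_split; apply: ler_sum => i _.
have vl := visc_lower hchi n.+1 (sv s i) (hg i).
have rb := hC n _ _ (sv s i) (hg i).
have l0 := @lambda_gt0 R n.+1.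
set Y := nsqX (high chi n.+1 (v s) i).
have hY : Y <= (C * (lambda n.+1)^-1) ^+ 2 * (3 * \sum_j nsqX (fun x => g i j x - Sop chi n.+1 (g i j) x)).
  rewrite /Y -N2_sqr; set N := \sum_j N2 _ _ in rb.
  have N0 : 0 <= N by apply: sumr_ge0 => j _; exact: N2_ge0.
  have cl : 0 <= C * (lambda n.+1)^-1 by rewrite mulr_ge0 ?invr_ge0 ?(ltW l0) ?(ltW C0).
  apply: (@le_trans _ _ ((C * (lambda n.+1)^-1) ^+ 2 * N ^+ 2)).
    by rewrite -exprMn lerXn2r// nnegrE ?N2_ge0// mulr_ge0.
  rewrite ler_wpM2l ?sqr_ge0// (eq_bigr (fun j => N2X (fun x => g i j x - Sop chi n.+1 (g i j) x) ^+ 2)).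
    exact: sqr_sum_ord3.
  by move=> j _; rewrite N2_sqr.
exact: tail_arith3 C0 l0 vl hY.
Qed.

Lemma energy_bound t0 t : energy_time nu T v t0 -> t0 <= t <= T -> nsq3 (v t) <= nsq3 (v t0).
Proof.
move=> [t0T h] /andP[]; rewrite le_eqVlt => /orP[/eqP <- //|t0t] tT.
have := h t; rewrite t0t tT => /(_ isT) h'; rewrite -lee_fin; apply: le_trans h'.
rewrite leeDl//; apply: mule_ge0; first by rewrite lee_fin mulr_ge0// ltW.
by apply: integral_ge0 => s _; exact: nabla_sqnorm_ge0.
Qed.

(** The enstrophy is replaced by an integrable real minorant [f], possibly negative. Its positive
    part [fp] is still below the enstrophy, and comparison of lower integrals applies to it. *)
Lemma enstrophy_energy t0 t (f : R -> R) : energy_time nu T v t0 -> t0 < t <= T -> Ig t0 t f ->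
  (forall s, ((f s)%:E <= nabla_sqnorm 1 (v s))%E) ->
  nsq3 (v t) + 2 * nu * It t0 t f <= nsq3 (v t0).
Proof.
move=> [t0T h] tT hf hl; have {}h := h t tT; rewrite -lee_fin; apply: le_trans h.
rewrite EFinD leeD2l// EFinM lee_pmul2l ?lte_fin ?mulr_gt0//.
apply: le_trans (itv_sub_integral _ _ _); last by move=> s; exact: nabla_sqnorm_ge0.
pose fp s := Num.max (\1_`]t0, t]%classic s * f s) 0.
have ifp : intg leb fp.
  apply: (intg_le _ (intg_abs hf)).
    apply: measurable_maxr; [exact: intg_meas hf|exact: measurable_cst].
  by move=> s; rewrite /fp; case: (leP (\1_`]t0, t]%classic s * f s) 0) => _; rewrite ?normr0.
apply: (@le_trans _ _ (\int[leb]_s fp s)%:E).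
  by apply: Ile => // s; rewrite le_max lexx.
rewrite (EFinI ifp) [X in (_ <= X)%E]integral_mkcond; apply: lower_integral_le => s _.
  by rewrite lee_fin le_max lexx orbT.
rewrite patchE /fp indicE; case: (s \in _); last by rewrite mul0r maxxx.
rewrite mul1r; case: (leP (f s) 0) => _; [exact: nabla_sqnorm_ge0|exact: hl].
Qed.

(** Leray-Hopf inequality minus the energy identity for the symbol [rho m.+3]: the low-frequency
    dissipation occurs in both with the factor [2 nu] and cancels, leaving the damping of the tail
    against the flux. *)
Lemma tail_inequality m t0 t (A : R -> R) : energy_time nu T v t0 -> t0 < t <= T ->
  (forall s, t0 < s <= t -> 0 <= A s /\
    (forall i j x, `|'d_j (Sop chi m (v s i)) x| <= A s) /\
    (forall i j x, `|'d_j (Rop chi m.+3 (v s i)) x| <= A s)) ->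
  Ig t0 t (fun s => A s * tail m s) ->
  tail m.+3 t + 2 * nu * tail_rate * lambda m.+3 ^+ 2 * It t0 t (tail m.+3) <=
  tail m.+3 t0 + 2 * flux_const chi * It t0 t (fun s => A s * tail m s).
Proof.
move=> et tT hA iA; have [/andP[t00 t0T] _] := et; have /andP[t0t tT'] := tT.
have [h1 h2] : Ig t0 t (fun s => 2 * rhs nu v (opv (rho chi m.+3) (v s)) s) /\
    pair (v t) (opv (rho chi m.+3) (v t)) - pair (v t0) (opv (rho chi m.+3) (v t0)) =
    It t0 t (fun s => 2 * rhs nu v (opv (rho chi m.+3) (v s)) s).
  apply: (energy_identity hchi nu0 wv hE dv hweak (etf_rho hchi m.+3) (rho_chis hchi m.+3) (ltW t00) (ltW t0t) tT' (M := 1 + nsq3 (v t0))).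
  move=> s i /andP[s0 st]; apply: le_trans (N2_le_en _ _) _; rewrite lerD2l.
  by apply: (energy_bound et); rewrite s0 (le_trans st).
have iD := Ig_dissip m.+3 (ltW t00) tT'; have iT := Ig_tail m.+3 (ltW t00) tT'.
pose c := tail_rate * lambda m.+3 ^+ 2.
have ef := enstrophy_energy et tT (IgD iD (IgZ c iT)) (fun s => enstrophy_lower m.+2 s).
rewrite (It_D iD (IgZ c iT)) (It_Z c iT) in ef.
have iF : Ig t0 t (fun s => 2 * flux (v s) (opv (rho chi m.+3) (v s))).
  apply: Ig_ext (IgD h1 (IgZ (2 * nu) iD)) => s _; rewrite /rhs /dissip; ring.
have e2 : It t0 t (fun s => 2 * rhs nu v (opv (rho chi m.+3) (v s)) s) =
    It t0 t (fun s => 2 * flux (v s) (opv (rho chi m.+3) (v s))) - 2 * nu * It t0 t (dissip m.+3).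
  rewrite -(It_Z (2 * nu) iD) -(It_B iF (IgZ (2 * nu) iD)); apply: It_ext => s _.
  rewrite /rhs /dissip; ring.
have lF : - (2 * flux_const chi * It t0 t (fun s => A s * tail m s)) <= It t0 t (fun s => 2 * flux (v s) (opv (rho chi m.+3) (v s))).
  rewrite -(It_Z (2 * flux_const chi) iA) -mulN1r -(It_Z (-1) (IgZ _ iA)).
  apply: It_le (IgZ (-1) (IgZ _ iA)) iF _ => s hs; have [A0 [a1 a2]] := hA s hs.
  have := flux_bound hchi (sv s) (dv s) A0 a1 a2; rewrite ler_norml => /andP[+ _].
  exact: tail_arith1.
move: ef h2 lF; rewrite e2 (tailE m.+3 t) (tailE m.+3 t0).
exact: tail_arith2.
Qed.

End Tail.

(** * Selection of times *)

Section TimeSelection.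
Context {R : realType}.
Implicit Types (f g : R -> R) (a b c t : R).

Lemma ae_exists (P : R -> Prop) a b : {ae leb, forall s : R, P s} -> a < b -> exists2 s, a < s < b & P s.
Proof.
move=> hP ab; apply: contrapT => hn.
have h : forall s, a < s < b -> ~ P s by move=> s hs Ps; apply: hn; exists s.
have hneg : leb.-negligible (`]a, b[%classic : set (measurableTypeR R)).
  by apply: negligibleS hP => s; exact: h.
have m : measurable (`]a, b[%classic : set (measurableTypeR R)) by exact: measurable_itv.
have E : lebesgue_measure `]a, b[%classic = 0%E := (negligibleP leb m).1 hneg.
move: E; rewrite lebesgue_measure_itv/= lte_fin ab.
by move=> /eqP; rewrite eqe subr_eq0 => /eqP ba; move: ab; rewrite ba ltxx.
Qed.

Lemma Ig_sum (f : nat -> R -> R) a b N : (forall m, Ig a b (f m)) -> Ig a b (fun s => \sum_(m < N) f m s).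
Proof.
move=> h; elim: N => [|N IH].
  by apply: Ig_ext (Ig_cst a b 0) => s _; rewrite big_ord0.
by apply: Ig_ext (IgD IH (h N)) => s _; rewrite big_ord_recr.
Qed.

Lemma It_sum (f : nat -> R -> R) a b N : (forall m, Ig a b (f m)) ->
  It a b (fun s => \sum_(m < N) f m s) = \sum_(m < N) It a b (f m).
Proof.
move=> h; elim: N => [|N IH].
  rewrite big_ord0 -[RHS](@I0 _ _ _ leb); apply: eqI => s; by rewrite big_ord0 mulr0.
rewrite big_ord_recr /= -IH -(It_D (Ig_sum N h) (h N)); apply: It_ext => s _.
by rewrite big_ord_recr.
Qed.

Lemma EFin_It a b f : Ig a b f -> (It a b f)%:E = (\int[leb]_(s in `]a, b]) (f s)%:E)%E.
Proof.
move=> h; rewrite indicE_itv (EFinI h); exact: eq_integral.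
Qed.

(** The series has integral at most [K], so it is finite almost everywhere, in particular at some
    time where [P] holds too. *)
Lemma ae_select (f : nat -> R -> R) (K : R) (P : R -> Prop) a b :
  (forall m, measurable_fun setT (f m)) -> (forall m s, 0 <= f m s) -> (forall m, Ig a b (f m)) ->
  (forall N, It a b (fun s => \sum_(m < N) f m s) <= K) ->
  {ae leb, forall s : R, P s} -> a < b ->
  exists s, [/\ a < s < b, P s & exists S, forall N, \sum_(m < N) f m s <= S].
Proof.
move=> mf f0 If hK hP ab.
pose F s := (\big[+%E/0%R]_(0 <= m <oo) (f m s)%:E)%E.
have m : measurable (`]a, b]%classic : set (measurableTypeR R)) by exact: measurable_itv.
have mfk k : measurable_fun (`]a, b]%classic : set (measurableTypeR R)) (fun s => (f k s)%:E).
  apply/measurable_EFinP; apply: measurable_funS (mf k) => //.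
have mF : measurable_fun (`]a, b]%classic : set (measurableTypeR R)) F.
  apply: ge0_emeasurable_sum => [k s _ _|k _]; [by rewrite lee_fin|exact: mfk].
have F0 s : (0 <= F s)%E by apply: nneseries_ge0 => k _ _; rewrite lee_fin.
have Ifin : (\int[leb]_(s in `]a, b]) F s <= K%:E)%E.
  rewrite (integral_nneseries leb m mfk); last by move=> k s _; rewrite lee_fin.
  apply: lime_le.
    by apply: is_cvg_nneseries => k _ _; apply: integral_ge0 => s _; rewrite lee_fin.
  apply: nearW => N; rewrite big_mkord.
  rewrite (eq_bigr (fun k : 'I_N => (It a b (f k))%:E)); last by move=> k _; rewrite EFin_It.
  by rewrite sumEFin lee_fin -It_sum.
have iF : leb.-integrable `]a, b] F.
  apply/integrableP; split => //; apply: le_lt_trans (ltry K); apply: le_trans Ifin.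
  apply: eq_ler; apply: eq_integral => s _; by rewrite gee0_abs.
have hF := integrable_ae m iF.
have hPF : {ae leb, forall s : R, P s /\ (`]a, b]%classic s -> F s \is a fin_num)}.
  exact: @filterS2 _ _ (ae_filter_ringOfSetsType leb) _ _ _ (fun s p q => conj p q) hP hF.
have [s sab [Ps hFs]] := ae_exists hPF ab.
exists s; split => //.
have fs : F s \is a fin_num.
  by apply: hFs; rewrite /= in_itv/=; move: sab => /andP[-> /ltW ->].
exists (fine (F s)) => N; rewrite -lee_fin fineK// -sumEFin.
have := @nneseries_lim_ge R (fun k => (f k s)%:E) xpredT 0 N; rewrite big_mkord; apply.
by move=> k _ _; rewrite lee_fin.
Qed.

End TimeSelection.

(** * Gronwall's lemma with an integrable coefficient *)

Section Gronwall.
Context {R : realType}.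
Implicit Types (b Z : R -> R) (t s : R).

(** Above a high level [N] the excess of [b] has integral at most [e / 2]; below it, [b] contributes
    at most [N] times the length of the interval. *)
Lemma uniformly_integrable (T : R) b (e : R) : 0 <= T -> measurable_fun setT b -> Ig 0 T b ->
  (forall s, 0 <= b s) -> 0 < e ->
  exists2 h : R, 0 < h & forall a a', 0 <= a -> a <= a' -> a' <= T -> a' - a <= h -> It a a' b <= e.
Proof.
move=> T0 mb ib b0 e0.
pose F (n : nat) s := Num.max (b s - n%:R) 0.
have F0 n s : 0 <= F n s by rewrite le_max lexx orbT.
have Fb n s : F n s <= b s by rewrite ge_max b0 andbT lerBlDr lerDl.
have mF n : measurable_fun setT (F n).
  by apply: measurable_maxr; [apply: measurable_funB|exact: measurable_cst].
have [] := @It_dct R 0 T F (fun=> 0) b mF ib.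
- move=> s _; apply: cvg_near_cst; exists (Num.bound (b s)) => // n /= hn; rewrite /F max_r// subr_le0.
  apply: ltW; apply: lt_le_trans (archi_boundP (b0 s)) _; by rewrite ler_nat.
- by move=> n s _; rewrite ger0_norm.
move=> _; rewrite (It_cst 0 T0) mul0r => cF.
have e2 : 0 < e / 2 by rewrite divr_gt0.
have [N /(_ N (leqnn N)) hN] := cvg0_le cF e2.
have iF : Ig 0 T (F N) by apply: (Ig_le (mF N) ib) => s _; rewrite ger0_norm.
exists (e / 2 / (N%:R + 1)); first by rewrite divr_gt0.
move=> a a' a0 aa aT h.
have ia := Ig_sub a0 aT iF; have ib' := Ig_sub a0 aT ib.
have h1 : It a a' b <= It a a' (F N) + It a a' (fun=> N%:R).
  rewrite -(It_D ia (Ig_cst a a' N%:R)); apply: It_le ib' (IgD ia (Ig_cst _ _ _)) _ => s _.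
  by rewrite -lerBlDr le_max lexx.
have h2 : It a a' (F N) <= e / 2.
  apply: le_trans (le_trans (ler_norm _) hN).
  rewrite (It_add a0 (le_trans aa aT) iF) (It_add aa aT (Ig_sub a0 (lexx T) iF)).
  have p1 : 0 <= It 0 a (F N) by apply: It_ge0.
  have p2 : 0 <= It a' T (F N) by apply: It_ge0.
  by move: p1 p2; lra.
have h3 : It a a' (fun=> N%:R) <= e / 2.
  rewrite (It_cst _ aa); move: h; rewrite ler_pdivlMr// => h.
  lra.
lra.
Qed.

Lemma le_of_halving (x y B : R) : (forall j : nat, x <= y + B * 2^-1 ^+ j) -> x <= y.
Proof.
move=> h; have c : (y + B * 2^-1 ^+ j) @[j --> \oo] --> y + B * 0.
  apply: cvgD; [exact: cvg_cst|apply: cvgM; first exact: cvg_cst].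
  by apply: cvg_expr; rewrite ger0_norm ?invr_ge0// invf_lt1// ltr1n.
by rewrite mulr0 addr0 in c; apply: (cvgr_to_ge c); exact: nearW.
Qed.

(** [Z] is merely measurable and bounded, so nothing is differentiated. [[0, T]] is covered by [n]
    steps on each of which [b] has integral at most [1/2], and on one step the bound at most
    doubles. The resulting constant [2^n] depends on [b] and [T] but not on the crude bound [B]. *)
Lemma gronwall (T : R) b : 0 <= T -> measurable_fun setT b -> Ig 0 T b -> (forall s, 0 <= b s) ->
  exists2 E : R, 0 <= E & forall t0 Z (K B : R), 0 <= t0 <= T -> 0 <= K -> measurable_fun setT Z ->
    (forall s, t0 < s <= T -> 0 <= Z s <= B) ->
    (forall t, t0 < t <= T -> Z t <= K + It t0 t (fun s => b s * Z s)) ->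
    forall t, t0 < t <= T -> Z t <= E * K.
Proof.
move=> T0 mb ib b0.
have [h h0 hh] := uniformly_integrable T0 mb ib b0 (divr_gt0 ltr01 (ltr0n R 2)).
pose n := Num.bound (T / h).
have nT : T <= n%:R * h.
  by rewrite -ler_pdivrMr// ltW// archi_boundP// divr_ge0// ltW.
exists (2 ^+ n); first exact: exprn_ge0.
move=> t0 Z K B /andP[t00 t0T] K0 mZ hZ hG.
have iZ a a' : t0 <= a -> a' <= T -> Ig a a' (fun s => b s * Z s).
  move=> ta aT; apply: (Ig_le _ (Ig_sub (le_trans t00 ta) aT (IgZ B ib))) => [|s /andP[as_ sa]].
    exact: measurable_funM.
  have /andP[Z0 ZB] : 0 <= Z s <= B by apply: hZ; rewrite (le_lt_trans ta)// (le_trans sa).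
  by rewrite normrM !ger0_norm// mulrC ler_wpM2r.
pose I t := K + It t0 t (fun s => b s * Z s).
have I_add a a' : t0 <= a -> a <= a' -> a' <= T -> I a' = I a + It a a' (fun s => b s * Z s).
  by move=> ta aa aT; rewrite /I (It_add ta aa (iZ _ _ (lexx _) aT)) addrA.
have It0 : It t0 t0 (fun s => b s * Z s) = 0.
  rewrite -[RHS](@I0 _ _ _ leb); apply: eqI => s; rewrite itv1E; case: (boolP (t0 < s <= t0)); last by rewrite mul0r.
  lra.
have claim k t : t0 <= t -> t <= T -> t <= t0 + k%:R * h -> I t <= 2 ^+ k * K.
  elim: k t => [|k IH] t t0t tT.
    rewrite mul0r addr0 => tt0; have -> : t = t0 by apply/eqP; rewrite eq_le tt0 t0t.
    by rewrite /I It0 addr0 mul1r.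
  move=> tk; have [tl|tl] := leP t (t0 + k%:R * h).
    apply: le_trans (IH t t0t tT tl) _; rewrite exprS ler_wpM2r// ler_peMl ?exprn_ge0// ler1n//.
  pose a := t0 + k%:R * h.
  have t0a : t0 <= a by rewrite lerDl mulr_ge0// ltW.
  have aT : a <= T by apply: le_trans tT; exact: ltW.
  have Ia := IH a t0a aT (lexx _).
  rewrite exprS -mulrA; apply: (@le_trans _ _ (2 * I a)); last by rewrite ler_pM2l.
  have I0' : 0 <= I a.
    apply: addr_ge0 => //; apply: It_ge0 => s /andP[s1 s2]; apply: mulr_ge0 => //.
    by have /andP[] : 0 <= Z s <= B by apply: hZ; rewrite s1 (le_trans s2).
  have B0 : 0 <= B.
    have tt : t0 < t <= T by rewrite tT (le_lt_trans t0a tl).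
    by have /andP[p q] := hZ t tt; exact: le_trans p q.
  have half s X : a < s <= t -> 0 <= X -> (forall r, a < r <= t -> Z r <= X) -> I s <= I a + X * 2^-1.
    move=> /andP[as_ st] X0 hX; have sT := le_trans st tT.
    rewrite (I_add a s t0a (ltW as_) sT) lerD2l.
    have ib' := Ig_sub (le_trans t00 t0a) sT ib.
    apply: (@le_trans _ _ (It a s (fun r => X * b r))).
      apply: It_le (iZ _ _ t0a sT) (IgZ X ib') _ => r /andP[r1 r2]; rewrite mulrC ler_wpM2r//.
      by apply: hX; rewrite r1 (le_trans r2).
    rewrite (It_Z X ib') ler_wpM2l// -[2^-1]mul1r; apply: hh (le_trans t00 t0a) (ltW as_) sT _.
    rewrite /a.
    lra.
  (* Feeding the inequality into itself halves the excess over [2 I a], starting from the crude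
     bound [B]. *)
  have it j : forall s, a < s <= t -> Z s <= 2 * I a + B * 2^-1 ^+ j.
    elim: j => [|j IHj] s hs.
      rewrite mulr1; apply: (@le_trans _ _ B); last by rewrite lerDr mulr_ge0.
      have /andP[as_ st] := hs.
      by have /andP[] : 0 <= Z s <= B by apply: hZ; rewrite (le_lt_trans t0a)// (le_trans st).
    have /andP[as_ st] := hs.
    apply: (@le_trans _ _ (I s)); first by apply: hG; rewrite (le_lt_trans t0a)// (le_trans st).
    have X0 : 0 <= 2 * I a + B * 2^-1 ^+ j.
      by rewrite addr_ge0// mulr_ge0.
    apply: le_trans (half s _ hs X0 IHj) _; apply: eq_ler.
    by rewrite exprSr; field.
  apply: (@le_of_halving _ _ B) => j.
  have X0 : 0 <= 2 * I a + B * 2^-1 ^+ j.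
    by rewrite addr_ge0// mulr_ge0.
  have tt : a < t <= t by rewrite tl lexx.
  apply: le_trans (half t _ tt X0 (it j)) _.
  have y0 : 0 <= B * 2^-1 ^+ j by rewrite mulr_ge0.
  lra.
move=> t /andP[t0t tT]; apply: le_trans (hG t _) _; first by rewrite t0t.
apply: claim => //; first exact: ltW.
lra.
Qed.

End Gronwall.

(** * Bootstrap for weighted sums of damped energies *)

Lemma weight_arith (R : realType) (l d e y1 y2 y3 y4 y5 : R) (w : nat) :
  8 ^+ w * l ^+ w * (y4 + d * (8 * l) ^+ 2 * y1) <= 8 ^+ w * l ^+ w * (y5 + (y3 + e * l ^+ 2 * y2)) ->
  8 ^+ w * l ^+ w * y4 + d * ((8 * l) ^+ w.+2 * y1) <=
  8 ^+ w * l ^+ w * y5 + (8 ^+ w * (l ^+ w * y3) + e * 8 ^+ w * (l ^+ w.+2 * y2)).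
Proof.
have e2 x : x ^+ w.+2 = x ^+ w * (x * x) by rewrite -addn2 exprD.
rewrite !e2 [(8 * l) ^+ w]exprMn.
lra.
Qed.

Section Bootstrap.
Context {R : realType}.
Implicit Types (s t : R) (m n w N : nat).
Variables (T tau d e B : R) (b : R -> R) (Y : nat -> R -> R) (G : R -> Prop).
Hypotheses (tau0 : 0 <= tau) (tauT : tau < T) (d0 : 0 < d) (e0 : 0 <= e).
Hypotheses (mb : measurable_fun setT b) (b0 : forall s, 0 <= b s) (ib : Ig 0 T b).
Hypotheses (mY : forall m, measurable_fun setT (Y m)) (Y0 : forall m s, 0 <= Y m s).
Hypothesis YB : forall m s, tau <= s <= T -> Y m s <= B.
Hypothesis aeG : {ae leb, forall s, tau < s < T -> G s}.
Hypothesis hY : forall t0 t m, G t0 -> tau <= t0 -> t0 < t <= T ->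
  Y m.+3 t + d * lambda m.+3 ^+ 2 * It t0 t (Y m.+3) <=
  Y m.+3 t0 + (It t0 t (fun s => b s * Y m s) + e * lambda m ^+ 2 * It t0 t (Y m)).

(** The sum starts at level 3 because [hY] controls [Y m.+3] only; it is finite, with all bounds
    uniform in [N], so that no convergence has to be known in advance. *)
Definition wsum w N t : R := \sum_(m < N) lambda m.+3 ^+ w * Y m.+3 t.

Definition good w t0 : Prop := [/\ G t0, tau < t0 < T & exists S, forall N, wsum w N t0 <= S].

Let lam0 n : 0 < lambda n :> R := lambda_gt0 n.

Let B0 : 0 <= B.
Proof. by apply: le_trans (Y0 0 T) (YB _ _); rewrite lexx ltW. Qed.

Let IY m a a' : tau <= a -> a' <= T -> Ig a a' (Y m).
Proof.
move=> ta aT; apply: (Ig_le (mY m) (Ig_cst a a' B)) => s /andP[s1 s2].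
by rewrite ger0_norm//; apply: YB; rewrite (le_trans ta (ltW s1)) (le_trans s2).
Qed.

Let IbY m a a' : tau <= a -> a' <= T -> Ig a a' (fun s => b s * Y m s).
Proof.
move=> ta aT; apply: (Ig_le _ (Ig_sub (le_trans tau0 ta) aT (IgZ B ib))) => [|s /andP[s1 s2]].
  exact: measurable_funM.
rewrite normrM !ger0_norm// mulrC ler_wpM2r//; apply: YB.
lra.
Qed.

Lemma wsum_ge0 w N t : 0 <= wsum w N t.
Proof. by apply: sumr_ge0 => m _; rewrite mulr_ge0// exprn_ge0// ltW. Qed.

Lemma wsum_measurable w N : measurable_fun setT (wsum w N).
Proof. by apply: measurable_sum => m; apply: measurable_funM. Qed.

Lemma Ig_wsum w N a a' : tau <= a -> a' <= T -> Ig a a' (wsum w N).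
Proof.
by move=> ta aT; apply: (@Ig_sum _ (fun m s => lambda m.+3 ^+ w * Y m.+3 s)) => m; exact: IgZ (IY _ ta aT).
Qed.

Lemma It_wsum w N a a' : tau <= a -> a' <= T ->
  It a a' (wsum w N) = \sum_(m < N) lambda m.+3 ^+ w * It a a' (Y m.+3).
Proof.
move=> ta aT; rewrite (@It_sum _ (fun m s => lambda m.+3 ^+ w * Y m.+3 s)).
  by apply: eq_bigr => m _; rewrite (It_Z _ (IY _ ta aT)).
by move=> m; exact: IgZ (IY _ ta aT).
Qed.

Definition low w : R := 3 * lambda 3 ^+ w * B.

Lemma low_ge0 w : 0 <= low w.
Proof. by rewrite mulr_ge0// mulr_ge0// exprn_ge0// ltW. Qed.

(* The three lowest frequencies are bounded. *)
Lemma shift_sum w N t : tau <= t <= T -> \sum_(m < N) lambda m ^+ w * Y m t <= low w + wsum w N t.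
Proof.
move=> tT; have p m : 0 <= lambda m ^+ w * Y m t by rewrite mulr_ge0// exprn_ge0// ltW.
have h3 m : (m < 3)%N -> lambda m ^+ w * Y m t <= lambda 3 ^+ w * B.
  move=> m3; apply: ler_pM => //; [by rewrite exprn_ge0// ltW| |exact: YB].
  by rewrite lerXn2r ?nnegrE ?(ltW (lam0 _))// ler_weXn2l ?ler1n// ltnW.
rewrite /wsum; have -> : \sum_(m < N) lambda m.+3 ^+ w * Y m.+3 t = \sum_(3 <= m < N.+3) lambda m ^+ w * Y m t.
  by rewrite -(addn3 N) -{1}[3%N]add0n big_addn addnK big_mkord; apply: eq_bigr => m _; rewrite addn3.
rewrite -(big_mkord xpredT (fun m => lambda m ^+ w * Y m t)).
apply: (@le_trans _ _ (\sum_(0 <= m < N.+3) lambda m ^+ w * Y m t)).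
  rewrite [leRHS](@big_cat_nat _ _ _ N) //=; last by rewrite -addn3 leq_addr.
  by rewrite lerDl; apply: sumr_ge0 => m _.
rewrite (@big_cat_nat _ _ _ 3) //= lerD2r big_mkord !big_ord_recl big_ord0 /low addr0.
have -> : 3 * lambda 3 ^+ w * B = lambda 3 ^+ w * B + (lambda 3 ^+ w * B + lambda 3 ^+ w * B) by ring.
by apply: lerD; [exact: (h3 0%N)|apply: lerD; [exact: (h3 1%N)|exact: (h3 2%N)]].
Qed.

Let lam3 m : lambda m.+3 = 8 * lambda m :> R.
Proof. by rewrite !lambdaS; ring. Qed.

(** [hY] is multiplied by [lambda m.+3 ^ w = 8^w lambda m ^ w] and summed. The term in [e] becomes
    [e 8^w] times the sum of weight [w + 2]; after the shift of [shift_sum] it is absorbed by half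
    of the dissipation, which has the same weight. *)
Lemma bootstrap_ineq w N t0 t : e * 8 ^+ w <= d / 2 -> G t0 -> tau < t0 -> t0 < t <= T ->
  wsum w N t + d / 2 * It t0 t (wsum w.+2 N) <=
  wsum w N t0 + 8 ^+ w * low w * It 0 T b + d / 2 * low w.+2 * T +
  It t0 t (fun s => 8 ^+ w * b s * wsum w N s).
Proof.
move=> hw Gt0 t0l tT; have /andP[t0t tT'] := tT.
have ta : tau <= t0 := ltW t0l.
have iD := Ig_wsum w.+2 N ta tT'; have iZ := Ig_wsum w N ta tT'.
have ibt := Ig_sub (le_trans tau0 ta) tT' ib.
have w0 : 0 <= 8 ^+ w :> R by exact: exprn_ge0.
have e1 : wsum w N t + d * It t0 t (wsum w.+2 N) <= wsum w N t0 +
    (8 ^+ w * (\sum_(m < N) lambda m ^+ w * It t0 t (fun s => b s * Y m s)) +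
     e * 8 ^+ w * \sum_(m < N) lambda m ^+ w.+2 * It t0 t (Y m)).
  rewrite (It_wsum _ _ ta tT') /wsum !mulr_sumr -!big_split /=; apply: ler_sum => m _.
  have l0 : 0 <= (lambda m.+3 : R) ^+ w by rewrite exprn_ge0// ltW.
  have := ler_wpM2l l0 (hY m Gt0 ta tT); rewrite lam3 exprMn.
  exact: weight_arith.
have e2 : \sum_(m < N) lambda m ^+ w * It t0 t (fun s => b s * Y m s) <=
    low w * It 0 T b + It t0 t (fun s => b s * wsum w N s).
  have i1 m : Ig t0 t (fun s => lambda m ^+ w * (b s * Y m s)) := IgZ _ (IbY m ta tT').
  have ibZ : Ig t0 t (fun s => b s * wsum w N s).
    apply: Ig_ext (@Ig_sum _ (fun m s => lambda m.+3 ^+ w * (b s * Y m.+3 s)) t0 t N (fun m => IgZ _ (IbY _ ta tT'))).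
    by move=> s _; rewrite /wsum mulr_sumr; apply: eq_bigr => m _; ring.
  rewrite (eq_bigr (fun m : 'I_N => It t0 t (fun s => lambda m ^+ w * (b s * Y m s)))); last first.
    by move=> m _; rewrite (It_Z _ (IbY m ta tT')).
  rewrite -(@It_sum _ (fun m s => lambda m ^+ w * (b s * Y m s)) t0 t N i1).
  apply: (@le_trans _ _ (It t0 t (fun s => low w * b s + b s * wsum w N s))).
    apply: It_le (Ig_sum N i1) (IgD (IgZ (low w) ibt) ibZ) _ => s /andP[s1 s2].
    have sT : tau <= s <= T by rewrite (le_trans ta (ltW s1)) (le_trans s2).
    have := ler_wpM2l (b0 s) (shift_sum w N sT); rewrite mulrDr [b s * low w]mulrC mulr_sumr.
    by apply: le_trans; apply: eq_ler; apply: eq_bigr => m _; ring.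
  rewrite (It_D (IgZ (low w) ibt) ibZ) (It_Z _ ibt) lerD2r ler_wpM2l ?low_ge0//.
  rewrite (It_add (le_trans tau0 ta) (ltW (lt_le_trans t0t tT')) ib).
  rewrite (It_add (ltW t0t) tT' (Ig_sub (le_trans tau0 ta) (lexx _) ib)).
  have p1 : 0 <= It 0 t0 b by apply: It_ge0.
  have p2 : 0 <= It t T b by apply: It_ge0.
  by move: p1 p2; lra.
have e3 : \sum_(m < N) lambda m ^+ w.+2 * It t0 t (Y m) <= low w.+2 * T + It t0 t (wsum w.+2 N).
  have i1 m : Ig t0 t (fun s => lambda m ^+ w.+2 * Y m s) := IgZ _ (IY m ta tT').
  rewrite (eq_bigr (fun m : 'I_N => It t0 t (fun s => lambda m ^+ w.+2 * Y m s))); last first.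
    by move=> m _; rewrite (It_Z _ (IY m ta tT')).
  rewrite -(@It_sum _ (fun m s => lambda m ^+ w.+2 * Y m s) t0 t N i1).
  apply: (@le_trans _ _ (It t0 t (fun s => low w.+2 + wsum w.+2 N s))).
    apply: It_le (Ig_sum N i1) (IgD (Ig_cst _ _ (low w.+2)) iD) _ => s /andP[s1 s2].
    by apply: shift_sum; rewrite (le_trans ta (ltW s1)) (le_trans s2).
  rewrite (It_D (Ig_cst _ _ (low w.+2)) iD) (It_cst _ (ltW t0t)) lerD2r ler_wpM2l ?low_ge0//.
  by rewrite lerBlDr (le_trans tT')// lerDl (le_trans tau0 ta).
have e4 : It t0 t (fun s => 8 ^+ w * b s * wsum w N s) = 8 ^+ w * It t0 t (fun s => b s * wsum w N s).
  rewrite -It_Z; first by apply: It_ext => s _; rewrite mulrA.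
  apply: Ig_ext (@Ig_sum _ (fun m s => lambda m.+3 ^+ w * (b s * Y m.+3 s)) t0 t N (fun m => IgZ _ (IbY _ ta tT'))).
  by move=> s _; rewrite mulr_sumr; apply: eq_bigr => m _; ring.
have E0 : 0 <= low w.+2 * T + It t0 t (wsum w.+2 N).
  apply: addr_ge0; last by apply: It_ge0 => s _; exact: wsum_ge0.
  by apply: mulr_ge0; [exact: low_ge0|exact: le_trans tau0 (ltW tauT)].
have e5 := le_trans (ler_wpM2l (mulr_ge0 e0 w0) e3) (ler_wpM2r E0 hw).
have e6 := ler_wpM2l w0 e2.
lra.
Qed.

(** Gronwall bounds the sum of weight [w] at all later times; inserted back, this bounds the
    surviving half of the dissipation, a time integral of weight [w + 2]. *)
Lemma bootstrap_step w t0 : e * 8 ^+ w <= d / 2 -> good w t0 ->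
  exists C, (forall N t, t0 < t <= T -> wsum w N t <= C) /\ (forall N t, t0 < t <= T -> It t0 t (wsum w.+2 N) <= C).
Proof.
move=> hw [Gt0 /andP[t0l t0T] [S hS]].
have w0 : 0 <= 8 ^+ w :> R by exact: exprn_ge0.
have T0 : 0 <= T := le_trans tau0 (ltW tauT).
have ib' : Ig 0 T (fun s => 8 ^+ w * b s) by exact: IgZ.
have mb' : measurable_fun setT (fun s => 8 ^+ w * b s) by exact: measurable_funM.
have b0' s : 0 <= 8 ^+ w * b s by rewrite mulr_ge0.
have [E E0 hE] := gronwall T0 mb' ib' b0'.
have S0 : 0 <= S by have := hS 0%N; rewrite /wsum big_ord0.
have Ib0 : 0 <= It 0 T b by apply: It_ge0.
pose K := S + 8 ^+ w * low w * It 0 T b + d / 2 * low w.+2 * T.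
have d2 : 0 < d / 2 by rewrite divr_gt0.
have K0 : 0 <= K.
  rewrite /K; apply: addr_ge0; last by rewrite mulr_ge0// mulr_ge0 ?low_ge0// ltW.
  by apply: addr_ge0 => //; rewrite mulr_ge0// mulr_ge0// low_ge0.
have pD N t : 0 <= It t0 t (wsum w.+2 N) by apply: It_ge0 => s _; exact: wsum_ge0.
have key N t : t0 < t <= T -> wsum w N t + d / 2 * It t0 t (wsum w.+2 N) <= K + It t0 t (fun s => 8 ^+ w * b s * wsum w N s).
  move=> tT; apply: le_trans (bootstrap_ineq N hw Gt0 t0l tT) _.
  by rewrite lerD2r /K !lerD2r; exact: hS.
have Zle N t : t0 < t <= T -> wsum w N t <= E * K.
  (* The a priori bound depends on [N]; this is harmless because [E] and [K] do not. *)
  move=> tT; apply: (hE t0 (wsum w N) K (\sum_(m < N) lambda m.+3 ^+ w * B)) => //.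
  - by rewrite (le_trans tau0 (ltW t0l)) ltW.
  - exact: wsum_measurable.
  - move=> s /andP[s1 s2]; rewrite wsum_ge0; apply: ler_sum => m _; rewrite ler_wpM2l ?exprn_ge0 ?(ltW (lam0 _))//.
    by apply: YB; rewrite (le_trans (ltW t0l) (ltW s1)).
  - by move=> s hs; apply: le_trans (key N s hs); rewrite lerDl; apply: mulr_ge0; [exact: ltW|exact: pD].
pose C2 := (d / 2)^-1 * (K + E * K * (8 ^+ w * It 0 T b)).
have EK : 0 <= E * K by rewrite mulr_ge0.
have C20 : 0 <= C2.
  by rewrite mulr_ge0// ?invr_ge0 ?(ltW d2)// addr_ge0// mulr_ge0// mulr_ge0.
exists (E * K + C2); split => [N t tT|N t tT].
  by apply: le_trans (Zle N t tT) _; rewrite lerDl.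
rewrite -[leLHS]add0r; apply: lerD => //; rewrite /C2 ler_pdivlMl//.
have /andP[t0t tT'] := tT.
have ibt := Ig_sub (le_trans tau0 (ltW t0l)) tT' ib'.
have h1 : It t0 t (fun s => 8 ^+ w * b s * wsum w N s) <= E * K * (8 ^+ w * It 0 T b).
  apply: (@le_trans _ _ (It t0 t (fun s => E * K * (8 ^+ w * b s)))).
    apply: It_le _ (IgZ (E * K) ibt) _ => [|s /andP[s1 s2]].
      apply: (Ig_le _ (IgZ (E * K) ibt)) => [|s /andP[s1 s2]].
        by apply: measurable_funM => //; exact: wsum_measurable.
      rewrite ger0_norm; last by rewrite mulr_ge0// wsum_ge0.
      by rewrite mulrC ler_wpM2r// Zle// s1 (le_trans s2).
    by rewrite mulrC ler_wpM2r// Zle// s1 (le_trans s2).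
  rewrite (It_Z _ ibt) ler_wpM2l// -(It_Z _ ib).
  rewrite (It_add (le_trans tau0 (ltW t0l)) (ltW t0T) ib').
  rewrite (It_add (ltW t0t) tT' (Ig_sub (le_trans tau0 (ltW t0l)) (lexx _) ib')).
  have p1 : 0 <= It 0 t0 (fun s => 8 ^+ w * b s) by apply: It_ge0.
  have p2 : 0 <= It t T (fun s => 8 ^+ w * b s) by apply: It_ge0.
  by move: p1 p2; lra.
have := key N t tT; have := wsum_ge0 w N t.
lra.
Qed.

Lemma good_select w K a c : tau <= a -> a < c -> c <= T -> (forall N, It a c (wsum w N) <= K) ->
  exists2 t0, a < t0 < c & good w t0.
Proof.
move=> ta ac cT hK.
have [|||s [sac Gs [S hS]]] := @ae_select _ (fun m s => lambda m.+3 ^+ w * Y m.+3 s) K _ a c _ _ _ hK aeG ac.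
- by move=> m; exact: measurable_funM.
- by move=> m s; rewrite mulr_ge0// exprn_ge0// ltW.
- by move=> m; exact: IgZ (IY _ ta cT).
have /andP[as_ sc] := sac.
have sT : tau < s < T by rewrite (le_lt_trans ta as_) (lt_le_trans sc cT).
by exists s => //; split; [exact: Gs|exact: sT|exists S].
Qed.

Lemma good_next w t0 a : e * 8 ^+ w <= d / 2 -> good w t0 -> t0 < a <= T ->
  exists2 t1, t0 < t1 < a & good w.+2 t1.
Proof.
move=> hw gt /andP[t0a aT]; have [C [_ hC]] := bootstrap_step hw gt.
have [_ /andP[t0l _] _] := gt.
by apply: (good_select (ltW t0l) t0a aT) => N; apply: hC; rewrite t0a.
Qed.

Lemma bootstrap (K ts : R) : e * 8 ^+ 11 <= d / 2 -> (forall N, It tau T (wsum 1 N) <= K) -> tau < ts <= T ->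
  exists C, forall N t, ts <= t <= T -> wsum 11 N t <= C.
Proof.
move=> h7 hK /andP[tts tsT].
have hw w : (w <= 11)%N -> e * 8 ^+ w <= d / 2.
  by move=> w7; apply: le_trans h7; rewrite ler_wpM2l// ler_weXn2l// ler1n.
have hK' N : It tau ts (wsum 1 N) <= K.
  apply: le_trans (hK N); rewrite (It_add (ltW tts) tsT (Ig_wsum 1 N (lexx _) (lexx _))) lerDl.
  by apply: It_ge0 => s _; exact: wsum_ge0.
(* A finite time integral of the sum of given weight yields a good starting time for that weight,
   always before [ts]. *)
have [t1 /andP[tt1 t1s] g1] := good_select (lexx tau) tts tsT hK'.
have n1 : t1 < ts <= T by rewrite t1s.
have [t3 /andP[_ t3s] g3] := good_next (hw 1%N isT) g1 n1.
have n3 : t3 < ts <= T by rewrite t3s.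
have [t5 /andP[_ t5s] g5] := good_next (hw 3%N isT) g3 n3.
have n5 : t5 < ts <= T by rewrite t5s.
have [t7 /andP[_ t7s] g7] := good_next (hw 5%N isT) g5 n5.
have n7 : t7 < ts <= T by rewrite t7s.
have [t9 /andP[_ t9s] g9] := good_next (hw 7%N isT) g7 n7.
have n9 : t9 < ts <= T by rewrite t9s.
have [t11 /andP[_ t11s] g11] := good_next (hw 9%N isT) g9 n9.
have [C [hC _]] := bootstrap_step (hw 11%N isT) g11.
by exists C => N t /andP[st tT]; apply: hC; rewrite (lt_le_trans t11s st).
Qed.

End Bootstrap.

(** * Essential suprema of continuous functions *)

Section EssentialSup.
Context {R : realType}.
Local Notation X := (space3 R).
Implicit Types (h : X -> R) (x : X).

Lemma leb3_box (A B C : set (measurableTypeR R)) : measurable A -> measurable B -> measurable C ->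
  leb3 (A `*` B `*` C) = (lebesgue_measure A * lebesgue_measure B * lebesgue_measure C)%E.
Proof.
move=> mA mB mC.
apply: (etrans (product_measure1E (lebesgue_measure \x lebesgue_measure)%E lebesgue_measure (measurableX mA mB) mC)).
by congr (_ * _)%E; exact: product_measure1E.
Qed.

Lemma ball3 x (r : R) : ball x r = (ball x.1.1 r `*` ball x.1.2 r `*` ball x.2 r).
Proof. by []. Qed.

(** If [h > c] at one point, it is so on a ball of the sup norm, which is a box of positive
    measure. *)
Lemma continuous_ae_le h (c : R) : continuous h -> {ae leb3, forall x, h x <= c} -> forall x, h x <= c.
Proof.
move=> ch hae x; rewrite leNgt; apply/negP => cx.
have : \forall y \near x, c < h y by exact: (cvgr_gt (h x)) (ch x) _ cx.
move=> /nbhs_ballP[r r0 hr].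
have m a : measurable (ball a r : set (measurableTypeR R)) by exact: measurable_ball.
have mB : measurable (ball x r : set (measurableTypeR R * measurableTypeR R * measurableTypeR R)).
  by apply: measurableX; [apply: measurableX|].
have neg : leb3.-negligible (ball x r : set (measurableTypeR R * measurableTypeR R * measurableTypeR R)).
  by apply: negligibleS hae => y /hr; rewrite ltNge => /negP.
have E0 := (negligibleP leb3 mB).1 neg.
have := etrans (esym (etrans (congr1 leb3 (ball3 x r)) (leb3_box (m _) (m _) (m _)))) E0.
rewrite !lebesgue_measure_ball ?ltW// => /eqP; apply/negP.
by rewrite !mulf_neq0// mulrn_eq0 lt0r_neq0.
Qed.

Lemma leb3_gt0 : (0 < leb3 [set: measurableTypeR R * measurableTypeR R * measurableTypeR R])%E.
Proof.
have -> : [set: measurableTypeR R * measurableTypeR R * measurableTypeR R] = setT `*` setT `*` setT.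
  by apply/seteqP.
rewrite leb3_box//; have g : (0 < lebesgue_measure [set: measurableTypeR R])%E.
  rewrite -[setT]/([set` `]-oo, +oo[]) || rewrite -set_itvNyy; rewrite lebesgue_measure_itv/=.
  by rewrite ltry.
by rewrite !mule_gt0.
Qed.

Lemma Lnorm_oo_le h (c : R) : continuous h -> (forall x, 0 <= h x) ->
  (Lnorm leb3 +oo (fun x => (h x)%:E) <= c%:E)%E <-> forall x, h x <= c.
Proof.
move=> ch h0; rewrite unlock leb3_gt0; split => [/ess_supP hc|hc].
  apply: (continuous_ae_le ch); move: hc; apply: (@filterS _ _ (ae_filter_ringOfSetsType leb3)) => x /=.
  by rewrite ger0_norm.
apply/ess_supP; apply: (@filterS _ _ (ae_filter_ringOfSetsType leb3) setT); last exact: @filterT _ _ (ae_filter_ringOfSetsType leb3).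
by move=> x _; rewrite lee_fin ger0_norm.
Qed.

End EssentialSup.

(** * Littlewood-Paley blocks as real fields *)

Section Blocks.
Context {R : realType} (chi : space3 R -> R) (hchi : lp_cutoff chi).
Local Notation X := (space3 R).
Implicit Types (x xi : X) (i j : 'I_3) (w : vfield R) (p q m n : nat).

(** The real form of [lp_block] (see [lp_blockE]), as [phi_q] is the difference of two consecutive
    dilates of [chi]. *)
Definition blk q w : vfield R := fun i x => Sop chi q.+1 (w i) x - Sop chi q (w i) x.

Lemma phi_qE q xi : phi_q chi q xi = chis chi (lambda q.+1) xi - chis chi (lambda q) xi.
Proof. by rewrite /phi_q /phi scalerA -invfM lambdaS. Qed.

Lemma etf_phi q : etf (phi_q chi q).
Proof.
have := etfB (etf_chil hchi q.+1) (etf_chil hchi q).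
by rewrite (_ : (fun xi => _) = phi_q chi q)//; apply/funext => xi; rewrite phi_qE.
Qed.

Lemma blkE q w i x : sqX (w i) -> blk q w i x = op (phi_q chi q) (w i) x.
Proof.
move=> sw; rewrite /blk -(opB x (etf_chil hchi q.+1) (etf_chil hchi q) sw).
by congr (op _ (w i) x); apply/funext => xi; rewrite phi_qE.
Qed.

(** The imaginary part is the sine transform of an even function. *)
Lemma inverse_fourierE al x : etf al -> inverse_fourier al x = ((kern al x)%:C)%C.
Proof.
move=> ea; rewrite /inverse_fourier /Cintegral.
have -> : \int[leb3]_xi complex.Re ((al xi)%:C%C * (cos (dot x xi) +i* sin (dot x xi))%C) = ctr al x.
  by apply: eqI => xi /=; rewrite mul0r subr0.
have -> : \int[leb3]_xi complex.Im ((al xi)%:C%C * (cos (dot x xi) +i* sin (dot x xi))%C) = str al x.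
  by apply: eqI => xi /=; rewrite mul0r addr0.
rewrite (str_even0 x ea.1 ea.2); apply/eqP; rewrite eq_complex /=.
by rewrite !mulr0 !mul0r subr0 addr0 !eqxx.
Qed.

Lemma lp_blockE q w i x : sqX (w i) -> lp_block chi q w i x = ((blk q w i x)%:C)%C.
Proof.
move=> sw; rewrite (blkE q x sw) /lp_block.
have -> : inverse_fourier (phi_q chi q) = fun z => ((kern (phi_q chi q) z)%:C)%C.
  by apply/funext => z; exact: inverse_fourierE (etf_phi q).
apply/eqP; rewrite eq_complex /=; apply/andP; split; apply/eqP.
  by apply: eqI => y; rewrite mulr0 subr0.
rewrite -[RHS](@I0 _ _ _ leb3); apply: eqI => y.
lra.
Qed.

Definition blkn q w x : R := Num.sqrt (\sum_i blk q w i x ^+ 2).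

Lemma blkn_ge0 q w x : 0 <= blkn q w x. Proof. exact: sqrtr_ge0. Qed.

Lemma lp_block_normE (r : \bar R) q w : vsqX w ->
  lp_block_norm chi r q w = Lnorm leb3 r (fun x => (blkn q w x)%:E).
Proof.
move=> sw; congr (Lnorm leb3 r _); apply/funext => x; congr (Num.sqrt _)%:E.
by apply: eq_bigr => i _; rewrite (lp_blockE q x (sw i)) expr0n addr0.
Qed.

Lemma sqi_blk q w i : vsqX w -> sqX (blk q w i).
Proof. by move=> sw; apply: sqiB; exact: sqi_Sop. Qed.

Lemma continuous_blk q w i : vsqX w -> continuous (blk q w i).
Proof.
move=> sw x; apply: cvgB; exact: (smooth_cont (reg_smooth (reg_Sop hchi _ (sw i)))).
Qed.

Lemma continuous_blkn q w : vsqX w -> continuous (blkn q w).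
Proof.
move=> sw x; apply: (@continuous_comp _ _ _ (fun y => \sum_i blk q w i y ^+ 2) Num.sqrt); last exact: sqrt_continuous.
apply: cvg_sumr => i; apply: (@continuous_comp _ _ _ (blk q w i) (fun a => a ^+ 2)); last exact: exprn_continuous.
exact: continuous_blk.
Qed.

Lemma lp_block_norm_oo q w (c : R) : vsqX w ->
  (lp_block_norm chi +oo q w <= c%:E)%E <-> forall x, blkn q w x <= c.
Proof.
move=> sw; rewrite lp_block_normE//; exact: Lnorm_oo_le c (continuous_blkn sw) (blkn_ge0 q w).
Qed.

Lemma lp_block_norm_ge0 r q w : (0 <= lp_block_norm chi r q w)%E.
Proof. exact: Lnorm_ge0. Qed.

Lemma lp_block_norm2 q w : vsqX w ->
  (lp_block_norm chi 2%:E q w ^+ 2 = (nsq3 (blk q w))%:E)%E.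
Proof.
by move=> sw; rewrite lp_block_normE//; exact: vLnorm2_sqr (fun i => sqi_blk q i sw).
Qed.

Lemma blk_le q w i x : `|blk q w i x| <= blkn q w x.
Proof.
rewrite -sqrtr_sqr ler_sqrt; last by apply: sumr_ge0 => k _; exact: sqr_ge0.
by rewrite (bigD1 i)//= lerDl; apply: sumr_ge0 => k _; exact: sqr_ge0.
Qed.

Lemma blkn_le q w x (c : R) : (forall i, `|blk q w i x| <= c) -> blkn q w x <= 2 * c.
Proof.
move=> h; have c0 : 0 <= c by apply: le_trans (h 0).
rewrite -[leRHS]ger0_norm ?mulr_ge0// -sqrtr_sqr ler_sqrt ?sqr_ge0//.
apply: (@le_trans _ _ (\sum_(i < 3) c ^+ 2)).
  by apply: ler_sum => i _; rewrite -real_normK ?num_real// lerXn2r.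
by rewrite !big_ord_recl big_ord0; move: (sqr_ge0 c); lra.
Qed.

Lemma Sop_blk q w i : sqX (w i) -> Sop chi q.+2 (blk q w i) = blk q w i.
Proof.
move=> sw; apply/funext => x.
have s1 := sqi_Sop hchi q.+1 sw; have s0 := sqi_Sop hchi q sw.
transitivity (Sop chi q.+2 (Sop chi q.+1 (w i)) x - Sop chi q.+2 (Sop chi q (w i)) x).
  exact: convBr x (pkern_kern (etf_chil hchi q.+2).1) s1 s0.
have e1 := congr1 (@^~ x) (Sop_high hchi (ltnSn q.+1) sw).
have e0 := congr1 (@^~ x) (Sop_high hchi (ltnW (ltnSn q.+1)) sw).
exact: (congr2 (fun a b : R => a - b) e1 e0).
Qed.

End Blocks.

(** * The dissipation wavenumber and bounds for low-frequency gradients *)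

Lemma gradient_arith (R : realType) (k1 k2 a b : R) : 0 <= k1 -> 0 <= k2 -> 0 <= a -> 0 <= b ->
  6 * k2 * a + 4 * k1 * (256 * b) <= (6 * k2 + 1024 * k1) * (a + b).
Proof.
move=> k10 k20 a0 b0; have := mulr_ge0 k20 b0; have := mulr_ge0 k10 a0.
lra.
Qed.

Section Wavenumber.
Context {R : realType} (chi : space3 R -> R) (hchi : lp_cutoff chi).
Local Notation X := (space3 R).
Implicit Types (x xi : X) (i j : 'I_3) (w : vfield R) (p q m n : nat).
Variables (c0 nu : R).
Hypotheses (c00 : 0 < c0) (nu0 : 0 < nu).

Let lam0 n : 0 < lambda n :> R := lambda_gt0 n.

Lemma lp_block_norm_fin q w : vsqX w -> lp_block_norm chi +oo q w \is a fin_num.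
Proof.
move=> sw; have b i : exists C : R, forall x, `|blk chi q w i x| <= C.
  have [C hC] := reg_bounded (reg_Sop hchi q.+1 (sw i)); have [D hD] := reg_bounded (reg_Sop hchi q (sw i)).
  by exists (C + D) => x; apply: le_trans (ler_normB _ _) _; exact: lerD.
pose C i := projT1 (cid (b i)).
have C0 i : 0 <= C i by apply: le_trans (projT2 (cid (b i)) 0).
have h x : blkn chi q w x <= 2 * \sum_i C i.
  apply: blkn_le => i; apply: le_trans (projT2 (cid (b i)) x) _.
  by rewrite (bigD1 i)//= lerDl; apply: sumr_ge0 => k _.
rewrite ge0_fin_numE ?lp_block_norm_ge0//; apply: le_lt_trans (ltry (2 * \sum_i C i)).
exact: (lp_block_norm_oo hchi q _ sw).2 h.
Qed.

Definition bmax q w : R := fine (lp_block_norm chi +oo q w).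

Lemma bmaxE q w : vsqX w -> lp_block_norm chi +oo q w = (bmax q w)%:E.
Proof. by move=> sw; rewrite fineK//; exact: lp_block_norm_fin. Qed.

Lemma bmax_ge0 q w : 0 <= bmax q w.
Proof. exact: fine_ge0 (lp_block_norm_ge0 _ _ _ _). Qed.

Lemma bmax_le q w (c : R) : vsqX w -> bmax q w <= c <-> forall x, blkn chi q w x <= c.
Proof. by move=> sw; rewrite -lee_fin -bmaxE//; exact: (lp_block_norm_oo hchi q c sw). Qed.

Lemma blk_le_bmax q w i x : vsqX w -> `|blk chi q w i x| <= bmax q w.
Proof.
move=> sw; apply: le_trans (blk_le chi q w i x) _; exact: (bmax_le q (bmax q w) sw).1 (lexx _) x.
Qed.

Lemma dissipativeP q w : vsqX w ->
  dissipative_above chi c0 nu w q <-> forall p, (q < p)%N -> bmax p w < c0 * nu * lambda p.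
Proof.
split=> h p qp; have := h p qp; rewrite bmaxE// lte_fin; by rewrite ltr_pdivrMl// mulrC.
Qed.

Lemma lambda_inj : injective (fun q => (lambda q : R)).
Proof.
move=> p q /eqP; rewrite eqrXn2 || rewrite eq_le !ler_eXn2l ?ltr1n// -eqn_leq => /eqP //.
Qed.

Lemma ler_lambda p q : (lambda p <= lambda q :> R) = (p <= q)%N.
Proof. by rewrite ler_eXn2l// ltr1n. Qed.

Lemma wavenumber_fin w q : dissipative_above chi c0 nu w q ->
  [/\ dissipative_above chi c0 nu w (dissipation_index chi c0 nu w),
      dissipation_wavenumber chi c0 nu w = (lambda (dissipation_index chi c0 nu w))%:E &
      forall p, dissipative_above chi c0 nu w p -> (dissipation_index chi c0 nu w <= p)%N].
Proof.
move=> hq.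
have ex : exists p, `[< dissipative_above chi c0 nu w p >] by exists q; apply/asboolP.
have [q0 /asboolP h0 hmin] := ex_minnP ex.
have E : dissipation_wavenumber chi c0 nu w = (lambda q0)%:E.
  apply/eqP; rewrite eq_le; apply/andP; split.
    by apply: ereal_inf_lbound; exists q0.
  apply: le_ereal_inf_tmp => _ [p hp <-]; rewrite lee_fin ler_lambda; apply: hmin; exact/asboolP.
have Q : dissipation_index chi c0 nu w = q0.
  rewrite /dissipation_index; case: xgetP => [p _|/(_ q0)]; last by rewrite /= E.
  by rewrite E => -[/lambda_inj].
by rewrite Q; split => // p hp; apply: hmin; exact/asboolP.
Qed.

Lemma wavenumber_infty w : (forall q, ~ dissipative_above chi c0 nu w q) ->
  dissipation_wavenumber chi c0 nu w = +oo%E /\ dissipation_index chi c0 nu w = 0%N.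
Proof.
move=> h; have E : dissipation_wavenumber chi c0 nu w = +oo%E.
  rewrite /dissipation_wavenumber (_ : [set _ | _ in _] = set0) ?ereal_inf0//.
  by apply/seteqP; split => // y [q hq _]; case: (h q hq).
rewrite /dissipation_index; case: xgetP => // p _; by rewrite E.
Qed.

(** A positive index is not the default value, so it is minimal: the level just below it is not
    dissipative, and the only new block it has to control is that of the index itself. *)
Lemma bmax_lower w : vsqX w -> (0 < dissipation_index chi c0 nu w)%N ->
  dissipation_wavenumber chi c0 nu w = (lambda (dissipation_index chi c0 nu w))%:E /\
  c0 * nu * lambda (dissipation_index chi c0 nu w) <= bmax (dissipation_index chi c0 nu w) w.
Proof.
move=> sw Q0; have [[q hq]|h] := pselect (exists q, dissipative_above chi c0 nu w q); last first.
  have [_ E] := wavenumber_infty (fun q hq => h (ex_intro _ q hq)); by rewrite E in Q0.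
have [hQ E hmin] := wavenumber_fin hq; split => //.
rewrite leNgt; apply/negP => hlt.
have /hmin : dissipative_above chi c0 nu w (dissipation_index chi c0 nu w).-1.
  apply/(dissipativeP _ sw) => p; rewrite prednK// leq_eqVlt => /orP[/eqP <- //|Qp].
  exact: (dissipativeP _ sw).1 hQ p Qp.
by rewrite -ltnS prednK// ltnn.
Qed.

Lemma D_Sop n f j x : sqX f ->
  'd_j (Sop chi n f) x = conv ('d_j (kern (dil (lambda n) chi))) f x.
Proof.
move=> sf; exact: (congr1 (@^~ x) (DE_conv 'u_j (schw_kern (etf_chil hchi n).1) sf)).
Qed.

Let K2 : R := \sum_j N2X ('d_j (kern chi)).
Let K1 : R := \sum_j N1 ('d_j (kern chi)).

Let K20 : 0 <= K2. Proof. by apply: sumr_ge0 => j _; exact: N2_ge0. Qed.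
Let K10 : 0 <= K1. Proof. by apply: sumr_ge0 => j _; exact: N1_ge0. Qed.

Lemma D_Sop_le n f j x : sqX f ->
  `|'d_j (Sop chi n f) x| <= K2 * (lambda n * Num.sqrt (lambda n ^+ 3)) * N2X f.
Proof.
move=> sf; rewrite D_Sop//.
apply: le_trans (bernstein_2oo [:: 'u_j] x (lam0 n) (etf_chi hchi) sf) _.
rewrite ler_wpM2r ?N2_ge0// mulrC ler_wpM2r ?mulr_ge0 ?(ltW (lam0 n))//.
by rewrite /K2 (bigD1 j)//= lerDl; apply: sumr_ge0 => k _; exact: N2_ge0.
Qed.

Lemma D_blk_le n w i j x (c : R) : vsqX w -> (forall i x, `|blk chi n w i x| <= c) ->
  `|'d_j (Sop chi n.+2 (blk chi n w i)) x| <= 4 * K1 * lambda n * c.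
Proof.
move=> sw hc; have sb := sqi_blk hchi n i sw; rewrite D_Sop//.
apply: le_trans (bernstein_oo [:: 'u_j] x (lam0 n.+2) (etf_chi hchi) sb.1 (hc i)) _.
have c0' : 0 <= c by apply: le_trans (hc i x).
rewrite ler_wpM2r// !lambdaS.
have h : N1 (iter_derive [:: 'u_j] (kern chi)) <= K1.
  by rewrite /K1 (bigD1 j)//= lerDl; apply: sumr_ge0 => k _; exact: N1_ge0.
have l4 : 0 <= 4 * lambda n :> R by rewrite mulr_ge0// ltW.
apply: (@le_trans _ _ (4 * lambda n * K1)); last by rewrite mulrAC.
have -> : 2 * (2 * lambda n) = 4 * lambda n :> R by ring.
by rewrite ler_wpM2l.
Qed.

Lemma D_SopS n w i j x : vsqX w ->
  'd_j (Sop chi n.+1 (w i)) x =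
  'd_j (Sop chi n (w i)) x + 'd_j (Sop chi n.+2 (blk chi n w i)) x.
Proof.
move=> sw; rewrite (Sop_blk hchi n (sw i)).
have r1 := reg_smooth (reg_Sop hchi n.+1 (sw i)); have r0 := reg_smooth (reg_Sop hchi n (sw i)).
rewrite [X in _ + X](_ : _ = 'd_j (Sop chi n.+1 (w i)) x - 'd_j (Sop chi n (w i)) x).
  by rewrite addrC subrK.
by apply: DB; exact: smooth_derivable.
Qed.

Lemma sqrt_lambdaS q : Num.sqrt (lambda q.+1 ^+ 3) <= 3 * Num.sqrt (lambda q ^+ 3) :> R.
Proof.
rewrite lambdaS exprMn sqrtrM ?exprn_ge0// ler_wpM2r ?sqrtr_ge0//.
by rewrite -[leRHS]ger0_norm// -sqrtr_sqr ler_sqrt; lra.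
Qed.

(** [lambda q ^ (5/2)]: one derivative and the passage from L^2 to the sup norm. *)
Definition wave q : R := lambda q * Num.sqrt (lambda q ^+ 3).

Lemma wave_ge0 q : 0 <= wave q.
Proof. by rewrite mulr_ge0 ?sqrtr_ge0// ltW. Qed.

Lemma waveS q : wave q.+1 <= 6 * wave q.
Proof.
rewrite /wave (_ : 6 * _ = 2 * lambda q * (3 * Num.sqrt (lambda q ^+ 3))); last ring.
rewrite -lambdaS; apply: ler_wpM2l; first exact: ltW.
exact: sqrt_lambdaS.
Qed.

Lemma ler_wave p q : (p <= q)%N -> wave p <= wave q.
Proof.
move=> pq; have l : lambda p <= lambda q :> R by rewrite ler_lambda.
apply: ler_pM; rewrite ?(ltW (lam0 _))// ler_sqrt ?exprn_ge0 ?(ltW lam0)//.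
by rewrite lerXn2r// nnegrE ltW.
Qed.

(** Induction on [n]. Up to level [q + 1] Bernstein from L^2 applies, the factor 6 being that of
    [waveS]. Beyond, each step adds a block of size below [c0 nu lambda n], whose gradient is of
    order [c0 nu lambda n ^ 2]; these add up geometrically. *)
Lemma gradient_bound q w n i j x (M : R) : vsqX w -> dissipative_above chi c0 nu w q ->
  (forall i, N2X (w i) <= M) ->
  `|'d_j (Sop chi n (w i)) x| <= 6 * K2 * (wave q * M) + 4 * K1 * (c0 * nu * lambda n ^+ 2).
Proof.
move=> sw hq hM.
have M0 : 0 <= M by apply: le_trans (N2_ge0 _ _) (hM 0).
have cn : 0 <= c0 * nu by rewrite mulr_ge0// ltW.
have p0 m : 0 <= 4 * K1 * (c0 * nu * lambda m ^+ 2).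
  by rewrite mulr_ge0 ?(mulr_ge0 _ K10)// mulr_ge0// exprn_ge0// ltW.
have low m : (m <= q.+1)%N -> `|'d_j (Sop chi m (w i)) x| <= 6 * K2 * (wave q * M).
  move=> mq; apply: le_trans (D_Sop_le m j x (sw i)) _; rewrite -/(wave m).
  rewrite (_ : 6 * K2 * (wave q * M) = K2 * (6 * wave q) * M); last by ring.
  apply: ler_pM; [|exact: N2_ge0| |exact: hM].
    by rewrite mulr_ge0// wave_ge0.
  by rewrite ler_wpM2l//; apply: le_trans (waveS q); exact: ler_wave.
elim: n => [|n IH]; first by apply: le_trans (low 0%N _) _; rewrite ?lerDl.
have [nq|qn] := leqP n.+1 q.+1; first by apply: le_trans (low _ nq) _; rewrite lerDl.
rewrite (D_SopS n i j x sw); apply: le_trans (ler_normD _ _) _.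
have hb : forall i x, `|blk chi n w i x| <= c0 * nu * lambda n.
  move=> k y; apply: le_trans (blk_le_bmax n k y sw) _; exact: ltW ((dissipativeP q sw).1 hq n qn).
have := D_blk_le i j x sw hb; move: IH; rewrite lambdaS.
have := p0 n; move: (`|_|) (`|_|) (6 * K2 * (wave q * M)) => a b c.
lra.
Qed.

Lemma D_Rop_le n f j x (c : R) : sqX f -> (forall y, `|'d_j (Sop chi n.+1 f) y| <= c) ->
  `|'d_j (Rop chi n f) x| <= N1 (kern (rho1 chi)) * c.
Proof.
move=> sf hc; have er := etf_rho hchi n; have rS := reg_Sop hchi n.+1 sf.
have e : Rop chi n f = op (rho chi n) (Sop chi n.+1 f).
  rewrite (op_op er (etf_chil hchi n.+1) sf); congr (op _ f).
  by apply/funext => xi; rewrite rho_chis.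
rewrite e (congr1 (@^~ x) (D_op_swap hchi j er rS)).
have := bernstein_oo [::] x (lam0 n) (etf_rho1 hchi) (smooth_mfun3 (reg_smooth (reg_D 'u_j rS))) hc.
lra.
Qed.

(** Controlling [Rop m.+3] requires level [m + 4], and [lambda m.+4 ^ 2 = 256 lambda m ^ 2]; with
    the factor 4 of [gradient_bound] this gives 1024. The first factor accounts for the kernel of
    [Rop]. *)
Definition gradient_const : R := (1 + N1 (kern (rho1 chi))) * (6 * K2 + 1024 * K1).

Lemma gradient_const_ge0 : 0 <= gradient_const.
Proof.
apply: mulr_ge0; first by apply: addr_ge0 => //; exact: N1_ge0.
by apply: addr_ge0; apply: mulr_ge0; [exact: ler0n|exact: K20|exact: ler0n|exact: K10].
Qed.

Lemma gradient_bounds q w m (M : R) : vsqX w -> dissipative_above chi c0 nu w q ->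
  (forall i, N2X (w i) <= M) ->
  (forall i j x, `|'d_j (Sop chi m (w i)) x| <= gradient_const * (wave q * M + c0 * nu * lambda m ^+ 2)) /\
  (forall i j x, `|'d_j (Rop chi m.+3 (w i)) x| <= gradient_const * (wave q * M + c0 * nu * lambda m ^+ 2)).
Proof.
move=> sw hq hM; have M0 : 0 <= M by apply: le_trans (N2_ge0 _ _) (hM 0).
have N0 := N1_ge0 (kern (rho1 chi)).
pose a := wave q * M; pose b := c0 * nu * lambda m ^+ 2.
have a0 : 0 <= a by rewrite mulr_ge0// wave_ge0.
have b0 : 0 <= b by rewrite mulr_ge0 ?(ltW (lam0 m))// mulr_ge0// ltW.
have key n : (n <= m.+4)%N -> forall i j x, `|'d_j (Sop chi n (w i)) x| <= (6 * K2 + 1024 * K1) * (a + b).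
  move=> nm i j x; apply: le_trans (gradient_bound n i j x sw hq hM) _.
  have l4 : c0 * nu * lambda n ^+ 2 <= 256 * b.
    have cn : 0 <= c0 * nu by rewrite mulr_ge0// ltW.
    rewrite (mulrCA 256); apply: (ler_wpM2l cn).
    have : lambda n <= 16 * lambda m :> R.
      by apply: (@le_trans _ _ (lambda m.+4)); [rewrite ler_lambda|rewrite !lambdaS; apply: eq_ler; ring].
    move=> h; have := ler_pM (ltW (lam0 n)) (ltW (lam0 n)) h h; lra.
  apply: (@le_trans _ _ (6 * K2 * a + 4 * K1 * (256 * b))).
    by rewrite lerD2l ler_wpM2l// mulr_ge0.
  exact: gradient_arith K10 K20 a0 b0.
have k0 : 0 <= (6 * K2 + 1024 * K1) * (a + b).
  apply: mulr_ge0; last exact: addr_ge0.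
  by apply: addr_ge0; apply: mulr_ge0; [exact: ler0n|exact: K20|exact: ler0n|exact: K10].
rewrite /gradient_const -mulrA -/a -/b; split => i j x.
  apply: le_trans (key m _ i j x) _; first by rewrite ltnW// ltnW// ltnW.
  by rewrite ler_peMl// lerDl.
apply: le_trans (D_Rop_le x (sw i) (key m.+4 (leqnn _) i j)) _.
lra.
Qed.

(** For the times at which no level is dissipative: [tail_inequality] asks for a bound at every
    time, and this one does not involve the wavenumber. *)
Lemma crude_bounds w m (M : R) : vsqX w -> (forall i, N2X (w i) <= M) ->
  (forall i j x, `|'d_j (Sop chi m (w i)) x| <= (1 + N1 (kern (rho1 chi))) * (K2 * wave m.+4 * M)) /\
  (forall i j x, `|'d_j (Rop chi m.+3 (w i)) x| <= (1 + N1 (kern (rho1 chi))) * (K2 * wave m.+4 * M)).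
Proof.
move=> sw hM; have M0 : 0 <= M by apply: le_trans (N2_ge0 _ _) (hM 0).
have N0 := N1_ge0 (kern (rho1 chi)).
have key n : (n <= m.+4)%N -> forall i j x, `|'d_j (Sop chi n (w i)) x| <= K2 * wave m.+4 * M.
  move=> nm i j x; apply: le_trans (D_Sop_le n j x (sw i)) _.
  apply: ler_pM; [by rewrite mulr_ge0 ?wave_ge0|exact: N2_ge0| |exact: hM].
  by rewrite ler_wpM2l// ler_wave.
have k0 : 0 <= K2 * wave m.+4 * M by rewrite mulr_ge0// mulr_ge0 ?wave_ge0.
split => i j x.
  apply: le_trans (key m _ i j x) _; first by rewrite ltnW// ltnW// ltnW.
  by rewrite ler_peMl// lerDl.
apply: le_trans (D_Rop_le x (sw i) (key m.+4 (leqnn _) i j)) _.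
lra.
Qed.

End Wavenumber.

(** * Blocks, enstrophy and finiteness of the wavenumber *)

Lemma blk_arith1 (R : realType) (l c a b : R) : 0 < l -> b ^+ 2 <= 3 * a ->
  l ^+ 2 * (c * l^-1 * b) ^+ 2 <= 3 * c ^+ 2 * a.
Proof.
move=> l0 h; have -> : l ^+ 2 * (c * l^-1 * b) ^+ 2 = c ^+ 2 * b ^+ 2 by field; exact: lt0r_neq0.
by rewrite -mulrA [leRHS]mulrCA; apply: ler_wpM2l h; exact: sqr_ge0.
Qed.

Lemma blk_arith2 (R : realType) (l a b n k : R) : 0 < l -> 0 < k -> 0 <= a -> 0 <= n ->
  l ^+ 2 * n <= b -> a ^+ 2 * b < l * k ^+ 2 -> a * Num.sqrt (l ^+ 3) * Num.sqrt n < k * l.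
Proof.
move=> l0 k0 a0 n0 h1 h2.
have p1 : 0 <= a * Num.sqrt (l ^+ 3) * Num.sqrt n by rewrite mulr_ge0 ?sqrtr_ge0// mulr_ge0.
have p2 : 0 <= k * l by rewrite mulr_ge0// ltW.
rewrite -ltr_sqr ?nnegrE//.
have -> : (a * Num.sqrt (l ^+ 3) * Num.sqrt n) ^+ 2 = a ^+ 2 * l ^+ 3 * n.
  by rewrite 2!exprMn !sqr_sqrtr// exprn_ge0// ltW.
have e1 : a ^+ 2 * l ^+ 3 * n <= l * (a ^+ 2 * b).
  have := ler_wpM2l (mulr_ge0 (sqr_ge0 a) (ltW l0)) h1 => h; apply: (@le_trans _ _ (a ^+ 2 * l * (l ^+ 2 * n))).
    lra.
  lra.
apply: (le_lt_trans e1); rewrite (_ : (k * l) ^+ 2 = l * (l * k ^+ 2)); last ring.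
by rewrite ltr_pM2l.
Qed.

Section WavenumberEnstrophy.
Context {R : realType} (chi : space3 R -> R) (hchi : lp_cutoff chi).
Local Notation X := (space3 R).
Implicit Types (x xi : X) (i j : 'I_3) (w : vfield R) (p q m n : nat).

Let lam0 n : 0 < lambda n :> R := lambda_gt0 n.

Lemma blk_enstrophy : exists2 C : R, 0 < C & forall q w, vsqX w ->
  ((lambda q ^+ 2 * nsq3 (blk chi q w))%:E <= C%:E * nabla_sqnorm 1 w)%E.
Proof.
have [C C0 hC] := block_grad hchi.
have C3 : 0 < 3 * C ^+ 2 by rewrite mulr_gt0// exprn_gt0.
exists (3 * C ^+ 2) => // q w sw.
case: (ltP (nabla_sqnorm 1 w) +oo%E) => [fin|]; last first.
  by rewrite leye_eq => /eqP ->; rewrite gt0_muley ?lte_fin// leey.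
have [g hg ->] := nabla_sqnorm1 hchi sw fin; rewrite -EFinM !mulr_sumr.
apply: ler_sum => i _.
have h := hC q (w i) (g i) (sw i) (hg i).
have N0 : 0 <= \sum_j N2X (g i j) by apply: sumr_ge0 => j _; exact: N2_ge0.
have cl : 0 <= C * (lambda q)^-1 by rewrite mulr_ge0 ?invr_ge0 ?(ltW (lam0 q)) ?(ltW C0).
have h2 : nsqX (blk chi q w i) <= (C * (lambda q)^-1 * \sum_j N2X (g i j)) ^+ 2.
  by rewrite -N2_sqr lerXn2r// nnegrE ?N2_ge0// mulr_ge0.
have h3 := sqr_sum_ord3 (fun j => N2X (g i j)).
have e : \sum_j N2X (g i j) ^+ 2 = \sum_j nsqX (g i j) by apply: eq_bigr => j _; exact: N2_sqr.
rewrite e in h3.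
apply: (le_trans (ler_wpM2l (exprn_ge0 2 (ltW (lam0 q))) h2)).
exact: blk_arith1 (lam0 q) h3.
Qed.

Lemma blk_sup q w i x : vsqX w ->
  `|blk chi q w i x| <= 8 * N2X (kern chi) * Num.sqrt (lambda q ^+ 3) * N2X (blk chi q w i).
Proof.
move=> sw; have sb := sqi_blk hchi q i sw.
rewrite -{1}(Sop_blk hchi q (sw i)).
apply: le_trans (bernstein_2oo [::] x (lam0 q.+2) (etf_chi hchi) sb) _.
rewrite mul1r ler_wpM2r ?N2_ge0// [8 * _]mulrC -mulrA [leRHS]mulrC; apply: ler_wpM2r; first exact: N2_ge0.
rewrite !lambdaS mulrA exprMn sqrtrM ?sqrtr_ge0//.
have -> : (2 * 2 : R) ^+ 3 = 8 ^+ 2 by ring.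
by rewrite sqrtr_sqr ger0_norm.
Qed.

(** With finite enstrophy the block [p] has L^2 norm of order at most [lambda p ^ (-1)], hence sup
    norm of order at most [lambda p ^ (1/2)] by Bernstein, which is below [c0 nu lambda p] once
    [lambda p > B]. *)
Lemma H1_dissipative (c0 nu : R) w : 0 < c0 -> 0 < nu -> vsqX w ->
  (nabla_sqnorm 1 w < +oo)%E -> exists q, dissipative_above chi c0 nu w q.
Proof.
move=> c00 nu0 sw fin; have [C C0 hC] := blk_enstrophy.
have [r hr] : exists r : R, nabla_sqnorm 1 w = r%:E.
  by exists (fine (nabla_sqnorm 1 w)); rewrite fineK// ge0_fin_numE// nabla_sqnorm_ge0.
have r0 : 0 <= r by rewrite -lee_fin -hr nabla_sqnorm_ge0.
pose A := 16 * N2X (kern chi); have A0 : 0 <= A by rewrite mulr_ge0 ?N2_ge0.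
have cn : 0 < c0 * nu by rewrite mulr_gt0.
pose B := A ^+ 2 * (C * r) / (c0 * nu) ^+ 2.
have B0 : 0 <= B by rewrite divr_ge0 ?sqr_ge0// mulr_ge0 ?sqr_ge0// mulr_ge0// ltW.
exists (Num.bound B); apply/(dissipativeP hchi _ _ _ sw) => p Np.
have Bp : B < lambda p.
  apply: (lt_trans (archi_boundP B0)); apply: (@lt_trans _ _ p%:R); first by rewrite ltr_nat.
  by rewrite /lambda -natrX ltr_nat ltn_expl.
have l0 := lam0 p.
have hb x : blkn chi p w x <= A * Num.sqrt (lambda p ^+ 3) * Num.sqrt (nsq3 (blk chi p w)).
  rewrite (_ : A * _ * _ = 2 * (8 * N2X (kern chi) * Num.sqrt (lambda p ^+ 3) * Num.sqrt (nsq3 (blk chi p w)))); last by rewrite /A; ring.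
  apply: blkn_le => i; apply: le_trans (blk_sup p i x sw) _; apply: ler_wpM2l.
    by rewrite mulr_ge0 ?sqrtr_ge0// mulr_ge0 ?N2_ge0.
  by rewrite ler_sqrt ?nsq3_ge0//; exact: nsq_le3.
have hb' := (bmax_le hchi p (A * Num.sqrt (lambda p ^+ 3) * Num.sqrt (nsq3 (blk chi p w))) sw).2 hb.
apply: (le_lt_trans hb').
have h1 := hC p w sw; rewrite hr in h1.
apply: (blk_arith2 l0 cn A0 (nsq3_ge0 _) h1).
by move: Bp; rewrite ltr_pdivrMr ?exprn_gt0.
Qed.

End WavenumberEnstrophy.

(** * Instantaneous smoothing under the intermittency hypothesis *)

Section Smoothing.
Context {R : realType} (chi : space3 R -> R) (hchi : lp_cutoff chi).
Local Notation X := (space3 R).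
Implicit Types (s t : R) (x xi : X) (i j : 'I_3) (w : vfield R) (p q m n N : nat).

Let lam0 n : 0 < lambda n :> R := lambda_gt0 n.

Lemma tail_enstrophy : exists2 C : R, 0 < C & forall n w, vsqX w ->
  ((lambda n.+1 ^+ 2 * nsq3 (high chi n.+1 w))%:E <= C%:E * nabla_sqnorm 1 w)%E.
Proof.
have [C C0 hC] := reverse_bernstein hchi.
pose D := 1 + N1 (kern chi); have D0 : 0 < D by rewrite ltr_pwDl// N1_ge0.
have C3 : 0 < 3 * (C * D) ^+ 2 by rewrite mulr_gt0// exprn_gt0// mulr_gt0.
exists (3 * (C * D) ^+ 2) => // n w sw.
case: (ltP (nabla_sqnorm 1 w) +oo%E) => [fin|]; last first.
  by rewrite leye_eq => /eqP ->; rewrite gt0_muley ?lte_fin// leey.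
have [g hg ->] := nabla_sqnorm1 hchi sw fin; rewrite -EFinM /nsq3 !mulr_sumr.
apply: ler_sum => i _; have [sg _] := hg i.
have h := hC n (w i) (g i) (sw i) (hg i).
have N0 : 0 <= \sum_j N2X (g i j) by apply: sumr_ge0 => j _; exact: N2_ge0.
have cl : 0 <= C * (lambda n.+1)^-1 by rewrite mulr_ge0 ?invr_ge0 ?(ltW (lam0 _)) ?(ltW C0).
have h' : \sum_j N2X (fun x => g i j x - Sop chi n.+1 (g i j) x) <= D * \sum_j N2X (g i j).
  rewrite mulr_sumr; apply: ler_sum => j _.
  apply: le_trans (N2B (sg j) (sqi_Sop hchi n.+1 (sg j))) _.
  by rewrite mulrDl mul1r lerD2l; exact: N2_Sop.
have h2 : nsqX (high chi n.+1 w i) <= (C * D * (lambda n.+1)^-1 * \sum_j N2X (g i j)) ^+ 2.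
  rewrite -N2_sqr lerXn2r// ?nnegrE ?N2_ge0//.
    by rewrite mulr_ge0// mulr_ge0 ?invr_ge0 ?(ltW (lam0 _))// mulr_ge0// ltW.
  apply: (le_trans h); apply: (le_trans (ler_wpM2l cl h')).
  lra.
have h3 := sqr_sum_ord3 (fun j => N2X (g i j)).
have e : \sum_j N2X (g i j) ^+ 2 = \sum_j nsqX (g i j) by apply: eq_bigr => j _; exact: N2_sqr.
rewrite e in h3.
apply: (le_trans (ler_wpM2l (exprn_ge0 2 (ltW (lam0 n.+1))) h2)).
exact: blk_arith1 (lam0 n.+1) h3.
Qed.

Variables (nu T : R) (u0 : vfield R) (u : R -> vfield R).
Hypotheses (nu0 : 0 < nu) (T0 : 0 < T) (hu : leray_hopf nu T u0 u).
Variable c0 : R.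
Hypothesis c00 : 0 < c0.

Let v := vpath T u.
Let wv i : wpath (fun t => v t i) := vpath_wpath T0 hu i.
Let sv t i : sqX (v t i) := vpath_sqi T0 hu t i.

Lemma Sop_path_continuous n i x : continuous (fun s => Sop chi n (v s i) x).
Proof.
have [_ c] := wv i; have pk := pkern_kern (etf_chil hchi n).1.
have sk : sqX (fun y => kern (chis chi (lambda n)) (x - y)) by exact/sqi_sub/pkern_sqi.
rewrite (_ : (fun s => _) = fun s => \int[leb3]_y (v s i y * kern (chis chi (lambda n)) (x - y))).
  exact: c sk.
by apply/funext => s; apply: eqI => y; rewrite mulrC.
Qed.

Lemma blkn_path_continuous p x : continuous (fun s => blkn chi p (v s) x).
Proof.
move=> s; apply: (@continuous_comp _ _ _ (fun s => \sum_i blk chi p (v s) i x ^+ 2) Num.sqrt); last exact: sqrt_continuous.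
apply: cvg_sumr => i; apply: (@continuous_comp _ _ _ (fun s => blk chi p (v s) i x) (fun a => a ^+ 2)); last exact: exprn_continuous.
by apply: cvgB; exact: Sop_path_continuous.
Qed.

(** At fixed [x] the block is continuous in time, because of weak continuity; a supremum over [x] of
    continuous functions is lower semicontinuous. *)
Lemma bmax_measurable p : measurable_fun setT (fun s => bmax chi p (v s)).
Proof.
have lsc : lower_semicontinuous (EFin \o (fun s => bmax chi p (v s))).
  apply/lower_semicontinuousP => a; rewrite openE => s0 /=; rewrite lte_fin => h.
  have [x hx] : exists x, a < blkn chi p (v s0) x.
    apply: contrapT => hn; move: h; rewrite ltNge => /negP; apply.
    by apply/(bmax_le hchi p a (sv s0)) => x; rewrite leNgt; apply/negP => ha; apply: hn; exists x.
  have : \forall s \near s0, a < blkn chi p (v s) x.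
    exact: cvgr_gt _ (@blkn_path_continuous p x s0) _ hx.
  apply: filterS => s ha; apply: (lt_le_trans ha).
  exact: (bmax_le hchi p (bmax chi p (v s)) (sv s)).1 (lexx _) x.
by have /measurable_EFinP := lower_semicontinuous_measurable lsc.
Qed.

Definition dset q : set (measurableTypeR R) := [set s | dissipative_above chi c0 nu (v s) q].

Lemma dset_measurable q : measurable (dset q).
Proof.
rewrite (_ : dset q = \bigcap_(p in [set p | (q < p)%N]) [set s | bmax chi p (v s) < c0 * nu * lambda p]).
  apply: bigcap_measurable => [|p _]; first by exists q.+1 => /=.
  have := @bmax_measurable p measurableT _ (measurable_itv `]-oo, (c0 * nu * lambda p)[).
  by congr measurable; apply/seteqP.
apply/seteqP; split => s.
  by move=> /(dissipativeP hchi c0 nu q (sv s)) h p; exact: h.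
by move=> h; apply/(dissipativeP hchi c0 nu q (sv s)) => p; exact: h.
Qed.

Let Q s := dissipation_index chi c0 nu (v s).

(** The times with infinite wavenumber, at which [Q] takes its default value 0. *)
Definition rough : set (measurableTypeR R) := [set s | forall q, ~ dset q s].

Lemma rough_measurable : measurable rough.
Proof.
rewrite (_ : rough = \bigcap_q ~` dset q).
  by apply: bigcap_measurable => [|q _]; [exists 0%N|apply: measurableC; exact: dset_measurable].
by apply/seteqP; split => s h q; [move=> _; exact: h|exact: h].
Qed.

Lemma index_set q : [set s | Q s = q] = (dset q `\` \bigcup_(p in [set p | (p < q)%N]) dset p) `|` (if q == 0%N then rough else set0).
Proof.
apply/seteqP; split => s.
  move=> /= Qq; have [[p hp]|h] := pselect (exists p, dset p s).
    have [hQ _ hmin] := wavenumber_fin hp; left; split; first by rewrite -Qq.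
    by move=> [r rq /hmin]; rewrite -/(Q s) Qq leqNgt rq.
  have hr : rough s by move=> r hr; apply: h; exists r.
  have [_ E] := wavenumber_infty hr; right.
  by move: Qq; rewrite /Q E => <-.
move=> [[hq hn]|].
  have [hQ _ hmin] := wavenumber_fin hq; apply/eqP; rewrite eqn_leq hmin//= leqNgt; apply/negP => Qq.
  by apply: hn; exists (Q s).
case: eqP => // -> hr; have [_ E] := wavenumber_infty hr; exact: E.
Qed.

Lemma wave_measurable : measurable_fun setT (fun s => wave (Q s) : R).
Proof.
move=> _ B mB; rewrite setTI.
rewrite (_ : _ @^-1` B = \bigcup_(q in [set q | B (wave q)]) [set s | Q s = q]).
  apply: bigcup_measurable => q _; rewrite index_set; apply: measurableU.
    apply: measurableD; first exact: dset_measurable.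
    by apply: bigcup_measurable => p _; exact: dset_measurable.
  by case: (q == 0%N); [exact: rough_measurable|exact: measurable0].
apply/seteqP; split => s /=; first by move=> h; exists (Q s).
by move=> [q hq e]; rewrite e.
Qed.

Lemma enstrophy_rough s : rough s -> nabla_sqnorm 1 (v s) = +oo%E.
Proof.
move=> hr; case: (ltP (nabla_sqnorm 1 (v s)) +oo%E) => [fin|].
  by have [q hq] := H1_dissipative hchi c00 nu0 (sv s) fin; case: (hr q hq).
by rewrite leye_eq => /eqP.
Qed.

Let enstr : R := fine (\int[leb]_(s in `[0%R, T]) nabla_sqnorm 1 (v s))%E.

Let enstrE : (\int[leb]_(s in `[0%R, T]) nabla_sqnorm 1 (v s))%E = enstr%:E.
Proof.
rewrite fineK// ge0_fin_numE; first exact: enstrophy_fin hu.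
by apply: integral_ge0 => s _; exact: nabla_sqnorm_ge0.
Qed.

Lemma enstrophy_dominates (f : R -> R) (C : R) : 0 < C -> measurable_fun setT f -> (forall s, 0 <= f s) ->
  (forall s, 0 <= s <= T -> ((f s)%:E <= C%:E * nabla_sqnorm 1 (v s))%E) ->
  Ig 0 T f /\ It 0 T f <= C * enstr.
Proof.
move=> C0 mf f0 hf.
have h : (\int[leb]_s (\1_`]0%R, T]%classic s * f s)%:E <= (C * enstr)%:E)%E.
  rewrite -indicE_itv; apply: (le_trans (itv_sub_integral _ _ _)); first by move=> s; rewrite lee_fin.
  rewrite EFinM -enstrE.
  apply: (@le_trans _ _ (\int[leb]_(s in `[0%R, T]) (C%:E * nabla_sqnorm 1 (v s)))%E); last first.
    by apply: (lower_integral_scale leb C0) => s _; exact: nabla_sqnorm_ge0.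
  apply: lower_integral_le => s; first by rewrite lee_fin.
  exact: hf.
have i : Ig 0 T f.
  apply: intg_ge0P.
  - by apply: measurable_funM.
  - by move=> s; rewrite mulr_ge0.
  - exact: le_lt_trans h (ltry _).
by rewrite -lee_fin EFinI.
Qed.

Let r s : R := \1_rough s.

Let r_measurable : measurable_fun setT r.
Proof. by apply: measurable_indic; exact: rough_measurable. Qed.

Let r0 s : 0 <= r s. Proof. by []. Qed.

(** The enstrophy is infinite on [rough], hence dominates every multiple of its indicator, while its
    own integral is finite. *)
Lemma rough_null : Ig 0 T r /\ It 0 T r = 0.
Proof.
have key k : 0 <= k -> Ig 0 T (fun s => k * r s) /\ It 0 T (fun s => k * r s) <= 1 * enstr.
  move=> k0; apply: enstrophy_dominates => //.
  - exact: measurable_funM.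
  - by move=> s; rewrite mulr_ge0.
  move=> s _; rewrite mul1e /r indicE; case: (boolP (s \in rough)) => [/[!inE] hs|_].
    by rewrite (enstrophy_rough hs) leey.
  by rewrite mulr0 nabla_sqnorm_ge0.
have [i1 _] := key 1 ler01.
have ir : Ig 0 T r by apply: Ig_ext i1 => s _; rewrite mul1r.
split => //; apply/eqP; rewrite eq_le It_ge0// andbT leNgt; apply/negP => h.
have e0 : 0 <= enstr by rewrite -lee_fin -enstrE; apply: integral_ge0 => s _; exact: nabla_sqnorm_ge0.
have k0 : 0 <= (enstr + 1) / It 0 T r by rewrite divr_ge0 ?addr_ge0// ltW.
have [_] := key _ k0; rewrite (It_Z _ ir) divfK ?lt0r_neq0//.
lra.
Qed.

(** This is where [d > 3/2] enters: it says [5/2 < 4 - sg], and [lambda q >= 1]. *)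
Lemma wave_powR q (sg : R) : 0 <= sg <= 3 -> 3 / 2 < 3 - sg -> (wave q : R) <= lambda q `^ (2 - sg) * lambda q ^+ 2.
Proof.
move=> /andP[s0 s3] hs; have l1 := @lambda_ge1 R q.
have -> : wave q = lambda q `^ 2^-1 * lambda q ^+ 2 :> R.
  rewrite /wave (_ : (lambda q : R) ^+ 3 = lambda q ^+ 2 * lambda q); last ring.
  by rewrite sqrtrM ?sqr_ge0// sqrtr_sqr ger0_norm ?ltW// powR12_sqrt ?ltW//; ring.
by rewrite ler_wpM2r ?sqr_ge0// ler_powR; lra.
Qed.

Lemma wave_ge1 q : 1 <= wave q :> R.
Proof.
have l1 := @lambda_ge1 R q; rewrite -[1]mulr1; apply: ler_pM => //.
by rewrite -[leLHS]sqrtr1 ler_sqrt ?exprn_ge0 ?(ltW (lam0 q))//; exact: exprn_ege1.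
Qed.

Hypothesis hyp : exists s K : R, [/\ 0 <= s <= 3, 3 / 2 < 3 - s, 0 < K &
  (T^-1%:E * \int[leb]_(t in `[0%R, T])
     (dissipation_wavenumber chi c0 nu (u t) `^ (2 - s) * lp_block_norm chi +oo (dissipation_index chi c0 nu (u t)) (u t) ^+ 2)
   <= K%:E * (T^-1%:E * \int[leb]_(t in `[0%R, T])
     (dissipation_wavenumber chi c0 nu (u t) ^+ 2 * lp_block_norm chi 2%:E (dissipation_index chi c0 nu (u t)) (u t) ^+ 2)))%E].

Lemma Ig_wave : Ig 0 T (fun s => wave (Q s)).
Proof.
have [sg [K [sg03 hsg K0 hle]]] := hyp.
have [C C0 hC] := blk_enstrophy hchi.
have rhs_fin : (\int[leb]_(t in `[0%R, T])
     (dissipation_wavenumber chi c0 nu (u t) ^+ 2 * lp_block_norm chi 2%:E (dissipation_index chi c0 nu (u t)) (u t) ^+ 2) <= (C * enstr)%:E)%E.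
  rewrite EFinM -enstrE.
  apply: (@le_trans _ _ (\int[leb]_(s in `[0%R, T]) (C%:E * nabla_sqnorm 1 (v s)))%E); last first.
    by apply: (lower_integral_scale leb C0) => s _; exact: nabla_sqnorm_ge0.
  apply: lower_integral_le => s sI.
    apply: mule_ge0; apply: expe_ge0; last exact: lp_block_norm_ge0.
    by apply: le_ereal_inf_tmp => _ [q _ <-]; rewrite lee_fin ltW.
  have sT : 0 <= s <= T by move: sI.
  rewrite -(vpath_id u sT).
  case: (ltP (nabla_sqnorm 1 (v s)) +oo%E) => [fin|]; last first.
    by rewrite leye_eq => /eqP ->; rewrite gt0_muley ?lte_fin// leey.
  have [q hq] := H1_dissipative hchi c00 nu0 (sv s) fin.
  have [_ -> _] := wavenumber_fin hq.
  by rewrite (lp_block_norm2 hchi _ (sv s)); exact: hC.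
have lhs_fin : (\int[leb]_(t in `[0%R, T])
     (dissipation_wavenumber chi c0 nu (u t) `^ (2 - sg) * lp_block_norm chi +oo (dissipation_index chi c0 nu (u t)) (u t) ^+ 2) <= (K * (C * enstr))%:E)%E.
  have Tp : (0 < T^-1%:E :> \bar R)%E by rewrite lte_fin invr_gt0.
  have := le_trans hle (lee_wpmul2l (ltW (K0 : (0%:E < K%:E)%E)) (lee_wpmul2l (ltW Tp) rhs_fin)).
  by rewrite muleCA lee_pmul2l.
pose D := (c0 * nu) ^+ 2; have D0 : 0 < D by rewrite exprn_gt0// mulr_gt0.
(* Subtracting 1 makes [g] vanish when [Q s = 0], the case that [bmax_lower] does not cover and that
   includes the rough times. *)
pose g s := D * (wave (Q s) - 1).
have mg : measurable_fun setT g.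
  by apply: measurable_funM => //; apply: measurable_funB => //; exact: wave_measurable.
have g0 s : 0 <= g s by rewrite mulr_ge0 ?(ltW D0)// subr_ge0 wave_ge1.
have ig : Ig 0 T g.
  apply: intg_ge0P.
  - by apply: measurable_funM.
  - by move=> s; rewrite mulr_ge0.
  rewrite -indicE_itv; apply: le_lt_trans (le_trans _ lhs_fin) (ltry _).
  apply: (le_trans (itv_sub_integral _ _ _)); first by move=> s; rewrite lee_fin.
  apply: lower_integral_le => s sI; first by rewrite lee_fin.
  have sT : 0 <= s <= T by move: sI.
  rewrite -(vpath_id u sT).
  have [Q0|Q0] := posnP (Q s).
    rewrite /g Q0 /wave expr1n sqrtr1 mulr1 subrr mulr0.
    by apply: mule_ge0; [exact: poweR_ge0|apply: expe_ge0; exact: lp_block_norm_ge0].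
  have [-> hb] := bmax_lower hchi (sv s) Q0.
  rewrite (bmaxE hchi _ (sv s)).
  have cn : 0 <= c0 * nu by rewrite mulr_ge0// ltW.
  apply: (@le_trans _ _ (D * wave (Q s))); first by rewrite ler_wpM2l ?(ltW D0)// gerDl.
  apply: (@le_trans _ _ (D * (lambda (Q s) `^ (2 - sg) * lambda (Q s) ^+ 2))).
    by rewrite ler_wpM2l ?(ltW D0)//; exact: wave_powR.
  rewrite mulrCA ler_wpM2l ?powR_ge0// -exprMn lerXn2r ?nnegrE ?bmax_ge0//.
  by rewrite mulr_ge0// ltW.
apply: Ig_ext (IgD (Ig_cst 0 T 1) (IgZ D^-1 ig)) => s _.
by rewrite mulrA mulVf ?lt0r_neq0// mul1r addrC subrK.
Qed.

Hypothesis hc : 2 * flux_const chi * gradient_const chi * c0 * 8 ^+ 11 <= tail_rate hchi.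

Lemma smoothing (ts : R) : 0 < ts <= T -> exists C, forall N t, ts <= t <= T -> wsum (tail chi v) 11 N t <= C.
Proof.
move=> /andP[ts0 tsT].
have tsh : 0 < ts / 2 by rewrite divr_gt0.
(* From an energy time [tau] on, the energy is at most [E0], which fixes the constants [M] and
   [B]. *)
have [tau /andP[tau0 tauts] gtau] := ae_exists (energy_time_ae T0 hu) tsh.
have tausT : tau < T by apply: lt_le_trans tauts _; move: ts0 tsT; lra.
have et : energy_time nu T v tau by apply: gtau; rewrite tau0.
have dv t : divf (v t) := vpath_divf hchi T0 hu t.
have hE : Ig 0 T (fun s => nsq3 (v s)) := vpath_energy hchi T0 hu.
have hweak := vpath_weak hchi T0 hu.
pose E0 := nsq3 (v tau).
have eb s : tau <= s <= T -> nsq3 (v s) <= E0 := energy_bound nu0 et.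
pose M := 1 + E0; have E00 : 0 <= E0 := nsq3_ge0 _.
have M0 : 0 <= M by rewrite addr_ge0.
have hM s i : tau <= s <= T -> N2X (v s i) <= M.
  by move=> hs; apply: le_trans (N2_le_en _ _) _; rewrite lerD2l; exact: eb.
pose gc := gradient_const chi; have gc0 : 0 <= gc := gradient_const_ge0 chi.
have fc0 : 0 <= flux_const chi := flux_const_ge0 chi.
pose a s : R := wave (Q s).
have a0 s : 0 <= a s := wave_ge0 (Q s).
have ia : Ig 0 T a := Ig_wave.
have ma : measurable_fun setT a := wave_measurable.
have [ir r00] := rough_null.
pose b s := 2 * flux_const chi * (gc * M) * a s.
pose L m : R := (1 + N1 (kern (rho1 chi))) * ((\sum_j N2X ('d_j (kern chi))) * wave m.+4 * M).
have L0 m : 0 <= L m.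
  apply: mulr_ge0; first by apply: addr_ge0 => //; exact: N1_ge0.
  apply: mulr_ge0 => //; apply: mulr_ge0; last exact: wave_ge0.
  by apply: sumr_ge0 => j _; exact: N2_ge0.
pose B := tail_const chi * E0.
have YB m s : tau <= s <= T -> tail chi v m s <= B.
  move=> hs; apply: le_trans (tail_le hchi wv m s) _; apply: ler_wpM2l (eb s hs); exact: sqr_ge0.
have B0 : 0 <= B.
  by apply: le_trans (tail_ge0 chi v 0 tau) (YB _ _ _); rewrite lexx ltW.
have mY m : measurable_fun setT (tail chi v m) := tail_measurable hchi wv m.
have Y0 m s : 0 <= tail chi v m s := tail_ge0 chi v m s.
have [C C0 hC] := tail_enstrophy.
have d0 : 0 < 2 * nu * tail_rate hchi by rewrite mulr_gt0 ?tail_rate_gt0// mulr_gt0.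
pose e := 2 * flux_const chi * gc * c0 * nu.
have e0 : 0 <= e.
  by rewrite mulr_ge0 ?(ltW nu0)// mulr_ge0 ?(ltW c00)// mulr_ge0// mulr_ge0.
(* The viscosity cancels, so the smallness required of [c0] depends on [chi] only. *)
have he : e * 8 ^+ 11 <= 2 * nu * tail_rate hchi / 2.
  have -> : e * 8 ^+ 11 = nu * (2 * flux_const chi * gc * c0 * 8 ^+ 11) by rewrite /e; move: (8 ^+ 11) => z; ring.
  have -> : 2 * nu * tail_rate hchi / 2 = nu * tail_rate hchi by field.
  by apply: ler_wpM2l hc; exact: ltW.
have mb : measurable_fun setT b by apply: measurable_funM.
have b0 s : 0 <= b s by apply: mulr_ge0; [do 2! apply: mulr_ge0 => //|exact: a0].
have ib : Ig 0 T b by exact: IgZ ia.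
have hY t0 t m : energy_time nu T v t0 -> tau <= t0 -> t0 < t <= T ->
  tail chi v m.+3 t + 2 * nu * tail_rate hchi * lambda m.+3 ^+ 2 * It t0 t (tail chi v m.+3) <=
  tail chi v m.+3 t0 + (It t0 t (fun s => b s * tail chi v m s) + e * lambda m ^+ 2 * It t0 t (tail chi v m)).
  move=> et0 tt0 tT; have /andP[t0t tT'] := tT.
  (* The last term covers the rough times, where only [crude_bounds] is available; being carried by
     a null set it contributes nothing to the integral ([rY0]). *)
  pose A s := gc * (a s * M + c0 * nu * lambda m ^+ 2) + L m * r s.
  have sT s : t0 < s <= t -> tau <= s <= T.
    by move=> /andP[s1 s2]; rewrite (le_trans tt0 (ltW s1)) (le_trans s2 tT').
  have cn : 0 <= c0 * nu * lambda m ^+ 2 by rewrite mulr_ge0 ?exprn_ge0 ?(ltW (lam0 m))// mulr_ge0// ltW.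
  have P0 s : 0 <= gc * (a s * M + c0 * nu * lambda m ^+ 2) by rewrite mulr_ge0// addr_ge0// mulr_ge0.
  have hA s : t0 < s <= t -> 0 <= A s /\
      (forall i j x, `|'d_j (Sop chi m (v s i)) x| <= A s) /\
      (forall i j x, `|'d_j (Rop chi m.+3 (v s i)) x| <= A s).
    move=> hs; have hMs i := hM s i (sT s hs).
    split; first by rewrite addr_ge0// mulr_ge0.
    have [[q hq]|hr] := pselect (exists q, dissipative_above chi c0 nu (v s) q).
      have [hQ _ _] := wavenumber_fin hq.
      have [h1 h2] := gradient_bounds hchi c00 nu0 m (sv s) hQ hMs.
      have l1 : gc * (a s * M + c0 * nu * lambda m ^+ 2) <= A s by rewrite lerDl mulr_ge0.
      by split=> i j x; [exact: le_trans (h1 i j x) l1|exact: le_trans (h2 i j x) l1].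
    have rs : r s = 1.
      by rewrite /r indicE mem_set// => q hq; apply: hr; exists q.
    have [h1 h2] := crude_bounds hchi m (sv s) hMs.
    have l1 : L m <= A s by rewrite /A rs mulr1 lerDr.
    by split=> i j x; [exact: le_trans (h1 i j x) l1|exact: le_trans (h2 i j x) l1].
  have t00 : 0 <= t0 := le_trans (ltW tau0) tt0.
  have iY : Ig t0 t (tail chi v m) := Ig_tail hchi wv hE m t00 tT'.
  have iaY : Ig t0 t (fun s => a s * tail chi v m s).
    apply: (Ig_le _ (Ig_sub t00 tT' (IgZ B ia))) => [|s hs]; first exact: measurable_funM.
    by rewrite (ger0_norm (mulr_ge0 (a0 s) (Y0 m s))) mulrC; apply: ler_wpM2r; [exact: a0|exact: YB (sT s hs)].
  have irY : Ig t0 t (fun s => r s * tail chi v m s).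
    apply: (Ig_le _ (Ig_sub t00 tT' (IgZ B ir))) => [|s hs]; first exact: measurable_funM.
    by rewrite (ger0_norm (mulr_ge0 (r0 s) (Y0 m s))) mulrC; apply: ler_wpM2r; [exact: r0|exact: YB (sT s hs)].
  have rY0 : It t0 t (fun s => r s * tail chi v m s) <= 0.
    apply: (@le_trans _ _ (B * It 0 T r)); last by rewrite r00 mulr0.
    rewrite (It_add t00 (le_trans (ltW t0t) tT') ir) (It_add (ltW t0t) tT' (Ig_sub t00 (lexx _) ir)).
    have ir' := Ig_sub t00 tT' ir.
    apply: (@le_trans _ _ (B * It t0 t r)).
      rewrite -(It_Z B ir'); apply: It_le irY (IgZ B ir') _ => s hs.
      by rewrite mulrC; apply: ler_wpM2r; [exact: r0|exact: YB (sT s hs)].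
    rewrite ler_wpM2l//; have p1 : 0 <= It 0 t0 r by apply: It_ge0.
    have p2 : 0 <= It t T r by apply: It_ge0.
    by move: p1 p2; lra.
  pose k := gc * (c0 * nu * lambda m ^+ 2).
  have AE s : A s * tail chi v m s = gc * M * (a s * tail chi v m s) + (k * tail chi v m s + L m * (r s * tail chi v m s)).
    by rewrite /A /k; ring.
  have iA2 := IgD (IgZ k iY) (IgZ (L m) irY).
  have iA3 := IgD (IgZ (gc * M) iaY) iA2.
  have iA : Ig t0 t (fun s => A s * tail chi v m s) by apply: Ig_ext iA3 => s _; rewrite AE.
  have IA : It t0 t (fun s => A s * tail chi v m s) <=
      gc * M * It t0 t (fun s => a s * tail chi v m s) + k * It t0 t (tail chi v m).
    rewrite (It_ext (fun s _ => AE s)) (It_D (IgZ (gc * M) iaY) iA2) (It_D (IgZ k iY) (IgZ (L m) irY)).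
    rewrite (It_Z _ iaY) (It_Z _ iY) (It_Z _ irY) lerD2l gerDl; exact: mulr_ge0_le0.
  have eb' : It t0 t (fun s => b s * tail chi v m s) =
      2 * flux_const chi * (gc * M) * It t0 t (fun s => a s * tail chi v m s).
    by rewrite -(It_Z _ iaY); apply: It_ext => s _; rewrite /b; ring.
  apply: le_trans (tail_inequality hchi nu0 wv hE dv hweak et0 tT hA iA) _.
  rewrite lerD2l eb'; have f2 : 0 <= 2 * flux_const chi by rewrite mulr_ge0.
  apply: (le_trans (ler_wpM2l f2 IA)); apply: eq_ler.
  by rewrite /k /e; ring.
(* Each tail satisfies [lambda^2 Y <= C enstrophy], uniformly in the level; giving up one power of
   [lambda] makes the series summable, so the bootstrap starts at weight 1. *)
have hK N : It tau T (wsum (tail chi v) 1 N) <= C * enstr.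
  have mw : measurable_fun setT (wsum (tail chi v) 1 N) by exact: wsum_measurable.
  have w0 s : 0 <= wsum (tail chi v) 1 N s by exact: wsum_ge0.
  have hw s : 0 <= s <= T -> ((wsum (tail chi v) 1 N s)%:E <= C%:E * nabla_sqnorm 1 (v s))%E.
    move=> _; case: (ltP (nabla_sqnorm 1 (v s)) +oo%E) => [fin|]; last first.
      by rewrite leye_eq => /eqP ->; rewrite gt0_muley ?lte_fin// leey.
    have [z hz] : exists z : R, nabla_sqnorm 1 (v s) = z%:E.
      by exists (fine (nabla_sqnorm 1 (v s))); rewrite fineK// ge0_fin_numE// nabla_sqnorm_ge0.
    have z0 : 0 <= z by rewrite -lee_fin -hz nabla_sqnorm_ge0.
    rewrite hz -EFinM lee_fin /wsum.
    apply: (@le_trans _ _ (\sum_(m < N) (lambda m.+3)^-1 * (C * z))).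
      apply: ler_sum => m _; have := hC m.+2 (v s) (sv s); rewrite hz -EFinM lee_fin -/(tail chi v m.+3 s) => h.
      by rewrite ler_pdivlMl// mulrA -expr2.
    rewrite -mulr_suml ler_piMl ?mulr_ge0 ?(ltW C0)//.
    suff h : \sum_(m < N) (lambda m.+3)^-1 <= 1 - (lambda N)^-1 :> R.
      by apply: (le_trans h); rewrite gerBl invr_ge0 ltW.
    elim: N {mw w0} => [|N IH]; first by rewrite big_ord0 /lambda expr0 invr1 subrr.
    rewrite big_ord_recr /=; apply: (le_trans (lerD IH (lexx _))).
    have l0 := lam0 N; rewrite !lambdaS !invfM; have : 0 < (lambda N)^-1 :> R by rewrite invr_gt0.
    by move: (lambda N)^-1 => y; lra.
  have [i1 h1] := enstrophy_dominates C0 mw w0 hw.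
  apply: le_trans h1; rewrite (It_add (ltW tau0) (ltW tausT) i1) lerDr.
  by apply: It_ge0.
have tts : tau < ts <= T by rewrite tsT; lra.
have aeG : {ae leb, forall s, tau < s < T -> energy_time nu T v s}.
  have h := energy_time_ae T0 hu; move: h; apply: (@filterS _ _ (ae_filter_ringOfSetsType leb)) => s h /andP[s1 s2].
  by apply: h; rewrite (lt_trans tau0).
exact: (bootstrap (ltW tau0) tausT d0 e0 mb b0 ib mY Y0 YB aeG hY he hK tts).
Qed.

End Smoothing.

(** * Fatou's lemma in norm form *)

Section Fatou.
Context {R : realType}.
Local Notation X := (space3 R).
Implicit Types (F : nat -> X -> R) (f : X -> R).

Lemma fatou2 F f (K : R) : (forall n, sqX (F n)) -> (forall n, N2X (F n) <= K) ->
  (forall x, F n x @[n --> \oo] --> f x) -> sqX f /\ N2X f <= K.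
Proof.
move=> sF hF cF; have K0 : 0 <= K by apply: le_trans (N2_ge0 _ _) (hF 0%N).
have mf : mfun3 f.
  by apply: (measurable_fun_cvg (fun n => (sF n).1)) => x _.
have nF n : nsqX (F n) <= K ^+ 2.
  by rewrite -N2_sqr lerXn2r// nnegrE ?N2_ge0.
have key : (\int[leb3]_x (f x ^+ 2)%:E <= (K ^+ 2)%:E)%E.
  have m n : measurable_fun setT (fun x => (F n x ^+ 2)%:E).
    by apply/measurable_EFinP; exact: intg_meas (sF n).2.
  have p n x : setT x -> (0 <= (F n x ^+ 2)%:E)%E by move=> _; rewrite lee_fin sqr_ge0.
  have fat := fatou leb3 measurableT m p.
  apply: (@le_trans _ _ (\int[leb3]_x limn_einf (fun n => (F n x ^+ 2)%:E))%E).
    apply: eq_ler; apply: eq_integral => x _; have c : (F n x ^+ 2)%:E @[n --> \oo] --> (f x ^+ 2)%:E.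
      apply: cvg_EFin; first exact: nearW.
      by apply: (@cvg_comp _ _ _ (fun n => F n x) (fun a => a ^+ 2) _ _ _ (cF x)); exact: exprn_continuous.
    by rewrite (cvg_limn_einf_sup c).1.
  apply: (le_trans fat); rewrite limn_einf_lim; apply: lime_le; first exact: is_cvg_einfs.
  apply: nearW => n; apply: (@le_trans _ _ (\int[leb3]_x (F n x ^+ 2)%:E)%E).
    by apply: ereal_inf_lbound; exists n => /=.
  by rewrite -(EFinI (sF n).2); exact: nF.
have i2 : intgX (fun x => f x ^+ 2).
  apply: intg_ge0P; [by apply: measurable_funX|by move=> x; exact: sqr_ge0|].
  exact: le_lt_trans key (ltry _).
rewrite -[leRHS]ger0_norm// -sqrtr_sqr ler_sqrt ?sqr_ge0// -lee_fin.
by rewrite (EFinI i2).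
Qed.

End Fatou.

(** * Weak derivatives as limits of derivatives of truncations *)

Section WeakLimitArithmetic.
Context {R : realType}.
Local Notation X := (space3 R).

Lemma ler_of_sqr (a b : R) : 0 <= a -> 0 <= b -> a ^+ 2 <= b ^+ 2 -> a <= b.
Proof. by move=> a0 b0; rewrite ler_sqr. Qed.

Lemma rate_arith1 (l s p a b n c : R) : 0 < l -> 0 <= a -> 0 <= b -> 0 <= n -> 1 <= s -> p <= 64 * l ^+ 3 ->
  l ^+ 4 * s * n <= 2 * c -> p * a * n <= 1024 * (a + b) * c * l^-1.
Proof.
move=> l0 a0 b0 n0 s1 hp h.
have c0 : 0 <= 2 * c by apply: le_trans h; rewrite mulr_ge0// mulr_ge0 ?exprn_ge0 ?(ltW l0)// (le_trans ler01).
have an : 0 <= a * n by rewrite mulr_ge0.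
apply: (@le_trans _ _ (64 * l ^+ 3 * (a * n))); first by rewrite -mulrA ler_wpM2r.
rewrite ler_pdivlMr//; apply: (@le_trans _ _ (64 * a * (2 * c))).
  apply: (@le_trans _ _ (64 * a * (l ^+ 4 * s * n))); last by rewrite ler_wpM2l// mulr_ge0.
  have -> : 64 * l ^+ 3 * (a * n) * l = 64 * a * (l ^+ 4 * 1 * n) by ring.
  by rewrite ler_wpM2l ?mulr_ge0// ler_wpM2r// ler_wpM2l// exprn_ge0// ltW.
move: (mulr_ge0 a0 c0) (mulr_ge0 b0 c0).
lra.
Qed.

Lemma rate_arith2 (l s p q a b n c : R) : 0 < l -> 0 <= a -> 0 <= b -> 0 <= n -> 1 <= s -> 0 <= p -> p <= 64 * l ^+ 3 ->
  q <= 8 * s -> l ^+ 4 * s * n <= 2 * c -> p * q * b * n <= 1024 * (a + b) * c * l^-1.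
Proof.
move=> l0 a0 b0 n0 s1 p0 hp hq h.
have s0 : 0 <= s by apply: le_trans s1.
have c0 : 0 <= 2 * c by apply: le_trans h; rewrite mulr_ge0// mulr_ge0 ?exprn_ge0 ?(ltW l0).
have bn : 0 <= b * n by rewrite mulr_ge0.
apply: (@le_trans _ _ (64 * l ^+ 3 * (8 * s) * (b * n))).
  rewrite -mulrA; apply: ler_wpM2r => //; apply: (@le_trans _ _ (p * (8 * s))); first exact: ler_wpM2l.
  by apply: ler_wpM2r => //; rewrite mulr_ge0.
rewrite ler_pdivlMr//; apply: (@le_trans _ _ (512 * b * (2 * c))).
  have -> : 64 * l ^+ 3 * (8 * s) * (b * n) * l = 512 * b * (l ^+ 4 * s * n) by ring.
  by apply: ler_wpM2l h; apply: mulr_ge0; [exact: ler0n|exact: b0].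
move: (mulr_ge0 a0 c0).
lra.
Qed.

Lemma lambdaV_lim (c : R) : c * (lambda n)^-1 @[n --> \oo] --> (0 : R).
Proof.
rewrite -[X in _ --> X](mulr0 c); apply: cvgM; first exact: cvg_cst.
under eq_fun do rewrite -exprVn.
by apply: cvg_expr; rewrite ger0_norm ?invr_ge0// invf_lt1// ltr1n.
Qed.

Lemma cvg_addl (f : nat -> R) (n : nat) (a : R) : f m @[m --> \oo] --> a -> f (n + m)%N @[m --> \oo] --> a.
Proof. by rewrite -(cvg_shiftn n); under eq_fun do rewrite addnC. Qed.

Lemma squeeze_le0 (a b : nat -> R) : (exists N, forall n, (N <= n)%N -> 0 <= a n /\ a n <= b n) ->
  b n @[n --> \oo] --> (0 : R) -> a n @[n --> \oo] --> (0 : R).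
Proof.
move=> [N h] cb; apply: squeeze_cvgr _ (cvg_cst 0) cb.
by exists N => // n Nn; have [-> ->] := h n Nn.
Qed.

Lemma pairing_lim (f : X -> R) (F : nat -> X -> R) (B : X -> R) : sqX f -> (forall n, sqX (F n)) -> sqX B ->
  N2X (fun x => f x - F n x) @[n --> \oo] --> (0 : R) ->
  \int[leb3]_x (F n x * B x) @[n --> \oo] --> \int[leb3]_x (f x * B x).
Proof.
move=> sf sF sB c0; apply/cvgrPdist_le => e e0.
have c1 : N2X (fun x => f x - F n x) * N2X B @[n --> \oo] --> 0.
  by rewrite -[X in _ --> X](mul0r (N2X B)); apply: cvgM => //; exact: cvg_cst.
have [N hN] := cvg0_le c1 e0; exists N => // n Nn.
rewrite -(IB (sqi_mul sf sB) (sqi_mul (sF n) sB)).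
have -> : \int[leb3]_x (f x * B x - F n x * B x) = \int[leb3]_x ((f x - F n x) * B x).
  by apply: eqI => x; rewrite mulrBl.
apply: (le_trans (cauchy_schwarz (sqiB sf (sF n)) sB)); exact: le_trans (ler_norm _) (hN n Nn).
Qed.

End WeakLimitArithmetic.

Section WeakLimit.
Context {R : realType} (chi : space3 R -> R) (hchi : lp_cutoff chi).
Local Notation X := (space3 R).
Implicit Types (x v : X) (i j : 'I_3) (w : vfield R) (l : seq 'I_3) (n N M : nat) (f h : X -> R).

Let lam0 n : 0 < lambda n :> R := lambda_gt0 n.

Lemma iter_deriveB (k : seq X) f h : smooth f -> smooth h ->
  iter_derive k (fun x => f x - h x) = fun x => iter_derive k f x - iter_derive k h x.
Proof.
move=> sf sh; elim: k => [//|v k IH] /=; rewrite IH; apply/funext => x.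
by apply: DB; apply: smooth_derivable; exact: smooth_iter.
Qed.

Lemma iter_derive_swap (k : seq X) v f : smooth f -> 'D_v (iter_derive k f) = iter_derive k ('D_v f).
Proof.
move=> sf; elim: k => [//|u k IH] /=; rewrite -IH; apply/funext => x.
by apply: derive_comm; exact: smooth_iter.
Qed.

Lemma reg_wder l h : reg h -> wder l h (iter_partial l h).
Proof.
elim: l h => [|j l IH] h rh B rB; first by rewrite mul1r.
have rlB : reg (iter_partial l B) := reg_iter _ rB.
rewrite (D_ibp hchi j rh rlB) (IH _ (reg_D 'u_j rh) B rB) exprS mulN1r mulNr.
by rewrite /iter_partial -(iter_derive_swap _ _ (reg_smooth rh)).
Qed.

Definition partS l n f : X -> R := iter_partial l (Sop chi n f).

(** An explicit representative of the weak derivative: under [smooth_rate] the derivatives of the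
    truncations converge at every point. *)
Definition wlim l f x : R := limn (fun n => partS l n f x).

Lemma partSE l n f : sqX f -> partS l n f = conv (iter_derive [seq 'u_i | i <- l] (kern (dil (lambda n) chi))) f.
Proof. by move=> sf; rewrite /partS /iter_partial iter_derive_conv//; exact: schw_kern (etf_chil hchi n).1. Qed.

Lemma reg_partS l n f : sqX f -> reg (partS l n f).
Proof. by move=> sf; apply: reg_iter; exact: reg_Sop. Qed.

Lemma partS_blk l n w i : vsqX w ->
  (fun x => partS l n.+1 (w i) x - partS l n (w i) x) = partS l n.+2 (blk chi n w i).
Proof.
move=> sw; rewrite /partS (Sop_blk hchi n (sw i)) /iter_partial iter_deriveB//.
  exact: reg_smooth (reg_Sop hchi n.+1 (sw i)).
exact: reg_smooth (reg_Sop hchi n (sw i)).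
Qed.

(** Levels below 3 are left out because [wsum] starts there; the bound is a square so that [c]
    itself bounds norms. *)
Definition smooth_rate (c : R) w : Prop := 0 <= c /\ forall n, (3 <= n)%N -> lambda n ^+ 11 * nsq3 (high chi n w) <= c ^+ 2.

(** The weight 11 is spent as [2 (3 + 3/2 + 1)]: three derivatives, the passage to the sup norm, and
    one power to sum over the levels. A block is a difference of two tails, whence [2 * c]. *)
Lemma blk_rate (c : R) n w i : vsqX w -> smooth_rate c w -> (3 <= n)%N ->
  lambda n ^+ 4 * Num.sqrt (lambda n ^+ 3) * N2X (blk chi n w i) <= 2 * c.
Proof.
move=> sw [c0 hc] n3.
have p0 : 0 <= lambda n ^+ 4 * Num.sqrt (lambda n ^+ 3) :> R by rewrite mulr_ge0 ?sqrtr_ge0// exprn_ge0// ltW.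
have hb m : (n <= m)%N -> lambda n ^+ 4 * Num.sqrt (lambda n ^+ 3) * N2X (high chi m w i) <= c.
  move=> nm; have m3 := leq_trans n3 nm.
  apply: ler_of_sqr => //; first by apply: mulr_ge0 => //; exact: N2_ge0.
  rewrite 2!exprMn N2_sqr sqr_sqrtr; last by rewrite exprn_ge0// ltW.
  have -> : (lambda n ^+ 4) ^+ 2 * lambda n ^+ 3 = lambda n ^+ 11 :> R by ring.
  apply: le_trans (hc m m3); apply: ler_pM.
  - by rewrite exprn_ge0// ltW.
  - exact: nsq_ge0.
  - by rewrite lerXn2r ?nnegrE ?(ltW (lam0 _))// ler_lambda.
  - exact: nsq_le3.
have e : blk chi n w i = fun x => high chi n w i x - high chi n.+1 w i x.
  have G (p q r : R) : q - r = (p - r) - (p - q) by ring.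
  by apply/funext => x; exact: G.
rewrite e; apply: (le_trans (ler_wpM2l p0 (N2B (sqi_high hchi n i sw) (sqi_high hchi n.+1 i sw)))).
rewrite mulrDr (_ : 2 * c = c + c); last ring.
by apply: lerD; apply: hb.
Qed.

(** [1024 = 64 * 8 * 2]: three derivatives at level [n + 2] cost [4^3], the sup norm costs the
    square root of [4^3], and 2 comes from [blk_rate]. *)
Definition part_const l : R := 1024 * (N1 (iter_derive [seq 'u_i | i <- l] (kern chi)) +
  N2X (iter_derive [seq 'u_i | i <- l] (kern chi))).

Lemma part_const_ge0 l : 0 <= part_const l.
Proof. by apply: mulr_ge0; [exact: ler0n|apply: addr_ge0; [exact: N1_ge0|exact: N2_ge0]]. Qed.

Lemma partS_step (c : R) l n w i : vsqX w -> smooth_rate c w -> (3 <= n)%N -> (size l <= 3)%N ->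
  N2X (fun x => partS l n.+1 (w i) x - partS l n (w i) x) <= part_const l * c * (lambda n)^-1 /\
  forall x, `|partS l n.+1 (w i) x - partS l n (w i) x| <= part_const l * c * (lambda n)^-1.
Proof.
move=> sw hc n3 l3; have sb := sqi_blk hchi n i sw; have hb := blk_rate i sw hc n3.
have eb := partS_blk l n i sw.
rewrite eb (partSE l n.+2 sb).
have b2 := bernstein2 [seq 'u_i | i <- l] (lam0 n.+2) (etf_chi hchi) sb.
have boo x := bernstein_2oo [seq 'u_i | i <- l] x (lam0 n.+2) (etf_chi hchi) sb.
rewrite size_map in b2; move: boo; rewrite size_map => boo.
have l0 := lam0 n; have l1 := @lambda_ge1 R n.
have lp : (lambda n.+2 : R) ^+ size l <= 64 * lambda n ^+ 3.
  have e : (lambda n.+2 : R) = 4 * lambda n by rewrite !lambdaS; ring.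
  apply: (@le_trans _ _ (lambda n.+2 ^+ 3)); first by rewrite ler_weXn2l// lambda_ge1.
  by rewrite e exprMn; have -> : 4 ^+ 3 = 64 :> R by ring.
have sl : Num.sqrt (lambda n.+2 ^+ 3) <= 8 * Num.sqrt (lambda n ^+ 3) :> R.
  have e : (lambda n.+2 : R) = 4 * lambda n by rewrite !lambdaS; ring.
  rewrite e exprMn sqrtrM ?exprn_ge0//.
  have -> : (4 : R) ^+ 3 = 8 ^+ 2 by ring.
  by rewrite sqrtr_sqr ger0_norm.
have sq1 : 1 <= Num.sqrt (lambda n ^+ 3) :> R.
  by rewrite -[leLHS]sqrtr1 ler_sqrt ?exprn_ge0 ?(ltW l0)//; exact: exprn_ege1.
have N20 := N2_ge0 leb3 (blk chi n w i).
have P0 : 0 <= (lambda n.+2 : R) ^+ size l by rewrite exprn_ge0// ltW.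
split.
  apply: (le_trans b2).
  exact: rate_arith1 l0 (N1_ge0 _) (N2_ge0 _ _) N20 sq1 lp hb.
move=> x; rewrite (congr1 (@^~ x) eb) (partSE l n.+2 sb).
apply: (le_trans (boo x)).
exact: rate_arith2 l0 (N1_ge0 _) (N2_ge0 _ _) N20 sq1 P0 lp sl hb.
Qed.

Lemma partS_tail (c : R) l n M w i : vsqX w -> smooth_rate c w -> (3 <= n)%N -> (size l <= 3)%N ->
  N2X (fun x => partS l (n + M) (w i) x - partS l n (w i) x) <= 2 * (part_const l * c) * (lambda n)^-1 /\
  forall x, `|partS l (n + M) (w i) x - partS l n (w i) x| <= 2 * (part_const l * c) * (lambda n)^-1.
Proof.
move=> sw hc n3 l3; have [c0 _] := hc; set E := part_const l * c.
have E0 : 0 <= E by apply: mulr_ge0 => //; exact: part_const_ge0.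
(* Keeping the subtracted term makes the bound for the geometric series pass through the induction
   on [M]. *)
suff h : N2X (fun x => partS l (n + M) (w i) x - partS l n (w i) x) <= 2 * E * ((lambda n)^-1 - (lambda (n + M))^-1) /\
    forall x, `|partS l (n + M) (w i) x - partS l n (w i) x| <= 2 * E * ((lambda n)^-1 - (lambda (n + M))^-1).
  have p : 2 * E * ((lambda n)^-1 - (lambda (n + M))^-1) <= 2 * E * (lambda n)^-1.
    by apply: ler_wpM2l; [exact: mulr_ge0|rewrite gerBl invr_ge0; exact: ltW].
  by case: h => h1 h2; split => [|x]; [exact: le_trans h1 p|exact: le_trans (h2 x) p].
elim: M => [|M [IH1 IH2]].
  rewrite addn0 subrr mulr0; split => [|x]; last by rewrite subrr normr0.
  rewrite (_ : (fun x => _) = fun=> 0); last by apply/funext => x; rewrite subrr.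
  rewrite /N2 (_ : nsq _ _ = 0) ?sqrtr0// -[RHS](@I0 _ _ _ leb3); apply: eqI => x; exact: expr0n.
have nM3 : (3 <= n + M)%N by rewrite (leq_trans n3)// leq_addr.
have [s1 s2] := partS_step i sw hc nM3 l3.
have eq1 x : partS l (n + M.+1) (w i) x - partS l n (w i) x =
    (partS l (n + M).+1 (w i) x - partS l (n + M) (w i) x) + (partS l (n + M) (w i) x - partS l n (w i) x).
  by rewrite addnS addrA subrK.
have eq2 : E * (lambda (n + M))^-1 + 2 * E * ((lambda n)^-1 - (lambda (n + M))^-1) =
    2 * E * ((lambda n)^-1 - (lambda (n + M.+1))^-1).
  by rewrite addnS lambdaS; field; rewrite !lt0r_neq0.
have sq m := reg_sqi (reg_partS l m (sw i)).
split => [|x].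
  rewrite (_ : (fun x => _) = fun x => (partS l (n + M).+1 (w i) x - partS l (n + M) (w i) x) + (partS l (n + M) (w i) x - partS l n (w i) x)).
    rewrite -eq2; apply: (le_trans (N2D (sqiB (sq _) (sq _)) (sqiB (sq _) (sq _)))).
    exact: lerD.
  by apply/funext => x.
rewrite eq1 -eq2; apply: le_trans (ler_normD _ _) _; apply: lerD; [exact: s2|exact: IH2].
Qed.

Lemma partS_cvg (c : R) l w i x : vsqX w -> smooth_rate c w -> (size l <= 3)%N ->
  partS l n (w i) x @[n --> \oo] --> wlim l (w i) x.
Proof.
move=> sw hc l3.
apply: cauchy_cvg; apply: cauchy_exP => e e0.
have cE : 2 * (part_const l * c) * (lambda n)^-1 @[n --> \oo] --> 0.
  exact: lambdaV_lim.
have [N hN] := cvg0_le cE (divr_gt0 e0 (ltr0n R 2)).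
pose n := maxn N 3.
exists (partS l n (w i) x); exists n => // m nm; rewrite -ball_normE /= distrC.
have [_ h] := partS_tail (m - n) i sw hc (leq_maxr N 3 : (3 <= n)%N) l3.
rewrite subnKC// in h; apply: (le_lt_trans (h x)).
have := hN n (leq_maxl N 3); move: e0; move: (2 * _ * _) => z e0 hz.
by apply: (le_lt_trans (le_trans (ler_norm z) hz)); lra.
Qed.

(** Fatou's lemma carries the bound of [partS_tail] to the pointwise limit, and square integrability
    with it. *)
Lemma wlim_tail (c : R) l n w i : vsqX w -> smooth_rate c w -> (size l <= 3)%N -> (3 <= n)%N ->
  sqX (wlim l (w i)) /\
  N2X (fun x => wlim l (w i) x - partS l n (w i) x) <= 2 * (part_const l * c) * (lambda n)^-1.
Proof.
move=> sw hc l3 n3; have sq m := reg_sqi (reg_partS l m (sw i)).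
have [] := @fatou2 _ (fun M x => partS l (n + M) (w i) x - partS l n (w i) x) (fun x => wlim l (w i) x - partS l n (w i) x) (2 * (part_const l * c) * (lambda n)^-1).
- by move=> M; exact: sqiB (sq _) (sq _).
- by move=> M; exact: (partS_tail M i sw hc n3 l3).1.
- move=> x; apply: cvgB; last exact: cvg_cst.
  exact: (cvg_addl n (@partS_cvg c l w i x sw hc l3)).
move=> s1 h; split => //.
by apply: sqi_ext (sqiD s1 (sq n)) => x; rewrite subrK.
Qed.

Lemma wlim_wder (c : R) l w i : vsqX w -> smooth_rate c w -> (size l <= 3)%N ->
  wder l (w i) (wlim l (w i)).
Proof.
move=> sw hc l3 B rB; have sB := reg_sqi rB; have sD : sqX (iter_partial l B) := reg_sqi (reg_iter _ rB).
have sS n := sqi_Sop hchi n (sw i); have sq m := reg_sqi (reg_partS l m (sw i)).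
have [sl _] := wlim_tail i sw hc l3 (leqnn 3).
have c1 : \int[leb3]_x (Sop chi n (w i) x * iter_partial l B x) @[n --> \oo] --> \int[leb3]_x (w i x * iter_partial l B x).
  exact: pairing_lim (sw i) sS sD (Sop_lim hchi (sw i)).
have c2 : \int[leb3]_x (partS l n (w i) x * B x) @[n --> \oo] --> \int[leb3]_x (wlim l (w i) x * B x).
  apply: pairing_lim sl sq sB _.
  apply: (@squeeze_le0 _ _ (fun n => 2 * (part_const l * c) * (lambda n)^-1)).
    by exists 3%N => n n3; split; [exact: N2_ge0|exact: (wlim_tail i sw hc l3 n3).2].
  exact: lambdaV_lim.
apply: (lim_eq _ c1 (cvgM (cvg_cst _) c2)) => n.
exact: reg_wder (reg_Sop hchi n (sw i)) B rB.
Qed.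

End WeakLimit.

(** * Continuity of the third-order Sobolev norm in time *)

Lemma dist_arith (R : realType) (a b d e : R) : b <= a + d -> a <= b + d -> d <= e -> `|a - b| <= e.
Proof. by rewrite ler_norml; lra. Qed.

Section Continuity.
Context {R : realType} (chi : space3 R -> R) (hchi : lp_cutoff chi).
Local Notation X := (space3 R).
Implicit Types (s t : R) (x xi : X) (i j : 'I_3) (w : vfield R) (l : seq 'I_3) (n : nat) (f h : X -> R).

Let lam0 n : 0 < lambda n :> R := lambda_gt0 n.

Definition chi2 n xi : R := chis chi (lambda n) xi * chis chi (lambda n) xi.

Lemma etf_chi2 n : etf (chi2 n).
Proof. exact: etfM (etf_chil hchi n) (etf_chil hchi n). Qed.

Lemma chi2_chis n xi : chi2 n xi * chis chi (lambda n.+1) xi = chi2 n xi.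
Proof.
have h := @chisM R chi hchi (lambda n) (lambda n.+1) xi (lambda_gt0 n).
rewrite lambdaS in h.
by rewrite lambdaS -mulrA h.
Qed.

Lemma Sop_pairing n f h : sqX f -> sqX h ->
  \int[leb3]_x (Sop chi n f x * Sop chi n h x) = \int[leb3]_x (f x * op (chi2 n) h x).
Proof.
move=> sf sh; have ec := etf_chil hchi n.
rewrite -(op_op ec ec sh).
transitivity (\int[leb3]_x (Sop chi n h x * op (chis chi (lambda n)) f x)).
  by apply: eqI => x; rewrite mulrC.
exact: op_sym ec sf (sqi_Sop hchi n sh).
Qed.

Lemma nsq3_Sop_sub n w w' : vsqX w -> vsqX w' ->
  nsq3 (fun i x => Sop chi n (w i) x - Sop chi n (w' i) x) =
  pair w (opv (chi2 n) w) - 2 * pair w (opv (chi2 n) w') + pair w' (opv (chi2 n) w').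
Proof.
move=> sw sw'; rewrite mulr_sumr -sumrB -big_split; apply: eq_bigr => i _.
have s1 := sqi_Sop hchi n (sw i); have s2 := sqi_Sop hchi n (sw' i).
have i1 := sqi_mul s1 s1; have i2 := sqi_mul s1 s2; have i3 := sqi_mul s2 s2.
apply: etrans _ (congr2 (fun p q : R => p + q) (congr2 (fun p q : R => p - 2 * q)
  (Sop_pairing n (sw i) (sw i)) (Sop_pairing n (sw i) (sw' i))) (Sop_pairing n (sw' i) (sw' i))).
rewrite -(IZ 2 i2) -(IB i1 (intgZ 2 i2)) -(ID (intgB i1 (intgZ 2 i2)) i3).
by apply: eqI => x; ring.
Qed.

Variables (nu T : R) (u0 : vfield R) (u : R -> vfield R).
Hypotheses (nu0 : 0 < nu) (T0 : 0 < T) (hu : leray_hopf nu T u0 u).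

Let v := vpath T u.
Let wv i : wpath (fun t => v t i) := vpath_wpath T0 hu i.
Let sv t i : sqX (v t i) := vpath_sqi T0 hu t i.

(** The energy identity applies to [chi2 n], the symbol of the square of [Sop n], and its integrand
    is bounded once the energy is, that is, after [tau]. *)
Lemma low_energy_lipschitz n tau : energy_time nu T v tau ->
  exists2 L, 0 <= L & forall s t, tau <= s -> s <= t -> t <= T ->
    `|pair (v t) (opv (chi2 n) (v t)) - pair (v s) (opv (chi2 n) (v s))| <= L * (t - s).
Proof.
move=> et; have [/andP[tau0 tauT] _] := et.
pose E0 := nsq3 (v tau); have E00 : 0 <= E0 := nsq3_ge0 _.
have eb s := energy_bound nu0 et.
have hM s i : tau <= s <= T -> N2X (v s i) <= 1 + E0.
  by move=> hs; apply: le_trans (N2_le_en _ _) _; rewrite lerD2l; exact: eb.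
have [D D0 hD] := opv_bound (1 + E0) (etf_chi2 n).
pose L := 2 * ((nu * 3 + 9) * D * (1 + E0)).
have K0 : 0 <= (nu * 3 + 9) * D by rewrite mulr_ge0// addr_ge0// mulr_ge0// ltW.
exists L; first by rewrite mulr_ge0// mulr_ge0// addr_ge0.
move=> s t taus st tT.
have [h1 h2] := energy_identity hchi nu0 wv (vpath_energy hchi T0 hu) (vpath_divf hchi T0 hu)
  (vpath_weak hchi T0 hu) (etf_chi2 n) (chi2_chis n) (le_trans (ltW tau0) taus) st tT
  (fun r i (hr : s <= r <= t) => hM r i (etrans (congr2 andb (le_trans taus (proj1 (andP hr))) (le_trans (proj2 (andP hr)) tT)) (erefl true))).
have b r : s < r <= t -> `|2 * rhs nu v (opv (chi2 n) (v r)) r| <= L.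
  move=> /andP[r1 r2]; have hr : tau <= r <= T by rewrite (le_trans taus (ltW r1)) (le_trans r2).
  have [d1 d2] := hD (v r) (sv r) (fun i => hM r i hr).
  rewrite normrM ger0_norm// ler_wpM2l//.
  apply: le_trans (rhs_le nu0 wv r D0 (fun i => op_reg (etf_chi2 n) (sv r i)) d1 d2) _.
  by rewrite ler_wpM2l// lerD2l; exact: eb.
rewrite h2 ler_norml -(It_cst L st) -mulN1r -(It_Z (-1) (Ig_cst s t L)); apply/andP; split.
  by apply: It_le (IgZ (-1) (Ig_cst _ _ L)) h1 _ => r /b; rewrite ler_norml mulN1r => /andP[].
by apply: It_le h1 (Ig_cst _ _ L) _ => r /b; rewrite ler_norml => /andP[].
Qed.

(* Weak continuity upgrades to norm continuity of the low frequencies because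
   their energy is continuous. *)
Lemma low_strong_continuous n tau t (e : R) : energy_time nu T v tau -> tau <= t <= T -> 0 < e ->
  \forall s \near t, tau <= s <= T ->
    nsq3 (fun i x => Sop chi n (v s i) x - Sop chi n (v t i) x) <= e.
Proof.
move=> et /andP[taut tT] e0; have [L L0 hL] := low_energy_lipschitz n et.
pose P s t := pair (v s) (opv (chi2 n) (v t)).
have cP : (fun s => P s t) @ t --> P t t.
  apply: cvg_sumr => i; exact: (wv i).2 _ (sqi_op (etf_chi2 n) (sv t i)) t.
have e4 : 0 < e / 4 by rewrite divr_gt0.
have L1 : 0 < L + 1 by rewrite ltr_wpDl.
have d0 : 0 < e / 2 / (L + 1) by rewrite !divr_gt0.
have h1 : \forall s \near t, `|P t t - P s t| <= e / 4 by move/cvgrPdist_le : cP => /(_ _ e4).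
have h2 : \forall s \near t, `|t - s| <= e / 2 / (L + 1).
  by have /cvgrPdist_le/(_ _ d0) := (@cvg_id _ (nbhs t)).
near=> s => /andP[taus sT].
rewrite (nsq3_Sop_sub n (sv s) (sv t)) -!/(P _ _).
have b1 : `|P t t - P s t| <= e / 4 by near: s.
have b3 : P s s - P t t <= e / 2.
  have b4 : L * `|t - s| <= e / 2.
    apply: (@le_trans _ _ ((L + 1) * `|t - s|)); first by rewrite ler_wpM2r// lerDl.
    by rewrite mulrC -ler_pdivlMr.
  apply: le_trans b4; apply: (le_trans (ler_norm _)); case: (leP s t) => st.
    have -> : `|t - s| = t - s by rewrite ger0_norm// subr_ge0.
    by rewrite distrC; exact: hL.
  have -> : `|t - s| = s - t by rewrite distrC ger0_norm// subr_ge0 ltW.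
  exact: hL (ltW st) sT.
move: b1 b3; rewrite ler_norml => /andP[_ b1] b3.
by move: (P s s) (P t t) (P s t) b1 b3 => p q r; lra.
Unshelve. all: end_near.
Qed.

Lemma partS_diff l n f h : sqX f -> sqX h ->
  N2X (fun x => partS chi l n f x - partS chi l n h x) <=
  lambda n.+1 ^+ size l * N1 (iter_derive [seq 'u_i | i <- l] (kern chi)) *
  N2X (fun x => Sop chi n f x - Sop chi n h x).
Proof.
move=> sf sh; have s1 := sqi_Sop hchi n sf; have s2 := sqi_Sop hchi n sh.
have sz := sqiB s1 s2.
have e : (fun x => partS chi l n f x - partS chi l n h x) = partS chi l n.+1 (fun x => Sop chi n f x - Sop chi n h x).
  have ez : Sop chi n.+1 (fun x => Sop chi n f x - Sop chi n h x) = fun x => Sop chi n f x - Sop chi n h x.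
    apply/funext => x; apply: (etrans (convBr x (pkern_kern (etf_chil hchi n.+1).1) s1 s2)).
    have e1 := congr1 (@^~ x) (Sop_high hchi (ltnSn n) sf).
    have e0 := congr1 (@^~ x) (Sop_high hchi (ltnSn n) sh).
    exact: (congr2 (fun a b : R => a - b) e1 e0).
  rewrite /partS ez /iter_partial iter_deriveB//; exact: reg_smooth (reg_Sop hchi n _).
rewrite e (partSE hchi l n.+1 sz).
by have := bernstein2 [seq 'u_i | i <- l] (lam0 n.+1) (etf_chi hchi) sz; rewrite size_map.
Qed.

Variables (ts c : R).
Hypotheses (ts0 : 0 < ts) (tsT : ts <= T).
Hypothesis hrate : forall t, ts <= t <= T -> smooth_rate chi c (v t).

(** Truncation at one fixed level: the remainders are small uniformly in time by [hrate], and the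
    truncated derivatives move continuously by [low_strong_continuous] and Bernstein. *)
Lemma wlim_continuous l i t (e : R) : (size l <= 3)%N -> ts <= t <= T -> 0 < e ->
  \forall s \near t, ts <= s <= T -> `|N2X (wlim chi l (v s i)) - N2X (wlim chi l (v t i))| <= e.
Proof.
move=> l3 tT e0.
have [tau /andP[tau0 tauts] gtau] := ae_exists (energy_time_ae T0 hu) ts0.
have tausT : tau < T := lt_le_trans tauts tsT.
have et : energy_time nu T v tau by apply: gtau; rewrite tau0.
have e4 : 0 < e / 4 by rewrite divr_gt0.
have [N hN] := cvg0_le (lambdaV_lim (2 * (part_const chi l * c))) e4.
pose n := maxn N 3; have n3 := leq_maxr N 3.
have {}hN := le_trans (ler_norm _) (hN n (leq_maxl N 3)).
pose K := lambda n.+1 ^+ size l * N1 (iter_derive [seq 'u_i | i <- l] (kern chi)).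
have K0 : 0 <= K by rewrite mulr_ge0 ?N1_ge0// exprn_ge0// ltW.
have K1 : 0 < K + 1 by rewrite ltr_wpDl.
have d0 : 0 < (e / 2 / (K + 1)) ^+ 2 by rewrite exprn_gt0// !divr_gt0.
have taut : tau <= t <= T by move: tT => /andP[a ->]; rewrite (le_trans (ltW tauts) a).
have := low_strong_continuous n et taut d0; apply: filterS => s hs sT.
have {hs} b1 := hs (_ : tau <= s <= T).
have {b1} b1 : N2X (fun x => Sop chi n (v s i) x - Sop chi n (v t i) x) <= e / 2 / (K + 1).
  apply: ler_of_sqr; [exact: N2_ge0|by rewrite !divr_ge0// ltW|].
  rewrite N2_sqr; apply: le_trans (b1 _); first exact: (nsq_le3 (fun i x => Sop chi n (v s i) x - Sop chi n (v t i) x)).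
  lra.
have b2 : N2X (fun x => partS chi l n (v s i) x - partS chi l n (v t i) x) <= e / 2.
  apply: (le_trans (partS_diff l n (sv s i) (sv t i))).
  apply: (@le_trans _ _ ((K + 1) * (e / 2 / (K + 1)))); last by rewrite mulrC divfK// lt0r_neq0.
  by apply: ler_pM => //; [exact: N2_ge0|rewrite lerDl].
have [s1 w1] := wlim_tail hchi i (sv s) (hrate sT) l3 n3.
have [s2 w2] := wlim_tail hchi i (sv t) (hrate tT) l3 n3.
have p1 := reg_sqi (reg_partS hchi l n (sv s i)); have p2 := reg_sqi (reg_partS hchi l n (sv t i)).
have w3 : N2X (fun x => wlim chi l (v s i) x - wlim chi l (v t i) x) <= e.
  have d1 := sqiB s1 p1; have d2 := sqiB p1 p2; have d3 := sqiB s2 p2.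
  rewrite (_ : (fun x => _) = fun x => ((wlim chi l (v s i) x - partS chi l n (v s i) x) +
     (partS chi l n (v s i) x - partS chi l n (v t i) x)) - (wlim chi l (v t i) x - partS chi l n (v t i) x)); last first.
    have G (a b p q : R) : a - b = ((a - p) + (p - q)) - (b - q) by ring.
    by apply/funext => x.
  apply: (le_trans (N2B (sqiD d1 d2) d3)); apply: (le_trans (lerD (N2D d1 d2) (lexx _))).
  have := le_trans w1 hN; have := le_trans w2 hN; move: b2; clear.
  by move: N2 (N2 _ _) (N2 _ _) => a b d h1 h2 h3; lra.
have e1 : N2X (wlim chi l (v t i)) <= N2X (wlim chi l (v s i)) + N2X (fun x => wlim chi l (v s i) x - wlim chi l (v t i) x).
  apply: le_trans (N2B s1 (sqiB s1 s2)); apply: eq_ler; congr N2.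
  have G (a b : R) : b = a - (a - b) by ring.
  by apply/funext => x.
have e2 : N2X (wlim chi l (v s i)) <= N2X (wlim chi l (v t i)) + N2X (fun x => wlim chi l (v s i) x - wlim chi l (v t i) x).
  apply: le_trans (N2D s2 (sqiB s1 s2)); apply: eq_ler; congr N2.
  have G (a b : R) : a = b + (a - b) by ring.
  by apply/funext => x.
exact: dist_arith e1 e2 w3.
Qed.

Definition sobolev_sqr w : R := \sum_(k < 4) \sum_i \sum_(l : k.-tuple 'I_3) N2X (wlim chi l (w i)) ^+ 2.

Lemma sobolev_sqr_ge0 w : 0 <= sobolev_sqr w.
Proof. by do 3! (apply: sumr_ge0 => ? _); exact: sqr_ge0. Qed.

Lemma sobolev_norm3E t : ts <= t <= T -> sobolev_norm 3 (v t) = (Num.sqrt (sobolev_sqr (v t)))%:E.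
Proof.
move=> tT; rewrite /sobolev_norm.
rewrite (_ : (\sum_(k < 4) nabla_sqnorm k (v t))%E = (sobolev_sqr (v t))%:E).
  by rewrite poweR_EFin powR12_sqrt// sobolev_sqr_ge0.
rewrite -sumEFin; apply: eq_bigr => k _; rewrite -sumEFin.
apply: eq_bigr => i _; rewrite -sumEFin; apply: eq_bigr => l _.
have l3 : (size l <= 3)%N by rewrite size_tuple -ltnS.
have [s1 _] := wlim_tail hchi i (sv t) (hrate tT) l3 (leqnn 3).
rewrite N2_sqr; exact: (weak_derivative_sqnormE hchi (sv t i) s1 (wlim_wder hchi i (sv t) (hrate tT) l3)).
Qed.

Lemma sobolev_sqr_continuous t : ts <= t <= T ->
  sobolev_sqr (v s) @[s --> within [set s | ts <= s <= T] (nbhs t)] --> sobolev_sqr (v t).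
Proof.
move=> tT; apply: cvg_sumr => k; apply: cvg_sumr => i; apply: cvg_sumr => l.
apply: (@cvg_comp _ _ _ (fun s => N2X (wlim chi l (v s i))) (fun a => a ^+ 2)); last exact: exprn_continuous.
have l3 : (size l <= 3)%N by rewrite size_tuple -ltnS.
apply/cvgrPdist_le => e e0; have := wlim_continuous i l3 tT e0.
apply: filterS => s hs sT; rewrite distrC; exact: hs.
Qed.

End Continuity.

(** * From decay of the tails to regularity, and the choice of the constant *)

Lemma wsum_term (R : realType) (Y : nat -> R -> R) (w m : nat) (t : R) : (forall n s, 0 <= Y n s) ->
  lambda m.+3 ^+ w * Y m.+3 t <= wsum Y w m.+1 t.
Proof.
move=> Y0; rewrite /wsum big_ord_recr lerDr; apply: sumr_ge0 => k _.
by rewrite mulr_ge0// exprn_ge0// ltW// lambda_gt0.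
Qed.

Lemma regularity (R : realType) (chi : space3 R -> R) (hchi : lp_cutoff chi) (nu T : R) (u0 : vfield R) (u : R -> vfield R) :
  0 < nu -> 0 < T -> leray_hopf nu T u0 u ->
  (forall ts, 0 < ts <= T -> exists C, forall N t, ts <= t <= T -> wsum (tail chi (vpath T u)) 11 N t <= C) ->
  regular_on `]0, T] u.
Proof.
move=> nu0 T0 hu hs.
have rate ts : 0 < ts -> ts <= T -> exists c, forall t, ts <= t <= T -> smooth_rate chi c (vpath T u t).
  move=> ts0 tsT; have [|C hC] := hs ts; first by rewrite ts0.
  (* [C <= (1 + |C|)^2], whatever the size of [C]. *)
  exists (1 + `|C|) => t tT; split; first by rewrite addr_ge0.
  move=> n n3; have -> : n = (n - 3).+3 by rewrite -addn3 subnK.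
  apply: (le_trans (wsum_term 11 (n - 3) t (tail_ge0 chi (vpath T u)))); apply: (le_trans (hC _ _ tT)).
  apply: (le_trans (ler_norm C)).
  nra.
have idI t : 0 < t -> t <= T -> vpath T u t = u t.
  by move=> t0 tT; apply: vpath_id; rewrite (ltW t0).
split => [t|].
  rewrite /= => /andP[t0 tT]; have [c hc] := rate t t0 tT.
  have tt : t <= t <= T by rewrite lexx.
  by rewrite -(idI t t0 tT) (sobolev_norm3E hchi T0 hu hc tt) ltry.
apply/subspace_continuousP => t; rewrite /= => /andP[t0 tT].
have th : 0 < t / 2 by rewrite divr_gt0.
have tht : t / 2 < t by move: t0; lra.
have thT := le_trans (ltW tht) tT.
(* The rate may degenerate at time 0, but it is uniform on [[t / 2, T]], a neighbourhood of [t] in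
   []0, T]]. *)
have [c hc] := rate (t / 2) th thT.
have tt : t / 2 <= t <= T by rewrite (ltW tht).
have c1 := sobolev_sqr_continuous hchi nu0 T0 hu th thT hc tt.
have c2 : Num.sqrt (sobolev_sqr chi (vpath T u s)) @[s --> within [set s | t / 2 <= s <= T] (nbhs t)] -->
    Num.sqrt (sobolev_sqr chi (vpath T u t)).
  apply: (@cvg_comp _ _ _ (fun s => sobolev_sqr chi (vpath T u s)) Num.sqrt _ _ _ c1); exact: sqrt_continuous.
suff : fine (sobolev_norm 3 (u s)) @[s --> within `]0, T]%classic (nbhs t)] --> fine (sobolev_norm 3 (u t)) by [].
rewrite -(idI t t0 tT) (sobolev_norm3E hchi T0 hu hc tt).
apply/cvgrPdist_le => e e0; move/cvgrPdist_le : c2 => /(_ e e0) h.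
have {}h : \forall s \near t, t / 2 <= s <= T ->
  `|Num.sqrt (sobolev_sqr chi (vpath T u t)) - Num.sqrt (sobolev_sqr chi (vpath T u s))| <= e := h.
have near_t : \forall s \near t, t / 2 < s by exact: (cvgr_gt t) (@cvg_id _ (nbhs t)) _ tht.
apply: filterS2 h near_t => s hs1 s1; rewrite /= => /andP[s0 sT].
have ss : t / 2 <= s <= T by rewrite (ltW s1).
rewrite -(idI s s0 sT) (sobolev_norm3E hchi T0 hu hc ss); exact: hs1.
Qed.

Theorem theorem5p1 (R : realType) (chi : space3 R -> R) (hchi : lp_cutoff chi) :
  exists2 c0 : R, 0 < c0 &
    forall (nu T : R) (u0 : vfield R) (u : R -> vfield R),
      0 < nu -> 0 < T ->
      vL2 u0 -> distr_div_free u0 ->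
      leray_hopf nu T u0 u ->
      let Lambda (t : R) := dissipation_wavenumber chi c0 nu (u t) in
      let Q (t : R) := dissipation_index chi c0 nu (u t) in
      (exists s K : R,
        [/\ 0 <= s <= 3, 3 / 2 < 3 - s, 0 < K &
          (T^-1%:E * \int[leb]_(t in `[0%R, T])
             (Lambda t `^ (2 - s) * lp_block_norm chi +oo (Q t) (u t) ^+ 2)
           <= K%:E * (T^-1%:E * \int[leb]_(t in `[0%R, T])
             (Lambda t ^+ 2 * lp_block_norm chi 2%:E (Q t) (u t) ^+ 2)))%E]) ->
      regular_on `]0, T] u.
Proof.
have r0 := tail_rate_gt0 hchi.
have k0 : 0 <= 2 * flux_const chi * gradient_const chi * 8 ^+ 11.
  apply: mulr_ge0; last exact: exprn_ge0 (ler0n _ _).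
  by apply: mulr_ge0; [apply: mulr_ge0 (ler0n _ _) (flux_const_ge0 chi)|exact: gradient_const_ge0].
move: r0 k0; set r := tail_rate hchi; set k := 2 * _ * _ * _ => r0 k0.
have k1 : 0 < k + 1 by rewrite ltr_wpDl.
(* Damping rate over flux constant, both depending on [chi] only; the added 1 keeps the denominator
   positive. *)
exists (r / (k + 1)); first exact: divr_gt0.
move=> nu T u0 u nu0 T0 _ _ hu Lambda Q hyp.
apply: (regularity hchi nu0 T0 hu) => ts hts.
apply: (smoothing nu0 T0 hu (divr_gt0 r0 k1) hyp _ hts).
rewrite mulrAC -/k mulrA ler_pdivrMr// mulrC ler_pM2l//.
lra.
Qed.
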